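(* Let $k\ge1$ be an odd integer, and let $\chi_1,\chi_2$ be primitive Dirichlet characters modulo $p$ and $q$ respectively, such that either both are non-principal even characters or both are odd characters. Let $a,x>0$. Then \begin{align*} \sum_{n=1}^\infty \sigma_{k,\chi_1,\chi_2}(n) K_0(a\sqrt{nx})= \frac{1}{2}c_{k,\chi_1,\chi_2} +\frac{ (-1)^{ \frac{k-1}{2}}k!\, p^k }{2(2 \pi)^{k+1}} \tau(\chi_1) \tau(\chi_2) \sum_{n=1}^\infty \sigma_{k,\bar{ \chi }_2,\bar{ \chi }_1}(n)\left(\frac{1}{n^{k+1}}-\frac{1}{(n+ \frac{a^2pqx}{16\pi^2} )^{k+1} } \right), \end{align*} where $c_{k,\chi_1,\chi_2}=L(-k,\chi_1)L'(0,\chi_2)$ if both $\chi_1,\chi_2$ are even, and $c_{k,\chi_1,\chi_2}=L'(-k,\chi_1)L(0,\chi_2)$ if both are odd.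
   Context: For Dirichlet characters $\chi_1,\chi_2$ and $z\in\mathbb{C}$: $\sigma_{z,\chi_1,\chi_2}(n)=\sum_{d\mid n}d^z\chi_1(d)\chi_2(n/d)$. $\tau(\chi)=\sum_{h=1}^q\chi(h)e^{2\pi i h/q}$ is the Gauss sum, $L(s,\chi)$ the Dirichlet $L$-function, and $K_0$ the modified Bessel function of the second kind of order $0$. *)

(* Defs.v *)
From Stdlib Require Import Reals ZArith Znumtheory.
From Coquelicot Require Import Coquelicot.

Open Scope R_scope.

Definition cexp (z : C) : C :=
  (exp (Re z) * cos (Im z), exp (Re z) * sin (Im z)).

Definition ncpow (n : nat) (s : C) : C := cexp (Cmult s (RtoC (ln (INR n)))).

Definition dchar (q : Z) (chi : Z -> C) : Prop :=
  (1 <= q)%Z /\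
  (forall n, chi (n + q)%Z = chi n) /\
  (forall m n, chi (m * n)%Z = Cmult (chi m) (chi n)) /\
  chi 1%Z = RtoC 1 /\
  (forall n, chi n = RtoC 0 <-> Z.gcd n q <> 1%Z).

Definition principal (q : Z) (chi : Z -> C) : Prop :=
  forall n, Z.gcd n q = 1%Z -> chi n = RtoC 1.

Definition primitive_char (q : Z) (chi : Z -> C) : Prop :=
  dchar q chi /\
  forall d : Z, (0 < d < q)%Z -> (d | q)%Z ->
    ~ (forall a, Z.gcd a q = 1%Z -> (a mod d = 1 mod d)%Z -> chi a = RtoC 1).

Definition even_char (chi : Z -> C) : Prop := chi (-1)%Z = RtoC 1.
Definition odd_char (chi : Z -> C) : Prop := chi (-1)%Z = RtoC (-1).

Definition conj_char (chi : Z -> C) : Z -> C := fun n => Cconj (chi n).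

Definition sigma (k : nat) (chi1 chi2 : Z -> C) (n : nat) : C :=
  sum_n (fun i : nat =>
    let d := S i in
    if Nat.eqb (Nat.modulo n d) 0
    then Cmult (RtoC (INR d ^ k)) (Cmult (chi1 (Z.of_nat d)) (chi2 (Z.of_nat (Nat.div n d))))
    else RtoC 0) (Nat.pred n).

Definition gauss_sum (q : Z) (chi : Z -> C) : C :=
  sum_n (fun i : nat =>
    let h := S i in
    Cmult (chi (Z.of_nat h)) (cexp (0, 2 * PI * INR h / IZR q))) (Nat.pred (Z.to_nat q)).

(* L is (the analytic continuation of) L(s,chi): an entire function with
   derivative dL, agreeing with the Dirichlet series for Re s > 1. *)
Definition is_Lfunction (chi : Z -> C) (L dL : C -> C) : Prop :=
  (forall s : C, is_derive (K := C_AbsRing) (V := C_NormedModule) L s (dL s)) /\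
  (forall s : C, 1 < Re s ->
     is_series (K := C_AbsRing) (V := C_NormedModule)
       (fun n : nat => Cmult (chi (Z.of_nat (S n))) (ncpow (S n) (Copp s))) (L s)).

Definition K0 (x : R) : R :=
  RInt_gen (fun t => exp (- (x * cosh t))) (at_point 0) (Rbar_locally p_infty).

Definition bessel_identity (k : nat) (p q : Z) (chi1 chi2 : Z -> C)
    (a x : R) (c : C) : Prop :=
  let A := a ^ 2 * IZR p * IZR q * x / (16 * PI ^ 2) in
  let coef := (-1) ^ (Nat.div (k - 1) 2) * INR (fact k) * IZR p ^ k
              / (2 * (2 * PI) ^ (k + 1)) in
  exists T : C,
    is_series (K := C_AbsRing) (V := C_NormedModule)
      (fun n : nat =>
         Cmult (sigma k (conj_char chi2) (conj_char chi1) (S n))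
           (RtoC (1 / INR (S n) ^ (k + 1) - 1 / (INR (S n) + A) ^ (k + 1)))) T
    /\
    is_series (K := C_AbsRing) (V := C_NormedModule)
      (fun n : nat =>
         Cmult (sigma k chi1 chi2 (S n)) (RtoC (K0 (a * sqrt (INR (S n) * x)))))
      (Cplus (Cmult (RtoC (1/2)) c)
         (Cmult (RtoC coef) (Cmult (Cmult (gauss_sum p chi1) (gauss_sum q chi2)) T))).

(* Main.v *)
(** Write [F t = sum d^k chi1(d) e^(-d t)] and [G t = sum chi2(m) e^(-m t)]. Since
    [2 K0(2 sqrt(y d m))] is the integral over the real line of [exp(-d e^v - m y e^(-v))], the left-hand side with
    [y = a^2 x / 4] is half the integral of [F(e^v) G(y e^(-v))].
    Summing over residue classes and expanding in a finite Fourier series, then letting the length of that series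
    grow, gives partial fraction expansions of [F] and [G] with poles at the points [2 pi i j / p] and [2 pi i j / q],
    whose coefficients are Gauss sums times conjugate characters. In
    [F G = (F - F(0)) (G - G(0)) + F(0) (G - G(0)) + G(0) F]
    the first product integrates term by term to the series on the right-hand side. The parity forces
    [G(0) = 0] (even case) or [F(0) = 0] (odd case), and the remaining integral is the constant [c]: comparing Mellin
    transforms, [F(0) = L(-k, chi1)], [G(0) = L(0, chi2)], and the regularised integrals of [F] and [G] are the
    derivatives of the L-functions at [-k] and [0]. Uniqueness of analytic continuation is proved from Goursat's theorem
    with a Gaussian weight. *)
From Stdlib Require Import Reals Lra Lia ZArith Znumtheory List Permutation FinFun.
From Stdlib Require Import ClassicalEpsilon FunctionalExtensionality.
From Coquelicot Require Import Coquelicot.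
Require Import Defs.
Open Scope R_scope.

(** * Integrals over the real line *)

(** In the variable [v], [F (e^v)] tends to [F 0] at minus infinity and dies off at plus infinity,
    while [G (y e^(-v))] does the opposite. So [F G] is integrable, but [F 0 * G] alone is
    integrable only if [G 0 = 0], and [G 0 * F] only if [F 0 = 0]. This is where parity enters: [G]
    continues to an odd function of [t] for an even character and to an even one for an odd
    character, while [F], minus the [k]-th derivative of such a function with [k] odd, has the
    opposite parity. With equal parities exactly one of the two expansions is that of an odd
    function, and its constant vanishes. The partial fractions do the work of a functional equation:
    Gauss sums and conjugate characters come from them, so [L] enters only through its Dirichlet
    series and its being entire. A pole term of [G] times one of [F] has an elementary integral. It
    depends on the two pole indices through their product, apart from a factor [j^k]. This produces
    [sigma] with exchanged conjugate characters and the shift by [a^2 p q x / (16 pi^2)]. *)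

Ltac toR := match goal with |- @eq _ ?a ?b => change (@eq R a b) end.

(** The working notion of absolute integrability: in [v = ln t] the integrands that get added,
    shifted or summed all have a two-sided exponential bound, which makes every tail explicit. *)
Definition dominated (d M : R) (f : R -> R) : Prop :=
  (forall v, continuous f v) /\
  (forall v, Rabs (f v) <= M * exp (- (d * Rabs v))).

(** A total function, with the default value of [Lim_seq] when the limit fails to exist; [IntR_lim]
    shows that it is a genuine limit for dominated integrands. Symmetric integer intervals let
    [IntR_FTC] work from the endpoint values of a primitive alone. *)
Definition IntR (f : R -> R) : R :=
  real (Lim_seq (fun n => RInt f (- INR n) (INR n))).

Lemma exp_mono (x y : R) : x <= y -> exp x <= exp y.
Proof. intros [H|H]; [left; now apply exp_increasing|rewrite H; lra]. Qed.

Lemma dominated_ge_0 (d M : R) (f : R -> R) : dominated d M f -> 0 <= M.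
Proof.
  intros [_ H]. specialize (H 0). rewrite Rabs_R0, Rmult_0_r, Ropp_0, exp_0 in H.
  pose proof (Rabs_pos (f 0)). lra.
Qed.

Lemma continuous_ex_RInt (f : R -> R) (a b : R) :
  (forall v, continuous f v) -> ex_RInt f a b.
Proof. intros H. apply (ex_RInt_continuous (V := R_CompleteNormedModule) f). auto. Qed.

Lemma RInt_FTC (f df : R -> R) (a b : R) :
  (forall v, is_derive f v (df v)) -> (forall v, continuous df v) ->
  RInt df a b = f b - f a.
Proof.
  intros H1 H2. apply is_RInt_unique.
  apply (is_RInt_derive (V := R_CompleteNormedModule) f df a b); auto.
Qed.

Lemma RInt_exp_lin (c a b : R) : c <> 0 ->
  RInt (fun v => exp (c * v)) a b = (exp (c * b) - exp (c * a)) / c.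
Proof.
  intros Hc. rewrite (RInt_FTC (fun v => exp (c * v) / c)).
  - toR. field. exact Hc.
  - intros v. auto_derive; trivial. field. exact Hc.
  - intros v. apply (ex_derive_continuous (fun v => exp (c * v))). auto_derive. trivial.
Qed.

Lemma RInt_exp_bound (f : R -> R) (c M a b : R) : c <> 0 -> a <= b ->
  (forall v, continuous f v) ->
  (forall v, a < v < b -> Rabs (f v) <= M * exp (c * v)) ->
  Rabs (RInt f a b) <= M * ((exp (c * b) - exp (c * a)) / c).
Proof.
  intros Hc Hab Hf H.
  eapply Rle_trans. apply abs_RInt_le; [exact Hab|now apply continuous_ex_RInt].
  rewrite <- (RInt_exp_lin c a b Hc).
  assert (E : forall v, continuous (fun v => exp (c * v)) v).
  { intros v. apply (ex_derive_continuous (fun v => exp (c * v))). auto_derive. trivial. }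
  change (M * RInt (fun v => exp (c * v)) a b) with (scal M (RInt (fun v => exp (c * v)) a b)).
  rewrite <- RInt_scal by now apply continuous_ex_RInt.
  apply RInt_le; trivial.
  - apply continuous_ex_RInt. intros v. now apply continuous_Rabs_comp.
  - apply (ex_RInt_scal (fun v => exp (c * v))). now apply continuous_ex_RInt.
Qed.

Lemma RInt_right_tail (d M : R) (f : R -> R) (a b : R) : 0 < d -> dominated d M f ->
  0 <= a <= b -> Rabs (RInt f a b) <= M / d * exp (- (d * a)).
Proof.
  intros Hd Hf [Ha Hab]. pose proof (dominated_ge_0 _ _ _ Hf) as HM. destruct Hf as [Hc Hb].
  eapply Rle_trans. apply (RInt_exp_bound f (- d) M); try lra; auto.
  - intros v Hv. replace (- d * v) with (- (d * Rabs v)) by (rewrite Rabs_pos_eq by lra; ring). auto.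
  - replace (- d * b) with (- (d * b)) by ring. replace (- d * a) with (- (d * a)) by ring.
    pose proof (exp_pos (- (d * b))).
    replace (M * ((exp (- (d * b)) - exp (- (d * a))) / - d)) with (M / d * (exp (- (d * a)) - exp (- (d * b)))) by (field; lra).
    apply Rmult_le_compat_l; [|lra]. apply Rmult_le_pos; trivial. left. now apply Rinv_0_lt_compat.
Qed.

Lemma RInt_left_tail (d M : R) (f : R -> R) (a b : R) : 0 < d -> dominated d M f ->
  a <= b <= 0 -> Rabs (RInt f a b) <= M / d * exp (d * b).
Proof.
  intros Hd Hf [Hab Hb0]. pose proof (dominated_ge_0 _ _ _ Hf) as HM. destruct Hf as [Hc Hb].
  eapply Rle_trans. apply (RInt_exp_bound f d M); try lra; auto.
  - intros v Hv. replace (d * v) with (- (d * Rabs v)) by (rewrite Rabs_left by lra; ring). auto.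
  - pose proof (exp_pos (d * a)).
    replace (M * ((exp (d * b) - exp (d * a)) / d)) with (M / d * (exp (d * b) - exp (d * a))) by (field; lra).
    apply Rmult_le_compat_l; [|lra]. apply Rmult_le_pos; trivial. left. now apply Rinv_0_lt_compat.
Qed.

Lemma RInt_diff_bound (d M : R) (f : R -> R) (a b a' b' : R) : 0 < d -> dominated d M f ->
  a' <= a <= 0 -> 0 <= b <= b' ->
  Rabs (RInt f a' b' - RInt f a b) <= M / d * (exp (d * a) + exp (- (d * b))).
Proof.
  intros Hd Hf Ha Hb. assert (E : forall x y, ex_RInt f x y) by (intros; apply continuous_ex_RInt; apply Hf).
  pose proof (RInt_Chasles f a' a b' (E _ _) (E _ _)) as H1.
  pose proof (RInt_Chasles f a b b' (E _ _) (E _ _)) as H2.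
  unfold plus in H1, H2; simpl in H1, H2.
  replace (RInt f a' b' - RInt f a b) with (RInt f a' a + RInt f b b') by lra.
  eapply Rle_trans. apply Rabs_triang.
  pose proof (RInt_right_tail d M f b b' Hd Hf Hb).
  pose proof (RInt_left_tail d M f a' a Hd Hf Ha). lra.
Qed.

Lemma exp_neg_lim (d : R) : 0 < d -> is_lim_seq (fun n => exp (- (d * INR n))) 0.
Proof.
  intros Hd. apply is_lim_seq_ext with (fun n => exp (- d) ^ n).
  - intros n. induction n as [|n IH]. { simpl. now rewrite Rmult_0_r, Ropp_0, exp_0. }
    rewrite S_INR. simpl. rewrite IH, <- exp_plus. f_equal. ring.
  - apply is_lim_seq_geom. rewrite Rabs_pos_eq by (left; apply exp_pos).
    rewrite <- exp_0. apply exp_increasing. lra.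
Qed.

Lemma IntR_lim (d M : R) (f : R -> R) : 0 < d -> dominated d M f ->
  is_lim_seq (fun n => RInt f (- INR n) (INR n)) (IntR f).
Proof.
  intros Hd Hf. unfold IntR. apply Lim_seq_correct'. apply ex_lim_seq_cauchy_corr.
  intros eps.
  assert (L : is_lim_seq (fun n => M / d * (2 * exp (- (d * INR n)))) 0).
  { replace (Finite 0) with (Rbar_mult (M / d) (Rbar_mult 2 0)) by (simpl; f_equal; ring).
    apply is_lim_seq_scal_l, is_lim_seq_scal_l, exp_neg_lim, Hd. }
  apply is_lim_seq_spec in L. destruct (L eps) as [N HN]. exists N.
  assert (K : forall n m, (N <= n)%nat -> (n <= m)%nat ->
    Rabs (RInt f (- INR m) (INR m) - RInt f (- INR n) (INR n)) < eps).
  { intros n m Hn Hm. eapply Rle_lt_trans.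
    - apply (RInt_diff_bound d M); auto; pose proof (le_INR _ _ Hm); pose proof (pos_INR n); lra.
    - specialize (HN n Hn). rewrite Rminus_0_r in HN. eapply Rle_lt_trans; [|exact HN].
      replace (d * - INR n) with (- (d * INR n)) by ring.
      eapply Rle_trans; [|apply Rle_abs]. apply Req_le. ring. }
  intros n m Hn Hm. destruct (Nat.le_ge_cases n m) as [H|H].
  - rewrite Rabs_minus_sym. now apply K.
  - now apply K.
Qed.

(** Endpoints are arbitrary reals on either side of 0, because [IntR_shift] moves the interval and
    [even_RInt_gen] takes a limit over a real upper bound. *)
Lemma IntR_approx (d M : R) (f : R -> R) (a b : R) : 0 < d -> dominated d M f ->
  a <= 0 <= b -> Rabs (IntR f - RInt f a b) <= M / d * (exp (d * a) + exp (- (d * b))).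
Proof.
  intros Hd Hf Hab.
  destruct (INR_unbounded (Rabs a + Rabs b)) as [N HN].
  pose proof (IntR_lim d M f Hd Hf) as L.
  assert (L2 : is_lim_seq (fun n => Rabs (RInt f (- INR n) (INR n) - RInt f a b)) (Rabs (IntR f - RInt f a b))).
  { apply (is_lim_seq_abs _ (Finite _)). apply (is_lim_seq_minus' _ _ (IntR f) (RInt f a b)); trivial. apply is_lim_seq_const. }
  refine (is_lim_seq_le_loc _ (fun _ => M / d * (exp (d * a) + exp (- (d * b)))) (Finite _) (Finite _) _ L2 (is_lim_seq_const _)).
  exists N. intros n Hn. apply le_INR in Hn.
  rewrite (Rabs_left1 a), (Rabs_pos_eq b) in HN by lra.
  apply RInt_diff_bound; trivial; lra.
Qed.
Lemma IntR_bound (d M : R) (f : R -> R) : 0 < d -> dominated d M f -> Rabs (IntR f) <= 2 * M / d.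
Proof.
  intros Hd Hf. pose proof (IntR_approx d M f 0 0 Hd Hf) as H.
  rewrite RInt_point in H. unfold zero in H; simpl in H.
  rewrite Rminus_0_r, Rmult_0_r, Ropp_0, exp_0 in H. replace (2 * M / d) with (M / d * (1 + 1)) by (field; lra). apply H; lra.
Qed.

Lemma IntR_unique (f : R -> R) (l : R) :
  is_lim_seq (fun n => RInt f (- INR n) (INR n)) l -> IntR f = l.
Proof. intros H. unfold IntR. now rewrite (is_lim_seq_unique _ _ H). Qed.

Lemma dominated_weaken (d M d' M' : R) (f : R -> R) : d' <= d -> M <= M' ->
  dominated d M f -> dominated d' M' f.
Proof.
  intros Hd HM H. pose proof (dominated_ge_0 _ _ _ H). destruct H as [H1 H2]. split; trivial.
  intros v. eapply Rle_trans. apply H2.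
  apply Rmult_le_compat; try lra. left; apply exp_pos.
  apply exp_mono. pose proof (Rabs_pos v). nra.
Qed.

Lemma dominated_plus (d M1 M2 : R) (f g : R -> R) :
  dominated d M1 f -> dominated d M2 g -> dominated d (M1 + M2) (fun v => f v + g v).
Proof.
  intros [A B] [A' B']. split.
  - intros v. now apply (continuous_plus f g).
  - intros v. eapply Rle_trans. apply Rabs_triang. specialize (B v). specialize (B' v). lra.
Qed.

Lemma dominated_scal (d M c : R) (f : R -> R) :
  dominated d M f -> dominated d (Rabs c * M) (fun v => c * f v).
Proof.
  intros [A B]. split.
  - intros v. now apply (continuous_scal_r c f).
  - intros v. rewrite Rabs_mult, Rmult_assoc. apply Rmult_le_compat_l; auto. apply Rabs_pos.
Qed.

Lemma IntR_plus (d M1 M2 : R) (f g : R -> R) : 0 < d ->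
  dominated d M1 f -> dominated d M2 g -> IntR (fun v => f v + g v) = IntR f + IntR g.
Proof.
  intros Hd Hf Hg. apply IntR_unique.
  apply is_lim_seq_ext with (fun n => RInt f (- INR n) (INR n) + RInt g (- INR n) (INR n)).
  - intros n. symmetry. apply (RInt_plus f g); apply continuous_ex_RInt; [apply Hf|apply Hg].
  - apply is_lim_seq_plus'; eapply IntR_lim; eauto.
Qed.

Lemma IntR_scal (d M c : R) (f : R -> R) : 0 < d ->
  dominated d M f -> IntR (fun v => c * f v) = c * IntR f.
Proof.
  intros Hd Hf. apply IntR_unique.
  apply is_lim_seq_ext with (fun n => c * RInt f (- INR n) (INR n)).
  - intros n. symmetry. apply (RInt_scal f); apply continuous_ex_RInt; apply Hf.
  - apply (is_lim_seq_scal_l _ c (Finite _)). eapply IntR_lim; eauto.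
Qed.

Lemma dominated_shift (d M h : R) (f : R -> R) : 0 < d ->
  dominated d M f -> dominated d (M * exp (d * Rabs h)) (fun v => f (v + h)).
Proof.
  intros Hd H. pose proof (dominated_ge_0 _ _ _ H) as HM. destruct H as [A B]. split.
  - intros v. apply (continuous_comp (fun v => v + h) f); auto.
    apply (continuous_plus (fun v => v) (fun _ => h)); [apply continuous_id|apply continuous_const].
  - intros v. eapply Rle_trans. apply B. rewrite Rmult_assoc, <- exp_plus.
    apply Rmult_le_compat_l; trivial.
    apply exp_mono. pose proof (Rabs_triang (v + h) (- h)) as T. rewrite Rabs_Ropp in T.
    replace (v + h + - h) with v in T by ring. nra.
Qed.

Lemma IntR_shift (d M h : R) (f : R -> R) : 0 < d ->
  dominated d M f -> IntR (fun v => f (v + h)) = IntR f.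
Proof.
  intros Hd Hf. apply IntR_unique.
  apply is_lim_seq_ext with (fun n => RInt f (- INR n + h) (INR n + h)).
  { intros n. symmetry.
    rewrite <- (RInt_ext (fun v => scal 1 (f (1 * v + h)))).
    2:{ intros v _. unfold scal; simpl. unfold mult; simpl. rewrite !Rmult_1_l. reflexivity. }
    rewrite (RInt_comp_lin f 1 h). now rewrite !Rmult_1_l. apply continuous_ex_RInt, Hf. }
  assert (Z : is_lim_seq (fun n => M / d * ((exp (d * Rabs h) + exp (d * Rabs h)) * exp (- (d * INR n)))) 0).
  { replace (Finite 0) with (Rbar_mult (M / d) (Rbar_mult (exp (d * Rabs h) + exp (d * Rabs h)) 0)) by (simpl; f_equal; ring).
    apply is_lim_seq_scal_l, is_lim_seq_scal_l, exp_neg_lim, Hd. }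
  apply is_lim_seq_spec. intros eps. apply is_lim_seq_spec in Z. destruct (Z eps) as [N HN].
  destruct (INR_unbounded (Rabs h)) as [N2 HN2]. exists (N + N2)%nat. intros n Hn.
  assert (Hn2 : Rabs h < INR n) by (eapply Rlt_le_trans; [exact HN2|apply le_INR; lia]).
  rewrite Rabs_minus_sym. pose proof (Rle_abs h). pose proof (Rle_abs (- h)) as T2. rewrite Rabs_Ropp in T2.
  eapply Rle_lt_trans. apply (IntR_approx d M f (- INR n + h) (INR n + h)); trivial; lra.
  eapply Rle_lt_trans; [|apply (HN n); lia]. rewrite Rminus_0_r. eapply Rle_trans; [|apply Rle_abs].
  apply Rmult_le_compat_l. { apply Rmult_le_pos. eapply dominated_ge_0; eauto. left. now apply Rinv_0_lt_compat. }
  rewrite Rmult_plus_distr_r, <- !exp_plus.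
  apply Rplus_le_compat; apply exp_mono; nra.
Qed.

Lemma IntR_reflect (d M : R) (f : R -> R) : 0 < d ->
  dominated d M f -> IntR (fun v => f (- v)) = IntR f.
Proof.
  intros Hd Hf. apply IntR_unique.
  apply is_lim_seq_ext with (fun n => RInt f (- INR n) (INR n)); [|eapply IntR_lim; eauto].
  intros n.
  assert (E : is_RInt f (- - INR n) (- INR n) (opp (RInt f (- INR n) (INR n)))).
  { rewrite Ropp_involutive. apply (is_RInt_swap f). apply (RInt_correct f). apply continuous_ex_RInt, Hf. }
  apply (is_RInt_comp_opp f) in E. apply is_RInt_opp in E. rewrite opp_opp in E.
  symmetry. apply is_RInt_unique. eapply is_RInt_ext; [|exact E]. intros v _. simpl. now rewrite opp_opp.
Qed.

Lemma IntR_FTC (f H : R -> R) (l : R) :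
  (forall v, is_derive H v (f v)) -> (forall v, continuous f v) ->
  is_lim_seq (fun n => H (INR n) - H (- INR n)) l -> IntR f = l.
Proof.
  intros HD HC HL. apply IntR_unique. eapply is_lim_seq_ext; [|exact HL].
  intros n. symmetry. now apply RInt_FTC.
Qed.

Lemma even_RInt_half (f : R -> R) (b : R) : (forall v, continuous f v) ->
  (forall v, f (- v) = f v) -> RInt f (- b) b = 2 * RInt f 0 b.
Proof.
  intros Hc He. assert (E : forall x y, ex_RInt f x y) by (intros; now apply continuous_ex_RInt).
  rewrite <- (RInt_Chasles f (- b) 0 b) by apply E.
  replace (RInt f (- b) 0) with (RInt f 0 b). unfold plus; simpl; ring.
  symmetry. apply is_RInt_unique.
  assert (Q : is_RInt f (- - b) (- 0) (opp (RInt f 0 b))).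
  { rewrite Ropp_involutive, Ropp_0. apply (is_RInt_swap f). apply (RInt_correct f), E. }
  apply (is_RInt_comp_opp f) in Q. apply is_RInt_opp in Q. rewrite opp_opp in Q.
  eapply is_RInt_ext; [|exact Q]. intros v _. simpl. rewrite opp_opp. apply He.
Qed.

(** The bridge to the improper integral by which [K0] is defined; evenness will come from [cosh]. *)
Lemma even_RInt_gen (d M : R) (f : R -> R) : 0 < d -> dominated d M f ->
  (forall v, f (- v) = f v) ->
  RInt_gen f (at_point 0) (Rbar_locally p_infty) = IntR f / 2.
Proof.
  intros Hd Hf He.
  refine (@is_RInt_gen_unique _ _ _ _ _ f (IntR f / 2) _).
  intros P [eps HP].
  assert (Z : is_lim_seq (fun n => M / d * (2 * exp (- (d * INR n)))) 0).
  { replace (Finite 0) with (Rbar_mult (M / d) (Rbar_mult 2 0)) by (simpl; f_equal; ring).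
    apply is_lim_seq_scal_l, is_lim_seq_scal_l, exp_neg_lim, Hd. }
  apply is_lim_seq_spec in Z. destruct (Z eps) as [N HN].
  apply (Filter_prod _ _ _ (fun x => x = 0) (fun b => INR N < b)).
  - reflexivity.
  - exists (INR N). auto.
  - intros x b -> Hb. simpl. exists (RInt f 0 b). split.
    + apply (RInt_correct f). apply continuous_ex_RInt, Hf.
    + apply HP. unfold ball; simpl. unfold AbsRing_ball, abs, minus, plus, opp; simpl.
      pose proof (pos_INR N).
      pose proof (IntR_approx d M f (- b) b Hd Hf) as A.
      rewrite even_RInt_half in A; trivial; [|apply Hf].
      replace (RInt f 0 b + - (IntR f / 2)) with (- ((IntR f - 2 * RInt f 0 b) / 2)) by field.
      rewrite Rabs_Ropp. unfold Rdiv at 1. rewrite Rabs_mult, (Rabs_pos_eq (/ 2)) by lra.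
      specialize (HN N (Nat.le_refl _)). rewrite Rminus_0_r in HN.
      assert (B : Rabs (IntR f - 2 * RInt f 0 b) < eps).
      { eapply Rle_lt_trans. apply A; lra. eapply Rle_lt_trans; [|exact HN]. eapply Rle_trans; [|apply Rle_abs].
        apply Rmult_le_compat_l. { apply Rmult_le_pos. eapply dominated_ge_0; eauto. left. now apply Rinv_0_lt_compat. }
        replace (d * - b) with (- (d * b)) by ring.
        assert (exp (- (d * b)) <= exp (- (d * INR N))) by (left; apply exp_increasing; nra). lra. }
      pose proof (Rabs_pos (IntR f - 2 * RInt f 0 b)). pose proof (cond_pos eps). lra.
Qed.

(** * Real series *)

Lemma is_lim_seq_eps (u : nat -> R) (l : R) :
  (forall eps, 0 < eps -> exists N, forall n, (N <= n)%nat -> Rabs (u n - l) < eps) ->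
  is_lim_seq u l.
Proof. intros H. apply is_lim_seq_spec. intros [eps He]. apply (H eps He). Qed.

Lemma is_lim_seq_eps_inv (u : nat -> R) (l eps : R) : is_lim_seq u l -> 0 < eps ->
  exists N, forall n, (N <= n)%nat -> Rabs (u n - l) < eps.
Proof. intros H He. apply is_lim_seq_spec in H. apply (H (mkposreal eps He)). Qed.

Lemma is_lim_seq_squeeze0 (u w : nat -> R) (l : R) :
  (forall n, Rabs (u n - l) <= w n) -> is_lim_seq w 0 -> is_lim_seq u l.
Proof.
  intros H Hw. apply is_lim_seq_eps. intros eps He.
  destruct (is_lim_seq_eps_inv w 0 eps Hw He) as [N HN]. exists N. intros n Hn.
  specialize (HN n Hn). rewrite Rminus_0_r in HN. pose proof (Rle_abs (w n)). specialize (H n). lra.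
Qed.

Lemma is_series_squeeze (u w : nat -> R) (l : R) :
  (forall N, Rabs (sum_n u N - l) <= w N) -> is_lim_seq w 0 -> is_series u l.
Proof. intros H Hw. exact (is_lim_seq_squeeze0 (sum_n u) w l H Hw). Qed.

Lemma ex_series_dom (u A : nat -> R) : (forall n, Rabs (u n) <= A n) -> ex_series A -> ex_series u.
Proof. intros H. apply (ex_series_le (V := R_CompleteNormedModule) u A). exact H. Qed.

Lemma Series_zero (u : nat -> R) : (forall n, u n = 0) -> Series u = 0.
Proof.
  intros H. rewrite (Series_ext u (fun n => 0 * 0)). rewrite (Series_scal_l 0 (fun _ => 0)). ring.
  intros n. rewrite H. ring.
Qed.

Lemma Series_split (u : nat -> R) (N : nat) : ex_series u ->
  Series u = sum_n u N + Series (fun k => u (S N + k)%nat).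
Proof. intros H. rewrite sum_n_Reals. apply (Series_incr_n u (S N)); [lia|exact H]. Qed.

Lemma Series_dom_le (u A : nat -> R) : (forall n, Rabs (u n) <= A n) -> ex_series A ->
  Rabs (Series u) <= Series A.
Proof.
  intros H HA. eapply Rle_trans. apply Series_Rabs.
  - apply (ex_series_dom _ A); trivial. intros n. now rewrite Rabs_Rabsolu.
  - apply Series_le; trivial. intros n. split; [apply Rabs_pos|apply H].
Qed.

Lemma ex_series_tail (A : nat -> R) (N : nat) : ex_series A -> ex_series (fun k => A (N + k)%nat).
Proof. intros H. now apply (ex_series_incr_n A N). Qed.

Lemma Series_tail_dom (u A : nat -> R) (N : nat) : (forall n, Rabs (u n) <= A n) -> ex_series A ->
  Rabs (Series u - sum_n u N) <= Series A - sum_n A N.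
Proof.
  intros H HA. rewrite (Series_split u N), (Series_split A N); trivial; [|now apply (ex_series_dom u A)].
  replace (sum_n u N + Series (fun k => u (S N + k)%nat) - sum_n u N) with (Series (fun k => u (S N + k)%nat)) by (toR; ring).
  replace (sum_n A N + Series (fun k => A (S N + k)%nat) - sum_n A N) with (Series (fun k => A (S N + k)%nat)) by (toR; ring).
  apply Series_dom_le; auto. now apply ex_series_tail.
Qed.

Lemma tail_lim (A : nat -> R) : ex_series A -> is_lim_seq (fun N => Series A - sum_n A N) 0.
Proof.
  intros H. apply Series_correct in H.
  replace (Finite 0) with (Finite (Series A - Series A)) by (f_equal; ring).
  apply is_lim_seq_minus'; [apply is_lim_seq_const|exact H].
Qed.

Lemma tail_small (A : nat -> R) (eps : R) : ex_series A -> 0 < eps ->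
  exists N, Rabs (Series A - sum_n A N) < eps.
Proof.
  intros H He. destruct (is_lim_seq_eps_inv _ 0 eps (tail_lim A H) He) as [N HN].
  exists N. specialize (HN N (Nat.le_refl _)). now rewrite Rminus_0_r in HN.
Qed.

(** Closeness is asked only near [v]: the Lambert series converge locally uniformly in [t > 0], and
    their bounds blow up at [t = 0]. *)
Lemma continuous_unif (f : R -> R) (v : R) :
  (forall eps, 0 < eps -> exists g : R -> R, continuous g v /\ locally v (fun y => Rabs (f y - g y) <= eps)) ->
  continuous f v.
Proof.
  intros H. apply filterlim_locally. intros [eps He]. destruct (H (eps / 4)) as [g [Hg Hl]]; [lra|].
  assert (He4 : 0 < eps / 4) by lra.
  pose proof (proj1 (filterlim_locally (F := locally v) g (g v)) Hg (mkposreal _ He4)) as Hg'.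
  pose proof (locally_singleton _ _ Hl) as H0.
  assert (L := filter_and _ _ Hl Hg'). revert L. apply filter_imp. intros y [A B].
  unfold ball in *; simpl in *. unfold AbsRing_ball, abs, minus, plus, opp in *; simpl in *.
  replace (f y + - f v) with ((f y - g y) + (g y + - g v) + - (f v - g v)) by ring.
  eapply Rle_lt_trans. eapply Rle_trans. apply Rabs_triang. apply Rplus_le_compat_r. apply Rabs_triang.
  rewrite Rabs_Ropp. lra.
Qed.

Lemma continuous_sum_n (f : nat -> R -> R) (N : nat) (v : R) :
  (forall n, continuous (f n) v) -> continuous (fun y => sum_n (fun n => f n y) N) v.
Proof.
  intros H. induction N as [|N IH].
  - apply (continuous_ext (f O)); [intros y; now rewrite sum_O|apply H].
  - apply (continuous_ext (fun y => plus (sum_n (fun n => f n y) N) (f (S N) y))).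
    + intros y. now rewrite sum_Sn.
    + now apply (continuous_plus (V := R_NormedModule)).
Qed.

Lemma continuous_Series (f : nat -> R -> R) (A : nat -> R) (v : R) :
  (forall n, continuous (f n) v) -> ex_series A ->
  locally v (fun y => forall n, Rabs (f n y) <= A n) ->
  continuous (fun y => Series (fun n => f n y)) v.
Proof.
  intros Hc HA Hb. apply continuous_unif. intros eps He.
  destruct (tail_small A eps HA He) as [N HN].
  exists (fun y => sum_n (fun n => f n y) N). split.
  - now apply continuous_sum_n.
  - revert Hb. apply filter_imp. intros y Hy.
    eapply Rle_trans. apply (Series_tail_dom _ A); auto. pose proof (Rle_abs (Series A - sum_n A N)). lra.
Qed.

Lemma sum_n_scal (c : R) (u : nat -> R) (N : nat) : sum_n (fun n => c * u n) N = c * sum_n u N.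
Proof. apply (sum_n_mult_l (K := R_Ring)). Qed.

Lemma dominated_Series (d : R) (M : nat -> R) (f : nat -> R -> R) : 0 < d ->
  (forall n, dominated d (M n) (f n)) -> ex_series M ->
  dominated d (Series M) (fun v => Series (fun n => f n v)).
Proof.
  intros Hd Hf HM. split.
  - intros v. apply (continuous_Series f M); trivial.
    + intros n. apply Hf.
    + exists (mkposreal 1 Rlt_0_1). intros y _ n. pose proof (dominated_ge_0 _ _ _ (Hf n)).
      eapply Rle_trans. apply Hf. rewrite <- (Rmult_1_r (M n)) at 2. apply Rmult_le_compat_l; trivial.
      rewrite <- exp_0. apply exp_mono. pose proof (Rabs_pos y). nra.
  - intros v. rewrite Rmult_comm, <- (Series_scal_l _ M). apply Series_dom_le.
    + intros n. rewrite Rmult_comm. apply Hf.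
    + now apply (ex_series_scal_l (exp (- (d * Rabs v))) M).
Qed.

Lemma IntR_sum_n (d : R) (M : nat -> R) (f : nat -> R -> R) (N : nat) : 0 < d ->
  (forall n, dominated d (M n) (f n)) ->
  dominated d (sum_n M N) (fun v => sum_n (fun n => f n v) N) /\
  IntR (fun v => sum_n (fun n => f n v) N) = sum_n (fun n => IntR (f n)) N.
Proof.
  intros Hd Hf. induction N as [|N [IH1 IH2]].
  - split.
    + rewrite sum_O. replace (fun v => sum_n (fun n => f n v) 0) with (f O) by (extensionality v; now rewrite sum_O). auto.
    + rewrite sum_O. f_equal. extensionality v. now rewrite sum_O.
  - replace (fun v => sum_n (fun n => f n v) (S N)) with (fun v => sum_n (fun n => f n v) N + f (S N) v)
      by (extensionality v; now rewrite sum_Sn).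
    rewrite !sum_Sn. split.
    + now apply dominated_plus.
    + rewrite (IntR_plus d _ _ _ _ Hd IH1 (Hf (S N))). exact (f_equal (fun z => z + IntR (f (S N))) IH2).
Qed.

(** The error of a partial sum is itself dominated, with the tail of [M] as constant, so
    [IntR_bound] controls its integral. *)
Lemma IntR_Series (d : R) (M : nat -> R) (f : nat -> R -> R) : 0 < d ->
  (forall n, dominated d (M n) (f n)) -> ex_series M ->
  IntR (fun v => Series (fun n => f n v)) = Series (fun n => IntR (f n)).
Proof.
  intros Hd Hf HM. symmetry. apply is_series_unique.
  apply (is_series_squeeze _ (fun N => 2 / d * (Series M - sum_n M N))).
  2:{ replace (Finite 0) with (Rbar_mult (2 / d) 0) by (simpl; f_equal; ring).
      apply is_lim_seq_scal_l, tail_lim, HM. }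
  intros N. destruct (IntR_sum_n d M f N Hd Hf) as [D1 D2]. rewrite <- D2.
  pose proof (dominated_Series d M f Hd Hf HM) as D0.
  pose proof (dominated_scal _ _ (-1) _ D1) as D3.
  rewrite Rabs_minus_sym.
  replace (IntR (fun v => Series (fun n => f n v)) - IntR (fun v => sum_n (fun n => f n v) N))
    with (IntR (fun v => Series (fun n => f n v) + (-1) * sum_n (fun n => f n v) N)).
  2:{ rewrite (IntR_plus d _ _ _ _ Hd D0 D3), (IntR_scal d _ _ _ Hd D1). ring. }
  replace (2 / d * (Series M - sum_n M N)) with (2 * (Series M - sum_n M N) / d) by (field; lra).
  apply IntR_bound; trivial. split.
  - intros v. pose proof (dominated_plus _ _ _ _ _ D0 D3) as [C _]. apply C.
  - intros v.
    replace (Series (fun n => f n v) + -1 * sum_n (fun n => f n v) N) with (Series (fun n => f n v) - sum_n (fun n => f n v) N) by (toR; ring).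
    set (c := exp (- (d * Rabs v))).
    replace ((Series M - sum_n M N) * c) with (Series (fun n => c * M n) - sum_n (fun n => c * M n) N)
      by (rewrite Series_scal_l, sum_n_scal; ring).
    apply Series_tail_dom.
    + intros n. rewrite Rmult_comm. apply Hf.
    + now apply (ex_series_scal_l c M).
Qed.

(** Dominated convergence for series: the part beyond [K] is small uniformly in [N], and the part up
    to [K] is a finite sum. *)
Lemma Series_tannery (u : nat -> nat -> R) (l A : nat -> R) : ex_series A ->
  (forall N n, Rabs (u N n) <= A n) -> (forall n, is_lim_seq (fun N => u N n) (l n)) ->
  is_lim_seq (fun N => Series (u N)) (Series l).
Proof.
  intros HA Hb Hl.
  assert (Hlb : forall n, Rabs (l n) <= A n).
  { intros n. refine (is_lim_seq_le _ (fun _ => A n) (Finite _) (Finite _) (fun N => Hb N n) _ (is_lim_seq_const _)).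
    apply (is_lim_seq_abs _ (Finite _)), Hl. }
  apply is_lim_seq_eps. intros eps He.
  destruct (tail_small A (eps / 4) HA) as [K HK]; [lra|].
  pose proof (Rle_abs (Series A - sum_n A K)) as HK'.
  assert (L : is_lim_seq (fun N => sum_n (u N) K) (sum_n l K)).
  { clear HK HK'. induction K as [|K IH].
    - rewrite sum_O. apply is_lim_seq_ext with (fun N => u N O); [intros; now rewrite sum_O|apply Hl].
    - rewrite sum_Sn. apply is_lim_seq_ext with (fun N => sum_n (u N) K + u N (S K)).
      intros; now rewrite sum_Sn. now apply is_lim_seq_plus'. }
  destruct (is_lim_seq_eps_inv _ _ (eps / 4) L) as [N HN]; [lra|].
  exists N. intros n Hn. specialize (HN n Hn).
  pose proof (Series_tail_dom (u n) A K (Hb n) HA) as T1.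
  pose proof (Series_tail_dom l A K Hlb HA) as T2.
  replace (Series (u n) - Series l) with ((Series (u n) - sum_n (u n) K) + (sum_n (u n) K - sum_n l K) - (Series l - sum_n l K)) by (toR; ring).
  unfold Rminus at 1. eapply Rle_lt_trans. eapply Rle_trans. apply Rabs_triang. apply Rplus_le_compat_r. apply Rabs_triang.
  rewrite Rabs_Ropp. lra.
Qed.

Lemma Series_finite (u : nat -> R) (K : nat) : (forall n, (K < n)%nat -> u n = 0) ->
  ex_series u /\ Series u = sum_n u K.
Proof.
  intros H.
  assert (S : is_series u (sum_n u K)).
  { assert (Q : forall n, (K <= n)%nat -> sum_n u n = sum_n u K).
    { intros n Hn. induction Hn as [|n Hn IH]; trivial. rewrite sum_Sn, IH, H by lia. apply (plus_zero_r (sum_n u K)). }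
    refine (is_lim_seq_eps (sum_n u) (sum_n u K) _). intros eps He. exists K. intros n Hn.
    rewrite (Q n Hn), Rminus_eq_0, Rabs_R0. exact He. }
  split; [now exists (sum_n u K)|now apply is_series_unique].
Qed.

(** Indices are shifted by one: [d] stands for the divisor [S d] of [S n], and the cofactor is
    likewise handed to [f] as its predecessor. *)
Definition divisor_term (f : nat -> nat -> R) (n d : nat) : R :=
  if Nat.eqb (Nat.modulo (S n) (S d)) 0 then f d (Nat.pred (Nat.div (S n) (S d))) else 0.

Definition psum (u : nat -> R) (K : nat) : R :=
  match K with O => 0 | S K' => sum_n u K' end.

Lemma psum_S (u : nat -> R) (K : nat) : psum u (S K) = psum u K + u K.
Proof. destruct K; simpl. rewrite sum_O. toR; ring. now rewrite sum_Sn. Qed.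

(** The quotient counts the multiples of [S d], and a new one appears exactly when [S d] divides the
    next integer. *)
Lemma div_step (n d : nat) :
  (S (S n) / S d = S n / S d + (if Nat.eqb (S (S n) mod S d) 0 then 1 else 0))%nat.
Proof.
  pose proof (Nat.div_mod_eq (S (S n)) (S d)) as E2.
  pose proof (Nat.mod_upper_bound (S (S n)) (S d)) as B2.
  destruct (Nat.eqb_spec (S (S n) mod S d) 0) as [H|H].
  - rewrite H in E2. assert (S (S n) / S d <> 0)%nat by nia.
    destruct (S (S n) / S d)%nat as [|c] eqn:Ec; [lia|].
    assert (S n / S d = c)%nat; [|lia]. symmetry. apply (Nat.div_unique _ _ _ d). lia. lia.
  - rewrite Nat.add_0_r. apply (Nat.div_unique _ _ _ (S (S n) mod S d - 1)). lia. lia.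
Qed.

Lemma divisor_psum (f : nat -> nat -> R) (d N : nat) :
  sum_n (fun n => divisor_term f n d) N = psum (f d) (S N / S d).
Proof.
  induction N as [|N IH].
  - rewrite sum_O. unfold divisor_term. destruct d as [|d].
    + simpl. now rewrite sum_O.
    + rewrite Nat.mod_small by lia. rewrite Nat.div_small by lia. reflexivity.
  - rewrite sum_Sn, IH. pose proof (div_step N d) as D. unfold divisor_term.
    destruct (Nat.eqb_spec (S (S N) mod S d) 0) as [H|H].
    + rewrite D, Nat.add_1_r, psum_S. reflexivity.
    + rewrite D, Nat.add_0_r. apply (plus_zero_r (G := R_AbelianGroup)).
Qed.

Lemma psum_bound (u B : nat -> R) (K : nat) : (forall n, Rabs (u n) <= B n) -> ex_series B ->
  Rabs (psum u K) <= Series B.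
Proof.
  intros H HB. assert (B0 : forall n, 0 <= B n) by (intros n; pose proof (Rabs_pos (u n)); specialize (H n); lra).
  assert (E : Rabs (psum u K) <= psum B K).
  { induction K as [|K IH]; [simpl; rewrite Rabs_R0; lra|]. rewrite !psum_S.
    eapply Rle_trans. apply Rabs_triang. specialize (H K). lra. }
  eapply Rle_trans. exact E. destruct K as [|K]; simpl.
  - rewrite <- (Series_zero (fun _ => 0)) by trivial. apply Series_le; trivial. intros n; split; [lra|apply B0].
  - rewrite (Series_split B K HB).
    assert (0 <= Series (fun k => B (S K + k)%nat)).
    { rewrite <- (Series_zero (fun _ => 0)) by trivial. apply Series_le; [|now apply ex_series_tail]. intros n; split; [lra|apply B0]. }
    lra.
Qed.

Lemma psum_lim (u B : nat -> R) (d : nat) : (forall n, Rabs (u n) <= B n) -> ex_series B ->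
  is_lim_seq (fun N => psum u (S N / S d)) (Series u).
Proof.
  intros H HB. pose proof (Series_correct u (ex_series_dom u B H HB)) as HS.
  apply is_lim_seq_eps. intros eps He. destruct (is_lim_seq_eps_inv _ _ eps HS He) as [K HK].
  exists (S K * S d)%nat. intros n Hn.
  assert (Q : (S K <= S n / S d)%nat). { apply Nat.div_le_lower_bound; lia. }
  destruct (S n / S d)%nat as [|k]; [lia|]. simpl. apply HK. lia.
Qed.

(** Grouped by divisor, the partial sum up to [N] is the series over [d] of partial sums of [f d] of
    length [S N / S d]. Each of these tends to [Series (f d)] and is bounded by [A d * Series B], so
    [Series_tannery] applies. *)
Lemma dirichlet_rearrange (f : nat -> nat -> R) (A B : nat -> R) :
  (forall d m, Rabs (f d m) <= A d * B m) -> ex_series A -> ex_series B ->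
  is_series (fun n => sum_n (divisor_term f n) n) (Series (fun d => Series (f d))).
Proof.
  intros H HA HB.
  assert (E : forall N, sum_n (fun n => sum_n (divisor_term f n) n) N = Series (fun d => psum (f d) (S N / S d))
       /\ ex_series (fun d => psum (f d) (S N / S d))).
  { assert (Fin : forall n, ex_series (divisor_term f n) /\ Series (divisor_term f n) = sum_n (divisor_term f n) n).
    { intros n. apply Series_finite. intros d Hd. unfold divisor_term. now rewrite Nat.mod_small by lia. }
    induction N as [|N [IH IHe]].
    - rewrite sum_O. destruct (Fin O) as [F1 F2]. rewrite <- F2.
      assert (X : forall d, divisor_term f 0 d = psum (f d) (1 / S d)).
      { intros d. rewrite <- (divisor_psum f d 0). now rewrite sum_O. }
      split; [apply Series_ext, X|]. eapply ex_series_ext; [apply X|exact F1].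
    - rewrite sum_Sn, IH. destruct (Fin (S N)) as [F1 F2]. rewrite <- F2.
      assert (X : forall d, psum (f d) (S N / S d) + divisor_term f (S N) d = psum (f d) (S (S N) / S d)).
      { intros d. rewrite <- !(divisor_psum f d). now rewrite sum_Sn. }
      split.
      + unfold plus; simpl AbelianMonoid.plus. rewrite <- Series_plus by trivial. apply Series_ext, X.
      + eapply ex_series_ext; [apply X|]. now apply (ex_series_plus (V := R_NormedModule)). }
  assert (Ab : forall d, ex_series (fun m => A d * B m)) by (intros d; now apply (ex_series_scal_l (A d) B)).
  refine (is_lim_seq_ext _ (sum_n (fun n => sum_n (divisor_term f n) n)) (Finite (Series (fun d => Series (f d)))) (fun n => eq_sym (proj1 (E n))) _).
  apply (Series_tannery _ _ (fun d => A d * Series B)).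
  - now apply (ex_series_scal_r (Series B) A).
  - intros N d. rewrite <- Series_scal_l. now apply psum_bound.
  - intros d. apply (psum_lim _ (fun m => A d * B m)); trivial.
Qed.

Lemma sum_Sn_R (u : nat -> R) (n : nat) : sum_n u (S n) = sum_n u n + u (S n).
Proof. exact (sum_Sn u n). Qed.

Lemma ex_series_le_bound (u : nat -> R) (C : R) : (forall n, 0 <= u n) ->
  (forall n, sum_n u n <= C) -> ex_series u.
Proof.
  intros H0 HC. destruct (ex_finite_lim_seq_incr (sum_n u) C) as [l Hl]; trivial.
  - intros n. rewrite sum_Sn. unfold plus; simpl. specialize (H0 (S n)). lra.
  - exists l. exact Hl.
Qed.

(** Telescoping: [1 / (n+1)^(3/2)] is at most [2 / sqrt n - 2 / sqrt (n+1)]. The exponent 3/2 is the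
    decay that [ej_bound] will have to offer. *)
Lemma ex_series_inv_32 : ex_series (fun n => / (INR (S n) * sqrt (INR (S n)))).
Proof.
  assert (P : forall n, 0 < INR (S n)) by (intros; apply lt_0_INR; lia).
  assert (Q : forall n, 0 < sqrt (INR (S n))) by (intros; now apply sqrt_lt_R0).
  apply (ex_series_le_bound _ 3).
  - intros n. left. apply Rinv_0_lt_compat, Rmult_lt_0_compat; auto.
  - intros n. apply Rle_trans with (3 - 2 / sqrt (INR (S n))).
    2:{ assert (0 < 2 / sqrt (INR (S n))). apply Rdiv_lt_0_compat; [lra|auto]. lra. }
    induction n as [|n IH].
    + rewrite sum_O. simpl. rewrite sqrt_1. lra.
    + rewrite sum_Sn_R.
      set (s := sqrt (INR (S n))) in *. set (r := sqrt (INR (S (S n)))).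
      assert (Hs : 0 < s) by apply Q. assert (Hr : 0 < r) by apply Q.
      assert (Es : s * s = INR (S n)) by (apply sqrt_sqrt; left; apply P).
      assert (Er : r * r = INR (S (S n))) by (apply sqrt_sqrt; left; apply P).
      assert (D : r * r = s * s + 1) by (rewrite Es, Er; apply S_INR).
      rewrite <- Er.
      assert (Hrs : s < r) by nra.
      assert (X : / (r * r * r) <= 2 / s - 2 / r); [|lra].
      replace (2 / s - 2 / r) with (2 / (r * s * (r + s))) by (field_simplify_eq; [nra|lra]).
      apply Rmult_le_reg_r with (r * r * r * (r * s * (r + s))).
      { repeat apply Rmult_lt_0_compat; lra. }
      field_simplify; [|lra|lra]. nra.
Qed.

Lemma ex_series_inv_sqr : ex_series (fun n => / (INR (S n) ^ 2)).
Proof.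
  apply (ex_series_dom _ (fun n => / (INR (S n) * sqrt (INR (S n))))); [|apply ex_series_inv_32].
  intros n. assert (P : 1 <= INR (S n)) by (rewrite S_INR; pose proof (pos_INR n); lra).
  assert (Q : 1 <= sqrt (INR (S n))) by (rewrite <- sqrt_1; apply sqrt_le_1; lra).
  rewrite Rabs_pos_eq by (left; apply Rinv_0_lt_compat; nra).
  pose proof (sqrt_sqrt (INR (S n))). apply Rinv_le_contravar; nra.
Qed.

(** * Complex-valued limits, series and integrals *)

Lemma fst_le_Cmod (z : C) : Rabs (fst z) <= Cmod z.
Proof. eapply Rle_trans; [apply Rmax_l|apply Rmax_Cmod]. Qed.

Lemma snd_le_Cmod (z : C) : Rabs (snd z) <= Cmod z.
Proof. eapply Rle_trans; [apply Rmax_r|apply Rmax_Cmod]. Qed.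

Lemma Cmod_le_add (z : C) : Cmod z <= Rabs (fst z) + Rabs (snd z).
Proof.
  destruct z as [x y]. simpl. replace (x, y) with (Cplus (RtoC x) (Cmult Ci (RtoC y))).
  - eapply Rle_trans. apply Cmod_triangle. rewrite Cmod_mult, !Cmod_R, Cmod_Ci. lra.
  - apply injective_projections; simpl; ring.
Qed.

Lemma Cmod_minus_le (z w : C) : Cmod (z - w) <= Cmod z + Cmod w.
Proof. unfold Cminus. eapply Rle_trans. apply Cmod_triangle. rewrite Cmod_opp. lra. Qed.

Lemma Cmod_small_eq (z w : C) : (forall eps, 0 < eps -> Cmod (z - w) <= eps) -> z = w.
Proof.
  intros H. assert (E : Cmod (z - w) = 0).
  { apply Rle_antisym; [|apply Cmod_ge_0]. apply Rnot_lt_le. intros Hp.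
    specialize (H (Cmod (z - w) / 2)). lra. }
  apply Cmod_eq_0 in E. replace z with (z - w + w)%C by ring. rewrite E. ring.
Qed.

(** Complex limits, continuity, series and integrals are componentwise, so that the real theorems
    apply, while bounds are stated with [Cmod]. Going from a modulus to the components costs
    nothing; going back costs a factor 2. *)
Definition clim (u : nat -> C) (l : C) : Prop :=
  is_lim_seq (fun n => fst (u n)) (fst l) /\ is_lim_seq (fun n => snd (u n)) (snd l).

Definition ccont (f : R -> C) (v : R) : Prop :=
  continuous (fun y => fst (f y)) v /\ continuous (fun y => snd (f y)) v.

Definition cdom (d M : R) (f : R -> C) : Prop :=
  (forall v, ccont f v) /\ (forall v, Cmod (f v) <= M * exp (- (d * Rabs v))).

Definition csum (u : nat -> C) (A : nat -> R) : Prop :=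
  (forall n, Cmod (u n) <= A n) /\ ex_series A.

Definition CSeries (u : nat -> C) : C :=
  (Series (fun n => fst (u n)), Series (fun n => snd (u n))).

Definition CI (f : R -> C) : C :=
  (IntR (fun v => fst (f v)), IntR (fun v => snd (f v))).

Lemma clim_ext (u w : nat -> C) (l : C) : (forall n, u n = w n) -> clim u l -> clim w l.
Proof.
  intros E [A B]. split; eapply is_lim_seq_ext; eauto; intros n; simpl; now rewrite E.
Qed.

Lemma clim_const (c : C) : clim (fun _ => c) c.
Proof. split; apply is_lim_seq_const. Qed.

Lemma clim_plus (u w : nat -> C) (a b : C) : clim u a -> clim w b -> clim (fun n => u n + w n)%C (a + b)%C.
Proof. intros [A B] [A' B']. split; simpl; now apply is_lim_seq_plus'. Qed.

Lemma clim_mult (u w : nat -> C) (a b : C) : clim u a -> clim w b -> clim (fun n => u n * w n)%C (a * b)%C.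
Proof.
  intros [A B] [A' B']. split; simpl.
  - apply is_lim_seq_minus'; now apply is_lim_seq_mult'.
  - apply is_lim_seq_plus'; now apply is_lim_seq_mult'.
Qed.

Lemma clim_RtoC (u : nat -> R) (l : R) : is_lim_seq u l -> clim (fun n => RtoC (u n)) (RtoC l).
Proof. intros H. split; simpl; [exact H|apply is_lim_seq_const]. Qed.

Lemma clim_squeeze (u : nat -> C) (w : nat -> R) (l : C) :
  (forall n, Cmod (u n - l) <= w n) -> is_lim_seq w 0 -> clim u l.
Proof.
  intros H Hw. split; apply (is_lim_seq_squeeze0 _ w); trivial; intros n.
  - eapply Rle_trans; [apply (fst_le_Cmod (u n - l))|apply H].
  - eapply Rle_trans; [apply (snd_le_Cmod (u n - l))|apply H].
Qed.

Lemma clim_unique (u : nat -> C) (a b : C) : clim u a -> clim u b -> a = b.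
Proof.
  intros [A B] [A' B']. apply is_lim_seq_unique in A, B, A', B'.
  apply injective_projections; congruence.
Qed.

Lemma Csqr_pos (z : C) : z <> RtoC 0 -> 0 < fst z ^ 2 + snd z ^ 2.
Proof.
  intros H. apply Rnot_le_lt. intros L. apply H. apply injective_projections; simpl; nra.
Qed.

Lemma clim_inv (u : nat -> C) (a : C) : a <> RtoC 0 -> clim u a -> clim (fun n => / u n)%C (/ a)%C.
Proof.
  intros Ha [A B].
  assert (D : is_lim_seq (fun n => fst (u n) ^ 2 + snd (u n) ^ 2) (fst a ^ 2 + snd a ^ 2)).
  { assert (Q : forall w b, is_lim_seq w (Finite b) -> is_lim_seq (fun n => w n ^ 2) (b ^ 2)).
    { intros w b Hw. apply is_lim_seq_ext with (fun n => w n * w n); [intros; ring|].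
      replace (b ^ 2) with (b * b) by ring. now apply is_lim_seq_mult'. }
    apply is_lim_seq_plus'; now apply Q. }
  pose proof (Csqr_pos a Ha) as P.
  split; unfold Cinv; cbn [fst snd]; apply is_lim_seq_div'; trivial; try lra.
  exact (proj1 (is_lim_seq_opp _ (Finite (snd a))) B).
Qed.

Lemma ccont_const (c : C) (v : R) : ccont (fun _ => c) v.
Proof. split; apply continuous_const. Qed.

Lemma ccont_plus (f g : R -> C) (v : R) : ccont f v -> ccont g v -> ccont (fun y => f y + g y)%C v.
Proof.
  intros [A B] [A' B']. split; simpl.
  - now apply (continuous_plus (V := R_NormedModule)).
  - now apply (continuous_plus (V := R_NormedModule)).
Qed.

Lemma ccont_opp (f : R -> C) (v : R) : ccont f v -> ccont (fun y => - f y)%C v.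
Proof. intros [A B]. split; simpl; now apply (continuous_opp (V := R_NormedModule)). Qed.

Lemma ccont_minus (f g : R -> C) (v : R) : ccont f v -> ccont g v -> ccont (fun y => f y - g y)%C v.
Proof. intros. unfold Cminus. apply ccont_plus; trivial. now apply ccont_opp. Qed.

Lemma ccont_mult (f g : R -> C) (v : R) : ccont f v -> ccont g v -> ccont (fun y => f y * g y)%C v.
Proof.
  intros [A B] [A' B']. split; simpl.
  - apply (continuous_minus (V := R_NormedModule)); now apply (continuous_mult (K := R_AbsRing)).
  - apply (continuous_plus (V := R_NormedModule)); now apply (continuous_mult (K := R_AbsRing)).
Qed.

Lemma ccont_pow (f : R -> C) (n : nat) (v : R) : ccont f v -> ccont (fun y => f y ^ n)%C v.
Proof. intros H. induction n as [|n IH]; simpl; [apply ccont_const|now apply ccont_mult]. Qed.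

Lemma ccont_RtoC (f : R -> R) (v : R) : continuous f v -> ccont (fun y => RtoC (f y)) v.
Proof. intros H. split; simpl; [exact H|apply continuous_const]. Qed.

Lemma ccont_inv (f : R -> C) (v : R) : f v <> RtoC 0 -> ccont f v -> ccont (fun y => / f y)%C v.
Proof.
  intros H [A B]. pose proof (Csqr_pos _ H) as P.
  assert (D : continuous (fun y => / (fst (f y) ^ 2 + snd (f y) ^ 2)) v).
  { apply (continuous_comp (fun y => fst (f y) ^ 2 + snd (f y) ^ 2) Rinv).
    - assert (Q : forall w : R -> R, continuous w v -> continuous (fun y => w y ^ 2) v).
      { intros w Hw. apply continuous_ext with (fun y => mult (w y) (w y)); [intros; unfold mult; simpl; toR; ring|].
        now apply (continuous_mult (K := R_AbsRing)). }
      apply (continuous_plus (V := R_NormedModule)); now apply Q.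
    - apply continuous_Rinv. lra. }
  split; unfold Cinv; cbn [fst snd]; unfold Rdiv; apply (continuous_mult (K := R_AbsRing)); trivial.
  now apply (continuous_opp (V := R_NormedModule)).
Qed.

Lemma ccont_comp (f : R -> C) (g : R -> R) (v : R) : continuous g v -> ccont f (g v) -> ccont (fun y => f (g y)) v.
Proof.
  intros Hg [A B]. split.
  - now apply (continuous_comp g (fun y => fst (f y))).
  - now apply (continuous_comp g (fun y => snd (f y))).
Qed.

Lemma cdom_fst (d M : R) (f : R -> C) : cdom d M f -> dominated d M (fun v => fst (f v)).
Proof. intros [A B]. split; intros v; [apply A|]. eapply Rle_trans; [apply fst_le_Cmod|apply B]. Qed.

Lemma cdom_snd (d M : R) (f : R -> C) : cdom d M f -> dominated d M (fun v => snd (f v)).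
Proof. intros [A B]. split; intros v; [apply A|]. eapply Rle_trans; [apply snd_le_Cmod|apply B]. Qed.

Lemma CI_bound (d M : R) (f : R -> C) : 0 < d -> cdom d M f -> Cmod (CI f) <= 4 / d * M.
Proof.
  intros Hd H. eapply Rle_trans. apply Cmod_le_add. simpl.
  pose proof (IntR_bound d M _ Hd (cdom_fst _ _ _ H)). pose proof (IntR_bound d M _ Hd (cdom_snd _ _ _ H)).
  replace (4 / d * M) with (2 * M / d + 2 * M / d) by (field; lra). lra.
Qed.

Lemma cdom_shift_ex (d M h : R) (f : R -> C) : 0 < d -> cdom d M f -> exists M', cdom d M' (fun v => f (v + h)).
Proof.
  intros Hd Hf. pose proof (dominated_shift d M h _ Hd (cdom_fst _ _ _ Hf)) as [A1 A2].
  pose proof (dominated_shift d M h _ Hd (cdom_snd _ _ _ Hf)) as [B1 B2].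
  exists (M * exp (d * Rabs h) + M * exp (d * Rabs h)). split.
  - intros v. split; auto.
  - intros v. eapply Rle_trans. apply Cmod_le_add. specialize (A2 v). specialize (B2 v). simpl in A2, B2. lra.
Qed.

Lemma cdom_plus (d M1 M2 : R) (f g : R -> C) :
  cdom d M1 f -> cdom d M2 g -> cdom d (M1 + M2) (fun v => f v + g v)%C.
Proof.
  intros [A B] [A' B']. split; intros v; [now apply ccont_plus|].
  eapply Rle_trans. apply Cmod_triangle. specialize (B v). specialize (B' v). lra.
Qed.

Lemma cdom_scal (d M : R) (c : C) (f : R -> C) : cdom d M f -> cdom d (Cmod c * M) (fun v => c * f v)%C.
Proof.
  intros [A B]. split; intros v; [apply ccont_mult; [apply ccont_const|apply A]|].
  rewrite Cmod_mult, Rmult_assoc. apply Rmult_le_compat_l; [apply Cmod_ge_0|apply B].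
Qed.

Lemma CI_plus (d M1 M2 : R) (f g : R -> C) : 0 < d -> cdom d M1 f -> cdom d M2 g ->
  CI (fun v => f v + g v)%C = (CI f + CI g)%C.
Proof.
  intros Hd Hf Hg. unfold CI, Cplus. simpl. f_equal.
  - apply (IntR_plus d M1 M2); trivial; now apply cdom_fst.
  - apply (IntR_plus d M1 M2); trivial; now apply cdom_snd.
Qed.

Lemma CI_scal (d M : R) (c : C) (f : R -> C) : 0 < d -> cdom d M f ->
  CI (fun v => c * f v)%C = (c * CI f)%C.
Proof.
  intros Hd Hf. pose proof (cdom_fst _ _ _ Hf) as H1. pose proof (cdom_snd _ _ _ Hf) as H2.
  unfold CI, Cmult; cbn [fst snd]. f_equal.
  - replace (fun v => fst c * fst (f v) - snd c * snd (f v))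
      with (fun v => fst c * fst (f v) + (- snd c) * snd (f v)) by (extensionality v; ring).
    rewrite (IntR_plus d _ _ _ _ Hd (dominated_scal _ _ _ _ H1) (dominated_scal _ _ _ _ H2)).
    rewrite (IntR_scal d _ _ _ Hd H1), (IntR_scal d _ _ _ Hd H2). ring.
  - rewrite (IntR_plus d _ _ _ _ Hd (dominated_scal _ _ _ _ H2) (dominated_scal _ _ _ _ H1)).
    rewrite (IntR_scal d _ _ _ Hd H1), (IntR_scal d _ _ _ Hd H2). ring.
Qed.

Lemma CI_minus (d M1 M2 : R) (f g : R -> C) : 0 < d -> cdom d M1 f -> cdom d M2 g ->
  CI (fun v => f v - g v)%C = (CI f - CI g)%C.
Proof.
  intros Hd Hf Hg.
  replace (fun v => f v - g v)%C with (fun v => f v + (RtoC (-1)) * g v)%C by (extensionality v; ring).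
  rewrite (CI_plus d _ _ _ _ Hd Hf (cdom_scal _ _ _ _ Hg)), (CI_scal d _ _ _ Hd Hg). ring.
Qed.

Lemma CI_shift (d M h : R) (f : R -> C) : 0 < d -> cdom d M f -> CI (fun v => f (v + h)) = CI f.
Proof.
  intros Hd Hf. unfold CI. f_equal.
  - apply (IntR_shift d M h (fun v => fst (f v))); trivial. now apply cdom_fst.
  - apply (IntR_shift d M h (fun v => snd (f v))); trivial. now apply cdom_snd.
Qed.

Lemma CI_reflect (d M : R) (f : R -> C) : 0 < d -> cdom d M f -> CI (fun v => f (- v)) = CI f.
Proof.
  intros Hd Hf. unfold CI. f_equal.
  - apply (IntR_reflect d M (fun v => fst (f v))); trivial. now apply cdom_fst.
  - apply (IntR_reflect d M (fun v => snd (f v))); trivial. now apply cdom_snd.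
Qed.

Lemma CI_RtoC (f : R -> R) : CI (fun v => RtoC (f v)) = RtoC (IntR f).
Proof.
  unfold CI, RtoC. simpl. f_equal. apply IntR_unique.
  apply is_lim_seq_ext with (fun _ => 0); [|apply is_lim_seq_const].
  intros n. rewrite RInt_const. unfold scal; simpl; unfold mult; simpl. ring.
Qed.

Definition cderiv (H : R -> C) (v : R) (l : C) : Prop :=
  is_derive (fun y => fst (H y)) v (fst l) /\ is_derive (fun y => snd (H y)) v (snd l).

Lemma CI_FTC (f H : R -> C) (l : C) :
  (forall v, cderiv H v (f v)) -> (forall v, ccont f v) ->
  clim (fun n => H (INR n) - H (Ropp (INR n)))%C l -> CI f = l.
Proof.
  intros HD HC [L1 L2]. apply injective_projections; simpl.
  - apply (IntR_FTC _ (fun y => fst (H y))); trivial; intros v; [apply HD|apply HC].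
  - apply (IntR_FTC _ (fun y => snd (H y))); trivial; intros v; [apply HD|apply HC].
Qed.

Lemma csum_fst (u : nat -> C) (A : nat -> R) : csum u A -> ex_series (fun n => fst (u n)).
Proof. intros [H HA]. apply (ex_series_dom _ A); trivial. intros n. eapply Rle_trans; [apply fst_le_Cmod|apply H]. Qed.

Lemma csum_snd (u : nat -> C) (A : nat -> R) : csum u A -> ex_series (fun n => snd (u n)).
Proof. intros [H HA]. apply (ex_series_dom _ A); trivial. intros n. eapply Rle_trans; [apply snd_le_Cmod|apply H]. Qed.

Lemma CSeries_ext (u w : nat -> C) : (forall n, u n = w n) -> CSeries u = CSeries w.
Proof. intros H. f_equal. extensionality n. apply H. Qed.

Lemma CSeries_bound (u : nat -> C) (A : nat -> R) : csum u A -> Cmod (CSeries u) <= 2 * Series A.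
Proof.
  intros [H HA]. eapply Rle_trans. apply Cmod_le_add. simpl.
  assert (Rabs (Series (fun n => fst (u n))) <= Series A).
  { apply Series_dom_le; trivial. intros n. eapply Rle_trans; [apply fst_le_Cmod|apply H]. }
  assert (Rabs (Series (fun n => snd (u n))) <= Series A).
  { apply Series_dom_le; trivial. intros n. eapply Rle_trans; [apply snd_le_Cmod|apply H]. }
  lra.
Qed.

Lemma csum_scal (c : C) (u : nat -> C) (A : nat -> R) : csum u A -> csum (fun n => c * u n)%C (fun n => Cmod c * A n).
Proof.
  intros [H HA]. split.
  - intros n. rewrite Cmod_mult. apply Rmult_le_compat_l; [apply Cmod_ge_0|apply H].
  - now apply (ex_series_scal_l (Cmod c) A).
Qed.

Lemma CSeries_plus (u w : nat -> C) (A B : nat -> R) : csum u A -> csum w B ->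
  CSeries (fun n => u n + w n)%C = (CSeries u + CSeries w)%C.
Proof.
  intros Hu Hw. unfold CSeries, Cplus; cbn [fst snd]. f_equal; apply Series_plus.
  eapply csum_fst; eauto. eapply csum_fst; eauto. eapply csum_snd; eauto. eapply csum_snd; eauto.
Qed.

Lemma CSeries_scal (c : C) (u : nat -> C) (A : nat -> R) : csum u A ->
  CSeries (fun n => c * u n)%C = (c * CSeries u)%C.
Proof.
  intros Hu. pose proof (csum_fst _ _ Hu) as H1. pose proof (csum_snd _ _ Hu) as H2.
  unfold CSeries, Cmult; cbn [fst snd]. f_equal.
  - rewrite Series_minus by (apply (ex_series_scal_l (V := R_NormedModule)); trivial). now rewrite !Series_scal_l.
  - rewrite Series_plus by (apply (ex_series_scal_l (V := R_NormedModule)); trivial). now rewrite !Series_scal_l.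
Qed.

Lemma CSeries_minus (u w : nat -> C) (A B : nat -> R) : csum u A -> csum w B ->
  CSeries (fun n => u n - w n)%C = (CSeries u - CSeries w)%C.
Proof.
  intros Hu Hw. rewrite (CSeries_ext _ (fun n => u n + RtoC (-1) * w n)%C) by (intros; ring).
  rewrite (CSeries_plus _ _ A _ Hu (csum_scal _ _ _ Hw)), (CSeries_scal _ _ _ Hw). ring.
Qed.

Lemma sum_n_C (u : nat -> C) (N : nat) :
  @sum_n (NormedModule.AbelianMonoid C_AbsRing C_NormedModule) u N = (sum_n (fun n => fst (u n)) N, sum_n (fun n => snd (u n)) N).
Proof.
  induction N as [|N IH].
  - rewrite !sum_O. apply surjective_pairing.
  - rewrite !sum_Sn, IH. reflexivity.
Qed.

Lemma is_series_C (u : nat -> C) (l : C) :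
  is_series (fun n => fst (u n)) (fst l) -> is_series (fun n => snd (u n)) (snd l) ->
  is_series (K := C_AbsRing) (V := C_NormedModule) u l.
Proof.
  intros H1 H2. apply filterlim_locally. intros eps.
  pose proof (proj1 (filterlim_locally (U := R_UniformSpace) _ _) H1 eps) as A.
  pose proof (proj1 (filterlim_locally (U := R_UniformSpace) _ _) H2 eps) as B.
  assert (L := filter_and _ _ A B). revert L. apply filter_imp.
  intros n [X Y]. rewrite sum_n_C. split; assumption.
Qed.

Lemma is_series_C_inv (u : nat -> C) (l : C) :
  is_series (K := C_AbsRing) (V := C_NormedModule) u l ->
  is_series (fun n => fst (u n)) (fst l) /\ is_series (fun n => snd (u n)) (snd l).
Proof.
  intros H. pose proof (proj1 (filterlim_locally (U := C_UniformSpace) _ _) H) as A.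
  split; apply (filterlim_locally (U := R_UniformSpace)); intros eps; generalize (A eps); apply filter_imp;
    intros n; rewrite sum_n_C; intros [X Y]; assumption.
Qed.

Lemma CSeries_unique (u : nat -> C) (l : C) :
  is_series (K := C_AbsRing) (V := C_NormedModule) u l -> CSeries u = l.
Proof.
  intros H. apply is_series_C_inv in H. destruct H as [A B].
  apply injective_projections; simpl; now apply is_series_unique.
Qed.

Lemma CI_CSeries (d : R) (M : nat -> R) (f : nat -> R -> C) : 0 < d ->
  (forall n, cdom d (M n) (f n)) -> ex_series M ->
  CI (fun v => CSeries (fun n => f n v)) = CSeries (fun n => CI (f n)).
Proof.
  intros Hd Hf HM. unfold CI, CSeries. simpl. f_equal.
  - apply (IntR_Series d M (fun n v => fst (f n v))); trivial. intros n. now apply cdom_fst.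
  - apply (IntR_Series d M (fun n v => snd (f n v))); trivial. intros n. now apply cdom_snd.
Qed.

Lemma cdom_CSeries (d : R) (M : nat -> R) (f : nat -> R -> C) : 0 < d ->
  (forall n, cdom d (M n) (f n)) -> ex_series M ->
  cdom d (2 * Series M) (fun v => CSeries (fun n => f n v)).
Proof.
  intros Hd Hf HM.
  pose proof (dominated_Series d M (fun n v => fst (f n v)) Hd (fun n => cdom_fst _ _ _ (Hf n)) HM) as [A1 A2].
  pose proof (dominated_Series d M (fun n v => snd (f n v)) Hd (fun n => cdom_snd _ _ _ (Hf n)) HM) as [B1 B2].
  split.
  - intros v. split; auto.
  - intros v. eapply Rle_trans. apply Cmod_le_add. simpl. specialize (A2 v). specialize (B2 v). lra.
Qed.

Lemma ccont_CSeries (f : nat -> R -> C) (A : nat -> R) (v : R) :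
  (forall n, ccont (f n) v) -> ex_series A ->
  locally v (fun y => forall n, Cmod (f n y) <= A n) ->
  ccont (fun y => CSeries (fun n => f n y)) v.
Proof.
  intros Hc HA Hb. split; simpl.
  - apply (continuous_Series (fun n y => fst (f n y)) A); trivial. { intros n; apply Hc. }
    revert Hb. apply filter_imp. intros y Hy n. eapply Rle_trans; [apply fst_le_Cmod|apply Hy].
  - apply (continuous_Series (fun n y => snd (f n y)) A); trivial. { intros n; apply Hc. }
    revert Hb. apply filter_imp. intros y Hy n. eapply Rle_trans; [apply snd_le_Cmod|apply Hy].
Qed.

Lemma CSeries_tannery (u : nat -> nat -> C) (l : nat -> C) (A : nat -> R) : ex_series A ->
  (forall N n, Cmod (u N n) <= A n) -> (forall n, clim (fun N => u N n) (l n)) ->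
  clim (fun N => CSeries (u N)) (CSeries l).
Proof.
  intros HA Hb Hl. split; simpl.
  - apply (Series_tannery (fun N n => fst (u N n)) (fun n => fst (l n)) A); trivial; [|intros n; apply Hl].
    intros N n. eapply Rle_trans; [apply fst_le_Cmod|apply Hb].
  - apply (Series_tannery (fun N n => snd (u N n)) (fun n => snd (l n)) A); trivial; [|intros n; apply Hl].
    intros N n. eapply Rle_trans; [apply snd_le_Cmod|apply Hb].
Qed.

Definition cdivisor_sum (f : nat -> nat -> C) (n : nat) : C :=
  @sum_n (NormedModule.AbelianMonoid C_AbsRing C_NormedModule) (fun i =>
    if Nat.eqb (Nat.modulo (S n) (S i)) 0 then f i (Nat.pred (Nat.div (S n) (S i))) else RtoC 0) n.

Lemma cdirichlet_rearrange (f : nat -> nat -> C) (A B : nat -> R) :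
  (forall d m, Cmod (f d m) <= A d * B m) -> ex_series A -> ex_series B ->
  is_series (K := C_AbsRing) (V := C_NormedModule) (cdivisor_sum f) (CSeries (fun d => CSeries (f d))).
Proof.
  intros H HA HB. apply is_series_C; unfold CSeries; cbn [fst snd].
  - eapply is_series_ext; [|apply (dirichlet_rearrange (fun d m => fst (f d m)) A B); trivial].
    + intros n. unfold cdivisor_sum. rewrite sum_n_C. cbn [fst snd]. apply sum_n_ext. intros d.
      unfold divisor_term. now destruct (Nat.eqb _ 0).
    + intros d m. eapply Rle_trans; [apply fst_le_Cmod|apply H].
  - eapply is_series_ext; [|apply (dirichlet_rearrange (fun d m => snd (f d m)) A B); trivial].
    + intros n. unfold cdivisor_sum. rewrite sum_n_C. cbn [fst snd]. apply sum_n_ext. intros d.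
      unfold divisor_term. now destruct (Nat.eqb _ 0).
    + intros d m. eapply Rle_trans; [apply snd_le_Cmod|apply H].
Qed.

(** Integrates a product of two series term by term and regroups the result according to the product
    of the two indices. It serves both sides of the theorem: the Bessel series and the series in
    [n + A]. *)
Lemma CI_product_series (d : R) (f g : nat -> R -> C) (A B : nat -> R) : 0 < d ->
  (forall i v, ccont (f i) v) -> (forall j v, ccont (g j) v) ->
  (forall i j v, Cmod (f i v * g j v) <= A i * B j * exp (- (d * Rabs v))) ->
  ex_series A -> ex_series B ->
  (forall v, exists A', csum (fun i => f i v) A') -> (forall v, exists B', csum (fun j => g j v) B') ->
  CI (fun v => CSeries (fun i => f i v) * CSeries (fun j => g j v))%C
    = CSeries (fun i => CSeries (fun j => CI (fun v => f i v * g j v)%C)) /\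
  is_series (K := C_AbsRing) (V := C_NormedModule)
    (cdivisor_sum (fun i j => CI (fun v => f i v * g j v)%C))
    (CI (fun v => CSeries (fun i => f i v) * CSeries (fun j => g j v))%C).
Proof.
  intros Hd Hf Hg Hb HA HB Sf Sg.
  assert (D : forall i j, cdom d (A i * B j) (fun v => f i v * g j v)%C).
  { intros i j. split; intros v; [now apply ccont_mult|apply Hb]. }
  assert (E : CI (fun v => CSeries (fun i => f i v) * CSeries (fun j => g j v))%C
    = CSeries (fun i => CSeries (fun j => CI (fun v => f i v * g j v)%C))).
  { transitivity (CI (fun v => CSeries (fun i => CSeries (fun j => f i v * g j v)%C))).
    - f_equal. extensionality v. destruct (Sf v) as [A' SA]. destruct (Sg v) as [B' SB].
      rewrite Cmult_comm, <- (CSeries_scal _ _ _ SA). apply CSeries_ext. intros i.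
      rewrite Cmult_comm. now rewrite (CSeries_scal _ _ _ SB).
    - rewrite (CI_CSeries d (fun i => 2 * Series (fun j => A i * B j))); trivial.
      + apply CSeries_ext. intros i. apply (CI_CSeries d (fun j => A i * B j)); trivial.
        now apply (ex_series_scal_l (A i) B).
      + intros i. apply (cdom_CSeries d (fun j => A i * B j)); trivial. now apply (ex_series_scal_l (A i) B).
      + apply (ex_series_scal_l (V := R_NormedModule)).
        apply ex_series_ext with (fun i => A i * Series B). { intros i. now rewrite Series_scal_l. }
        now apply (ex_series_scal_r (Series B) A). }
  split; trivial. rewrite E.
  apply (cdirichlet_rearrange _ (fun i => 4 / d * A i) B); trivial.
  - intros i j. rewrite Rmult_assoc. now apply CI_bound.
  - now apply (ex_series_scal_l (4 / d) A).
Qed.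

(** * Complex differentiation and Goursat's theorem *)

(** Differentiability over [C_AbsRing] as a module over itself, where the product and chain rules
    live; the hypothesis on [L] uses [C_NormedModule] instead. The epsilon forms [is_derive_C_eps]
    and [Cdiff_intro] connect the two. *)
Definition Cdiff (f : C -> C) (s l : C) : Prop :=
  is_derive (K := C_AbsRing) (V := AbsRing_NormedModule C_AbsRing) f s l.

Lemma is_derive_C_eps (f : C -> C) (s l : C) :
  is_derive (K := C_AbsRing) (V := C_NormedModule) f s l ->
  forall eps, 0 < eps -> exists del, 0 < del /\ forall z, Cmod (z - s) < del ->
    Cmod (f z - f s - l * (z - s)) <= eps * Cmod (z - s).
Proof.
  intros [_ H] eps He. specialize (H s (fun P HP => HP) (mkposreal eps He)).
  destruct H as [[del Hdel] H]. exists del. split; trivial. intros z Hz.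
  specialize (H z Hz). simpl in H.
  replace (Cmod (f z - f s - l * (z - s))) with (Cmod ((f z + - f s) + - ((z + - s) * l))%C); [exact H|].
  f_equal. unfold Cminus. ring.
Qed.

Lemma Cdiff_intro (f : C -> C) (s l : C) :
  (forall eps, 0 < eps -> exists del, 0 < del /\ forall z, Cmod (z - s) < del ->
    Cmod (f z - f s - l * (z - s)) <= eps * Cmod (z - s)) -> Cdiff f s l.
Proof.
  intros H. split.
  - apply (is_linear_scal_l (K := C_AbsRing)).
  - intros x Hx. assert (Es : x = s).
    { symmetry. apply (is_filter_lim_locally_unique (V := AbsRing_NormedModule C_AbsRing) s x Hx). }
    subst x. intros [eps He]. destruct (H eps He) as [del [Hd H']].
    exists (mkposreal del Hd). intros z Hz. specialize (H' z Hz). simpl.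
    replace (Cmod (f z - f s - l * (z - s))) with (Cmod ((f z + - f s) + - ((z + - s) * l))%C) in H'; [exact H'|].
    f_equal. unfold Cminus. ring.
Qed.

Lemma Cdiff_eps (f : C -> C) (s l : C) : Cdiff f s l ->
  forall eps, 0 < eps -> exists del, 0 < del /\ forall z, Cmod (z - s) < del ->
    Cmod (f z - f s - l * (z - s)) <= eps * Cmod (z - s).
Proof.
  intros [_ H] eps He. specialize (H s (fun P HP => HP) (mkposreal eps He)).
  destruct H as [[del Hdel] H]. exists del. split; trivial. intros z Hz.
  specialize (H z Hz). simpl in H.
  replace (Cmod (f z - f s - l * (z - s))) with (Cmod ((f z + - f s) + - ((z + - s) * l))%C); [exact H|].
  f_equal. unfold Cminus. ring.
Qed.

Lemma Cdiff_const (c s : C) : Cdiff (fun _ => c) s (RtoC 0).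
Proof. exact (is_derive_const (K := C_AbsRing) (V := AbsRing_NormedModule C_AbsRing) c s). Qed.

Lemma Cdiff_id (s : C) : Cdiff (fun z => z) s (RtoC 1).
Proof. exact (is_derive_id (K := C_AbsRing) s). Qed.

Lemma Cdiff_plus (f g : C -> C) (s a b : C) : Cdiff f s a -> Cdiff g s b -> Cdiff (fun z => f z + g z)%C s (a + b)%C.
Proof. exact (is_derive_plus (K := C_AbsRing) (V := AbsRing_NormedModule C_AbsRing) f g s a b). Qed.

Lemma Cdiff_minus (f g : C -> C) (s a b : C) : Cdiff f s a -> Cdiff g s b -> Cdiff (fun z => f z - g z)%C s (a - b)%C.
Proof. exact (is_derive_minus (K := C_AbsRing) (V := AbsRing_NormedModule C_AbsRing) f g s a b). Qed.

Lemma Cdiff_mult (f g : C -> C) (s a b : C) : Cdiff f s a -> Cdiff g s b ->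
  Cdiff (fun z => f z * g z)%C s (a * g s + f s * b)%C.
Proof. intros H1 H2. exact (is_derive_mult (K := C_AbsRing) f g s a b H1 H2 Cmult_comm). Qed.

Lemma Cdiff_comp (f g : C -> C) (s a b : C) : Cdiff f (g s) a -> Cdiff g s b ->
  Cdiff (fun z => f (g z)) s (b * a)%C.
Proof. exact (is_derive_comp (K := C_AbsRing) (V := AbsRing_NormedModule C_AbsRing) f g s a b). Qed.

Lemma cexp_add (z w : C) : cexp (z + w) = (cexp z * cexp w)%C.
Proof.
  destruct z as [a b], w as [c d]. unfold cexp, Cplus, Cmult, Re, Im; cbn [fst snd].
  rewrite exp_plus, cos_plus, sin_plus. f_equal; ring.
Qed.

Lemma cexp_0 : cexp (RtoC 0) = RtoC 1.
Proof. unfold cexp. simpl. rewrite exp_0, cos_0, sin_0. apply injective_projections; simpl; ring. Qed.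

Lemma Cmod_cexp (z : C) : Cmod (cexp z) = exp (Re z).
Proof.
  unfold cexp, Cmod. simpl.
  replace (exp (Re z) * cos (Im z) * (exp (Re z) * cos (Im z) * 1) + exp (Re z) * sin (Im z) * (exp (Re z) * sin (Im z) * 1))
    with (Rsqr (exp (Re z)) * (Rsqr (sin (Im z)) + Rsqr (cos (Im z)))) by (unfold Rsqr; ring).
  rewrite sin2_cos2, Rmult_1_r. apply sqrt_Rsqr. left. apply exp_pos.
Qed.

(** Both directions come from [1 + x <= exp x], used at [x] and at [- x]. *)
Lemma exp_taylor1 (x : R) : Rabs (exp x - 1) <= Rabs x * exp (Rabs x).
Proof.
  pose proof (exp_ineq1_le x) as L1. pose proof (exp_ineq1_le (- x)) as L2.
  assert (P := exp_pos x). rewrite exp_Ropp in L2.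
  assert (L3 : exp x - 1 <= x * exp x).
  { apply Rmult_le_compat_l with (r := exp x) in L2; [|lra]. rewrite Rinv_r in L2 by lra. nra. }
  destruct (Rle_dec 0 x) as [H|H].
  - rewrite !Rabs_pos_eq by lra. lra.
  - rewrite (Rabs_left x) by lra. rewrite Rabs_left1 by (rewrite <- exp_0; apply Rle_minus, exp_mono; lra).
    assert (1 <= exp (- x)) by (rewrite <- exp_0; apply exp_mono; lra). nra.
Qed.

(** The mean value inequality for [exp t - 1 - t], whose derivative [exp_taylor1] bounds. *)
Lemma exp_taylor2 (x : R) : Rabs (exp x - 1 - x) <= x ^ 2 * exp (Rabs x).
Proof.
  assert (H : forall t, Rabs (t - 0) <= Rabs (x - 0) ->
    is_derive (fun t => exp t - 1 - t) t (exp t - 1) /\ Rabs (exp t - 1) <= Rabs x * exp (Rabs x)).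
  { intros t Ht. rewrite !Rminus_0_r in Ht. split.
    - auto_derive; trivial. ring.
    - eapply Rle_trans. apply exp_taylor1. apply Rmult_le_compat; try apply Rabs_pos; trivial.
      left; apply exp_pos. now apply exp_mono. }
  pose proof (bounded_variation _ _ _ _ _ H) as B; cbv beta in B. rewrite exp_0 in B.
  replace (exp x - 1 - x - (1 - 1 - 0)) with (exp x - 1 - x) in B by ring.
  eapply Rle_trans. exact B. rewrite Rminus_0_r, <- (pow2_abs x). apply Req_le. ring.
Qed.

Lemma cos_taylor (x : R) : Rabs (cos x - 1) <= x ^ 2.
Proof.
  assert (S : forall t, Rabs (sin t) <= Rabs t).
  { intros t. assert (H : forall y, Rabs (y - 0) <= Rabs (t - 0) -> is_derive sin y (cos y) /\ Rabs (cos y) <= 1).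
    { intros y _. split; [auto_derive; trivial; ring|]. apply Rabs_le. apply COS_bound. }
    pose proof (bounded_variation _ _ _ _ _ H) as B; cbv beta in B. rewrite sin_0, !Rminus_0_r, Rmult_1_l in B. exact B. }
  assert (H : forall y, Rabs (y - 0) <= Rabs (x - 0) -> is_derive cos y (- sin y) /\ Rabs (- sin y) <= Rabs x).
  { intros y Hy. rewrite !Rminus_0_r in Hy. split; [auto_derive; trivial; ring|]. rewrite Rabs_Ropp. eapply Rle_trans; [apply S|exact Hy]. }
  pose proof (bounded_variation _ _ _ _ _ H) as B; cbv beta in B. rewrite cos_0, Rminus_0_r in B.
  eapply Rle_trans. exact B. rewrite <- (pow2_abs x). apply Req_le. ring.
Qed.

Lemma sin_taylor (x : R) : Rabs (sin x - x) <= x ^ 2 * Rabs x.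
Proof.
  assert (H : forall y, Rabs (y - 0) <= Rabs (x - 0) ->
    is_derive (fun y => sin y - y) y (cos y - 1) /\ Rabs (cos y - 1) <= x ^ 2).
  { intros y Hy. rewrite !Rminus_0_r in Hy. split; [auto_derive; trivial; ring|]. eapply Rle_trans; [apply cos_taylor|].
    rewrite <- (pow2_abs x), <- (pow2_abs y). apply pow_incr. split; [apply Rabs_pos|exact Hy]. }
  pose proof (bounded_variation _ _ _ _ _ H) as B; cbv beta in B. rewrite sin_0, !Rminus_0_r in B. exact B.
Qed.

(** The constants are crude. What counts is a quadratic factor times an exponential: in
    [cdom_shift_estimate] the argument is [w * v] with [v] on the whole line, and only exponential
    growth can be absorbed there. *)
Lemma cexp_taylor (w : C) : Cmod (cexp w - 1 - w) <= 5 * Cmod w ^ 2 * exp (2 * Cmod w).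
Proof.
  destruct w as [x y]. set (m := Cmod (x, y)).
  assert (Hx : Rabs x <= m) by apply (fst_le_Cmod (x, y)).
  assert (Hy : Rabs y <= m) by apply (snd_le_Cmod (x, y)).
  assert (M0 : 0 <= m) by apply Cmod_ge_0.
  assert (Ex : exp (Rabs x) <= exp m) by now apply exp_mono.
  assert (Ex' : exp x <= exp m) by (eapply Rle_trans; [apply exp_mono, Rle_abs|exact Ex]).
  assert (E1 : 1 <= exp m) by (rewrite <- exp_0; apply exp_mono; lra).
  assert (Em : m <= exp m) by (pose proof (exp_ineq1_le m); lra).
  assert (X2 : x ^ 2 <= m ^ 2) by (rewrite <- (pow2_abs x); apply pow_incr; split; [apply Rabs_pos|trivial]).
  assert (Y2 : y ^ 2 <= m ^ 2) by (rewrite <- (pow2_abs y); apply pow_incr; split; [apply Rabs_pos|trivial]).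
  assert (P := exp_pos x). assert (M2 : 0 <= m ^ 2) by apply pow2_ge_0.
  eapply Rle_trans. apply Cmod_le_add. unfold cexp. simpl.
  replace (2 * m) with (m + m) by ring. rewrite exp_plus. set (e := exp m) in *.
  assert (A : Rabs (exp x * cos y + - (1) + - x) <= 2 * (m ^ 2 * e)).
  { replace (exp x * cos y + - (1) + - x) with ((exp x - 1 - x) + exp x * (cos y - 1)) by ring.
    eapply Rle_trans. apply Rabs_triang. rewrite Rabs_mult, (Rabs_pos_eq (exp x)) by lra.
    pose proof (exp_taylor2 x). pose proof (cos_taylor y).
    assert (x ^ 2 * exp (Rabs x) <= m ^ 2 * e) by (apply Rmult_le_compat; trivial; [apply pow2_ge_0|left; apply exp_pos]).
    assert (exp x * Rabs (cos y - 1) <= e * m ^ 2) by (apply Rmult_le_compat; try lra; apply Rabs_pos).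
    lra. }
  assert (B : Rabs (exp x * sin y + - 0 + - y) <= m ^ 2 * e * e + m ^ 2 * e).
  { replace (exp x * sin y + - 0 + - y) with (exp x * (sin y - y) + (exp x - 1) * y) by ring.
    eapply Rle_trans. apply Rabs_triang. rewrite !Rabs_mult, (Rabs_pos_eq (exp x)) by lra.
    pose proof (exp_taylor1 x) as T1. pose proof (sin_taylor y) as T2.
    apply Rplus_le_compat.
    - replace (m ^ 2 * e * e) with (e * (m ^ 2 * e)) by ring. apply Rmult_le_compat; try lra; [apply Rabs_pos|].
      eapply Rle_trans. exact T2. apply Rmult_le_compat; trivial; [apply pow2_ge_0|apply Rabs_pos|lra].
    - replace (m ^ 2 * e) with (m * e * m) by ring. apply Rmult_le_compat; try apply Rabs_pos; trivial.
      eapply Rle_trans. exact T1. apply Rmult_le_compat; trivial; [apply Rabs_pos|left; apply exp_pos]. }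
  assert (m ^ 2 * e <= m ^ 2 * e * e) by nra. nra.
Qed.

Lemma Cdiff_cexp (s : C) : Cdiff cexp s (cexp s).
Proof.
  apply Cdiff_intro. intros eps He. set (K := exp (Re s) * 5 * exp 2).
  assert (HK : 0 < K). { unfold K. pose proof (exp_pos (Re s)). pose proof (exp_pos 2). nra. }
  exists (Rmin 1 (eps / K)). split. { apply Rmin_pos; [lra|]. now apply Rdiv_lt_0_compat. }
  intros z Hz. set (w := (z - s)%C) in *.
  replace (cexp z - cexp s - cexp s * w)%C with (cexp s * (cexp w - 1 - w))%C.
  2:{ replace z with (s + w)%C by (unfold w; ring). rewrite cexp_add. ring. }
  rewrite Cmod_mult, Cmod_cexp. pose proof (cexp_taylor w) as T.
  pose proof (Rmin_l 1 (eps / K)). pose proof (Rmin_r 1 (eps / K)).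
  assert (W0 := Cmod_ge_0 w).
  apply Rle_trans with (K * Cmod w * Cmod w).
  - unfold K. rewrite !Rmult_assoc. apply Rmult_le_compat_l; [left; apply exp_pos|].
    eapply Rle_trans. exact T. rewrite !Rmult_assoc. apply Rmult_le_compat_l; [lra|].
    replace (exp 2 * (Cmod w * Cmod w)) with (Cmod w ^ 2 * exp 2) by ring.
    apply Rmult_le_compat_l; [apply pow2_ge_0|]. apply exp_mono. lra.
  - apply Rmult_le_compat_r; trivial.
    apply Rle_trans with (K * (eps / K)); [apply Rmult_le_compat_l; lra|]. apply Req_le. field. lra.
Qed.

(** * Integrals around rectangles and Goursat's theorem *)

Definition CR (f : R -> C) (a b : R) : C :=
  (RInt (fun v => fst (f v)) a b, RInt (fun v => snd (f v)) a b).

Definition ccont_on (f : R -> C) (a b : R) : Prop := forall v, a <= v <= b -> ccont f v.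

Lemma ccont_on_ex (f : R -> C) (a b : R) : a <= b -> ccont_on f a b ->
  ex_RInt (fun v => fst (f v)) a b /\ ex_RInt (fun v => snd (f v)) a b.
Proof.
  intros Hab H. split; apply (ex_RInt_continuous (V := R_CompleteNormedModule));
    intros z Hz; rewrite Rmin_left, Rmax_right in Hz by lra; now apply H.
Qed.

Lemma RInt_abs_bound (f : R -> R) (a b M : R) : a <= b -> ex_RInt f a b ->
  (forall v, a <= v <= b -> Rabs (f v) <= M) -> Rabs (RInt f a b) <= M * (b - a).
Proof.
  intros Hab He H. rewrite Rmult_comm. exact (norm_RInt_le_const f a b (RInt f a b) M Hab H (RInt_correct f a b He)).
Qed.

Lemma CR_bound (f : R -> C) (a b M : R) : a <= b -> ccont_on f a b ->
  (forall v, a <= v <= b -> Cmod (f v) <= M) -> Cmod (CR f a b) <= 2 * M * (b - a).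
Proof.
  intros Hab Hc H. destruct (ccont_on_ex f a b Hab Hc) as [E1 E2].
  eapply Rle_trans. apply Cmod_le_add. unfold CR; cbn [fst snd].
  assert (Rabs (RInt (fun v => fst (f v)) a b) <= M * (b - a)).
  { apply RInt_abs_bound; trivial. intros v Hv. eapply Rle_trans; [apply fst_le_Cmod|auto]. }
  assert (Rabs (RInt (fun v => snd (f v)) a b) <= M * (b - a)).
  { apply RInt_abs_bound; trivial. intros v Hv. eapply Rle_trans; [apply snd_le_Cmod|auto]. }
  lra.
Qed.

Lemma CR_minus (f g : R -> C) (a b : R) : a <= b -> ccont_on f a b -> ccont_on g a b ->
  CR (fun v => f v - g v)%C a b = (CR f a b - CR g a b)%C.
Proof.
  intros Hab Hf Hg. destruct (ccont_on_ex f a b Hab Hf) as [F1 F2]. destruct (ccont_on_ex g a b Hab Hg) as [G1 G2].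
  apply injective_projections; simpl.
  - exact (RInt_minus (fun v => fst (f v)) (fun v => fst (g v)) a b F1 G1).
  - exact (RInt_minus (fun v => snd (f v)) (fun v => snd (g v)) a b F2 G2).
Qed.

Lemma CR_Chasles (f : R -> C) (a b c : R) : a <= b -> b <= c -> ccont_on f a c ->
  CR f a c = (CR f a b + CR f b c)%C.
Proof.
  intros Hab Hbc H.
  destruct (ccont_on_ex f a b Hab) as [F1 F2]. { intros v Hv; apply H; lra. }
  destruct (ccont_on_ex f b c Hbc) as [G1 G2]. { intros v Hv; apply H; lra. }
  apply injective_projections; simpl; symmetry.
  - exact (RInt_Chasles (fun v => fst (f v)) a b c F1 G1).
  - exact (RInt_Chasles (fun v => snd (f v)) a b c F2 G2).
Qed.

(** The integral along the boundary, counterclockwise; the factor [Ci] on the vertical sides is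
    [dz = i dy]. *)
Definition rect (f : C -> C) (x1 x2 y1 y2 : R) : C :=
  (CR (fun x => f (x, y1)) x1 x2 - CR (fun x => f (x, y2)) x1 x2
   + Ci * (CR (fun y => f (x2, y)) y1 y2 - CR (fun y => f (x1, y)) y1 y2))%C.

(** Continuity along horizontal and vertical lines is all that [rect] needs. The half-plane
    [0 < Re s] is where the Mellin transform of [gamf] converges. *)
Definition hcont (f : C -> C) : Prop :=
  forall x y, 0 < x -> ccont (fun t => f (t, y)) x /\ ccont (fun t => f (x, t)) y.

Definition holo (f : C -> C) : Prop := forall s, 0 < Re s -> exists l, Cdiff f s l.

Lemma ccont_Cmod (f : R -> C) (v : R) :
  (forall eps, 0 < eps -> locally v (fun y => Cmod (f y - f v) < eps)) -> ccont f v.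
Proof.
  intros H. split; apply filterlim_locally; intros [eps He]; generalize (H eps He); apply filter_imp; intros y Hy.
  - exact (Rle_lt_trans _ _ _ (fst_le_Cmod (f y - f v)) Hy).
  - exact (Rle_lt_trans _ _ _ (snd_le_Cmod (f y - f v)) Hy).
Qed.

Lemma Cdiff_close (f : C -> C) (s l : C) (eps : R) : Cdiff f s l -> 0 < eps ->
  exists del, 0 < del /\ forall z, Cmod (z - s) < del -> Cmod (f z - f s) < eps.
Proof.
  intros H He. destruct (Cdiff_eps f s l H 1 Rlt_0_1) as [del [Hd H']].
  assert (K : 0 < 1 + Cmod l) by (pose proof (Cmod_ge_0 l); lra).
  exists (Rmin del (eps / (1 + Cmod l))). split. { apply Rmin_pos; trivial. now apply Rdiv_lt_0_compat. }
  intros z Hz. pose proof (Rmin_l del (eps / (1 + Cmod l))). pose proof (Rmin_r del (eps / (1 + Cmod l))).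
  specialize (H' z ltac:(lra)).
  replace (f z - f s)%C with ((f z - f s - l * (z - s)) + l * (z - s))%C by ring.
  eapply Rle_lt_trans. apply Cmod_triangle. rewrite Cmod_mult.
  apply Rle_lt_trans with ((1 + Cmod l) * Cmod (z - s)); [lra|].
  replace eps with ((1 + Cmod l) * (eps / (1 + Cmod l))) by (field; lra).
  apply Rmult_lt_compat_l; lra.
Qed.

Lemma Cmod_hdiff (t x y : R) : Cmod ((t, y) - (x, y)) = Rabs (t - x).
Proof. rewrite <- Cmod_R. f_equal. apply injective_projections; simpl; ring. Qed.

Lemma Cmod_vdiff (t x y : R) : Cmod ((x, t) - (x, y)) = Rabs (t - y).
Proof.
  rewrite <- Cmod_R, <- (Rmult_1_l (Cmod (RtoC _))), <- Cmod_Ci, <- Cmod_mult.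
  f_equal. apply injective_projections; simpl; ring.
Qed.

Lemma holo_hcont (f : C -> C) : holo f -> hcont f.
Proof.
  intros H x y Hx. destruct (H (x, y) Hx) as [l Hl].
  split; apply ccont_Cmod; intros eps He; destruct (Cdiff_close f _ l eps Hl He) as [del [Hd H']];
    exists (mkposreal del Hd); intros t Ht; apply H'.
  - eapply Rle_lt_trans; [apply Req_le, Cmod_hdiff|exact Ht].
  - eapply Rle_lt_trans; [apply Req_le, Cmod_vdiff|exact Ht].
Qed.

Lemma hcont_h (f : C -> C) (y x1 x2 : R) : hcont f -> 0 < x1 -> ccont_on (fun x => f (x, y)) x1 x2.
Proof. intros H H1 v Hv. apply H. lra. Qed.

Lemma hcont_v (f : C -> C) (x y1 y2 : R) : hcont f -> 0 < x -> ccont_on (fun y => f (x, y)) y1 y2.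
Proof. intros H H1 v Hv. now apply H. Qed.

Lemma rect_split_x (f : C -> C) (x1 xm x2 y1 y2 : R) : hcont f -> 0 < x1 -> x1 <= xm <= x2 ->
  rect f x1 x2 y1 y2 = (rect f x1 xm y1 y2 + rect f xm x2 y1 y2)%C.
Proof.
  intros H Hx Hm. unfold rect.
  rewrite (CR_Chasles (fun x => f (x, y1)) x1 xm x2), (CR_Chasles (fun x => f (x, y2)) x1 xm x2);
    try lra; try (apply hcont_h; trivial; lra). ring.
Qed.

Lemma rect_split_y (f : C -> C) (x1 x2 y1 ym y2 : R) : hcont f -> 0 < x1 -> x1 <= x2 -> y1 <= ym <= y2 ->
  rect f x1 x2 y1 y2 = (rect f x1 x2 y1 ym + rect f x1 x2 ym y2)%C.
Proof.
  intros H Hx H12 Hm. unfold rect.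
  rewrite (CR_Chasles (fun y => f (x1, y)) y1 ym y2), (CR_Chasles (fun y => f (x2, y)) y1 ym y2);
    try lra; try (apply hcont_v; trivial; lra). ring.
Qed.

Lemma rect_bound (f : C -> C) (x1 x2 y1 y2 M : R) : hcont f -> 0 < x1 -> x1 <= x2 -> y1 <= y2 ->
  (forall x y, x1 <= x <= x2 -> y1 <= y <= y2 -> Cmod (f (x, y)) <= M) ->
  Cmod (rect f x1 x2 y1 y2) <= 4 * M * ((x2 - x1) + (y2 - y1)).
Proof.
  intros H Hx H12 Hy HM. unfold rect.
  assert (A1 : Cmod (CR (fun x => f (x, y1)) x1 x2) <= 2 * M * (x2 - x1)).
  { apply CR_bound; trivial. now apply hcont_h. intros; apply HM; lra. }
  assert (A2 : Cmod (CR (fun x => f (x, y2)) x1 x2) <= 2 * M * (x2 - x1)).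
  { apply CR_bound; trivial. now apply hcont_h. intros; apply HM; lra. }
  assert (A3 : Cmod (CR (fun y => f (x2, y)) y1 y2) <= 2 * M * (y2 - y1)).
  { apply CR_bound; trivial. apply hcont_v; trivial; lra. intros; apply HM; lra. }
  assert (A4 : Cmod (CR (fun y => f (x1, y)) y1 y2) <= 2 * M * (y2 - y1)).
  { apply CR_bound; trivial. now apply hcont_v. intros; apply HM; lra. }
  eapply Rle_trans. apply Cmod_triangle. rewrite Cmod_mult, Cmod_Ci, Rmult_1_l.
  eapply Rle_trans. apply Rplus_le_compat; apply Cmod_minus_le. lra.
Qed.

Lemma rect_minus (f g : C -> C) (x1 x2 y1 y2 : R) : hcont f -> hcont g -> 0 < x1 -> x1 <= x2 -> y1 <= y2 ->
  rect (fun s => f s - g s)%C x1 x2 y1 y2 = (rect f x1 x2 y1 y2 - rect g x1 x2 y1 y2)%C.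
Proof.
  intros Hf Hg Hx H12 Hy. unfold rect.
  rewrite !(CR_minus (fun x => f (x, _)) (fun x => g (x, _))), !(CR_minus (fun y => f (_, y)) (fun y => g (_, y)));
    trivial; try (apply hcont_v; trivial; lra); try (apply hcont_h; trivial; lra). ring.
Qed.

Lemma RInt_affine (c d a b : R) : RInt (fun v => c + d * v) a b = c * (b - a) + d * (b ^ 2 - a ^ 2) / 2.
Proof.
  rewrite (RInt_FTC (fun v => c * v + d * v ^ 2 / 2)).
  - toR. field.
  - intros v. auto_derive; trivial. field.
  - intros v. apply (ex_derive_continuous (fun v => c + d * v)). auto_derive. trivial.
Qed.

Lemma rect_affine (al be : C) (x1 x2 y1 y2 : R) : rect (fun s => al + be * s)%C x1 x2 y1 y2 = RtoC 0.
Proof.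
  destruct al as [a1 a2], be as [b1 b2]. unfold rect, CR; cbn [fst snd Cplus Cmult].
  assert (Ex : forall (g : R -> R) c d a b, (forall v, g v = c + d * v) -> RInt g a b = c * (b - a) + d * (b ^ 2 - a ^ 2) / 2).
  { intros g c d a b E. rewrite <- RInt_affine. apply RInt_ext. auto. }
  rewrite (Ex (fun v => a1 + (b1 * v - b2 * y1)) (a1 - b2 * y1) b1) by (intros; ring).
  rewrite (Ex (fun v => a2 + (b1 * y1 + b2 * v)) (a2 + b1 * y1) b2) by (intros; ring).
  rewrite (Ex (fun v => a1 + (b1 * v - b2 * y2)) (a1 - b2 * y2) b1) by (intros; ring).
  rewrite (Ex (fun v => a2 + (b1 * y2 + b2 * v)) (a2 + b1 * y2) b2) by (intros; ring).
  rewrite (Ex (fun v => a1 + (b1 * x2 - b2 * v)) (a1 + b1 * x2) (- b2)) by (intros; ring).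
  rewrite (Ex (fun v => a2 + (b1 * v + b2 * x2)) (a2 + b2 * x2) b1) by (intros; ring).
  rewrite (Ex (fun v => a1 + (b1 * x1 - b2 * v)) (a1 + b1 * x1) (- b2)) by (intros; ring).
  rewrite (Ex (fun v => a2 + (b1 * v + b2 * x1)) (a2 + b2 * x1) b1) by (intros; ring).
  apply injective_projections; simpl; field.
Qed.

Lemma holo_affine (al be : C) : holo (fun s => al + be * s)%C.
Proof.
  intros s _. eexists. apply Cdiff_plus. apply Cdiff_const. apply Cdiff_mult. apply Cdiff_const. apply Cdiff_id.
Qed.

Lemma rect_quarter (f : C -> C) (x y hx hy : R) : hcont f -> 0 < x -> 0 <= hx -> 0 <= hy ->
  exists x' y', x <= x' <= x + hx / 2 /\ y <= y' <= y + hy / 2 /\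
    Cmod (rect f x (x + hx) y (y + hy)) <= 4 * Cmod (rect f x' (x' + hx / 2) y' (y' + hy / 2)).
Proof.
  intros H Hx Hhx Hhy.
  set (xm := x + hx / 2). set (ym := y + hy / 2).
  assert (E : rect f x (x + hx) y (y + hy) =
    (rect f x (x + hx / 2) y (y + hy / 2) + rect f x (x + hx / 2) ym (ym + hy / 2)
     + (rect f xm (xm + hx / 2) y (y + hy / 2) + rect f xm (xm + hx / 2) ym (ym + hy / 2)))%C).
  { replace (xm + hx / 2) with (x + hx) by (unfold xm; field). replace (ym + hy / 2) with (y + hy) by (unfold ym; field).
    rewrite (rect_split_x f x xm (x + hx)) by (trivial; try split; subst xm; lra).
    rewrite (rect_split_y f x xm y ym (y + hy)) by (trivial; try split; subst xm ym; lra).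
    rewrite (rect_split_y f xm (x + hx) y ym (y + hy)) by (trivial; try split; subst xm ym; lra). reflexivity. }
  set (q1 := rect f x (x + hx / 2) y (y + hy / 2)) in *.
  set (q2 := rect f x (x + hx / 2) ym (ym + hy / 2)) in *.
  set (q3 := rect f xm (xm + hx / 2) y (y + hy / 2)) in *.
  set (q4 := rect f xm (xm + hx / 2) ym (ym + hy / 2)) in *.
  assert (T : Cmod (rect f x (x + hx) y (y + hy)) <= Cmod q1 + Cmod q2 + (Cmod q3 + Cmod q4)).
  { rewrite E. eapply Rle_trans. apply Cmod_triangle. apply Rplus_le_compat; apply Cmod_triangle. }
  set (R0 := Cmod (rect f x (x + hx) y (y + hy))) in *.
  destruct (Rle_dec R0 (4 * Cmod q1)) as [L|L]. { exists x, y. repeat split; try exact L; subst xm ym; lra. }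
  destruct (Rle_dec R0 (4 * Cmod q2)) as [L2|L2]. { exists x, ym. repeat split; try exact L2; subst xm ym; lra. }
  destruct (Rle_dec R0 (4 * Cmod q3)) as [L3|L3]. { exists xm, y. repeat split; try exact L3; subst xm ym; lra. }
  assert (L4 : R0 <= 4 * Cmod q4) by lra.
  exists xm, ym. repeat split; try exact L4; subst xm ym; lra.
Qed.

(** The left ends [u n] increase, and the right ends [u n + h / 2^n] decrease because each step is
    at most half of the current length. *)
Lemma nested_limit (u : nat -> R) (h : R) : 0 <= h ->
  (forall n, u n <= u (S n) <= u n + h / 2 ^ S n) ->
  exists l, forall n, u n <= l <= u n + h / 2 ^ n.
Proof.
  intros Hh H.
  assert (P : forall n, 0 < 2 ^ n) by (intros; apply pow_lt; lra).
  assert (D : forall n m, u n <= u (n + m)%nat /\ u (n + m)%nat + h / 2 ^ (n + m) <= u n + h / 2 ^ n).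
  { intros n m. induction m as [|m [I1 I2]]. { rewrite Nat.add_0_r. lra. }
    rewrite Nat.add_succ_r. specialize (H (n + m)%nat). split; [lra|].
    assert (E : h / 2 ^ (n + m) = h / 2 ^ S (n + m) + h / 2 ^ S (n + m)).
    { simpl. field. apply Rgt_not_eq, P. }
    lra. }
  destruct (ex_finite_lim_seq_incr u (u O + h)) as [l Hl].
  - intros n. apply H.
  - intros n. destruct (D O n) as [_ I]. simpl in I. assert (0 <= h / 2 ^ n). { apply Rmult_le_pos; trivial. left. apply Rinv_0_lt_compat, P. } lra.
  - exists l. intros n. split.
    + refine (is_lim_seq_le_loc (fun _ => u n) u (Finite _) (Finite _) _ (is_lim_seq_const _) Hl).
      exists n. intros m Hm. destruct (D n (m - n)%nat) as [I _]. now replace (n + (m - n))%nat with m in I by lia.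
    + refine (is_lim_seq_le_loc u (fun _ => u n + h / 2 ^ n) (Finite _) (Finite _) _ Hl (is_lim_seq_const _)).
      exists n. intros m Hm. destruct (D n (m - n)%nat) as [_ I]. replace (n + (m - n))%nat with m in I by lia.
      assert (0 <= h / 2 ^ m). { apply Rmult_le_pos; trivial. left. apply Rinv_0_lt_compat, P. } lra.
Qed.

(** Quartering: one quarter always carries at least a fourth of the integral, hence at least
    [R0 / 4^n] after [n] stages. Near the common point [f] is affine up to [eps |z - z0|]; affine
    functions integrate to 0, and the remainder contributes [eps] times the squared size, also of
    order [4^(-n)]. *)
Lemma goursat (f : C -> C) (x0 y0 hx hy : R) : holo f -> 0 < x0 -> 0 <= hx -> 0 <= hy ->
  rect f x0 (x0 + hx) y0 (y0 + hy) = RtoC 0.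
Proof.
  intros Hf Hx0 Hhx Hhy. pose proof (holo_hcont f Hf) as Hc.
  set (R0 := Cmod (rect f x0 (x0 + hx) y0 (y0 + hy))).
  assert (P : forall n, 0 < 2 ^ n) by (intros; apply pow_lt; lra).
  assert (Hn : forall h n, 0 <= h -> 0 <= h / 2 ^ n). { intros h n Hh. apply Rmult_le_pos; trivial. left. apply Rinv_0_lt_compat, P. }
  set (Q := fun (n : nat) (p : R * R) => x0 <= fst p /\
     R0 <= 4 ^ n * Cmod (rect f (fst p) (fst p + hx / 2 ^ n) (snd p) (snd p + hy / 2 ^ n))).
  assert (Step : forall n p, Q n p -> exists p', Q (S n) p' /\
     fst p <= fst p' <= fst p + hx / 2 ^ S n /\ snd p <= snd p' <= snd p + hy / 2 ^ S n).
  { intros n [x y] [Qx QR]. simpl in Qx, QR.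
    destruct (rect_quarter f x y (hx / 2 ^ n) (hy / 2 ^ n) Hc) as [x' [y' [Bx [By B]]]]; auto; [lra|].
    assert (E : forall h, h / 2 ^ S n = h / 2 ^ n / 2). { intros h. simpl. field. apply Rgt_not_eq, P. }
    exists (x', y'). unfold Q. cbn [fst snd]. rewrite !E. repeat split; try lra.
    simpl. assert (0 < 4 ^ n) by (apply pow_lt; lra). nra. }
  (* The successor is made total by staying put outside [Q]; [SQ] shows that the sequence never
     leaves [Q]. *)
  destruct (choice (fun (a b : nat * (R * R)) => Q (fst a) (snd a) -> fst b = S (fst a) /\ Q (S (fst a)) (snd b) /\
     fst (snd a) <= fst (snd b) <= fst (snd a) + hx / 2 ^ S (fst a) /\ snd (snd a) <= snd (snd b) <= snd (snd a) + hy / 2 ^ S (fst a))) as [F HF].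
  { intros [n p]. destruct (classic (Q n p)) as [HQ|HQ].
    - destruct (Step n p HQ) as [p' Hp]. exists (S n, p'). intros _. simpl. tauto.
    - exists (n, p). simpl. tauto. }
  set (seq := fix s n := match n with O => (x0, y0) | S k => snd (F (k, s k)) end).
  assert (SQ : forall n, Q n (seq n)).
  { induction n as [|n IH].
    - split; simpl; [lra|]. unfold R0. rewrite !Rdiv_1_r. lra.
    - apply (HF (n, seq n) IH). }
  destruct (nested_limit (fun n => fst (seq n)) hx Hhx) as [X HX].
  { intros n. apply (HF (n, seq n) (SQ n)). }
  destruct (nested_limit (fun n => snd (seq n)) hy Hhy) as [Y HY].
  { intros n. apply (HF (n, seq n) (SQ n)). }
  assert (HX0 : 0 < X). { specialize (HX O). simpl in HX. lra. }
  destruct (Hf (X, Y) HX0) as [l Hl].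
  apply Cmod_eq_0. fold R0. apply Rle_antisym; [|apply Cmod_ge_0].
  (* [K] exceeds the half perimeter, the [1] keeping it positive for a degenerate rectangle, and
     [eps = R0 / (8 K^2)] makes the final bound equal to [R0 / 2]. *)
  set (K := hx + hy + 1). assert (HK : 0 < K) by (unfold K; lra).
  apply Rnot_lt_le. intros Rpos.
  assert (He : 0 < R0 / (8 * K * K)). { apply Rdiv_lt_0_compat; nra. }
  destruct (Cdiff_eps f _ l Hl _ He) as [del [Hd H']]. set (eps := R0 / (8 * K * K)) in *.
  assert (exists n, K / 2 ^ n < del) as [n Hnd].
  { destruct (pow_lt_1_zero (1 / 2) ltac:(rewrite Rabs_pos_eq; lra) (del / K) ltac:(now apply Rdiv_lt_0_compat)) as [N HN].
    exists N. specialize (HN N (Nat.le_refl _)). rewrite Rabs_pos_eq in HN by (apply pow_le; lra).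
    apply Rmult_lt_compat_l with (r := K) in HN; [|lra]. replace (K * (del / K)) with del in HN by (field; lra).
    eapply Rle_lt_trans; [|exact HN]. apply Req_le. unfold Rdiv. rewrite Rmult_1_l, pow_inv. reflexivity. }
  destruct (SQ n) as [Qx QR]. specialize (HX n). specialize (HY n). simpl in HX, HY.
  set (x := fst (seq n)) in *. set (y := snd (seq n)) in *.
  pose proof (Hn hx n Hhx) as Bx. pose proof (Hn hy n Hhy) as By.
  assert (KE : K / 2 ^ n = hx / 2 ^ n + hy / 2 ^ n + 1 / 2 ^ n). { unfold K. field. apply Rgt_not_eq, P. }
  assert (B1 : 0 < 1 / 2 ^ n) by (apply Rdiv_lt_0_compat; [lra|apply P]).
  (* [f] minus its tangent at the common point: the same boundary integral, but of first-order small
     size. *)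
  set (g := (fun s => f s - ((f (X, Y) - l * (X, Y)) + l * s))%C).
  assert (Hg : rect f x (x + hx / 2 ^ n) y (y + hy / 2 ^ n) = rect g x (x + hx / 2 ^ n) y (y + hy / 2 ^ n)).
  { unfold g. rewrite rect_minus, rect_affine; trivial; try lra. ring. apply holo_hcont, holo_affine. }
  assert (HgM : Cmod (rect g x (x + hx / 2 ^ n) y (y + hy / 2 ^ n)) <= 4 * (eps * (K / 2 ^ n)) * ((x + hx / 2 ^ n - x) + (y + hy / 2 ^ n - y))).
  { apply rect_bound; try lra.
    - unfold g. intros u v Hu. destruct (Hc u v Hu) as [C1 C2]. destruct (holo_hcont _ (holo_affine (f (X, Y) - l * (X, Y))%C l) u v Hu) as [D1 D2].
      split; now apply ccont_minus.
    - intros u v Hu Hv. unfold g.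
      replace (f (u, v) - (f (X, Y) - l * (X, Y) + l * (u, v)))%C with (f (u, v) - f (X, Y) - l * ((u, v) - (X, Y)))%C by ring.
      assert (Dm : Cmod ((u, v) - (X, Y)) <= hx / 2 ^ n + hy / 2 ^ n).
      { eapply Rle_trans. apply Cmod_le_add. simpl. apply Rplus_le_compat; apply Rabs_le; lra. }
      eapply Rle_trans. apply H'. lra. apply Rmult_le_compat_l; lra. }
  rewrite <- Hg in HgM.
  assert (Z : R0 <= 4 ^ n * (4 * (eps * (K / 2 ^ n)) * (K / 2 ^ n))).
  { eapply Rle_trans. exact QR. apply Rmult_le_compat_l; [apply pow_le; lra|].
    eapply Rle_trans. exact HgM. apply Rmult_le_compat_l.
    - apply Rmult_le_pos; [lra|]. apply Rmult_le_pos; lra.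
    - lra. }
  replace (4 ^ n * (4 * (eps * (K / 2 ^ n)) * (K / 2 ^ n))) with (4 * eps * K * K) in Z.
  2:{ replace (4 ^ n) with (2 ^ n * 2 ^ n) by (rewrite <- Rpow_mult_distr; f_equal; ring). field. apply Rgt_not_eq, P. }
  replace (4 * eps * K * K) with (R0 / 2) in Z by (unfold eps; field; lra). lra.
Qed.

(** * Uniqueness of analytic continuation *)

Lemma continuous_bounded (u : R -> R) (a b : R) : a <= b ->
  (forall v, a <= v <= b -> continuous u v) -> exists M, forall v, a <= v <= b -> Rabs (u v) <= M.
Proof.
  intros Hab Hc.
  destruct (continuity_ab_maj (fun v => Rabs (u v)) a b Hab) as [m [Hm _]].
  - intros c Hcab. apply continuity_pt_filterlim. apply (continuous_Rabs_comp u c). now apply Hc.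
  - now exists (Rabs (u m)).
Qed.

(* If [u 0 > 0], the peak at [0] contributes at least a constant times [exp (- n r^2)] for a small [r]. *)
Lemma laplace_not_pos (u : R -> R) (Y K : R) : 0 < Y -> (forall v, continuous u v) ->
  (forall n : nat, Rabs (RInt (fun y => u y * exp (- (INR n * y ^ 2))) (- Y) Y) <= K * exp (- INR n)) ->
  ~ 0 < u 0.
Proof.
  intros HY Hc HK Hu.
  destruct (continuous_bounded u (- Y) Y) as [M HM]; [lra|auto|].
  assert (M0 : 0 <= M). { pose proof (Rabs_pos (u 0)). specialize (HM 0 ltac:(lra)). lra. }
  assert (exists e0, 0 < e0 /\ forall y, Rabs y < e0 -> u 0 / 2 < u y) as [e0 [He0 Hloc]].
  { assert (Hp : 0 < u 0 / 2) by lra.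
    destruct (proj1 (filterlim_locally (F := locally 0) u (u 0)) (Hc 0) (mkposreal _ Hp)) as [del Hd].
    exists del. split; [apply cond_pos|]. intros y Hy.
    assert (Hb : ball 0 del y). { unfold ball; simpl. unfold AbsRing_ball, abs, minus, plus, opp; simpl. now rewrite Ropp_0, Rplus_0_r. }
    specialize (Hd y Hb). unfold ball in Hd; simpl in Hd. unfold AbsRing_ball, abs, minus, plus, opp in Hd; simpl in Hd.
    apply Rabs_def2 in Hd. lra. }
  (* On [|y| <= e] the function stays above [u 0 / 2]; [e <= Y / 2] keeps the peak inside the
     interval, and [e <= 1 / 2] allows [exp (- n)] to be bounded by [exp (- n e^2)]. *)
  set (e := Rmin (e0 / 2) (Rmin (Y / 2) (1 / 2))).
  assert (E : 0 < e /\ e <= e0 / 2 /\ e <= Y / 2 /\ e <= 1 / 2).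
  { unfold e. repeat split.
    - repeat apply Rmin_pos; lra.
    - apply Rmin_l.
    - eapply Rle_trans; [apply Rmin_r|apply Rmin_l].
    - eapply Rle_trans; [apply Rmin_r|apply Rmin_r]. }
  destruct E as [E0 [E1 [E2 E3]]].
  assert (K0 : 0 <= K).
  { specialize (HK O). simpl in HK. rewrite Ropp_0, exp_0 in HK. pose proof (Rabs_pos (RInt (fun y => u y * exp (- (0 * (y * (y * 1))))) (- Y) Y)). lra. }
  (* The middle half of the peak contributes at least [e * (u 0 / 2) * exp (- n e^2 / 4)], and all
     that opposes it is of order [exp (- n e^2)]. The exponent with 3/4 is the quotient of the
     two. *)
  assert (Main : forall n : nat, e * (u 0 / 2) <= (2 * Y * M + K) * exp (- (3 / 4 * e ^ 2 * INR n))).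
  { intros n. pose proof (pos_INR n) as Hn. set (w := fun y => u y * exp (- (INR n * y ^ 2))).
    assert (Wc : forall y, continuous w y).
    { intros y. apply (continuous_mult (K := R_AbsRing)); [apply Hc|].
      apply (ex_derive_continuous (fun y => exp (- (INR n * y ^ 2)))). auto_derive. trivial. }
    assert (X : forall a b, ex_RInt w a b) by (intros; now apply continuous_ex_RInt).
    specialize (HK n). fold w in HK.
    pose proof (RInt_Chasles w (- Y) (- e) Y (X _ _) (X _ _)) as C1.
    pose proof (RInt_Chasles w (- e) (- (e / 2)) Y (X _ _) (X _ _)) as C2.
    pose proof (RInt_Chasles w (- (e / 2)) (e / 2) Y (X _ _) (X _ _)) as C3.
    pose proof (RInt_Chasles w (e / 2) e Y (X _ _) (X _ _)) as C4.
    unfold plus in C1, C2, C3, C4; simpl in C1, C2, C3, C4.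
    set (q := exp (- (INR n * e ^ 2))).
    assert (Far : forall y, e ^ 2 <= y ^ 2 -> - Y <= y <= Y -> Rabs (w y) <= M * q).
    { intros y Hy HyY. unfold w. rewrite Rabs_mult, (Rabs_pos_eq (exp _)) by (left; apply exp_pos).
      apply Rmult_le_compat; [apply Rabs_pos|left; apply exp_pos|now apply HM|]. apply exp_mono. nra. }
    assert (F1 : Rabs (RInt w (- Y) (- e)) <= M * q * (- e - - Y)).
    { apply RInt_abs_bound; [lra|apply X|]. intros y Hy. apply Far; [nra|lra]. }
    assert (F2 : Rabs (RInt w e Y) <= M * q * (Y - e)).
    { apply RInt_abs_bound; [lra|apply X|]. intros y Hy. apply Far; [nra|lra]. }
    assert (G1 : 0 <= RInt w (- e) (- (e / 2))).
    { apply RInt_ge_0; [lra|apply X|]. intros y Hy. unfold w. apply Rmult_le_pos; [|left; apply exp_pos].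
      assert (u 0 / 2 < u y); [apply Hloc; apply Rabs_def1; lra|lra]. }
    assert (G2 : 0 <= RInt w (e / 2) e).
    { apply RInt_ge_0; [lra|apply X|]. intros y Hy. unfold w. apply Rmult_le_pos; [|left; apply exp_pos].
      assert (u 0 / 2 < u y); [apply Hloc; apply Rabs_def1; lra|lra]. }
    set (c := u 0 / 2 * exp (- (INR n * (e / 2) ^ 2))).
    assert (G3 : e * c <= RInt w (- (e / 2)) (e / 2)).
    { replace (e * c) with (RInt (fun _ => c) (- (e / 2)) (e / 2)).
      2:{ rewrite RInt_const. unfold scal; simpl; unfold mult; simpl. field. }
      apply RInt_le; [lra|apply ex_RInt_const|apply X|]. intros y Hy. unfold w, c.
      apply Rmult_le_compat; [lra|left; apply exp_pos|left; apply Hloc; apply Rabs_def1; lra|]. apply exp_mono.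
      assert (y ^ 2 <= (e / 2) ^ 2) by nra. apply Ropp_le_contravar, Rmult_le_compat_l; trivial. }
    assert (T : e * c <= 2 * Y * M * q + K * exp (- INR n)).
    { apply Rabs_le_between in F1. apply Rabs_le_between in F2. apply Rabs_le_between in HK.
      assert (Q0 : 0 <= M * q * e) by (repeat apply Rmult_le_pos; try lra; left; apply exp_pos). lra. }
    assert (Kq : K * exp (- INR n) <= K * q).
    { apply Rmult_le_compat_l; trivial. apply exp_mono. assert (e ^ 2 <= 1) by nra. nra. }
    set (r := exp (- (INR n * (e / 2) ^ 2))) in *.
    assert (Eq : q = r * exp (- (3 / 4 * e ^ 2 * INR n))).
    { unfold q, r. rewrite <- exp_plus. f_equal. field. }
    assert (Rp : 0 < r) by apply exp_pos.
    apply Rmult_le_reg_r with r; trivial. unfold c in T. rewrite Eq in T, Kq. nra. }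
  assert (L : is_lim_seq (fun n => (2 * Y * M + K) * exp (- (3 / 4 * e ^ 2 * INR n))) 0).
  { replace (Finite 0) with (Rbar_mult (2 * Y * M + K) 0) by (simpl; f_equal; ring).
    apply is_lim_seq_scal_l, exp_neg_lim. nra. }
  pose proof (is_lim_seq_le (fun _ => e * (u 0 / 2)) _ (Finite _) (Finite 0) Main (is_lim_seq_const _) L) as Z.
  simpl in Z. nra.
Qed.

Lemma laplace_zero (u : R -> R) (Y K : R) : 0 < Y -> (forall v, continuous u v) ->
  (forall n : nat, Rabs (RInt (fun y => u y * exp (- (INR n * y ^ 2))) (- Y) Y) <= K * exp (- INR n)) ->
  u 0 = 0.
Proof.
  intros HY Hc HK. pose proof (laplace_not_pos u Y K HY Hc HK) as H1.
  assert (H2 : ~ 0 < - u 0).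
  { apply (laplace_not_pos (fun v => - u v) Y K); trivial.
    - intros v. now apply (continuous_opp (V := R_NormedModule) u).
    - intros n. set (w := fun y => u y * exp (- (INR n * y ^ 2))).
      assert (E : ex_RInt w (- Y) Y).
      { apply continuous_ex_RInt. intros v. apply (continuous_mult (K := R_AbsRing)); [apply Hc|].
        apply (ex_derive_continuous (fun y => exp (- (INR n * y ^ 2)))). auto_derive. trivial. }
      replace (RInt (fun y => - u y * exp (- (INR n * y ^ 2))) (- Y) Y) with (- RInt w (- Y) Y).
      { rewrite Rabs_Ropp. apply HK. }
      symmetry. apply is_RInt_unique. eapply is_RInt_ext; [|exact (is_RInt_opp w _ _ _ (RInt_correct w _ _ E))].
      intros y _. unfold w, opp; simpl. ring. }
  lra.
Qed.

(* Apply Cauchy's theorem to [W s * exp (n (s - x0)^2)] on a rectangle with left side through [x0]. The weight is [exp (- n y^2)]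
   on that side and exponentially small on the horizontal sides, and [W = 0] on the right one, so [laplace_zero] applies. *)
Lemma zero_of_half_plane_zero (W : C -> C) (sigma0 x0 : R) : holo W ->
  (forall s, sigma0 < Re s -> W s = RtoC 0) -> 0 < x0 -> W (RtoC x0) = RtoC 0.
Proof.
  intros HW HZ Hx0. destruct (Rlt_dec sigma0 x0) as [H|H]. { now apply HZ. }
  (* The right side of the rectangle lies at [sigma0 + 1], where [W] vanishes. On the horizontal
     sides [(x - x0)^2 - Y^2 <= d^2 - (d + 1)^2 <= -1], so the weight is at most [exp (- n)]
     there. *)
  set (d := sigma0 + 1 - x0). set (Y := d + 1).
  assert (Hd : 0 < d) by (unfold d; lra). assert (HY : 0 < Y) by (unfold Y; lra).
  pose proof (holo_hcont W HW) as Wc.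
  assert (B : forall y, exists M, forall x, x0 <= x <= x0 + d -> Cmod (W (x, y)) <= M).
  { intros y. destruct (continuous_bounded (fun x => fst (W (x, y))) x0 (x0 + d)) as [M1 H1]; [lra|intros v Hv; apply Wc; lra|].
    destruct (continuous_bounded (fun x => snd (W (x, y))) x0 (x0 + d)) as [M2 H2]; [lra|intros v Hv; apply Wc; lra|].
    exists (M1 + M2). intros x Hx. eapply Rle_trans. apply Cmod_le_add. specialize (H1 x Hx). specialize (H2 x Hx). simpl in H1, H2. lra. }
  destruct (B Y) as [M1 HM1]. destruct (B (- Y)) as [M2 HM2].
  set (g := fun n s => cexp (RtoC (INR n) * ((s - RtoC x0) * (s - RtoC x0)))%C).
  assert (Hg : forall n s, exists l, Cdiff (g n) s l).
  { intros n s. eexists. unfold g. apply (Cdiff_comp cexp). apply Cdiff_cexp.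
    pose proof (Cdiff_minus (fun z => z) (fun _ => RtoC x0) s _ _ (Cdiff_id s) (Cdiff_const _ s)) as D.
    exact (Cdiff_mult (fun _ => RtoC (INR n)) _ s _ _ (Cdiff_const _ s) (Cdiff_mult _ _ s _ _ D D)). }
  set (f := fun n s => (W s * g n s)%C).
  assert (Hf : forall n, holo (f n)).
  { intros n s Hs. destruct (HW s Hs) as [l Hl]. destruct (Hg n s) as [l' Hl']. eexists. apply Cdiff_mult; eauto. }
  assert (Gmod : forall n x y, Cmod (g n (x, y)) = exp (INR n * ((x - x0) ^ 2 - y ^ 2))).
  { intros n x y. unfold g. rewrite Cmod_cexp. f_equal. unfold Re; simpl. ring. }
  assert (Edge : forall n y M, y = Y \/ y = - Y -> (forall x, x0 <= x <= x0 + d -> Cmod (W (x, y)) <= M) ->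
     Cmod (CR (fun x => f n (x, y)) x0 (x0 + d)) <= 2 * (M * exp (- INR n)) * d).
  { intros n y M Hy HM. replace d with (x0 + d - x0) at 2 by ring. apply CR_bound; [lra|apply hcont_h; trivial; now apply holo_hcont|].
    intros x Hx. unfold f. rewrite Cmod_mult, Gmod. apply Rmult_le_compat; [apply Cmod_ge_0|left; apply exp_pos|auto|].
    apply exp_mono. assert (y ^ 2 = Y ^ 2) by (destruct Hy as [->| ->]; ring). rewrite H0.
    assert ((x - x0) ^ 2 <= d ^ 2) by (apply pow_incr; lra). pose proof (pos_INR n). unfold Y. nra. }
  set (K := 2 * (M1 + M2) * d).
  assert (Left : forall n, Cmod (CR (fun y => f n (x0, y)) (- Y) Y) <= K * exp (- INR n)).
  { intros n. pose proof (goursat (f n) x0 (- Y) d (2 * Y) (Hf n) Hx0 ltac:(lra) ltac:(lra)) as G.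
    unfold rect in G. replace (- Y + 2 * Y) with Y in G by ring.
    assert (R0 : CR (fun y => f n (x0 + d, y)) (- Y) Y = RtoC 0).
    { replace (fun y => f n (x0 + d, y)) with (fun _ : R => RtoC 0).
      - unfold CR; simpl. rewrite !RInt_const. apply injective_projections; simpl; unfold scal; simpl; unfold mult; simpl; ring.
      - extensionality y. unfold f. rewrite HZ. ring. simpl. unfold d. lra. }
    rewrite R0 in G.
    assert (E : (Ci * CR (fun y => f n (x0, y)) (- Y) Y = CR (fun x => f n (x, (- Y)%R)) x0 (x0 + d) - CR (fun x => f n (x, Y)) x0 (x0 + d))%C).
    { rewrite <- (Cplus_0_l (Ci * _)), <- G. ring. }
    rewrite <- (Rmult_1_l (Cmod _)), <- Cmod_Ci, <- Cmod_mult, E.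
    eapply Rle_trans. apply Cmod_minus_le.
    pose proof (Edge n Y M1 (or_introl eq_refl) HM1). pose proof (Edge n (- Y) M2 (or_intror eq_refl) HM2).
    unfold K. nra. }
  assert (Gx0 : forall n y, f n (x0, y) = (W (x0, y) * RtoC (exp (- (INR n * y ^ 2))))%C).
  { intros n y. unfold f, g. f_equal. unfold cexp, Cmult, Cminus, Cplus, Copp, RtoC, Re, Im; cbn [fst snd].
    replace (INR n * ((x0 + - x0) * (x0 + - x0) - (y + - 0) * (y + - 0)) - 0 * ((x0 + - x0) * (y + - 0) + (y + - 0) * (x0 + - x0)))
      with (- (INR n * y ^ 2)) by ring.
    replace (INR n * ((x0 + - x0) * (y + - 0) + (y + - 0) * (x0 + - x0)) + 0 * ((x0 + - x0) * (x0 + - x0) - (y + - 0) * (y + - 0)))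
      with 0 by ring.
    rewrite cos_0, sin_0. f_equal; ring. }
  apply injective_projections; simpl.
  - apply (laplace_zero (fun y => fst (W (x0, y))) Y K HY). { intros v. apply Wc. lra. }
    intros n. eapply Rle_trans; [|apply (Left n)]. eapply Rle_trans; [|apply fst_le_Cmod].
    unfold CR; cbn [fst snd]. apply Req_le. f_equal. apply RInt_ext. intros y _. rewrite Gx0. simpl. toR. ring.
  - apply (laplace_zero (fun y => snd (W (x0, y))) Y K HY). { intros v. apply Wc. lra. }
    intros n. eapply Rle_trans; [|apply (Left n)]. eapply Rle_trans; [|apply snd_le_Cmod].
    unfold CR; cbn [fst snd]. apply Req_le. f_equal. apply RInt_ext. intros y _. rewrite Gx0. simpl. toR. ring.
Qed.

(** * Characters and Gauss sums *)

(** A half-open sum, unlike [sum_n]: splitting, reversing and permuting a full set of residues is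
    then free of boundary terms. *)
Fixpoint fsum (f : nat -> C) (n : nat) : C :=
  match n with O => RtoC 0 | S m => (fsum f m + f m)%C end.

Lemma fsum_ext (f g : nat -> C) (n : nat) : (forall i, (i < n)%nat -> f i = g i) -> fsum f n = fsum g n.
Proof. induction n as [|n IH]; intros H; simpl; trivial. rewrite IH, H; auto. Qed.

Lemma fsum_plus (f g : nat -> C) (n : nat) : fsum (fun i => f i + g i)%C n = (fsum f n + fsum g n)%C.
Proof. induction n as [|n IH]; simpl; [ring|rewrite IH; ring]. Qed.

Lemma fsum_scal (c : C) (f : nat -> C) (n : nat) : fsum (fun i => c * f i)%C n = (c * fsum f n)%C.
Proof. induction n as [|n IH]; simpl; [ring|rewrite IH; ring]. Qed.

Lemma fsum_0 (n : nat) : fsum (fun _ => RtoC 0) n = RtoC 0.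
Proof. induction n as [|n IH]; simpl; [ring|rewrite IH; ring]. Qed.

Lemma fsum_swap (f : nat -> nat -> C) (n m : nat) :
  fsum (fun i => fsum (fun j => f i j) m) n = fsum (fun j => fsum (fun i => f i j) n) m.
Proof. induction n as [|n IH]; simpl. now rewrite fsum_0. now rewrite IH, fsum_plus. Qed.

Lemma fsum_add (f : nat -> C) (n m : nat) : fsum f (n + m) = (fsum f n + fsum (fun i => f (n + i)%nat) m)%C.
Proof.
  induction m as [|m IH]; [rewrite Nat.add_0_r; simpl; ring|].
  rewrite Nat.add_succ_r. simpl. rewrite IH. ring.
Qed.

Lemma fsum_S_l (f : nat -> C) (n : nat) : fsum f (S n) = (f O + fsum (fun i => f (S i)) n)%C.
Proof. rewrite (fsum_add f 1 n : fsum f (S n) = _). simpl. ring. Qed.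

Lemma fsum_rev (f : nat -> C) (n : nat) : fsum f n = fsum (fun i => f (n - S i)%nat) n.
Proof.
  induction n as [|n IH]; trivial. rewrite (fsum_S_l (fun i => f (S n - S i)%nat)).
  change (fsum f (S n)) with (fsum f n + f n)%C. rewrite IH.
  replace (S n - 1)%nat with n by lia. apply Cplus_comm.
Qed.

Lemma fsum_single (f : nat -> C) (n k : nat) : (k < n)%nat -> (forall i, (i < n)%nat -> i <> k -> f i = RtoC 0) ->
  fsum f n = f k.
Proof.
  induction n as [|n IH]; intros Hk H; [lia|]. simpl. destruct (Nat.eq_dec k n) as [->|Hne].
  - rewrite (fsum_ext f (fun _ => RtoC 0)), fsum_0 by (intros i Hi; apply H; lia). ring.
  - rewrite IH, (H n); try lia. ring. intros i Hi Hi2; apply H; lia.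
Qed.

Lemma sum_n_fsum (u : nat -> C) (N : nat) :
  @sum_n (NormedModule.AbelianMonoid C_AbsRing C_NormedModule) u N = fsum u (S N).
Proof.
  induction N as [|N IH].
  - rewrite sum_O. simpl. ring.
  - rewrite sum_Sn, IH. reflexivity.
Qed.

Lemma fsum_list (f : nat -> C) (n : nat) : fsum f n = fold_right Cplus (RtoC 0) (map f (seq 0 n)).
Proof.
  induction n as [|n IH]; trivial. rewrite seq_S, map_app, fold_right_app. simpl. rewrite IH.
  generalize (map f (seq 0 n)). intros l. generalize (f n). intros c. induction l as [|a l IHl]; simpl; [ring|rewrite <- IHl; ring].
Qed.

Lemma fold_right_perm (l l' : list C) : Permutation l l' -> fold_right Cplus (RtoC 0) l = fold_right Cplus (RtoC 0) l'.
Proof. induction 1; simpl; trivial; try congruence. ring. Qed.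

Lemma fsum_perm (f : nat -> C) (g : nat -> nat) (n : nat) : bFun n g -> Injective g ->
  fsum (fun i => f (g i)) n = fsum f n.
Proof.
  intros H1 H2. rewrite !fsum_list. rewrite <- (map_map g f). apply fold_right_perm, Permutation_map.
  exact (nat_bijection_Permutation H1 H2).
Qed.

Lemma periodic_Z (f : Z -> C) (q : Z) : (forall n, f (n + q)%Z = f n) -> forall n k, f (n + k * q)%Z = f n.
Proof.
  intros H.
  assert (P : forall (k : nat) n, f (n + Z.of_nat k * q)%Z = f n).
  { induction k as [|k IH]; intros n. { f_equal. lia. }
    rewrite <- (IH n), <- (H (n + Z.of_nat k * q)%Z). f_equal. lia. }
  intros n k. destruct (Z_le_gt_dec 0 k) as [L|L].
  - rewrite <- (Z2Nat.id k L). apply P.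
  - rewrite <- (P (Z.to_nat (- k)) (n + k * q)%Z). f_equal. rewrite Z2Nat.id by lia. lia.
Qed.

Lemma periodic_mod (f : Z -> C) (q : Z) : (forall n, f (n + q)%Z = f n) -> forall n, f (n mod q)%Z = f n.
Proof.
  intros H n. rewrite <- (periodic_Z f q H (n mod q) (n / q)). f_equal.
  destruct (Z.eq_dec q 0) as [->|Hq]; [rewrite Zmod_0_r; lia|]. pose proof (Z.div_mod n q Hq). lia.
Qed.

(** Multiplication by a unit permutes the residues mod [q]. *)
Lemma fsum_unit_mul (f : Z -> C) (q : nat) (a : Z) : (0 < q)%nat ->
  (forall n, f (n + Z.of_nat q)%Z = f n) -> Z.gcd a (Z.of_nat q) = 1%Z ->
  fsum (fun h => f (a * Z.of_nat h)%Z) q = fsum (fun h => f (Z.of_nat h)) q.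
Proof.
  intros Hq Hp Ha.
  (* Extended by the identity beyond [q], since the permutation lemma asks for injectivity on all of
     [nat]. *)
  set (g := fun h : nat => if Nat.ltb h q then Z.to_nat ((a * Z.of_nat h) mod Z.of_nat q) else h).
  assert (B : forall h, (h < q)%nat -> (0 <= (a * Z.of_nat h) mod Z.of_nat q < Z.of_nat q)%Z).
  { intros h _. apply Z.mod_pos_bound. lia. }
  rewrite (fsum_ext _ (fun h => f (Z.of_nat (g h)))).
  2:{ intros h Hh. unfold g. rewrite (proj2 (Nat.ltb_lt h q) Hh). rewrite Z2Nat.id by apply B, Hh.
      symmetry. now apply periodic_mod. }
  apply (fsum_perm (fun h => f (Z.of_nat h)) g).
  - intros h Hh. unfold g. rewrite (proj2 (Nat.ltb_lt h q) Hh). specialize (B h Hh). lia.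
  - intros h k E. unfold g in E.
    destruct (Nat.ltb_spec h q) as [L1|L1]; destruct (Nat.ltb_spec k q) as [L2|L2]; trivial.
    + pose proof (B h L1). pose proof (B k L2). apply Z2Nat.inj in E; try lia.
      assert (D : (Z.of_nat q | a * (Z.of_nat h - Z.of_nat k))%Z).
      { exists ((a * Z.of_nat h) / Z.of_nat q - (a * Z.of_nat k) / Z.of_nat q)%Z.
        pose proof (Z.div_mod (a * Z.of_nat h) (Z.of_nat q)). pose proof (Z.div_mod (a * Z.of_nat k) (Z.of_nat q)). lia. }
      apply Z.gauss in D; [|rewrite Z.gcd_comm; exact Ha].
      destruct D as [c Hc]. assert (c = 0)%Z by nia. subst c. lia.
    + pose proof (B h L1). lia.
    + pose proof (B k L2). lia.
Qed.

(** The additive character [exp (2 pi i x)] of [R / Z]. *)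
Definition ee (x : R) : C := (cos (2 * PI * x), sin (2 * PI * x)).

Lemma ee_add (x y : R) : ee (x + y) = (ee x * ee y)%C.
Proof.
  unfold ee, Cmult; cbn [fst snd]. rewrite Rmult_plus_distr_l, cos_plus, sin_plus. f_equal; ring.
Qed.

Lemma ee_0 : ee 0 = RtoC 1.
Proof. unfold ee. rewrite Rmult_0_r, cos_0, sin_0. reflexivity. Qed.

Lemma ee_nat (n : nat) : ee (INR n) = RtoC 1.
Proof.
  induction n as [|n IH]; [apply ee_0|]. rewrite S_INR, ee_add, IH. unfold ee.
  rewrite Rmult_1_r, cos_2PI, sin_2PI. apply injective_projections; simpl; ring.
Qed.

Lemma ee_Z (n : Z) : ee (IZR n) = RtoC 1.
Proof.
  destruct (Z_le_gt_dec 0 n) as [L|L].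
  - rewrite <- (Z2Nat.id n L), <- INR_IZR_INZ. apply ee_nat.
  - assert (E : (ee (IZR n) * ee (INR (Z.to_nat (- n))) = RtoC 1)%C).
    { rewrite <- ee_add, INR_IZR_INZ, Z2Nat.id by lia. rewrite <- plus_IZR.
      replace (n + - n)%Z with 0%Z by lia. apply ee_0. }
    rewrite ee_nat in E. rewrite <- E. ring.
Qed.

Lemma ee_shift (x : R) (n : Z) : ee (x + IZR n) = ee x.
Proof. rewrite ee_add, ee_Z. ring. Qed.

Lemma ee_pow (x : R) (n : nat) : (ee x ^ n)%C = ee (INR n * x).
Proof.
  induction n as [|n IH]. { simpl. now rewrite Rmult_0_l, ee_0. }
  rewrite S_INR, Rmult_plus_distr_r, Rmult_1_l, ee_add, <- IH. simpl. ring.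
Qed.

Lemma Cmod_ee (x : R) : Cmod (ee x) = 1.
Proof.
  unfold ee, Cmod. cbn [fst snd].
  replace (cos (2 * PI * x) ^ 2 + sin (2 * PI * x) ^ 2) with (Rsqr (sin (2 * PI * x)) + Rsqr (cos (2 * PI * x))) by (unfold Rsqr; ring).
  rewrite sin2_cos2. apply sqrt_1.
Qed.

Lemma ee_neq_1 (x : R) : 0 < Rabs x < 1 -> ee x <> RtoC 1.
Proof.
  intros Hx E. apply (f_equal fst) in E. simpl in E.
  replace (2 * PI * x) with (2 * (PI * x)) in E by ring. rewrite cos_2a_sin in E.
  assert (S0 : sin (PI * x) * sin (PI * x) = 0) by lra.
  assert (S1 : sin (PI * x) = 0) by nra.
  pose proof PI_RGT_0. destruct (Rle_dec 0 x) as [L|L].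
  - rewrite Rabs_pos_eq in Hx by lra. pose proof (sin_gt_0 (PI * x) ltac:(nra) ltac:(nra)). lra.
  - rewrite Rabs_left in Hx by lra. pose proof (sin_gt_0 (PI * - x) ltac:(nra) ltac:(nra)) as P.
    replace (PI * - x) with (- (PI * x)) in P by ring. rewrite sin_neg in P. lra.
Qed.

Lemma Cmult_integral (z w : C) : (z * w = RtoC 0)%C -> z = RtoC 0 \/ w = RtoC 0.
Proof.
  intros H. destruct (classic (z = RtoC 0)) as [E|E]; [now left|right].
  replace w with (/ z * (z * w))%C by (field; exact E). rewrite H. ring.
Qed.

Lemma RtoC_neq (x : R) : x <> 0 -> RtoC x <> RtoC 0.
Proof. intros H E. apply H. now apply RtoC_inj. Qed.

Lemma geom_sum (z : C) (n : nat) : (fsum (fun i => z ^ i) n * (1 - z) = 1 - z ^ n)%C.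
Proof. induction n as [|n IH]; simpl. ring. rewrite Cmult_plus_distr_r, IH. ring. Qed.

(** A full geometric sum whose ratio is an [N]-th root of unity other than 1, because
    [0 < |m| < N]. *)
Lemma ee_orthogonal (N : nat) (m : Z) : (0 < N)%nat -> m <> 0%Z -> (Z.abs m < Z.of_nat N)%Z ->
  fsum (fun j => ee (INR j * (IZR m / INR N))) N = RtoC 0.
Proof.
  intros HN Hm Hb. assert (PN : 0 < INR N) by (now apply lt_0_INR).
  set (z := ee (IZR m / INR N)).
  assert (Hz : z <> RtoC 1).
  { apply ee_neq_1. unfold Rdiv. rewrite Rabs_mult, (Rabs_pos_eq (/ INR N)) by (left; now apply Rinv_0_lt_compat).
    rewrite <- abs_IZR. split.
    - apply Rmult_lt_0_compat; [apply IZR_lt; lia|now apply Rinv_0_lt_compat].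
    - apply Rmult_lt_reg_r with (INR N); trivial. rewrite Rmult_assoc, Rinv_l by lra.
      rewrite Rmult_1_r, Rmult_1_l, INR_IZR_INZ. now apply IZR_lt. }
  rewrite (fsum_ext _ (fun i => z ^ i)%C) by (intros i _; symmetry; apply ee_pow).
  assert (E : (fsum (fun i => z ^ i) N * (1 - z) = RtoC 0)%C).
  { rewrite geom_sum. unfold z. rewrite ee_pow. replace (INR N * (IZR m / INR N)) with (IZR m) by (field; lra). rewrite ee_Z. ring. }
  apply Cmult_integral in E. destruct E as [E|E]; trivial. exfalso. apply Hz.
  replace z with (1 - (1 - z))%C by ring. rewrite E. ring.
Qed.

Section Character.
Variables (q : Z) (chi : Z -> C).
Hypothesis Hd : dchar q chi.

Lemma chi_periodic (n : Z) : chi (n + q)%Z = chi n.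
Proof. apply Hd. Qed.

Lemma chi_mult (m n : Z) : chi (m * n)%Z = (chi m * chi n)%C.
Proof. apply Hd. Qed.

Lemma chi_bounded : exists B, forall n, Cmod (chi n) <= B.
Proof.
  assert (H : forall N : nat, exists B, forall h, (h < N)%nat -> Cmod (chi (Z.of_nat h)) <= B).
  { induction N as [|N [B HB]]. { exists 0. intros; lia. }
    exists (Rmax B (Cmod (chi (Z.of_nat N)))). intros h Hh. destruct (Nat.eq_dec h N) as [->|Hne]; [apply Rmax_r|].
    eapply Rle_trans; [apply HB; lia|apply Rmax_l]. }
  assert (Hq : (1 <= q)%Z) by apply Hd.
  destruct (H (Z.to_nat q)) as [B HB]. exists B. intros n. rewrite <- (periodic_mod chi q chi_periodic).
  pose proof (Z.mod_pos_bound n q ltac:(lia)).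
  rewrite <- (Z2Nat.id (n mod q)) by lia. apply HB. lia.
Qed.

Lemma chi_pow (n : Z) (k : nat) : chi (n ^ Z.of_nat k)%Z = (chi n ^ k)%C.
Proof.
  induction k as [|k IH]; [apply Hd|]. rewrite Nat2Z.inj_succ, Z.pow_succ_r, chi_mult, IH by lia. reflexivity.
Qed.

(** Powers of [chi n] are again values of [chi], hence bounded; by Bernoulli's inequality a modulus
    above 1 would make them grow without bound. *)
Lemma chi_le_1 (n : Z) : Cmod (chi n) <= 1.
Proof.
  destruct chi_bounded as [B HB]. apply Rnot_lt_le. intros H.
  set (x := Cmod (chi n) - 1). assert (Hx : 0 < x) by (unfold x; lra).
  destruct (INR_unbounded (B / x)) as [k Hk].
  pose proof (HB (n ^ Z.of_nat k)%Z) as L. rewrite chi_pow, Cmod_pow in L.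
  replace (Cmod (chi n)) with (1 + x) in L by (unfold x; ring).
  pose proof (poly k x Hx) as P. apply Rmult_lt_compat_r with (r := x) in Hk; trivial.
  replace (B / x * x) with B in Hk by (field; lra). lra.
Qed.

(** A Bezout inverse [u] gives [chi u * chi n = 1], and neither factor exceeds 1 in modulus. *)
Lemma chi_unit (n : Z) : Z.gcd n q = 1%Z -> (Cconj (chi n) * chi n = RtoC 1)%C.
Proof.
  intros H. destruct (Zis_gcd_bezout n q 1) as [u v E].
  { rewrite <- H. apply Zgcd_is_gcd. }
  assert (E1 : (chi u * chi n = RtoC 1)%C).
  { rewrite <- chi_mult. rewrite <- (periodic_Z chi q chi_periodic (u * n) v), E. apply Hd. }
  assert (M : Cmod (chi u) * Cmod (chi n) = 1) by (rewrite <- Cmod_mult, E1; apply Cmod_1).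
  pose proof (chi_le_1 u). pose proof (chi_le_1 n). pose proof (Cmod_ge_0 (chi u)). pose proof (Cmod_ge_0 (chi n)).
  assert (M1 : Cmod (chi n) = 1) by nra.
  rewrite Cmult_comm, <- Cmod2_conj, M1. now rewrite pow1.
Qed.

Lemma chi_0 : (2 <= q)%Z -> chi 0 = RtoC 0.
Proof. intros H. apply Hd. rewrite Z.gcd_0_l. lia. Qed.

End Character.

Section Gauss.
Variables (q : nat) (chi : Z -> C).
Hypothesis Hq : (2 <= q)%nat.
Hypothesis Hp : primitive_char (Z.of_nat q) chi.

Let Hd : dchar (Z.of_nat q) chi := proj1 Hp.

Lemma INR_q_pos : 0 < INR q.
Proof. apply lt_0_INR. lia. Qed.

(** The range moves from [1..q] to [0..q-1], which changes nothing because [chi 0 = chi q = 0]. *)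
Lemma gauss_sum_fsum : gauss_sum (Z.of_nat q) chi = fsum (fun h => chi (Z.of_nat h) * ee (INR h / INR q))%C q.
Proof.
  unfold gauss_sum. rewrite Nat2Z.id.
  transitivity (fsum (fun i => chi (Z.of_nat (S i)) * ee (INR (S i) / INR q))%C q).
  - destruct q as [|q']; [lia|]. rewrite (sum_n_fsum _ q'). apply fsum_ext. intros i _. f_equal.
    unfold cexp, ee. rewrite <- INR_IZR_INZ. unfold Re, Im; cbn [fst snd]. rewrite exp_0, !Rmult_1_l.
    unfold Rdiv. now rewrite !Rmult_assoc.
  - set (g := fun h => (chi (Z.of_nat h) * ee (INR h / INR q))%C).
    pose proof (fsum_S_l g q) as E. change (fsum g (S q)) with (fsum g q + g q)%C in E.
    assert (G0 : g O = RtoC 0) by (unfold g; simpl Z.of_nat; rewrite (chi_0 _ _ Hd) by lia; ring).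
    assert (Gq : g q = RtoC 0).
    { unfold g. replace (Z.of_nat q) with (0 + Z.of_nat q)%Z by lia.
      rewrite (chi_periodic _ _ Hd), (chi_0 _ _ Hd) by lia. ring. }
    rewrite G0, Gq in E. change (fsum (fun i => g (S i)) q = fsum g q).
    rewrite <- (Cplus_0_l (fsum (fun i => g (S i)) q)), <- E. ring.
Qed.

Lemma twisted_periodic (j n : Z) :
  (chi (n + Z.of_nat q) * ee (IZR j * IZR (n + Z.of_nat q) / INR q) = chi n * ee (IZR j * IZR n / INR q))%C.
Proof.
  rewrite (chi_periodic _ _ Hd). f_equal. rewrite <- (ee_shift (IZR j * IZR n / INR q) j). f_equal.
  rewrite plus_IZR, <- INR_IZR_INZ. pose proof INR_q_pos. field. lra.
Qed.

Lemma twisted_mult (a j : Z) : Z.gcd a (Z.of_nat q) = 1%Z ->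
  (chi a * fsum (fun h => chi (Z.of_nat h) * ee (IZR j * (IZR a * INR h) / INR q)) q
   = fsum (fun h => chi (Z.of_nat h) * ee (IZR j * INR h / INR q)) q)%C.
Proof.
  intros Ha.
  pose proof (fsum_unit_mul (fun n => chi n * ee (IZR j * IZR n / INR q))%C q a ltac:(lia) (twisted_periodic j) Ha) as H.
  rewrite (fsum_ext (fun h => chi (Z.of_nat h) * ee (IZR j * INR h / INR q))%C (fun h => chi (Z.of_nat h) * ee (IZR j * IZR (Z.of_nat h) / INR q))%C)
    by (intros; now rewrite INR_IZR_INZ).
  rewrite <- H, <- fsum_scal. apply fsum_ext. intros h _. rewrite (chi_mult _ _ Hd), mult_IZR, <- !INR_IZR_INZ. ring.
Qed.

(** If [j] is prime to [q], substitute [h -> j h]. Otherwise the twist [e (j h / q)] has the period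
    [d = q / gcd (j, q) < q]. Primitivity supplies a unit [a = 1 mod d] with [chi a <> 1], and the
    substitution [h -> a h] gives [chi a * S = S], hence [S = 0]. *)
Lemma gauss_twisted (j : Z) :
  fsum (fun h => chi (Z.of_nat h) * ee (IZR j * INR h / INR q))%C q = (Cconj (chi j) * gauss_sum (Z.of_nat q) chi)%C.
Proof.
  set (S := fsum (fun h => chi (Z.of_nat h) * ee (IZR j * INR h / INR q))%C q).
  destruct (Z.eq_dec (Z.gcd j (Z.of_nat q)) 1) as [H|H].
  - assert (E : (chi j * S = gauss_sum (Z.of_nat q) chi)%C).
    { rewrite gauss_sum_fsum. pose proof (twisted_mult j 1 H) as T.
      unfold S. rewrite (fsum_ext _ (fun h => chi (Z.of_nat h) * ee (1 * (IZR j * INR h) / INR q))%C) by (intros; now rewrite Rmult_1_l).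
      rewrite T. apply fsum_ext. intros h _. now rewrite Rmult_1_l. }
    rewrite <- E, Cmult_assoc, (chi_unit _ _ Hd j H). ring.
  - replace (Cconj (chi j)) with (RtoC 0).
    2:{ destruct Hd as [_ [_ [_ [_ Z0]]]]. rewrite (proj2 (Z0 j) H). apply injective_projections; simpl; ring. }
    rewrite Cmult_0_l. set (g := Z.gcd j (Z.of_nat q)) in *.
    assert (G0 : (0 < g)%Z). { pose proof (Z.gcd_nonneg j (Z.of_nat q)). assert (g <> 0)%Z; [|lia]. intros E. apply Z.gcd_eq_0_r in E. lia. }
    destruct (Z.gcd_divide_r j (Z.of_nat q)) as [d Ed]. fold g in Ed.
    destruct (Z.gcd_divide_l j (Z.of_nat q)) as [j' Ej]. fold g in Ej.
    pose proof (proj2 Hp) as Prim.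
    assert (Dd : (0 < d < Z.of_nat q)%Z) by nia.
    specialize (Prim d Dd ltac:(exists g; lia)).
    apply not_all_ex_not in Prim. destruct Prim as [a Ha].
    apply imply_to_and in Ha. destruct Ha as [Ha1 Ha]. apply imply_to_and in Ha. destruct Ha as [Ha2 Ha3].
    assert (E : (chi a * S = S)%C).
    { etransitivity; [|exact (twisted_mult a j Ha1)]. f_equal. apply fsum_ext. intros h _. f_equal.
      assert (Dv : (d | a - 1)%Z). { apply Z.mod_divide; [lia|]. rewrite Zminus_mod, Ha2, Z.sub_diag. apply Zmod_0_l. }
      destruct Dv as [c Hc].
      rewrite <- (ee_shift (IZR j * INR h / INR q) (j' * c * Z.of_nat h)). f_equal.
      rewrite !mult_IZR, <- INR_IZR_INZ. replace a with (c * d + 1)%Z by lia.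
      assert (Eq : INR q = IZR d * IZR g) by (rewrite <- mult_IZR, <- Ed; apply INR_IZR_INZ).
      rewrite Eq, Ej, plus_IZR, !mult_IZR. field.
      split; apply not_0_IZR; lia. }
    assert (Z1 : ((chi a - 1) * S = RtoC 0)%C) by (transitivity (chi a * S - S)%C; [ring|rewrite E; ring]).
    apply Cmult_integral in Z1. destruct Z1 as [Z1|Z1]; trivial. exfalso. apply Ha3.
    replace (chi a) with (chi a - 1 + 1)%C by ring. rewrite Z1. ring.
Qed.

(* [Fk chi 0], with the sum over each residue class mod [q] taken as a geometric series; this form makes sense for [t < 0] too. *)
Definition Gfin (t : R) : C :=
  (fsum (fun h => chi (Z.of_nat h) * RtoC (exp (- (INR h * t)))) q / RtoC (1 - exp (- (INR q * t))))%C.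

Lemma Cconj_chi_neg (eps : R) (j : Z) : chi (-1)%Z = RtoC eps -> Cconj (chi (- j)%Z) = (RtoC eps * Cconj (chi j))%C.
Proof.
  intros He. replace (- j)%Z with (-1 * j)%Z by lia. rewrite (chi_mult _ _ Hd), He.
  apply injective_projections; simpl; ring.
Qed.

Lemma one_minus_r_ee (r x : R) : 0 < r -> r <> 1 -> (1 - RtoC r * ee x)%C <> RtoC 0.
Proof.
  intros Hr Hr1 E. apply Hr1. assert (E2 : (RtoC r * ee x = RtoC 1)%C).
  { replace (RtoC r * ee x)%C with (1 - (1 - RtoC r * ee x))%C by ring. rewrite E. ring. }
  apply (f_equal Cmod) in E2. rewrite Cmod_mult, Cmod_ee, Cmod_R, Cmod_1, Rmult_1_r, Rabs_pos_eq in E2; lra.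
Qed.

(** Let [r = exp (- t / M)] and [N = q M]. Then [(1 - r^N) / (1 - r e (j / N))] is the sum of
    [r^n e (j n / N)] over [n < N], and [eps * tau * Cconj (chi j)] is the sum of
    [chi h * e (- j h / q)]. Summing over [j] mod [N] singles out [n = h M], where
    [r^n = exp (- h t)]. The parameter [M] is free; its growth is what turns the denominators into
    linear functions of [t]. *)
Lemma finite_fourier (eps t : R) (M : nat) : chi (-1)%Z = RtoC eps -> (0 < M)%nat -> t <> 0 ->
  Gfin t = (RtoC eps * gauss_sum (Z.of_nat q) chi / RtoC (INR (q * M)) *
    fsum (fun j => Cconj (chi (Z.of_nat j)) / (1 - RtoC (exp (- (t / INR M))) * ee (INR j / INR (q * M)))) (q * M))%C.
Proof.
  intros He HM Ht. set (N := (q * M)%nat). set (r := exp (- (t / INR M))). set (tau := gauss_sum (Z.of_nat q) chi).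
  assert (PM : 0 < INR M) by (now apply lt_0_INR). pose proof INR_q_pos as Pq.
  assert (NE : INR N = INR q * INR M) by (unfold N; apply mult_INR).
  assert (PN : 0 < INR N) by (rewrite NE; nra).
  assert (Pr : 0 < r) by apply exp_pos.
  assert (Hr1 : r <> 1).
  { unfold r. rewrite <- exp_0. intros E. apply exp_inv in E. apply Ht.
    replace t with (- (- (t / INR M)) * INR M) by (field; lra). rewrite E. ring. }
  assert (rpow : forall n, r ^ n = exp (- (INR n * t / INR M))).
  { intros n. unfold r. induction n as [|n IH]. { simpl. rewrite <- exp_0. f_equal. field. lra. }
    rewrite S_INR. simpl. rewrite IH, <- exp_plus. f_equal. field. lra. }
  assert (rN : r ^ N = exp (- (INR q * t))).
  { rewrite rpow, NE. f_equal. field. lra. }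
  assert (HrN : 1 - r ^ N <> 0).
  { rewrite rN. intros E. assert (E2 : exp (- (INR q * t)) = exp 0) by (rewrite exp_0; lra). apply exp_inv in E2. apply Ht. nra. }
  assert (Term : forall j, (j < N)%nat ->
     (RtoC eps * tau * (Cconj (chi (Z.of_nat j)) / (1 - RtoC r * ee (INR j / INR N))) * RtoC (1 - r ^ N)
      = fsum (fun h => chi (Z.of_nat h) * fsum (fun n => RtoC (r ^ n) * ee (INR j * (IZR (Z.of_nat n - Z.of_nat (h * M)) / INR N))) N) q)%C).
  { intros j _. set (w := ee (INR j / INR N)).
    assert (G : (RtoC (1 - r ^ N) / (1 - RtoC r * w) = fsum (fun n => RtoC (r ^ n) * ee (INR j * (INR n / INR N))) N)%C).
    { pose proof (geom_sum (RtoC r * w)%C N) as G. pose proof (one_minus_r_ee r (INR j / INR N) Pr Hr1) as Nz. fold w in Nz.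
      replace ((RtoC r * w) ^ N)%C with (RtoC (r ^ N)) in G.
      2:{ rewrite Cpow_mult_l, RtoC_pow. unfold w. rewrite ee_pow. replace (INR N * (INR j / INR N)) with (INR j) by (field; lra). rewrite ee_nat. ring. }
      rewrite RtoC_minus. unfold Cdiv. rewrite <- G, <- Cmult_assoc, Cinv_r, Cmult_1_r by exact Nz.
      apply fsum_ext. intros n _. rewrite Cpow_mult_l, RtoC_pow. f_equal. unfold w. rewrite ee_pow. f_equal. field. lra. }
    transitivity (RtoC eps * Cconj (chi (Z.of_nat j)) * tau * (RtoC (1 - r ^ N) / (1 - RtoC r * w)))%C; [unfold Cdiv; ring|].
    rewrite G, <- (Cconj_chi_neg eps _ He). unfold tau. rewrite <- gauss_twisted.
    rewrite Cmult_comm, <- fsum_scal. apply fsum_ext. intros h _.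
    rewrite (Cmult_comm (fsum _ _)), <- Cmult_assoc. f_equal. rewrite <- fsum_scal. apply fsum_ext. intros n _.
    rewrite (Cmult_comm (ee _)), <- Cmult_assoc. f_equal. rewrite <- ee_add. f_equal.
    rewrite minus_IZR, opp_IZR, <- !INR_IZR_INZ, mult_INR, NE. field. lra. }
  assert (Tot : (RtoC eps * tau / RtoC (INR N) * fsum (fun j => Cconj (chi (Z.of_nat j)) / (1 - RtoC r * ee (INR j / INR N))) N * RtoC (1 - r ^ N)
     = fsum (fun h => chi (Z.of_nat h) * RtoC (exp (- (INR h * t)))) q)%C).
  { assert (NzN : RtoC (INR N) <> RtoC 0) by (apply RtoC_neq; lra).
    transitivity (/ RtoC (INR N) * fsum (fun j => RtoC eps * tau * (Cconj (chi (Z.of_nat j)) / (1 - RtoC r * ee (INR j / INR N))) * RtoC (1 - r ^ N)) N)%C.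
    { rewrite (fsum_ext (fun j => RtoC eps * tau * (Cconj (chi (Z.of_nat j)) / (1 - RtoC r * ee (INR j / INR N))) * RtoC (1 - r ^ N))%C
        (fun j => (RtoC eps * tau * RtoC (1 - r ^ N)) * (Cconj (chi (Z.of_nat j)) / (1 - RtoC r * ee (INR j / INR N))))%C) by (intros; ring).
      rewrite fsum_scal. unfold Cdiv. ring. }
    rewrite (fsum_ext _ _ N Term), fsum_swap, <- fsum_scal. apply fsum_ext. intros h Hh.
    rewrite fsum_scal, fsum_swap.
    assert (HhM : (h * M < N)%nat) by (unfold N; nia).
    rewrite (fsum_single _ N (h * M) HhM).
    - rewrite fsum_scal.
      rewrite (fsum_ext (fun j => ee (INR j * (IZR (Z.of_nat (h * M) - Z.of_nat (h * M)) / INR N))) (fun _ => RtoC 1)).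
      2:{ intros j _. rewrite Z.sub_diag. unfold Rdiv. rewrite Rmult_0_l, Rmult_0_r. apply ee_0. }
      assert (Cn : forall n, fsum (fun _ => RtoC 1) n = RtoC (INR n)).
      { induction n as [|n IH]; trivial. rewrite S_INR, RtoC_plus, <- IH. reflexivity. }
      rewrite Cn, rpow, mult_INR. replace (INR h * INR M * t / INR M) with (INR h * t) by (field; lra).
      field. exact NzN.
    - intros n Hn Hne. rewrite fsum_scal, ee_orthogonal; [ring| |lia|lia]. lia. }
  unfold Gfin. rewrite <- rN. rewrite <- Tot. field.
  split; apply RtoC_neq; lra.
Qed.

End Gauss.

(** * Partial fractions *)

(** The Taylor bound [sin u >= u - u^3 / 6]; the interval [[0, 2]] covers [[0, PI / 2]]. *)
Lemma sin_third (u : R) : 0 <= u <= 2 -> u / 3 <= sin u.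
Proof.
  intros Hu. destruct (pre_sin_bound u 0 ltac:(lra) ltac:(lra)) as [H _].
  unfold sin_approx, sin_term in H. simpl in H. nra.
Qed.

(** The square of the modulus is [(1 - r)^2 + 4 r sin^2 (PI x)], and [|sin (PI x)| >= |x|] for
    [|x| <= 1/2] by [sin_third] and [PI >= 3]. *)
Lemma Cmod_one_minus (r x : R) : 0 < r -> Rabs x <= 1 / 2 -> 4 * r * x ^ 2 <= Cmod (1 - RtoC r * ee x) ^ 2.
Proof.
  intros Hr Hx. rewrite Cmod2_alt. unfold ee, Re, Im; cbn [fst snd Cminus Cplus Copp Cmult RtoC].
  set (c := cos (2 * PI * x)). set (s := sin (2 * PI * x)).
  assert (E : (1 + - (r * c - 0 * s)) ^ 2 + (0 + - (r * s + 0 * c)) ^ 2 = (1 - r) ^ 2 + 2 * r * (1 - c)).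
  { assert (s * s + c * c = 1) by apply (sin2_cos2 (2 * PI * x)). nra. }
  rewrite E. unfold c. replace (2 * PI * x) with (2 * (PI * x)) by ring. rewrite cos_2a_sin.
  assert (S : x ^ 2 <= sin (PI * x) ^ 2).
  { assert (P4 := PI_4). assert (P3 := PI2_3_2). unfold PI2 in P3.
    rewrite <- (pow2_abs x), <- (pow2_abs (sin _)). apply pow_incr. split; [apply Rabs_pos|].
    assert (Rabs (sin (PI * x)) = sin (PI * Rabs x)) as ->.
    { destruct (Rle_dec 0 x) as [L|L].
      - rewrite (Rabs_pos_eq x) by lra. rewrite (Rabs_pos_eq x) in Hx by lra. apply Rabs_pos_eq. apply sin_ge_0; nra.
      - rewrite (Rabs_left x) by lra. rewrite (Rabs_left x) in Hx by lra.
        replace (PI * x) with (- (PI * - x)) by ring. rewrite sin_neg, Rabs_Ropp. apply Rabs_pos_eq. apply sin_ge_0; nra. }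
    pose proof (Rabs_pos x). pose proof (sin_third (PI * Rabs x)) as T. assert (PI * Rabs x / 3 <= sin (PI * Rabs x)) by (apply T; nra). nra. }
  pose proof (pow2_ge_0 (1 - r)). nra.
Qed.

Lemma CSeries_finite (u : nat -> C) (K : nat) :
  CSeries (fun i => if Nat.ltb i K then u i else RtoC 0) = fsum u K.
Proof.
  set (w := fun i => if Nat.ltb i K then u i else RtoC 0).
  assert (W : forall n, (K < n)%nat -> w n = RtoC 0).
  { intros n Hn. unfold w. destruct (Nat.ltb_spec n K); [lia|trivial]. }
  assert (E : CSeries w = @sum_n (NormedModule.AbelianMonoid C_AbsRing C_NormedModule) w K).
  { rewrite sum_n_C. apply injective_projections; unfold CSeries; cbn [fst snd].
    - apply (Series_finite (fun n => fst (w n))). intros n Hn. now rewrite W.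
    - apply (Series_finite (fun n => snd (w n))). intros n Hn. now rewrite W. }
  rewrite E, sum_n_fsum. simpl. unfold w at 2. rewrite Nat.ltb_irrefl.
  rewrite (fsum_ext w u); [ring|]. intros i Hi. unfold w. now rewrite (proj2 (Nat.ltb_lt i K) Hi).
Qed.

Lemma cexp_lim (z : C) (a : nat -> R) : (forall m, 0 < a m) -> is_lim_seq (fun m => / a m) 0 ->
  clim (fun m => RtoC (a m) * (1 - cexp (RtoC (/ a m) * z)))%C (- z)%C.
Proof.
  intros Ha HL.
  apply (clim_squeeze _ (fun m => / a m * (5 * Cmod z ^ 2 * exp (2 * (/ a m * Cmod z))))).
  - intros m. specialize (Ha m). set (w := (RtoC (/ a m) * z)%C).
    assert (Ia : 0 < / a m) by now apply Rinv_0_lt_compat.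
    replace (RtoC (a m) * (1 - cexp w) - - z)%C with (- RtoC (a m) * (cexp w - 1 - w))%C.
    2:{ unfold w. rewrite RtoC_inv by lra. field. apply RtoC_neq. lra. }
    rewrite Cmod_mult, Cmod_opp, Cmod_R, Rabs_pos_eq by lra.
    pose proof (cexp_taylor w) as T.
    assert (Ew : Cmod w = / a m * Cmod z) by (unfold w; rewrite Cmod_mult, Cmod_R, Rabs_pos_eq; lra).
    rewrite Ew in T.
    apply Rmult_le_compat_l with (r := a m) in T; [|lra]. eapply Rle_trans. exact T. apply Req_le. field. lra.
  - replace (Finite 0) with (Finite (0 * (5 * Cmod z ^ 2 * exp (2 * (0 * Cmod z))))) by (f_equal; ring).
    apply is_lim_seq_mult'; trivial. apply is_lim_seq_mult'; [apply is_lim_seq_const|].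
    apply (is_lim_seq_continuous exp).
    + apply derivable_continuous_pt, derivable_pt_exp.
    + apply is_lim_seq_mult'; [apply is_lim_seq_const|]. apply is_lim_seq_mult'; [trivial|apply is_lim_seq_const].
Qed.

Lemma inv_lin_lim (c : R) : 0 < c -> is_lim_seq (fun m => / (c * INR (S m))) 0.
Proof.
  intros Hc. apply is_lim_seq_eps. intros eps He.
  destruct (INR_unbounded (/ (c * eps))) as [N HN]. exists N. intros n Hn.
  assert (P : 0 < INR (S n)) by (apply lt_0_INR; lia).
  assert (L : INR N <= INR (S n)) by (apply le_INR; lia).
  rewrite Rminus_0_r, Rabs_pos_eq by (left; apply Rinv_0_lt_compat; nra).
  rewrite <- (Rinv_inv eps). apply Rinv_lt_contravar. { apply Rmult_lt_0_compat; [now apply Rinv_0_lt_compat|nra]. }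
  apply Rlt_gt, Rmult_gt_compat_l with (r := c) in HN; trivial.
  replace (c * / (c * eps)) with (/ eps) in HN by (field; lra). nra.
Qed.

(** The point [x + i y]. A pole at [i b] thus appears as [/ cpt t (- b)], and [freq q j] below is
    the ordinate [2 pi (j + 1) / q] of a pole. *)
Definition cpt (x y : R) : C := (x, y).

Lemma cpt_nz (x y : R) : y <> 0 -> cpt x y <> RtoC 0.
Proof. intros H E. apply H. exact (f_equal snd E). Qed.

Definition freq (q j : nat) : R := 2 * PI * INR (S j) / INR q.

Lemma freq_pos (q j : nat) : (2 <= q)%nat -> 0 < freq q j.
Proof.
  intros Hq. unfold freq. pose proof PI_RGT_0. assert (0 < INR (S j)) by (apply lt_0_INR; lia).
  assert (0 < INR q) by (apply lt_0_INR; lia). apply Rdiv_lt_0_compat; nra.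
Qed.

Section PartialFractions.
Variables (q : nat) (chi : Z -> C) (eps : R).
Hypothesis Hq : (2 <= q)%nat.
Hypothesis Hp : primitive_char (Z.of_nat q) chi.
Hypothesis He : chi (-1)%Z = RtoC eps.

Let Hd : dchar (Z.of_nat q) chi := proj1 Hp.

(* The denominators in [finite_fourier] for [M = 2 (m + 1)], scaled so as to converge to [q (t - 2 pi i x / q)] as [m -> oo]. *)
Definition Bn (m : nat) (t x : R) : C :=
  (RtoC (INR (q * (2 * S m))) * (1 - RtoC (exp (- (t / INR (2 * S m)))) * ee (x / INR (q * (2 * S m)))))%C.

Lemma INR_double_modulus (m : nat) : INR (q * (2 * S m)) = 2 * INR q * INR (S m).
Proof. rewrite !mult_INR. simpl (INR 2). ring. Qed.

Lemma Bn_lim (t x : R) : clim (fun m => Bn m t x) (RtoC (INR q) * cpt t (- (2 * PI * x / INR q)))%C.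
Proof.
  assert (Pq : 0 < INR q) by (apply lt_0_INR; lia).
  assert (PS : forall m, 0 < INR (S m)) by (intros; apply lt_0_INR; lia).
  pose proof (cexp_lim (cpt (- (INR q * t)) (2 * PI * x)) (fun m => 2 * INR q * INR (S m)) ) as L.
  replace (RtoC (INR q) * cpt t (- (2 * PI * x / INR q)))%C with (- (cpt (- (INR q * t)) (2 * PI * x)))%C
    by (apply injective_projections; simpl; field; lra).
  eapply clim_ext; [|apply L].
  - intros m. unfold Bn. rewrite INR_double_modulus. f_equal. f_equal. f_equal. specialize (PS m).
    unfold cexp, cpt, ee, RtoC, Cmult, Re, Im; cbn [fst snd].
    replace (/ (2 * INR q * INR (S m)) * - (INR q * t) - 0 * (2 * PI * x)) with (- (t / INR (2 * S m)))
      by (rewrite mult_INR; simpl (INR 2); field; lra).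
    replace (/ (2 * INR q * INR (S m)) * (2 * PI * x) + 0 * - (INR q * t)) with (2 * PI * (x / (2 * INR q * INR (S m)))) by (field; lra).
    f_equal; ring.
  - intros m. specialize (PS m). nra.
  - apply inv_lin_lim. lra.
Qed.

(** A bound uniform in [m], as Tannery's theorem demands. The range of [x] is half of the period
    [N = 2 q (m + 1)], which is why the sum over [j] will be folded to positive and negative
    indices. *)
Lemma Bn_lower (m : nat) (t x : R) : Rabs x <= INR (q * S m) -> exp (- Rabs t) * Rabs x <= Cmod (Bn m t x).
Proof.
  intros Hx. assert (Pq : 0 < INR q) by (apply lt_0_INR; lia). assert (PS : 0 < INR (S m)) by (apply lt_0_INR; lia).
  rewrite mult_INR in Hx. unfold Bn. rewrite INR_double_modulus. set (N := 2 * INR q * INR (S m)).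
  assert (PN : 0 < N) by (unfold N; nra). set (r := exp (- (t / INR (2 * S m)))).
  rewrite Cmod_mult, Cmod_R, (Rabs_pos_eq N) by lra.
  assert (Hx2 : Rabs (x / N) <= 1 / 2).
  { unfold Rdiv at 1. rewrite Rabs_mult, (Rabs_pos_eq (/ N)) by (left; now apply Rinv_0_lt_compat).
    apply Rmult_le_reg_r with N; trivial. rewrite Rmult_assoc, Rinv_l by lra. unfold N. lra. }
  pose proof (Cmod_one_minus r (x / N) (exp_pos _) Hx2) as L.
  assert (Lr : exp (- Rabs t) <= r).
  { unfold r. apply exp_mono. assert (P2 : 1 <= INR (2 * S m)) by (rewrite mult_INR; simpl (INR 2); assert (1 <= INR (S m)) by (rewrite S_INR; pose proof (pos_INR m); lra); lra).
    apply Ropp_le_contravar. unfold Rdiv. apply Rle_trans with (Rabs t * / INR (2 * S m)).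
    - apply Rmult_le_compat_r; [left; apply Rinv_0_lt_compat; lra|apply Rle_abs].
    - rewrite <- (Rmult_1_r (Rabs t)) at 2. apply Rmult_le_compat_l; [apply Rabs_pos|]. rewrite <- Rinv_1. apply Rinv_le_contravar; lra. }
  assert (E1 : exp (- Rabs t) <= 1) by (rewrite <- exp_0; apply exp_mono; pose proof (Rabs_pos t); lra).
  assert (E0 : 0 < exp (- Rabs t)) by apply exp_pos.
  apply Rsqr_incr_0_var; [|apply Rmult_le_pos; [lra|apply Cmod_ge_0]].
  rewrite !Rsqr_pow2, !Rpow_mult_distr, pow2_abs.
  apply Rle_trans with (N ^ 2 * (4 * r * (x / N) ^ 2)); [|apply Rmult_le_compat_l; [apply pow2_ge_0|exact L]].
  replace (N ^ 2 * (4 * r * (x / N) ^ 2)) with (4 * r * x ^ 2) by (field; lra).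
  apply Rmult_le_compat_r; [apply pow2_ge_0|]. nra.
Qed.

(** The exponents contain [t / M], and this [1 / M] cancels the factor [M] of the scaling [q M];
    hence a bound that is uniform in [m]. *)
Lemma Bn_diff (m : nat) (t t' x : R) :
  Cmod (Bn m t' x - Bn m t x) <= INR q * Rabs (t - t') * exp (Rabs t' + Rabs (t - t')).
Proof.
  assert (Pq : 0 < INR q) by (apply lt_0_INR; lia). assert (PS : 1 <= INR (S m)) by (rewrite S_INR; pose proof (pos_INR m); lra).
  unfold Bn. rewrite INR_double_modulus. replace (INR (2 * S m)) with (2 * INR (S m)) by (rewrite mult_INR; simpl (INR 2); ring).
  set (M := 2 * INR (S m)). set (w := ee _).
  assert (PM : 1 <= M) by (unfold M; lra).
  replace (RtoC (2 * INR q * INR (S m)) * (1 - RtoC (exp (- (t' / M))) * w) - RtoC (2 * INR q * INR (S m)) * (1 - RtoC (exp (- (t / M))) * w))%C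
    with (RtoC (INR q * M * (exp (- (t / M)) - exp (- (t' / M)))) * w)%C.
  2:{ unfold M. rewrite !RtoC_mult, RtoC_minus. ring. }
  rewrite Cmod_mult. unfold w. rewrite Cmod_ee, Rmult_1_r, Cmod_R, !Rabs_mult, (Rabs_pos_eq (INR q)), (Rabs_pos_eq M) by lra.
  replace (exp (- (t / M)) - exp (- (t' / M))) with (exp (- (t' / M)) * (exp ((t' - t) / M) - 1)).
  2:{ rewrite Rmult_minus_distr_l, <- exp_plus. f_equal; [f_equal; field; lra|ring]. }
  rewrite Rabs_mult, (Rabs_pos_eq (exp _)) by (left; apply exp_pos).
  assert (Q : forall y, Rabs (y / M) <= Rabs y /\ Rabs (y / M) = Rabs y / M).
  { intros y. unfold Rdiv. rewrite Rabs_mult, (Rabs_pos_eq (/ M)) by (left; apply Rinv_0_lt_compat; lra). split; trivial.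
    rewrite <- (Rmult_1_r (Rabs y)) at 2. apply Rmult_le_compat_l; [apply Rabs_pos|]. rewrite <- Rinv_1. apply Rinv_le_contravar; lra. }
  destruct (Q (t' - t)) as [Q1 Q2]. destruct (Q t') as [Q3 _].
  pose proof (exp_taylor1 ((t' - t) / M)) as T. rewrite Q2 in T at 1. rewrite exp_plus.
  assert (X1 : exp (- (t' / M)) <= exp (Rabs t')).
  { apply exp_mono. pose proof (Rle_abs (- (t' / M))) as A. rewrite Rabs_Ropp in A. lra. }
  assert (X2 : exp (Rabs ((t' - t) / M)) <= exp (Rabs (t - t'))).
  { apply exp_mono. rewrite (Rabs_minus_sym t t'). exact Q1. }
  rewrite (Rabs_minus_sym t t') in *. set (D := Rabs (t' - t)) in *.
  assert (D0 : 0 <= D) by apply Rabs_pos.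
  apply Rle_trans with (INR q * M * (exp (Rabs t') * (D / M * exp D))).
  - apply Rmult_le_compat_l; [nra|]. apply Rmult_le_compat; [left; apply exp_pos|apply Rabs_pos|exact X1|].
    eapply Rle_trans. exact T. apply Rmult_le_compat_l; [|exact X2]. apply Rmult_le_pos; trivial. left; apply Rinv_0_lt_compat; lra.
  - apply Req_le. field. lra.
Qed.

Lemma Bn_nz (m : nat) (t x : R) : x <> 0 -> Rabs x <= INR (q * S m) -> Bn m t x <> RtoC 0.
Proof.
  intros Hx HN E. pose proof (Bn_lower m t x HN) as L. rewrite E, Cmod_0 in L.
  pose proof (exp_pos (- Rabs t)). pose proof (Rabs_pos_lt x Hx). nra.
Qed.

(** [1 / Bn] decays only like [1 / x], too slowly for an absolutely convergent sum. The difference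
    between two values of [t] decays like [1 / x^2], so differences of [Gfin] are expanded instead
    of [Gfin] itself. *)
Lemma Bn_inv_diff (m : nat) (t t' x : R) : x <> 0 -> Rabs x <= INR (q * S m) ->
  Cmod (/ Bn m t x - / Bn m t' x) <=
    INR q * Rabs (t - t') * exp (Rabs t' + Rabs (t - t')) * exp (Rabs t) * exp (Rabs t') / x ^ 2.
Proof.
  intros Hx HN. pose proof (Bn_nz m t x Hx HN) as N1. pose proof (Bn_nz m t' x Hx HN) as N2.
  replace (/ Bn m t x - / Bn m t' x)%C with ((Bn m t' x - Bn m t x) / (Bn m t x * Bn m t' x))%C by (field; now split).
  assert (N3 : (Bn m t x * Bn m t' x)%C <> RtoC 0). { intros E. apply Cmult_integral in E. tauto. }
  rewrite Cmod_div, Cmod_mult by exact N3.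
  pose proof (Bn_diff m t t' x) as D. pose proof (Bn_lower m t x HN) as L1. pose proof (Bn_lower m t' x HN) as L2.
  assert (X : 0 < Rabs x) by now apply Rabs_pos_lt.
  set (A := INR q * Rabs (t - t') * exp (Rabs t' + Rabs (t - t'))) in *.
  assert (A0 : 0 <= A) by (eapply Rle_trans; [apply Cmod_ge_0|exact D]).
  rewrite exp_Ropp in L1, L2. set (e1 := exp (Rabs t)) in *. set (e2 := exp (Rabs t')) in *.
  assert (P1 : 0 < e1) by apply exp_pos. assert (P2 : 0 < e2) by apply exp_pos.
  assert (I1 : 0 < / e1 * Rabs x) by (apply Rmult_lt_0_compat; trivial; now apply Rinv_0_lt_compat).
  assert (I2 : 0 < / e2 * Rabs x) by (apply Rmult_lt_0_compat; trivial; now apply Rinv_0_lt_compat).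
  apply Rle_trans with (A / ((/ e1 * Rabs x) * (/ e2 * Rabs x))).
  - unfold Rdiv. apply Rmult_le_compat; [apply Cmod_ge_0| |exact D|].
    + left. apply Rinv_0_lt_compat. nra.
    + apply Rinv_le_contravar; nra.
  - rewrite <- (pow2_abs x). apply Req_le. field. repeat split; lra.
Qed.

(** The [2 K] frequencies, [K = q (m + 1)], are cut in the middle, and the upper half is read as the
    negative indices [j - 2 K], where [chi (-1)] brings in [eps]. The lower half has only [K - 1]
    terms since [j = 0] is killed by [chi 0 = 0]. *)
Lemma Gfin_diff_finite (m : nat) (t t' : R) : t <> 0 -> t' <> 0 ->
  (Gfin q chi t - Gfin q chi t')%C = (RtoC eps * gauss_sum (Z.of_nat q) chi *
    CSeries (fun i => Cconj (chi (Z.of_nat (S i))) *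
      ((if Nat.ltb i (q * S m - 1) then / Bn m t (INR (S i)) - / Bn m t' (INR (S i)) else RtoC 0) +
       (if Nat.ltb i (q * S m) then RtoC eps * (/ Bn m t (- INR (S i)) - / Bn m t' (- INR (S i))) else RtoC 0))))%C.
Proof.
  intros Ht Ht'. set (K := (q * S m)%nat). set (tau := gauss_sum (Z.of_nat q) chi).
  assert (HK : (0 < K)%nat) by (unfold K; lia).
  assert (NK : (q * (2 * S m) = K + K)%nat) by (unfold K; lia).
  assert (PN : 0 < INR (q * (2 * S m))) by (apply lt_0_INR; lia).
  set (A := fun x : R => (/ Bn m t x - / Bn m t' x)%C).
  assert (H1 : (Gfin q chi t - Gfin q chi t' = RtoC eps * tau * fsum (fun j => Cconj (chi (Z.of_nat j)) * A (INR j)) (K + K))%C).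
  { assert (X : forall s, s <> 0 -> (Gfin q chi s = RtoC eps * tau * fsum (fun j => Cconj (chi (Z.of_nat j)) * / Bn m s (INR j)) (K + K))%C).
    { intros s Hs. rewrite (finite_fourier q chi Hq Hp eps s (2 * S m) He ltac:(lia) Hs). rewrite NK.
      rewrite <- NK. unfold Cdiv. rewrite <- !Cmult_assoc. f_equal. fold tau. f_equal. rewrite <- fsum_scal. rewrite NK. apply fsum_ext.
      intros j _. unfold Bn. rewrite NK.
      assert (Nz := one_minus_r_ee (exp (- (s / INR (2 * S m)))) (INR j / INR (K + K)) (exp_pos _)).
      assert (E1 : exp (- (s / INR (2 * S m))) <> 1).
      { rewrite <- exp_0. intros E. apply exp_inv in E. apply Hs. assert (P2 : 0 < INR (2 * S m)) by (apply lt_0_INR; lia).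
        replace s with (- - (s / INR (2 * S m)) * INR (2 * S m)) by (field; lra). rewrite E. ring. }
      specialize (Nz E1). assert (RtoC (INR (K + K)) <> RtoC 0) by (apply RtoC_neq; rewrite <- NK; lra).
      field. now split. }
    rewrite (X t Ht), (X t' Ht').
    transitivity (RtoC eps * tau * (fsum (fun j => Cconj (chi (Z.of_nat j)) * / Bn m t (INR j)) (K + K) + RtoC (-1) * fsum (fun j => Cconj (chi (Z.of_nat j)) * / Bn m t' (INR j)) (K + K)))%C; [ring|].
    f_equal. rewrite <- fsum_scal, <- fsum_plus. apply fsum_ext. intros j _. unfold A. ring. }
  rewrite H1. f_equal. rewrite fsum_add.
  set (u := fun i => (Cconj (chi (Z.of_nat (S i))) * A (INR (S i)))%C).
  set (w := fun i => (Cconj (chi (Z.of_nat (S i))) * (RtoC eps * A (Ropp (INR (S i)))))%C).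
  assert (P1 : fsum (fun j => Cconj (chi (Z.of_nat j)) * A (INR j))%C K = fsum u (K - 1)).
  { replace K with (S (K - 1)) at 1 by lia. rewrite fsum_S_l. simpl Z.of_nat at 1. rewrite (chi_0 _ _ Hd) by lia.
    replace (Cconj (RtoC 0)) with (RtoC 0) by (apply injective_projections; simpl; ring). unfold u. ring. }
  assert (P2 : fsum (fun i => Cconj (chi (Z.of_nat (K + i))) * A (INR (K + i)))%C K = fsum w K).
  { rewrite fsum_rev. apply fsum_ext. intros i Hi. unfold w.
    replace (Z.of_nat (K + (K - S i))) with (- Z.of_nat (S i) + Z.of_nat (2 * S m) * Z.of_nat q)%Z by lia.
    rewrite (periodic_Z _ _ (chi_periodic _ _ Hd)), (Cconj_chi_neg q chi Hq Hp eps _ He).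
    rewrite (Cmult_comm (RtoC eps)), <- Cmult_assoc. f_equal. f_equal. unfold A.
    assert (Y : forall s, Bn m s (INR (K + (K - S i))) = Bn m s (- INR (S i))).
    { intros s. unfold Bn.
      replace (ee (INR (K + (K - S i)) / INR (q * (2 * S m)))) with (ee (- INR (S i) / INR (q * (2 * S m)))); trivial.
      rewrite <- (ee_shift (- INR (S i) / INR (q * (2 * S m))) 1). f_equal. replace (K + (K - S i))%nat with (q * (2 * S m) - S i)%nat by lia.
      rewrite minus_INR by lia. field. lra. }
    now rewrite !Y. }
  rewrite P1, P2, <- !CSeries_finite.
  assert (Fin : forall (v : nat -> C) (L : nat), exists B, csum (fun i => if Nat.ltb i L then v i else RtoC 0) B).
  { intros v L. exists (fun i => Cmod (if Nat.ltb i L then v i else RtoC 0)). split; [intros; lra|].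
    apply (Series_finite _ L). intros n Hn. destruct (Nat.ltb_spec n L); [lia|apply Cmod_0]. }
  destruct (Fin u (K - 1)%nat) as [B1 S1]. destruct (Fin w K) as [B2 S2].
  rewrite <- (CSeries_plus _ _ _ _ S1 S2). apply CSeries_ext. intros i. unfold u, w, A.
  destruct (Nat.ltb i (K - 1)); destruct (Nat.ltb i K); ring.
Qed.

(** Tannery's theorem as [m] tends to infinity, with the majorant of [Bn_inv_diff]. *)
Lemma Gfin_diff (t t' : R) : t <> 0 -> t' <> 0 ->
  (Gfin q chi t - Gfin q chi t')%C = (RtoC eps * gauss_sum (Z.of_nat q) chi / RtoC (INR q) *
    CSeries (fun i => Cconj (chi (Z.of_nat (S i))) *
      ((/ cpt t (- freq q i) - / cpt t' (- freq q i)) + RtoC eps * (/ cpt t (freq q i) - / cpt t' (freq q i)))))%C.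
Proof.
  intros Ht Ht'. assert (Pq : 0 < INR q) by (apply lt_0_INR; lia).
  set (C0 := INR q * Rabs (t - t') * exp (Rabs t' + Rabs (t - t')) * exp (Rabs t) * exp (Rabs t')).
  assert (C00 : 0 <= C0). { unfold C0. repeat apply Rmult_le_pos; try apply Rabs_pos; try (left; apply exp_pos). lra. }
  set (u := fun m i => (Cconj (chi (Z.of_nat (S i))) *
      ((if Nat.ltb i (q * S m - 1) then / Bn m t (INR (S i)) - / Bn m t' (INR (S i)) else RtoC 0) +
       (if Nat.ltb i (q * S m) then RtoC eps * (/ Bn m t (- INR (S i)) - / Bn m t' (- INR (S i))) else RtoC 0)))%C).
  set (l := fun i => (Cconj (chi (Z.of_nat (S i))) *
      ((/ (RtoC (INR q) * cpt t (- freq q i)) - / (RtoC (INR q) * cpt t' (- freq q i))) + RtoC eps * (/ (RtoC (INR q) * cpt t (freq q i)) - / (RtoC (INR q) * cpt t' (freq q i)))))%C).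
  assert (L : clim (fun m => CSeries (u m)) (CSeries l)).
  { apply (CSeries_tannery u l (fun i => C0 * (1 + Rabs eps) * / (INR (S i) ^ 2))).
    - apply (ex_series_scal_l (C0 * (1 + Rabs eps)) _ ex_series_inv_sqr).
    - intros m i. unfold u. assert (PS : 0 < INR (S i)) by (apply lt_0_INR; lia).
      rewrite Cmod_mult, Cmod_conj. rewrite <- (Rmult_1_l (C0 * _ * _)). apply Rmult_le_compat; try apply Cmod_ge_0. { apply (chi_le_1 _ _ Hd). }
      eapply Rle_trans. apply Cmod_triangle.
      replace (C0 * (1 + Rabs eps) * / INR (S i) ^ 2) with (C0 / INR (S i) ^ 2 + Rabs eps * (C0 / INR (S i) ^ 2)) by (field; lra).
      assert (Q0 : 0 <= C0 / INR (S i) ^ 2). { apply Rmult_le_pos; trivial. left. apply Rinv_0_lt_compat. nra. }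
      apply Rplus_le_compat.
      + destruct (Nat.ltb_spec i (q * S m - 1)) as [B|B]; [|rewrite Cmod_0; exact Q0].
        apply Bn_inv_diff; [lra|]. rewrite Rabs_pos_eq by lra. apply le_INR. lia.
      + destruct (Nat.ltb_spec i (q * S m)) as [B|B]; [|rewrite Cmod_0; apply Rmult_le_pos; [apply Rabs_pos|exact Q0]].
        rewrite Cmod_mult, Cmod_R. apply Rmult_le_compat_l; [apply Rabs_pos|].
        replace (INR (S i) ^ 2) with ((- INR (S i)) ^ 2) by ring.
        apply Bn_inv_diff; [lra|]. rewrite Rabs_Ropp, Rabs_pos_eq by lra. apply le_INR. lia.
    - intros i. unfold u, l.
      assert (Nz : forall s b, b <> 0 -> (RtoC (INR q) * cpt s b)%C <> RtoC 0).
      { intros s b Hb E. apply Cmult_integral in E. destruct E as [E|E]; [apply RtoC_neq in E; lra|]. now apply cpt_nz in E. }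
      pose proof (freq_pos q i Hq) as Fp.
      assert (LB : forall s, clim (fun m => / Bn m s (INR (S i)))%C (/ (RtoC (INR q) * cpt s (- freq q i)))%C).
      { intros s. apply clim_inv; [apply Nz; lra|]. apply (Bn_lim s (INR (S i))). }
      assert (LB' : forall s, clim (fun m => / Bn m s (- INR (S i)))%C (/ (RtoC (INR q) * cpt s (freq q i)))%C).
      { intros s. apply clim_inv; [apply Nz; lra|]. replace (freq q i) with (- (2 * PI * - INR (S i) / INR q)) by (unfold freq; field; lra).
        apply (Bn_lim s (- INR (S i))). }
      (* A fixed index [i] is within the range of summation for all large [m], so the cut-off does
         not affect the limit. *)
      assert (Ev : forall (v : nat -> C) (a : C) (g : nat -> nat), (forall m, (m <= g m)%nat) -> clim v a ->
         clim (fun m => if Nat.ltb i (g m) then v m else RtoC 0) a).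
      { intros v a g Hg [V1 V2]. split.
        - apply (is_lim_seq_ext_loc (fun m => fst (v m))); trivial. exists (S i). intros m Hm. specialize (Hg m).
          destruct (Nat.ltb_spec i (g m)); [trivial|lia].
        - apply (is_lim_seq_ext_loc (fun m => snd (v m))); trivial. exists (S i). intros m Hm. specialize (Hg m).
          destruct (Nat.ltb_spec i (g m)); [trivial|lia]. }
      assert (Mi : forall (v w : nat -> C) a b, clim v a -> clim w b -> clim (fun m => v m - w m)%C (a - b)%C).
      { intros v w a b [V1 V2] [W1 W2]. split; simpl.
        - exact (is_lim_seq_minus' _ _ _ _ V1 W1).
        - exact (is_lim_seq_minus' _ _ _ _ V2 W2). }
      apply clim_mult; [apply clim_const|]. apply clim_plus.
      + apply (Ev (fun m => / Bn m t (INR (S i)) - / Bn m t' (INR (S i)))%C _ (fun m => q * S m - 1)%nat); [intros; nia|]. now apply Mi.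
      + apply (Ev (fun m => RtoC eps * (/ Bn m t (- INR (S i)) - / Bn m t' (- INR (S i))))%C _ (fun m => q * S m)%nat); [intros; nia|].
        apply clim_mult; [apply clim_const|]. now apply Mi. }
  assert (L2 : clim (fun m => RtoC eps * gauss_sum (Z.of_nat q) chi * CSeries (u m))%C (RtoC eps * gauss_sum (Z.of_nat q) chi * CSeries l)%C).
  { apply clim_mult; [apply clim_const|exact L]. }
  assert (L3 : clim (fun m => RtoC eps * gauss_sum (Z.of_nat q) chi * CSeries (u m))%C (Gfin q chi t - Gfin q chi t')%C).
  { eapply clim_ext; [|apply clim_const]. intros m. now apply Gfin_diff_finite. }
  rewrite (clim_unique _ _ _ L3 L2). unfold Cdiv. rewrite <- !Cmult_assoc. f_equal. f_equal.
  set (l' := fun i => (Cconj (chi (Z.of_nat (S i))) *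
      ((/ cpt t (- freq q i) - / cpt t' (- freq q i)) + RtoC eps * (/ cpt t (freq q i) - / cpt t' (freq q i))))%C).
  assert (El : forall i, l i = (/ RtoC (INR q) * l' i)%C).
  { intros i. unfold l, l'. pose proof (freq_pos q i Hq) as Fp.
    field. repeat split; try (apply cpt_nz; lra). apply RtoC_neq; lra. }
  apply injective_projections; unfold CSeries, Cmult; cbn [fst snd].
  - rewrite (Series_ext (fun n => fst (l n)) (fun n => / INR q * fst (l' n))).
    2:{ intros i. rewrite El, <- RtoC_inv by lra. simpl. ring. }
    rewrite Series_scal_l, <- RtoC_inv by lra. simpl. ring.
  - rewrite (Series_ext (fun n => snd (l n)) (fun n => / INR q * snd (l' n))).
    2:{ intros i. rewrite El, <- RtoC_inv by lra. simpl. ring. }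
    rewrite Series_scal_l, <- RtoC_inv by lra. simpl. ring.
Qed.

End PartialFractions.

(** * Lambert series [Fk] and their partial fraction expansions *)

Lemma exp_pow_bound (j : nat) (x : R) : (0 < j)%nat -> 0 < x -> exp (- x) <= (INR j / x) ^ j.
Proof.
  intros Hj Hx. assert (Pj : 0 < INR j) by now apply lt_0_INR.
  assert (E : exp x = exp (x / INR j) ^ j).
  { assert (Q : forall n y, exp y ^ n = exp (INR n * y)).
    { intros n y. induction n as [|n IH]. simpl. now rewrite Rmult_0_l, exp_0.
      rewrite S_INR. simpl. rewrite IH, <- exp_plus. f_equal. ring. }
    rewrite Q. f_equal. field. lra. }
  assert (L : (x / INR j) ^ j <= exp x).
  { rewrite E. apply pow_incr. split. left; now apply Rdiv_lt_0_compat. pose proof (exp_ineq1_le (x / INR j)). lra. }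
  rewrite exp_Ropp. replace (INR j / x) with (/ (x / INR j)) by (field; lra). rewrite pow_inv.
  apply Rinv_le_contravar; trivial. apply pow_lt. now apply Rdiv_lt_0_compat.
Qed.

(** The constant from [exp_pow_bound] at exponent [k + 2]: [k] powers absorb the coefficient [n^k],
    and two more leave the summable [1 / n^2]. *)
Definition expC (k : nat) (t : R) : R := (INR (k + 2) / t) ^ (k + 2).

Lemma exp_term_bound (k n : nat) (t : R) : 0 < t ->
  INR (S n) ^ k * exp (- (INR (S n) * t)) <= expC k t * / INR (S n) ^ 2.
Proof.
  intros Ht. assert (P : 0 < INR (S n)) by (apply lt_0_INR; lia).
  pose proof (exp_pow_bound (k + 2) (INR (S n) * t) ltac:(lia) ltac:(nra)) as B.
  assert (Pk : 0 < INR (S n) ^ k) by now apply pow_lt.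
  apply Rmult_le_compat_l with (r := INR (S n) ^ k) in B; [|lra].
  eapply Rle_trans. exact B. unfold expC. apply Req_le.
  unfold Rdiv. rewrite Rinv_mult, !Rpow_mult_distr, !pow_inv, !(pow_add (INR (S n)) k 2).
  assert (0 < t ^ (k + 2)) by now apply pow_lt. field. lra.
Qed.

Lemma expC_pos (k : nat) (t : R) : 0 < t -> 0 <= expC k t.
Proof. intros H. apply pow_le. apply Rmult_le_pos; [apply pos_INR|left; now apply Rinv_0_lt_compat]. Qed.

Lemma Cmod_inv_cpt_le (t b : R) : b <> 0 -> Cmod (/ cpt t b) <= / Rabs b.
Proof.
  intros Hb. rewrite Cmod_inv by now apply cpt_nz. apply Rinv_le_contravar; [now apply Rabs_pos_lt|]. apply (snd_le_Cmod (cpt t b)).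
Qed.

Lemma inv_cpt_diff (t s b : R) : b <> 0 -> (/ cpt t b - / cpt s b = RtoC (s - t) * (/ cpt t b * / cpt s b))%C.
Proof.
  intros Hb. assert (E : RtoC (s - t) = (cpt s b - cpt t b)%C) by (apply injective_projections; simpl; ring).
  rewrite E. field. split; now apply cpt_nz.
Qed.

Lemma inv_cpt_pow_diff (l : nat) (t s b : R) : b <> 0 ->
  Cmod ((/ cpt t b) ^ l - (/ cpt s b) ^ l) <= INR l * Rabs (t - s) * (/ Rabs b) ^ S l.
Proof.
  intros Hb. pose proof (Rabs_pos_lt b Hb) as Pb. assert (Ib : 0 < / Rabs b) by now apply Rinv_0_lt_compat.
  induction l as [|l IH].
  - simpl. replace (RtoC 1 - RtoC 1)%C with (RtoC 0) by ring. rewrite Cmod_0. lra.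
  - set (a := (/ cpt t b)%C) in *. set (c := (/ cpt s b)%C) in *.
    replace (a ^ S l - c ^ S l)%C with (a * (a ^ l - c ^ l) + (a - c) * c ^ l)%C by (simpl; ring).
    eapply Rle_trans. apply Cmod_triangle. rewrite !Cmod_mult, Cmod_pow.
    assert (A : Cmod a <= / Rabs b) by now apply Cmod_inv_cpt_le.
    assert (B : Cmod c <= / Rabs b) by now apply Cmod_inv_cpt_le.
    assert (D : Cmod (a - c) <= Rabs (t - s) * (/ Rabs b * / Rabs b)).
    { unfold a, c. rewrite inv_cpt_diff by trivial. rewrite !Cmod_mult, Cmod_R, Rabs_minus_sym.
      apply Rmult_le_compat_l; [apply Rabs_pos|]. apply Rmult_le_compat; try apply Cmod_ge_0; trivial. }
    assert (Bl : Cmod c ^ l <= (/ Rabs b) ^ l) by (apply pow_incr; split; [apply Cmod_ge_0|trivial]).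
    rewrite S_INR.
    replace ((INR l + 1) * Rabs (t - s) * (/ Rabs b) ^ S (S l)) with (/ Rabs b * (INR l * Rabs (t - s) * (/ Rabs b) ^ S l) + Rabs (t - s) * (/ Rabs b * / Rabs b) * (/ Rabs b) ^ l) by (simpl; ring).
    apply Rplus_le_compat; apply Rmult_le_compat; try apply Cmod_ge_0; trivial. apply pow_le, Cmod_ge_0.
Qed.

(** The triangular number [l (l + 1) / 2], produced by the induction in [inv_cpt_quad]. *)
Fixpoint quadC (l : nat) : R := match l with O => 0 | S m => quadC m + INR (S m) end.

(** First-order Taylor expansion of a pole term. The remainder is uniform in [t] and carries two
    extra powers of [1 / |b|], so it can be summed over the poles. *)
Lemma inv_cpt_quad (l : nat) (t h b : R) : b <> 0 ->
  Cmod ((/ cpt (t + h) b) ^ l - (/ cpt t b) ^ l + RtoC (INR l * h) * (/ cpt t b) ^ S l) <= quadC l * h ^ 2 * (/ Rabs b) ^ S (S l).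
Proof.
  intros Hb. pose proof (Rabs_pos_lt b Hb) as Pb. assert (Ib : 0 < / Rabs b) by now apply Rinv_0_lt_compat.
  induction l as [|l IH].
  - simpl. replace (RtoC 1 - RtoC 1 + RtoC (0 * h) * (/ cpt t b * RtoC 1))%C with (RtoC 0) by (rewrite Rmult_0_l; ring). rewrite Cmod_0. lra.
  - pose proof (inv_cpt_pow_diff (S l) (t + h) t b Hb) as D. replace (t + h - t) with h in D by ring.
    pose proof (inv_cpt_diff (t + h) t b Hb) as E. replace (t - (t + h)) with (- h) in E by ring.
    set (a' := (/ cpt (t + h) b)%C) in *. set (a := (/ cpt t b)%C) in *.
    assert (A : Cmod a <= / Rabs b) by now apply Cmod_inv_cpt_le.
    replace (a' ^ S l - a ^ S l + RtoC (INR (S l) * h) * a ^ S (S l))%C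
      with (a * (a' ^ l - a ^ l + RtoC (INR l * h) * a ^ S l) + RtoC (- h) * (a * (a' ^ S l - a ^ S l)))%C.
    2:{ transitivity (a * (a' ^ l - a ^ l + RtoC (INR l * h) * a ^ S l) + (a' ^ l * (a' - a) + RtoC h * a ^ S (S l)))%C.
        - f_equal. rewrite E. rewrite RtoC_opp. simpl. ring.
        - rewrite S_INR, Rmult_plus_distr_r, RtoC_plus, Rmult_1_l. simpl. ring. }
    eapply Rle_trans. apply Cmod_triangle. rewrite !Cmod_mult, Cmod_R, Rabs_Ropp.
    change (quadC (S l)) with (quadC l + INR (S l)).
    replace ((quadC l + INR (S l)) * h ^ 2 * (/ Rabs b) ^ S (S (S l)))
      with (/ Rabs b * (quadC l * h ^ 2 * (/ Rabs b) ^ S (S l)) + Rabs h * (/ Rabs b * (INR (S l) * Rabs h * (/ Rabs b) ^ S (S l)))).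
    2:{ rewrite <- (pow2_abs h). change ((/ Rabs b) ^ S (S (S l))) with (/ Rabs b * (/ Rabs b) ^ S (S l)). ring. }
    apply Rplus_le_compat.
    + apply Rmult_le_compat; try apply Cmod_ge_0; trivial.
    + apply Rmult_le_compat_l; [apply Rabs_pos|]. apply Rmult_le_compat; try apply Cmod_ge_0; trivial.
Qed.

(** Subtracting the two expansions gives [h |d - d'| <= (K + K') h^2]. Increments [h > 0] are
    enough, and they keep [t + h] positive. *)
Lemma quad_unique (X : R -> C) (d d' : C) (del K K' : R) : 0 < del ->
  (forall h, 0 < h <= del -> Cmod (X h - RtoC h * d) <= K * h ^ 2) ->
  (forall h, 0 < h <= del -> Cmod (X h - RtoC h * d') <= K' * h ^ 2) -> d = d'.
Proof.
  intros Hdel H1 H2. apply Cmod_small_eq. intros eps He.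
  set (Q := Rabs K + Rabs K' + 1). assert (HQ : 0 < Q) by (unfold Q; pose proof (Rabs_pos K); pose proof (Rabs_pos K'); lra).
  set (h := Rmin del (eps / Q)).
  assert (Hh : 0 < h <= del) by (unfold h; split; [apply Rmin_pos; trivial; now apply Rdiv_lt_0_compat|apply Rmin_l]).
  assert (Hh2 : h <= eps / Q) by apply Rmin_r.
  specialize (H1 h Hh). specialize (H2 h Hh).
  assert (E : Cmod (RtoC h * (d - d')) <= (K + K') * h ^ 2).
  { replace (RtoC h * (d - d'))%C with ((X h - RtoC h * d') - (X h - RtoC h * d))%C by ring.
    eapply Rle_trans. apply Cmod_minus_le. lra. }
  rewrite Cmod_mult, Cmod_R, Rabs_pos_eq in E by lra.
  apply Rmult_le_reg_l with h; [lra|]. eapply Rle_trans. exact E.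
  apply Rle_trans with (Q * h * h). { pose proof (Rle_abs K). pose proof (Rle_abs K'). unfold Q. nra. }
  apply Rle_trans with (eps * h); [|lra]. apply Rmult_le_compat_r; [lra|].
  apply Rmult_le_compat_l with (r := Q) in Hh2; [|lra]. replace (Q * (eps / Q)) with eps in Hh2 by (field; lra). exact Hh2.
Qed.

Lemma CSeries_split (u : nat -> C) (A : nat -> R) (N : nat) : (0 < N)%nat -> csum u A ->
  CSeries u = (fsum u N + CSeries (fun k => u (N + k)%nat))%C.
Proof.
  intros HN Hu. destruct N as [|N]; [lia|]. rewrite <- sum_n_fsum, sum_n_C.
  apply injective_projections; unfold CSeries, Cplus; cbn [fst snd].
  - apply (Series_split (fun n => fst (u n))). eapply csum_fst; eauto.
  - apply (Series_split (fun n => snd (u n))). eapply csum_snd; eauto.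
Qed.

Definition Fk (chi : Z -> C) (k : nat) (t : R) : C :=
  CSeries (fun n => RtoC (INR (S n) ^ k) * chi (Z.of_nat (S n)) * RtoC (exp (- (INR (S n) * t))))%C.

Lemma Fk_csum (chi : Z -> C) (k : nat) (t : R) : (forall n, Cmod (chi n) <= 1) -> 0 < t ->
  csum (fun n => RtoC (INR (S n) ^ k) * chi (Z.of_nat (S n)) * RtoC (exp (- (INR (S n) * t))))%C
    (fun n => expC k t * / INR (S n) ^ 2).
Proof.
  intros Hc Ht. split; [|apply (ex_series_scal_l (expC k t) _ ex_series_inv_sqr)].
  intros n. rewrite !Cmod_mult, !Cmod_R, (Rabs_pos_eq (INR (S n) ^ k)) by apply pow_le, pos_INR.
  rewrite (Rabs_pos_eq (exp _)) by (left; apply exp_pos).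
  pose proof (exp_term_bound k n t Ht) as B. specialize (Hc (Z.of_nat (S n))). pose proof (Cmod_ge_0 (chi (Z.of_nat (S n)))).
  assert (0 <= INR (S n) ^ k) by (apply pow_le, pos_INR). pose proof (exp_pos (- (INR (S n) * t))).
  eapply Rle_trans; [|exact B]. apply Rmult_le_compat_r; [lra|]. nra.
Qed.

(** Termwise [exp_taylor2]; its factor [exp (x h)] uses up at most half of [exp (- x t)] because
    [h <= t / 2], whence the constant at [t / 2]. *)
Lemma Fk_quad (chi : Z -> C) (k : nat) (t : R) : (forall n, Cmod (chi n) <= 1) -> 0 < t ->
  exists K, forall h, 0 < h <= t / 2 -> Cmod (Fk chi k (t + h) - Fk chi k t - RtoC h * (- Fk chi (S k) t)) <= K * h ^ 2.
Proof.
  intros Hc Ht. exists (2 * Series (fun n => expC (k + 2) (t / 2) * / INR (S n) ^ 2)). intros h Hh.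
  pose proof (Fk_csum chi k (t + h) Hc ltac:(lra)) as S1. pose proof (Fk_csum chi k t Hc Ht) as S2. pose proof (Fk_csum chi (S k) t Hc Ht) as S3.
  set (u := fun n : nat => (RtoC (INR (S n) ^ k) * chi (Z.of_nat (S n)) * RtoC (exp (- (INR (S n) * (t + h)))))%C) in *.
  set (w := fun n : nat => (RtoC (INR (S n) ^ k) * chi (Z.of_nat (S n)) * RtoC (exp (- (INR (S n) * t))))%C) in *.
  set (z := fun n : nat => (RtoC (INR (S n) ^ S k) * chi (Z.of_nat (S n)) * RtoC (exp (- (INR (S n) * t))))%C) in *.
  replace (Fk chi k (t + h) - Fk chi k t - RtoC h * (- Fk chi (S k) t))%C with (CSeries (fun n => (u n - w n) + RtoC h * z n)%C).
  2:{ assert (S12 : csum (fun n => u n - w n)%C (fun n => expC k (t + h) * / INR (S n) ^ 2 + expC k t * / INR (S n) ^ 2)).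
      { destruct S1 as [A1 B1]. destruct S2 as [A2 B2]. split.
        - intros n. eapply Rle_trans. apply Cmod_minus_le. now apply Rplus_le_compat.
        - now apply (ex_series_plus (V := R_NormedModule)). }
      rewrite (CSeries_plus _ _ _ _ S12 (csum_scal _ _ _ S3)), (CSeries_minus _ _ _ _ S1 S2), (CSeries_scal _ _ _ S3).
      unfold Fk. fold u w z. ring. }
  assert (B : csum (fun n => (u n - w n) + RtoC h * z n)%C (fun n => h ^ 2 * (expC (k + 2) (t / 2) * / INR (S n) ^ 2))).
  { split.
    - intros n. unfold u, w, z. set (x := INR (S n)). assert (Px : 0 < x) by (apply lt_0_INR; lia).
      replace (RtoC (x ^ k) * chi (Z.of_nat (S n)) * RtoC (exp (- (x * (t + h)))) - RtoC (x ^ k) * chi (Z.of_nat (S n)) * RtoC (exp (- (x * t))) + RtoC h * (RtoC (x ^ S k) * chi (Z.of_nat (S n)) * RtoC (exp (- (x * t)))))%C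
        with (chi (Z.of_nat (S n)) * RtoC (x ^ k * (exp (- (x * t)) * (exp (- (x * h)) - 1 - - (x * h)))))%C.
      2:{ replace (- (x * (t + h))) with (- (x * t) + - (x * h)) by ring. rewrite exp_plus.
          replace (x ^ S k) with (x * x ^ k) by reflexivity. rewrite !RtoC_mult, !RtoC_minus, RtoC_opp, !RtoC_mult. ring. }
      rewrite Cmod_mult, Cmod_R, !Rabs_mult, (Rabs_pos_eq (x ^ k)), (Rabs_pos_eq (exp (- (x * t)))) by (try (left; apply exp_pos); apply pow_le; lra).
      pose proof (exp_taylor2 (- (x * h))) as T. rewrite Rabs_Ropp, (Rabs_pos_eq (x * h)) in T by nra.
      pose proof (exp_term_bound (k + 2) n (t / 2) ltac:(lra)) as Bd. fold x in Bd.
      rewrite <- (Rmult_1_l (h ^ 2 * _)). apply Rmult_le_compat; [apply Cmod_ge_0| |apply Hc|].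
      { repeat apply Rmult_le_pos; try apply Rabs_pos; try (left; apply exp_pos). apply pow_le; lra. }
      apply Rle_trans with (x ^ k * (exp (- (x * t)) * ((- (x * h)) ^ 2 * exp (x * h)))).
      { apply Rmult_le_compat_l; [apply pow_le; lra|]. apply Rmult_le_compat_l; [left; apply exp_pos|exact T]. }
      apply Rle_trans with (h ^ 2 * (x ^ (k + 2) * exp (- (x * (t / 2))))); [|apply Rmult_le_compat_l; [apply pow2_ge_0|exact Bd]].
      replace (x ^ k * (exp (- (x * t)) * ((- (x * h)) ^ 2 * exp (x * h)))) with (h ^ 2 * (x ^ (k + 2) * (exp (- (x * t)) * exp (x * h)))) by (rewrite pow_add; ring).
      rewrite <- exp_plus. apply Rmult_le_compat_l; [apply pow2_ge_0|]. apply Rmult_le_compat_l; [apply pow_le; lra|]. apply exp_mono. nra.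
    - apply (ex_series_scal_l (V := R_NormedModule) (h ^ 2) (fun n => expC (k + 2) (t / 2) * / INR (S n) ^ 2)). apply (ex_series_scal_l (expC (k + 2) (t / 2)) _ ex_series_inv_sqr). }
  eapply Rle_trans. apply (CSeries_bound _ _ B). rewrite Series_scal_l. apply Req_le. ring.
Qed.

Section LambertSeries.
Variables (q : nat) (chi : Z -> C) (eps : R).
Hypothesis Hq : (2 <= q)%nat.
Hypothesis Hp : primitive_char (Z.of_nat q) chi.
Hypothesis He : chi (-1)%Z = RtoC eps.

Let Hd : dchar (Z.of_nat q) chi := proj1 Hp.

(** Splitting off the first period, the series [S] satisfies [S = fsum u q + exp (- q t) * S]. *)
Lemma Fk_Gfin (t : R) : 0 < t -> Fk chi 0 t = Gfin q chi t.
Proof.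
  intros Ht. set (u := fun n => (chi (Z.of_nat n) * RtoC (exp (- (INR n * t))))%C).
  assert (Pq : 0 < INR q) by (apply lt_0_INR; lia).
  assert (U0 : u O = RtoC 0) by (unfold u; simpl Z.of_nat; rewrite (chi_0 _ _ Hd) by lia; ring).
  pose proof (Fk_csum chi 0 t (chi_le_1 _ _ Hd) Ht) as S1.
  assert (S2 : csum (fun n => u (S n)) (fun n => expC 0 t * / INR (S n) ^ 2)).
  { destruct S1 as [A B]. split; trivial. intros n. specialize (A n). simpl pow in A.
    replace (RtoC 1 * chi (Z.of_nat (S n)) * RtoC (exp (- (INR (S n) * t))))%C with (u (S n)) in A by (unfold u; ring). exact A. }
  assert (S3 : csum u (fun n => match n with O => 0 | S n => expC 0 t * / INR (S n) ^ 2 end)).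
  { split. intros [|n]. rewrite U0, Cmod_0. lra. apply S2.
    apply ex_series_incr_1. apply S2. }
  assert (E1 : Fk chi 0 t = CSeries u).
  { rewrite (CSeries_split u _ 1 ltac:(lia) S3). simpl fsum. rewrite U0. unfold Fk.
    rewrite (CSeries_ext _ (fun k => u (1 + k)%nat)); [ring|]. intros n. unfold u. simpl pow. simpl Nat.add. ring. }
  assert (E2 : CSeries u = (fsum u q + RtoC (exp (- (INR q * t))) * CSeries u)%C).
  { rewrite (CSeries_split u _ q ltac:(lia) S3) at 1. f_equal. rewrite <- (CSeries_scal _ _ _ S3). apply CSeries_ext. intros n.
    unfold u. rewrite Nat2Z.inj_add, Z.add_comm, (chi_periodic _ _ Hd), plus_INR.
    replace (- ((INR q + INR n) * t)) with (- (INR q * t) + - (INR n * t)) by ring. rewrite exp_plus, RtoC_mult. ring. }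
  rewrite E1. unfold Gfin. fold u.
  assert (Nz : RtoC (1 - exp (- (INR q * t))) <> RtoC 0).
  { apply RtoC_neq. assert (exp (- (INR q * t)) < 1); [|lra]. rewrite <- exp_0. apply exp_increasing. nra. }
  assert (E3 : fsum u q = (CSeries u * RtoC (1 - exp (- (INR q * t))))%C).
  { rewrite RtoC_minus. transitivity (CSeries u - RtoC (exp (- (INR q * t))) * CSeries u)%C; [rewrite E2 at 1; ring|ring]. }
  rewrite E3. field. exact Nz.
Qed.

(** Replace [h] by [q - h] in the numerator: this yields [eps] and a factor [exp (q t)], which turns
    [1 - exp (q t)] into minus the original denominator. *)
Lemma Gfin_neg (t : R) : 0 < t -> Gfin q chi (- t) = (RtoC (- eps) * Gfin q chi t)%C.
Proof.
  intros Ht. assert (Pq : 0 < INR q) by (apply lt_0_INR; lia).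
  set (g := fun s h => (chi (Z.of_nat h) * RtoC (exp (- (INR h * s))))%C).
  assert (G0 : forall s, g s O = RtoC 0) by (intros; unfold g; simpl Z.of_nat; rewrite (chi_0 _ _ Hd) by lia; ring).
  assert (E : fsum (g (- t)) q = (RtoC eps * RtoC (exp (INR q * t)) * fsum (g t) q)%C).
  { destruct q as [|q'] eqn:Eq; [lia|]. rewrite !fsum_S_l, !G0. rewrite fsum_rev, Cmult_plus_distr_l, <- fsum_scal.
    rewrite Cmult_0_r. f_equal. apply fsum_ext. intros i Hi. unfold g.
    replace (Z.of_nat (S (q' - S i))) with (- Z.of_nat (S i) + Z.of_nat (S q'))%Z by lia. rewrite (chi_periodic _ _ Hd).
    replace (- Z.of_nat (S i))%Z with (-1 * Z.of_nat (S i))%Z by lia. rewrite (chi_mult _ _ Hd), He.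
    replace (S (q' - S i))%nat with (S q' - S i)%nat by lia. rewrite minus_INR by lia.
    replace (- ((INR (S q') - INR (S i)) * - t)) with (INR (S q') * t + - (INR (S i) * t)) by ring.
    rewrite exp_plus, RtoC_mult. ring. }
  unfold Gfin. fold (g t) (g (- t)). rewrite E. replace (- (INR q * - t)) with (INR q * t) by ring.
  assert (X : exp (INR q * t) * exp (- (INR q * t)) = 1) by (rewrite <- exp_plus, Rplus_opp_r; apply exp_0).
  set (x := exp (INR q * t)) in *. set (x' := exp (- (INR q * t))) in *.
  assert (Hx : 1 < x) by (unfold x; rewrite <- exp_0; apply exp_increasing; nra).
  assert (Hx' : x' <> 1) by nra.
  assert (N1 : RtoC (1 - x) <> RtoC 0) by (apply RtoC_neq; lra). assert (N2 : RtoC (1 - x') <> RtoC 0) by (apply RtoC_neq; lra).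
  assert (Y : (RtoC x / RtoC (1 - x) = - / RtoC (1 - x'))%C).
  { assert (Z : (RtoC x * RtoC (1 - x') = - RtoC (1 - x))%C) by (rewrite <- RtoC_mult, <- RtoC_opp; f_equal; nra).
    transitivity (RtoC x * RtoC (1 - x') / (RtoC (1 - x) * RtoC (1 - x')))%C; [field; now split|]. rewrite Z. field. now split. }
  transitivity (RtoC eps * fsum (g t) q * (RtoC x / RtoC (1 - x)))%C; [unfold Cdiv; ring|].
  rewrite Y, RtoC_opp. unfold Cdiv. ring.
Qed.

(** The joint contribution of the poles [i b] and [- i b], normalised to vanish at [t = 0]; the
    subtraction makes the sum over the poles converge absolutely. *)
Definition e0 (b t : R) : C :=
  ((/ cpt t (- b) - / cpt 0 (- b)) + RtoC eps * (/ cpt t b - / cpt 0 b))%C.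

(** The same two poles with order [k + 1]. For [k >= 1] their sum converges absolutely as it
    stands. *)
Definition ek (k : nat) (b t : R) : C :=
  ((/ cpt t (- b)) ^ S k + RtoC eps * (/ cpt t b) ^ S k)%C.

Definition cchi (j : nat) : C := Cconj (chi (Z.of_nat (S j))).

Lemma cchi_le_1 (j : nat) : Cmod (cchi j) <= 1.
Proof. unfold cchi. rewrite Cmod_conj. apply (chi_le_1 _ _ Hd). Qed.

Lemma e0_bound (b t : R) : 0 < b -> Cmod (e0 b t) <= (1 + Rabs eps) * Rabs t * (/ b) ^ 2.
Proof.
  intros Hb.
  assert (A : forall c, Rabs c = b -> Cmod (/ cpt t c - / cpt 0 c) <= Rabs t * (/ b) ^ 2).
  { intros c Hc. assert (c <> 0) by (intros ->; rewrite Rabs_R0 in Hc; lra).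
    pose proof (inv_cpt_pow_diff 1 t 0 c H) as D. rewrite Hc in D. simpl INR in D. rewrite Rminus_0_r in D.
    rewrite !Cpow_1_r in D. lra. }
  unfold e0. eapply Rle_trans. apply Cmod_triangle. rewrite Cmod_mult, Cmod_R.
  pose proof (A (- b) ltac:(rewrite Rabs_Ropp, Rabs_pos_eq; lra)). pose proof (A b ltac:(rewrite Rabs_pos_eq; lra)).
  pose proof (Rabs_pos eps). nra.
Qed.

Lemma inv_freq (l j : nat) : (2 <= l)%nat -> (/ freq q j) ^ l <= INR q ^ l * / INR (S j) ^ 2.
Proof.
  intros Hl. assert (Pq : 0 < INR q) by (apply lt_0_INR; lia).
  assert (P1 : 1 <= INR (S j)) by (rewrite S_INR; pose proof (pos_INR j); lra).
  assert (P3 := PI2_3_2). unfold PI2 in P3.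
  assert (L : / freq q j <= INR q * / INR (S j)).
  { unfold freq. replace (/ (2 * PI * INR (S j) / INR q)) with (INR q * / (2 * PI * INR (S j))) by (field; lra).
    apply Rmult_le_compat_l; [lra|]. apply Rinv_le_contravar; nra. }
  apply Rle_trans with ((INR q * / INR (S j)) ^ l).
  - apply pow_incr. split; trivial. left. apply Rinv_0_lt_compat. now apply freq_pos.
  - rewrite Rpow_mult_distr, pow_inv. apply Rmult_le_compat_l; [apply pow_le; lra|].
    apply Rinv_le_contravar; [apply pow_lt; lra|]. now apply Rle_pow.
Qed.

Lemma csum_cchi (u : nat -> C) (K : R) (l : nat) : (2 <= l)%nat -> 0 <= K ->
  (forall j, Cmod (u j) <= K * (/ freq q j) ^ l) ->
  csum (fun j => cchi j * u j)%C (fun j => K * INR q ^ l * / INR (S j) ^ 2).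
Proof.
  intros Hl HK H. split; [|apply (ex_series_scal_l (K * INR q ^ l) _ ex_series_inv_sqr)].
  intros j. rewrite Cmod_mult. pose proof (cchi_le_1 j). pose proof (Cmod_ge_0 (cchi j)). pose proof (Cmod_ge_0 (u j)).
  apply Rle_trans with (1 * Cmod (u j)); [nra|]. rewrite Rmult_1_l. eapply Rle_trans. apply H.
  rewrite Rmult_assoc. apply Rmult_le_compat_l; trivial. now apply inv_freq.
Qed.

Lemma e0_csum (t : R) : exists A, csum (fun j => cchi j * e0 (freq q j) t)%C A.
Proof.
  eexists. apply (csum_cchi _ ((1 + Rabs eps) * Rabs t) 2); [lia| |].
  - pose proof (Rabs_pos eps). pose proof (Rabs_pos t). nra.
  - intros j. now apply e0_bound, freq_pos.
Qed.

Lemma ek_bound (k : nat) (b t : R) : 0 < b -> Cmod (ek k b t) <= (1 + Rabs eps) * (/ b) ^ S k.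
Proof.
  intros Hb. unfold ek. eapply Rle_trans. apply Cmod_triangle. rewrite Cmod_mult, Cmod_R, !Cmod_pow.
  assert (A : forall c, Rabs c = b -> Cmod (/ cpt t c) ^ S k <= (/ b) ^ S k).
  { intros c Hc. apply pow_incr. split; [apply Cmod_ge_0|]. rewrite <- Hc. apply Cmod_inv_cpt_le. intros ->. rewrite Rabs_R0 in Hc. lra. }
  pose proof (A (- b) ltac:(rewrite Rabs_Ropp, Rabs_pos_eq; lra)). pose proof (A b ltac:(rewrite Rabs_pos_eq; lra)).
  pose proof (Rabs_pos eps). nra.
Qed.

Lemma ek_csum (k : nat) (t : R) : (1 <= k)%nat -> exists A, csum (fun j => cchi j * ek k (freq q j) t)%C A.
Proof.
  intros Hk. eexists. apply (csum_cchi _ (1 + Rabs eps) (S k)); [lia| |].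
  - pose proof (Rabs_pos eps). lra.
  - intros j. now apply ek_bound, freq_pos.
Qed.

Lemma ek_lip (k : nat) (b t s : R) : 0 < b -> Cmod (ek k b t - ek k b s) <= (1 + Rabs eps) * INR (S k) * Rabs (t - s) * (/ b) ^ S (S k).
Proof.
  intros Hb. unfold ek.
  replace ((/ cpt t (- b)) ^ S k + RtoC eps * (/ cpt t b) ^ S k - ((/ cpt s (- b)) ^ S k + RtoC eps * (/ cpt s b) ^ S k))%C
    with (((/ cpt t (- b)) ^ S k - (/ cpt s (- b)) ^ S k) + RtoC eps * ((/ cpt t b) ^ S k - (/ cpt s b) ^ S k))%C by ring.
  eapply Rle_trans. apply Cmod_triangle. rewrite Cmod_mult, Cmod_R.
  pose proof (inv_cpt_pow_diff (S k) t s (- b) ltac:(lra)) as D1. pose proof (inv_cpt_pow_diff (S k) t s b ltac:(lra)) as D2.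
  rewrite Rabs_Ropp in D1. rewrite (Rabs_pos_eq b) in D1, D2 by lra. pose proof (Rabs_pos eps). nra.
Qed.

(** The constant of [Gfin_diff] times the [k!] from differentiating [1 / (t - i b)]; the sign of
    each differentiation cancels against [Fk chi (S k) = - (Fk chi k)']. *)
Definition kap (k : nat) : C := (RtoC (INR (fact k)) * (RtoC eps * gauss_sum (Z.of_nat q) chi / RtoC (INR q)))%C.

Lemma Gfin_e0 (t t' : R) : t <> 0 -> t' <> 0 ->
  (Gfin q chi t - Gfin q chi t' =
   kap 0 * (CSeries (fun j => cchi j * e0 (freq q j) t) - CSeries (fun j => cchi j * e0 (freq q j) t')))%C.
Proof.
  intros Ht Ht'. rewrite (Gfin_diff q chi eps Hq Hp He t t' Ht Ht').
  destruct (e0_csum t) as [A SA]. destruct (e0_csum t') as [B SB]. rewrite <- (CSeries_minus _ _ _ _ SA SB).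
  unfold kap. simpl fact. simpl INR. rewrite Cmult_1_l. f_equal. apply CSeries_ext. intros j. unfold cchi, e0. ring.
Qed.

(** By [Gfin_e0] the point 1 could be any nonzero point, so this is the constant term of the
    expansion, that is, the limit of [Fk chi 0] at 0. *)
Definition g0 : C := (Gfin q chi 1 - kap 0 * CSeries (fun j => cchi j * e0 (freq q j) 1))%C.

Lemma Fk_partial_fractions_0 (t : R) : 0 < t -> (Fk chi 0 t = g0 + kap 0 * CSeries (fun j => cchi j * e0 (freq q j) t))%C.
Proof.
  intros Ht. rewrite Fk_Gfin by trivial. pose proof (Gfin_e0 t 1 ltac:(lra) ltac:(lra)) as E. unfold g0.
  replace (Gfin q chi t) with (Gfin q chi t - Gfin q chi 1 + Gfin q chi 1)%C by ring. rewrite E. ring.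
Qed.

(** The constant is the same at [1] and at [- 1]. For [eps = 1] both [Gfin] and the sum of the [e0]
    are odd, so it also equals its own opposite. *)
Lemma g0_even : eps = 1 -> g0 = RtoC 0.
Proof.
  intros E1. unfold g0. pose proof (Gfin_e0 1 (- (1)) ltac:(lra) ltac:(lra)) as E.
  rewrite (Gfin_neg 1 ltac:(lra)) in E.
  destruct (e0_csum 1) as [A SA].
  assert (EP : CSeries (fun j => cchi j * e0 (freq q j) (- (1)))%C = (RtoC (-1) * CSeries (fun j => cchi j * e0 (freq q j) 1))%C).
  { rewrite <- (CSeries_scal _ _ _ SA). apply CSeries_ext. intros j. unfold e0. rewrite E1.
    pose proof (freq_pos q j Hq) as Fp. set (b := freq q j) in *.
    assert (X1 : cpt (- (1)) (- b) = (- cpt 1 b)%C) by (apply injective_projections; simpl; ring).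
    assert (X2 : cpt (- (1)) b = (- cpt 1 (- b))%C) by (apply injective_projections; simpl; ring).
    assert (X3 : cpt 0 (- b) = (- cpt 0 b)%C) by (apply injective_projections; simpl; ring).
    rewrite X1, X2, X3. field. repeat split; apply cpt_nz; lra. }
  rewrite EP, E1 in E. set (P := CSeries (fun j => (cchi j * e0 (freq q j) 1)%C)) in *.
  assert (E2 : (RtoC 2 * (Gfin q chi 1 - kap 0 * P) = RtoC 0)%C).
  { transitivity ((Gfin q chi 1 - RtoC (- (1)) * Gfin q chi 1) - RtoC 2 * (kap 0 * P))%C; [rewrite RtoC_opp; ring|]. rewrite E. ring. }
  apply Cmult_integral in E2. destruct E2 as [E2|E2]; trivial. apply RtoC_inj in E2. lra.
Qed.

(** [e0] and [ek 0] differ by a constant in [t]. Comparing increments lets the first differentiation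
    start from the normalised terms although the series of [ek 0] is not absolutely summable. *)
Lemma e0_ek (b t h : R) : (e0 b (t + h) - e0 b t = ek 0 b (t + h) - ek 0 b t)%C.
Proof. unfold e0, ek. rewrite !Cpow_1_r. ring. Qed.

Lemma ek_quad (k : nat) (b t h : R) : 0 < b ->
  Cmod (ek k b (t + h) - ek k b t + RtoC h * (RtoC (INR (S k)) * ek (S k) b t)) <= (1 + Rabs eps) * quadC (S k) * h ^ 2 * (/ b) ^ S (S (S k)).
Proof.
  intros Hb. unfold ek.
  replace ((/ cpt (t + h) (- b)) ^ S k + RtoC eps * (/ cpt (t + h) b) ^ S k - ((/ cpt t (- b)) ^ S k + RtoC eps * (/ cpt t b) ^ S k)
     + RtoC h * (RtoC (INR (S k)) * ((/ cpt t (- b)) ^ S (S k) + RtoC eps * (/ cpt t b) ^ S (S k))))%C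
   with (((/ cpt (t + h) (- b)) ^ S k - (/ cpt t (- b)) ^ S k + RtoC (INR (S k) * h) * (/ cpt t (- b)) ^ S (S k))
     + RtoC eps * ((/ cpt (t + h) b) ^ S k - (/ cpt t b) ^ S k + RtoC (INR (S k) * h) * (/ cpt t b) ^ S (S k)))%C.
  2:{ rewrite RtoC_mult. ring. }
  eapply Rle_trans. apply Cmod_triangle. rewrite Cmod_mult, Cmod_R.
  pose proof (inv_cpt_quad (S k) t h (- b) ltac:(lra)) as D1. pose proof (inv_cpt_quad (S k) t h b ltac:(lra)) as D2.
  rewrite Rabs_Ropp in D1. rewrite (Rabs_pos_eq b) in D1, D2 by lra. pose proof (Rabs_pos eps). nra.
Qed.

Lemma quadC_pos (l : nat) : 0 <= quadC l.
Proof. induction l as [|l IH]; [simpl; lra|]. change (quadC (S l)) with (quadC l + INR (S l)). pose proof (pos_INR (S l)). lra. Qed.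

(* Both sides have a second-order expansion in [h] at [t]; comparing the linear terms differentiates the expansion without
   a theorem on derivatives of series. *)
Lemma partial_fractions_step (k : nat) (E : R -> nat -> C) (c : C) :
  (forall t, exists A, csum (fun j => cchi j * E t j)%C A) ->
  (forall t h j, (E (t + h)%R j - E t j = ek k (freq q j) (t + h) - ek k (freq q j) t)%C) ->
  (forall t, 0 < t -> (Fk chi k t = c + kap k * CSeries (fun j => cchi j * E t j))%C) ->
  forall t, 0 < t -> (Fk chi (S k) t = kap (S k) * CSeries (fun j => cchi j * ek (S k) (freq q j) t))%C.
Proof.
  intros HS HE HF t Ht.
  destruct (Fk_quad chi k t (chi_le_1 _ _ Hd) Ht) as [K1 HK1].
  destruct (ek_csum (S k) t ltac:(lia)) as [B SB].
  set (P := CSeries (fun j => (cchi j * ek (S k) (freq q j) t)%C)) in *.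
  set (K0 := (1 + Rabs eps) * quadC (S k)).
  assert (K0p : 0 <= K0). { unfold K0. pose proof (Rabs_pos eps). pose proof (quadC_pos (S k)). nra. }
  set (SS := Series (fun j => K0 * INR q ^ S (S (S k)) * / INR (S j) ^ 2)).
  assert (HK2 : forall h, 0 < h <= t / 2 ->
    Cmod (Fk chi k (t + h) - Fk chi k t - RtoC h * (- (kap (S k) * P))) <= Cmod (kap k) * (2 * SS) * h ^ 2).
  { intros h Hh. rewrite (HF (t + h) ltac:(lra)), (HF t Ht).
    destruct (HS (t + h)) as [A1 S1]. destruct (HS t) as [A2 S2].
    assert (Kp : kap (S k) = (kap k * RtoC (INR (S k)))%C).
    { unfold kap. change (fact (S k)) with (S k * fact k)%nat. rewrite mult_INR, RtoC_mult. ring. }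
    replace (c + kap k * CSeries (fun j => cchi j * E (t + h)%R j) - (c + kap k * CSeries (fun j => cchi j * E t j)) - RtoC h * (- (kap (S k) * P)))%C
      with (kap k * CSeries (fun j => cchi j * (ek k (freq q j) (t + h) - ek k (freq q j) t + RtoC h * (RtoC (INR (S k)) * ek (S k) (freq q j) t))))%C.
    2:{ rewrite Kp.
      assert (S12 : csum (fun j => cchi j * E (t + h)%R j - cchi j * E t j)%C (fun n => A1 n + A2 n)).
      { destruct S1 as [a1 b1]. destruct S2 as [a2 b2]. split.
        - intros n. eapply Rle_trans. apply Cmod_minus_le. now apply Rplus_le_compat.
        - now apply (ex_series_plus (V := R_NormedModule)). }
      rewrite (CSeries_ext _ (fun j => (cchi j * E (t + h)%R j - cchi j * E t j) + (RtoC h * RtoC (INR (S k))) * (cchi j * ek (S k) (freq q j) t))%C).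
      2:{ intros j. rewrite <- HE. ring. }
      rewrite (CSeries_plus _ _ _ _ S12 (csum_scal _ _ _ SB)), (CSeries_minus _ _ _ _ S1 S2), (CSeries_scal _ _ _ SB). fold P. ring. }
    rewrite Cmod_mult.
    assert (HB : csum (fun j => cchi j * (ek k (freq q j) (t + h) - ek k (freq q j) t + RtoC h * (RtoC (INR (S k)) * ek (S k) (freq q j) t)))%C
       (fun j => (K0 * h ^ 2) * INR q ^ S (S (S k)) * / INR (S j) ^ 2)).
    { apply csum_cchi; [lia| |]. { apply Rmult_le_pos; trivial. apply pow2_ge_0. }
      intros j. unfold K0. apply ek_quad. now apply freq_pos. }
    rewrite Rmult_assoc. apply Rmult_le_compat_l; [apply Cmod_ge_0|]. eapply Rle_trans. apply (CSeries_bound _ _ HB).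
    unfold SS. rewrite (Series_ext _ (fun j => h ^ 2 * (K0 * INR q ^ S (S (S k)) * / INR (S j) ^ 2))) by (intros; ring).
    rewrite Series_scal_l. apply Req_le. ring. }
  pose proof (quad_unique (fun h => Fk chi k (t + h)%R - Fk chi k t)%C _ _ (t / 2) _ _ ltac:(lra) HK1 HK2) as Q.
  replace (Fk chi (S k) t) with (- - Fk chi (S k) t)%C by ring. rewrite Q. ring.
Qed.

Lemma Fk_partial_fractions_S (k : nat) (t : R) : 0 < t ->
  (Fk chi (S k) t = kap (S k) * CSeries (fun j => cchi j * ek (S k) (freq q j) t))%C.
Proof.
  revert t. induction k as [|k IH].
  - apply (partial_fractions_step 0 (fun t j => e0 (freq q j) t) g0).
    + intros t. apply e0_csum.
    + intros. apply e0_ek.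
    + apply Fk_partial_fractions_0.
  - apply (partial_fractions_step (S k) (fun t j => ek (S k) (freq q j) t) (RtoC 0)).
    + intros t. apply ek_csum. lia.
    + reflexivity.
    + intros t Ht. rewrite IH by trivial. ring.
Qed.

End LambertSeries.

(** * Mellin transforms and L-values *)

Lemma ccont_cexp (s : C) (v : R) : ccont (fun y => cexp (s * RtoC y)%C) v.
Proof.
  split; unfold cexp; cbn [fst snd Cmult RtoC Re Im].
  - apply (ex_derive_continuous (fun y => exp (fst s * y - snd s * 0) * cos (fst s * 0 + snd s * y))). auto_derive. trivial.
  - apply (ex_derive_continuous (fun y => exp (fst s * y - snd s * 0) * sin (fst s * 0 + snd s * y))). auto_derive. trivial.
Qed.

(** Differentiation under the integral sign, as a first-order expansion in the exponent [w] with
    quadratic remainder. *)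
Lemma cdom_shift_estimate (d0 M0 : R) (g : R -> C) : 0 < d0 -> cdom d0 M0 g ->
  exists (W1 : C) (K : R), forall w, Cmod w <= d0 / 6 ->
    (exists M, cdom (d0 / 2) M (fun v => cexp (w * RtoC v) * g v)%C) /\
    Cmod (CI (fun v => cexp (w * RtoC v) * g v)%C - CI g - W1 * w) <= K * Cmod w ^ 2.
Proof.
  intros Hd0 Hg. pose proof (dominated_ge_0 _ _ _ (cdom_fst _ _ _ Hg)) as HM. destruct Hg as [Gc Gb].
  (* In the remainder, [v^2] costs [exp (r |v|)] and the exponential of [cexp_taylor] costs
     [exp (2 r |v|)]. With [r = d0 / 6] this is half of the available decay. *)
  set (r := d0 / 6). assert (Hr : 0 < r) by (unfold r; lra).
  assert (V2 : forall v, v ^ 2 <= 4 / r ^ 2 * exp (r * Rabs v)).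
  { intros v. destruct (Req_dec v 0) as [->|Hv].
    { rewrite Rabs_R0, Rmult_0_r, exp_0. assert (0 <= 4 / r ^ 2). apply Rmult_le_pos; [lra|left; apply Rinv_0_lt_compat; nra]. lra. }
    pose proof (Rabs_pos_lt v Hv) as Pv. pose proof (exp_pow_bound 2 (r * Rabs v) ltac:(lia) ltac:(nra)) as B.
    rewrite exp_Ropp in B. rewrite <- (pow2_abs v). set (y := Rabs v) in *. set (E := exp (r * y)) in *. assert (PE : 0 < E) by apply exp_pos.
    simpl (INR 2) in B. apply Rmult_le_compat_r with (r := E * y ^ 2) in B; [|nra].
    replace (/ E * (E * y ^ 2)) with (y ^ 2) in B by (field; lra). eapply Rle_trans. exact B. apply Req_le. field. lra. }
  assert (V1 : forall v, Rabs v <= 1 / r * exp (r * Rabs v)).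
  { intros v. pose proof (exp_ineq1_le (r * Rabs v)). apply Rmult_le_reg_l with r; trivial.
    replace (r * (1 / r * exp (r * Rabs v))) with (exp (r * Rabs v)) by (field; lra). lra. }
  assert (Cv : forall (c : C) v, ccont (fun y => c * RtoC y)%C v).
  { intros c v. apply ccont_mult; [apply ccont_const|]. apply ccont_RtoC, continuous_id. }
  assert (D0 : cdom (d0 / 2) M0 g).
  { split; trivial. intros v. eapply Rle_trans. apply Gb. apply Rmult_le_compat_l; trivial. apply exp_mono. pose proof (Rabs_pos v). nra. }
  assert (D1 : cdom (d0 / 2) (1 / r * M0) (fun v => RtoC v * g v)%C).
  { split. { intros v. apply ccont_mult; [apply ccont_RtoC, continuous_id|apply Gc]. }
    intros v. rewrite Cmod_mult, Cmod_R. specialize (V1 v). specialize (Gb v).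
    apply Rle_trans with (1 / r * exp (r * Rabs v) * (M0 * exp (- (d0 * Rabs v)))).
    { apply Rmult_le_compat; trivial; [apply Rabs_pos|apply Cmod_ge_0]. }
    replace (1 / r * exp (r * Rabs v) * (M0 * exp (- (d0 * Rabs v)))) with (1 / r * M0 * (exp (r * Rabs v) * exp (- (d0 * Rabs v)))) by ring.
    rewrite <- exp_plus. apply Rmult_le_compat_l. { apply Rmult_le_pos; trivial. left. apply Rdiv_lt_0_compat; lra. }
    apply exp_mono. unfold r. pose proof (Rabs_pos v). nra. }
  exists (CI (fun v => RtoC v * g v)%C), (4 / (d0 / 2) * (5 * (4 / r ^ 2) * M0)). intros w Hw. fold r in Hw.
  assert (Ew : forall v, Cmod (w * RtoC v) <= r * Rabs v).
  { intros v. rewrite Cmod_mult, Cmod_R. apply Rmult_le_compat_r; [apply Rabs_pos|exact Hw]. }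
  assert (Dw : cdom (d0 / 2) M0 (fun v => cexp (w * RtoC v) * g v)%C).
  { split. { intros v. apply ccont_mult; [apply ccont_cexp|apply Gc]. }
    intros v. rewrite Cmod_mult, Cmod_cexp. specialize (Gb v). specialize (Ew v).
    assert (Re (w * RtoC v) <= r * Rabs v). { eapply Rle_trans; [|exact Ew]. eapply Rle_trans; [apply Rle_abs|apply re_le_Cmod]. }
    apply Rle_trans with (exp (r * Rabs v) * (M0 * exp (- (d0 * Rabs v)))).
    { apply Rmult_le_compat; trivial; [left; apply exp_pos|apply Cmod_ge_0|now apply exp_mono]. }
    replace (exp (r * Rabs v) * (M0 * exp (- (d0 * Rabs v)))) with (M0 * (exp (r * Rabs v) * exp (- (d0 * Rabs v)))) by ring.
    rewrite <- exp_plus. apply Rmult_le_compat_l; trivial. apply exp_mono. unfold r. pose proof (Rabs_pos v). nra. }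
  split; [now exists M0|].
  assert (Hh : 0 < d0 / 2) by lra.
  assert (E : (CI (fun v => cexp (w * RtoC v) * g v) - CI g - CI (fun v => RtoC v * g v) * w)%C
     = CI (fun v => (cexp (w * RtoC v) - 1 - w * RtoC v) * g v)%C).
  { rewrite (Cmult_comm _ w), <- (CI_scal (d0 / 2) _ _ _ Hh D1).
    rewrite <- (CI_minus (d0 / 2) _ _ _ _ Hh Dw D0).
    assert (Dwm : cdom (d0 / 2) (M0 + Cmod (RtoC (-1)) * M0) (fun v => cexp (w * RtoC v) * g v - g v)%C).
    { replace (fun v => cexp (w * RtoC v) * g v - g v)%C with (fun v => cexp (w * RtoC v) * g v + RtoC (-1) * g v)%C by (extensionality v; ring).
      apply cdom_plus; trivial. now apply cdom_scal. }
    rewrite <- (CI_minus (d0 / 2) _ _ _ _ Hh Dwm (cdom_scal _ _ _ _ D1)). f_equal. extensionality v. ring. }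
  rewrite E.
  assert (Dq : cdom (d0 / 2) (5 * (4 / r ^ 2) * M0 * Cmod w ^ 2) (fun v => (cexp (w * RtoC v) - 1 - w * RtoC v) * g v)%C).
  { split. { intros v. apply ccont_mult; [|apply Gc]. apply ccont_minus; [|apply Cv]. apply ccont_minus; [apply ccont_cexp|apply ccont_const]. }
    intros v. rewrite Cmod_mult. specialize (Gb v). pose proof (cexp_taylor (w * RtoC v)) as T.
    assert (T2 : Cmod (cexp (w * RtoC v) - 1 - w * RtoC v) <= 5 * (Cmod w ^ 2 * (4 / r ^ 2 * exp (r * Rabs v))) * exp (2 * (r * Rabs v))).
    { eapply Rle_trans. exact T. apply Rmult_le_compat; [|left; apply exp_pos| |apply exp_mono; specialize (Ew v); lra].
      - apply Rmult_le_pos; [lra|apply pow2_ge_0].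
      - apply Rmult_le_compat_l; [lra|]. rewrite Cmod_mult, Cmod_R, Rpow_mult_distr, pow2_abs. apply Rmult_le_compat_l; [apply pow2_ge_0|apply V2]. }
    eapply Rle_trans. { apply Rmult_le_compat; [apply Cmod_ge_0|apply Cmod_ge_0|exact T2|exact Gb]. }
    replace (5 * (Cmod w ^ 2 * (4 / r ^ 2 * exp (r * Rabs v))) * exp (2 * (r * Rabs v)) * (M0 * exp (- (d0 * Rabs v))))
      with (5 * (4 / r ^ 2) * M0 * Cmod w ^ 2 * (exp (r * Rabs v) * exp (2 * (r * Rabs v)) * exp (- (d0 * Rabs v)))) by ring.
    rewrite <- !exp_plus. apply Rmult_le_compat_l.
    - apply Rmult_le_pos; [|apply pow2_ge_0]. apply Rmult_le_pos; trivial. apply Rmult_le_pos; [lra|]. left. apply Rdiv_lt_0_compat; [lra|nra].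
    - apply exp_mono. unfold r. pose proof (Rabs_pos v). nra. }
  eapply Rle_trans. apply (CI_bound _ _ _ Hh Dq). apply Req_le. ring.
Qed.

(** The Mellin transform in [v = ln t], where [t^s dt / t] becomes [e^(s v) dv]. *)
Definition mellin (f : R -> C) (s : C) : C := CI (fun v => cexp (s * RtoC v) * f v)%C.

(** Order [t^al] at [t = 0] and exponential decay at infinity, so that the Mellin transform is
    holomorphic for [Re s > - al]. *)
Definition decays (al : R) (f : R -> C) : Prop :=
  (forall v, ccont f v) /\ exists K, 0 <= K /\ (forall v, v <= 0 -> Cmod (f v) <= K * exp (al * v)) /\
    (forall v, 0 <= v -> Cmod (f v) <= K * exp (- (exp v / 2))).

Lemma double_exp_bound (j : nat) (v : R) : (0 < j)%nat -> exp (- (exp v / 2)) <= (2 * INR j) ^ j * exp (- (INR j * v)).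
Proof.
  intros Hj. pose proof (exp_pos v) as P. pose proof (exp_pow_bound j (exp v / 2) Hj ltac:(lra)) as B.
  eapply Rle_trans. exact B. replace (INR j / (exp v / 2)) with (2 * INR j * / exp v) by (field; lra).
  rewrite Rpow_mult_distr. apply Req_le. f_equal. rewrite <- exp_Ropp. clear. induction j as [|j IH].
  - simpl. now rewrite Rmult_0_l, Ropp_0, exp_0.
  - rewrite S_INR. simpl. rewrite IH, <- exp_plus. f_equal. ring.
Qed.

Lemma Re_mul_R (s : C) (v : R) : Re (s * RtoC v) = Re s * v.
Proof. unfold Re; simpl. ring. Qed.

Lemma decays_cdom (al : R) (f : R -> C) (s : C) : decays al f -> 0 < Re s + al ->
  exists d M, 0 < d /\ cdom d M (fun v => cexp (s * RtoC v) * f v)%C.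
Proof.
  intros [Fc [K [K0 [F1 F2]]]] Hs. set (sg := Re s) in *.
  destruct (INR_unbounded (Rabs sg + 1)) as [j Hj].
  assert (J0 : (0 < j)%nat). { apply INR_lt. simpl. pose proof (Rabs_pos sg). lra. }
  set (d := Rmin 1 (sg + al)). assert (Hd : 0 < d) by (apply Rmin_pos; lra).
  assert (d1 : d <= 1) by apply Rmin_l. assert (d2 : d <= sg + al) by apply Rmin_r.
  set (c := 1 + (2 * INR j) ^ j). assert (c1 : 0 <= (2 * INR j) ^ j) by (apply pow_le; pose proof (pos_INR j); lra).
  exists d, (K * c). split; trivial. split.
  - intros v. apply ccont_mult; [apply ccont_cexp|apply Fc].
  - intros v. rewrite Cmod_mult, Cmod_cexp, Re_mul_R. fold sg. destruct (Rle_dec v 0) as [L|L].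
    + apply Rle_trans with (exp (sg * v) * (K * exp (al * v))).
      { apply Rmult_le_compat_l; [left; apply exp_pos|now apply F1]. }
      replace (exp (sg * v) * (K * exp (al * v))) with (K * (exp (sg * v) * exp (al * v))) by ring.
      rewrite <- exp_plus, Rmult_assoc. apply Rmult_le_compat_l; trivial.
      rewrite <- (Rmult_1_l (exp (sg * v + al * v))). apply Rmult_le_compat; [lra|left; apply exp_pos|unfold c; lra|].
      apply exp_mono. rewrite Rabs_left1 by lra. nra.
    + apply Rle_trans with (exp (sg * v) * (K * ((2 * INR j) ^ j * exp (- (INR j * v))))).
      { apply Rmult_le_compat_l; [left; apply exp_pos|]. eapply Rle_trans. apply F2; lra. apply Rmult_le_compat_l; trivial. now apply double_exp_bound. }
      replace (exp (sg * v) * (K * ((2 * INR j) ^ j * exp (- (INR j * v))))) with (K * (2 * INR j) ^ j * (exp (sg * v) * exp (- (INR j * v)))) by ring.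
      rewrite <- exp_plus. apply Rmult_le_compat; [now apply Rmult_le_pos|left; apply exp_pos|apply Rmult_le_compat_l; trivial; unfold c; lra|].
      apply exp_mono. rewrite Rabs_pos_eq by lra. pose proof (Rle_abs sg). nra.
Qed.

(** Write [e^(z v) = e^((z - s) v) e^(s v)] and apply [cdom_shift_estimate] with [w = z - s]. *)
Lemma mellin_diff (al : R) (f : R -> C) (s : C) : decays al f -> 0 < Re s + al -> exists l, Cdiff (mellin f) s l.
Proof.
  intros Hf Hs. destruct (decays_cdom al f s Hf Hs) as [d [M [Hd HD]]].
  destruct (cdom_shift_estimate d M _ Hd HD) as [W1 [K H]]. exists W1. apply Cdiff_intro. intros eps He.
  set (K' := Rabs K + 1). assert (HK : 0 < K') by (unfold K'; pose proof (Rabs_pos K); lra).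
  exists (Rmin (d / 6) (eps / K')). split. { apply Rmin_pos; [lra|now apply Rdiv_lt_0_compat]. }
  intros z Hz. pose proof (Rmin_l (d / 6) (eps / K')). pose proof (Rmin_r (d / 6) (eps / K')).
  destruct (H (z - s)%C ltac:(lra)) as [_ B].
  replace (mellin f z) with (CI (fun v => cexp ((z - s) * RtoC v) * (cexp (s * RtoC v) * f v))%C).
  2:{ unfold mellin. f_equal. extensionality v. rewrite Cmult_assoc, <- cexp_add. f_equal. f_equal. ring. }
  eapply Rle_trans. exact B. apply Rle_trans with (K' * Cmod (z - s) * Cmod (z - s)).
  - pose proof (Rle_abs K). pose proof (Cmod_ge_0 (z - s)). unfold K'. nra.
  - apply Rmult_le_compat_r; [apply Cmod_ge_0|]. apply Rle_trans with (K' * (eps / K')); [apply Rmult_le_compat_l; lra|]. apply Req_le. field. lra.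
Qed.

(* Its Mellin transform (in the variable [v = ln t]) is the Gamma function. *)
Definition gamf (v : R) : C := RtoC (exp (- exp v)).

Lemma gamf_decays : decays 0 gamf.
Proof.
  split.
  - intros v. apply ccont_RtoC. apply (ex_derive_continuous (fun v => exp (- exp v))). auto_derive. trivial.
  - exists 1. split; [lra|]. split; intros v Hv; unfold gamf; rewrite Cmod_R, Rabs_pos_eq by (left; apply exp_pos); rewrite Rmult_1_l.
    + apply exp_mono. pose proof (exp_pos v). lra.
    + apply exp_mono. pose proof (exp_pos v). lra.
Qed.

(** The Gamma function at a real point. Its recursion and [gam 1 = 1] serve to show that [x * gam x]
    tends to 1 at 0. *)
Definition gam (x : R) : R := IntR (fun v => exp (x * v) * exp (- exp v)).

Lemma mellin_gamf_real (x : R) : mellin gamf (RtoC x) = RtoC (gam x).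
Proof.
  unfold mellin, gam. rewrite <- CI_RtoC. f_equal. extensionality v. unfold gamf. rewrite RtoC_mult. f_equal.
  unfold cexp, RtoC, Cmult, Re, Im; cbn [fst snd]. replace (x * 0 + 0 * v) with 0 by ring. rewrite cos_0, sin_0.
  replace (x * v - 0 * 0) with (x * v) by ring. f_equal; ring.
Qed.

Lemma gam_dom (x : R) : 0 < x -> exists d M, 0 < d /\ dominated d M (fun v => exp (x * v) * exp (- exp v)).
Proof.
  intros Hx. destruct (decays_cdom 0 gamf (RtoC x) gamf_decays) as [d [M [Hd HD]]]. { simpl. lra. }
  exists d, M. split; trivial. apply cdom_fst in HD. destruct HD as [A B].
  assert (E : forall v, fst (cexp (RtoC x * RtoC v) * gamf v)%C = exp (x * v) * exp (- exp v)).
  { intros v. unfold gamf, cexp, RtoC, Cmult, Re, Im; cbn [fst snd]. replace (x * 0 + 0 * v) with 0 by ring. rewrite cos_0, sin_0.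
    replace (x * v - 0 * 0) with (x * v) by ring. ring. }
  split.
  - intros v. apply (continuous_ext _ _ _ E (A v)).
  - intros v. rewrite <- E. apply B.
Qed.

(** Integration by parts: [x H - H1] is the derivative of [H], which vanishes at both ends. *)
Lemma gam_rec (x : R) : 0 < x -> x * gam x = gam (x + 1).
Proof.
  intros Hx. destruct (gam_dom x Hx) as [d [M [Hd HD]]]. destruct (gam_dom (x + 1) ltac:(lra)) as [d' [M' [Hd' HD']]].
  set (H := fun v => exp (x * v) * exp (- exp v)) in *. set (H1 := fun v => exp ((x + 1) * v) * exp (- exp v)) in *.
  set (m := Rmin d d'). assert (Hm : 0 < m) by now apply Rmin_pos.
  apply (dominated_weaken d M m M H (Rmin_l d d') (Rle_refl M)) in HD. apply (dominated_weaken d' M' m M' H1 (Rmin_r d d') (Rle_refl M')) in HD'.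
  pose proof (dominated_scal _ _ x _ HD) as D1. pose proof (dominated_scal _ _ (-1) _ HD') as D2.
  assert (E : IntR (fun v => x * H v + -1 * H1 v) = 0).
  { apply (IntR_FTC _ H).
    - intros v. unfold H, H1. auto_derive; trivial. replace ((x + 1) * v) with (x * v + v) by ring. rewrite exp_plus. ring.
    - apply (dominated_plus _ _ _ _ _ D1 D2).
    - replace (Finite 0) with (Finite (0 - 0)) by (f_equal; ring).
      assert (L : is_lim_seq (fun n => M * exp (- (m * INR n))) 0).
      { replace (Finite 0) with (Rbar_mult M 0) by (simpl; f_equal; ring). apply is_lim_seq_scal_l, exp_neg_lim, Hm. }
      apply is_lim_seq_minus'.
      + apply (is_lim_seq_squeeze0 _ _ _) with (2 := L). intros n. rewrite Rminus_0_r. rewrite <- (Rabs_pos_eq (INR n)) at 2 by apply pos_INR. apply HD.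
      + apply (is_lim_seq_squeeze0 _ _ _) with (2 := L). intros n. rewrite Rminus_0_r. rewrite <- (Rabs_pos_eq (INR n)) at 2 by apply pos_INR.
        rewrite <- (Rabs_Ropp (INR n)). apply HD. }
  rewrite (IntR_plus m _ _ _ _ Hm D1 D2), (IntR_scal m _ _ _ Hm HD), (IntR_scal m _ _ _ Hm HD') in E.
  unfold gam. fold H H1. lra.
Qed.

Lemma gam_1 : gam 1 = 1.
Proof.
  unfold gam. apply (IntR_FTC _ (fun v => - exp (- exp v))).
  - intros v. rewrite (Rmult_1_l v). auto_derive; trivial. ring.
  - destruct (gam_dom 1 ltac:(lra)) as [d [M [_ HD]]]. apply HD.
  - replace (Finite 1) with (Finite (0 - - (1))) by (f_equal; ring).
    assert (L : is_lim_seq (fun n => exp (- (1 * INR n))) 0) by (apply exp_neg_lim; lra).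
    apply is_lim_seq_minus'.
    + apply (is_lim_seq_squeeze0 _ (fun n => exp (- (1 * INR n)))); trivial. intros n. rewrite Rminus_0_r, Rabs_Ropp, Rabs_pos_eq by (left; apply exp_pos).
      apply exp_mono. pose proof (exp_ineq1_le (INR n)). lra.
    + apply (is_lim_seq_squeeze0 _ (fun n => exp (- (1 * INR n)))); trivial. intros n.
      pose proof (exp_pos (- INR n)) as P. pose proof (exp_ineq1_le (- exp (- INR n))) as Q.
      assert (exp (- exp (- INR n)) <= 1) by (rewrite <- exp_0; apply exp_mono; lra).
      rewrite Rmult_1_l. apply Rabs_le. lra.
Qed.

(** Scaling [t] by [n] is a shift of [v] by [ln n]. *)
Lemma mellin_exp_n (n : nat) (s : C) : 0 < Re s ->
  CI (fun v => cexp (s * RtoC v) * RtoC (exp (- (INR (S n) * exp v))))%C = (ncpow (S n) (- s) * mellin gamf s)%C.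
Proof.
  intros Hs. assert (Pn : 0 < INR (S n)) by (apply lt_0_INR; lia).
  destruct (decays_cdom 0 gamf s gamf_decays ltac:(lra)) as [d [M [Hd HD]]].
  unfold mellin. rewrite <- (CI_shift d M (ln (INR (S n))) _ Hd HD).
  destruct (cdom_shift_ex d M (ln (INR (S n))) _ Hd HD) as [M' HD'].
  rewrite <- (CI_scal d M' _ _ Hd HD'). f_equal. extensionality v. unfold gamf, ncpow.
  rewrite exp_plus, exp_ln by trivial. rewrite (Cmult_assoc (cexp (- s * _))), <- cexp_add. f_equal.
  - f_equal. rewrite RtoC_plus. ring.
  - f_equal. f_equal. ring.
Qed.

Lemma exp_INR_mul (n : nat) (y : R) : exp (INR n * y) = exp y ^ n.
Proof.
  induction n as [|n IH]. { simpl. now rewrite Rmult_0_l, exp_0. }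
  rewrite S_INR, Rmult_plus_distr_r, Rmult_1_l, exp_plus, IH. simpl. ring.
Qed.

Lemma expC_exp (k : nat) (c v : R) : 0 < c -> expC k (c * exp v) = (INR (k + 2) / c) ^ (k + 2) * exp (- (INR (k + 2) * v)).
Proof.
  intros Hc. unfold expC. pose proof (exp_pos v).
  replace (- (INR (k + 2) * v)) with (INR (k + 2) * - v) by ring. rewrite exp_INR_mul, exp_Ropp, <- Rpow_mult_distr.
  f_equal. field. lra.
Qed.

Lemma cdom_weaken (d M d' M' : R) (f : R -> C) : d' <= d -> M <= M' -> cdom d M f -> cdom d' M' f.
Proof.
  intros Hd HM H. pose proof (dominated_ge_0 _ _ _ (cdom_fst _ _ _ H)) as M0. destruct H as [A B]. split; trivial.
  intros v. eapply Rle_trans. apply B. apply Rmult_le_compat; trivial; [left; apply exp_pos|].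
  apply exp_mono. pose proof (Rabs_pos v). nra.
Qed.

Lemma Cdiff_seq (f : C -> C) (s l : C) (x : nat -> R) : Cdiff f s l -> is_lim_seq x 0 ->
  clim (fun n => f (s + RtoC (x n))%C) (f s).
Proof.
  intros Hf Hx.
  assert (H : forall eps, 0 < eps -> exists N, forall n, (N <= n)%nat -> Cmod (f (s + RtoC (x n))%C - f s) < eps).
  { intros eps He. destruct (Cdiff_close f s l eps Hf He) as [del [Hd H]].
    destruct (is_lim_seq_eps_inv x 0 del Hx Hd) as [N HN]. exists N. intros n Hn. apply H.
    replace (s + RtoC (x n) - s)%C with (RtoC (x n)) by ring. rewrite Cmod_R. specialize (HN n Hn). now rewrite Rminus_0_r in HN. }
  split; apply is_lim_seq_eps; intros eps He; destruct (H eps He) as [N HN]; exists N; intros n Hn; specialize (HN n Hn).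
  - exact (Rle_lt_trans _ _ _ (fst_le_Cmod (f (s + RtoC (x n))%C - f s)) HN).
  - exact (Rle_lt_trans _ _ _ (snd_le_Cmod (f (s + RtoC (x n))%C - f s)) HN).
Qed.

Lemma Cdiff_quot (f : C -> C) (s l : C) (x : nat -> R) : Cdiff f s l -> is_lim_seq x 0 -> (forall n, x n <> 0) ->
  clim (fun n => (f (s + RtoC (x n)) - f s) / RtoC (x n))%C l.
Proof.
  intros Hf Hx Hn0.
  assert (H : forall eps, 0 < eps -> exists N, forall n, (N <= n)%nat -> Cmod ((f (s + RtoC (x n)) - f s) / RtoC (x n) - l)%C < eps).
  { intros eps He. destruct (Cdiff_eps f s l Hf (eps / 2) ltac:(lra)) as [del [Hd H]].
    destruct (is_lim_seq_eps_inv x 0 del Hx Hd) as [N HN]. exists N. intros n Hn.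
    specialize (HN n Hn). rewrite Rminus_0_r in HN. specialize (H (s + RtoC (x n))%C).
    replace (s + RtoC (x n) - s)%C with (RtoC (x n)) in H by ring. rewrite Cmod_R in H. specialize (H HN).
    pose proof (Rabs_pos_lt _ (Hn0 n)) as P. assert (Nz : RtoC (x n) <> RtoC 0) by now apply RtoC_neq.
    replace ((f (s + RtoC (x n)) - f s) / RtoC (x n) - l)%C with ((f (s + RtoC (x n)) - f s - l * RtoC (x n)) / RtoC (x n))%C by (field; exact Nz).
    rewrite Cmod_div, Cmod_R by exact Nz. apply Rle_lt_trans with (eps / 2); [|lra].
    apply Rmult_le_reg_r with (Rabs (x n)); trivial. unfold Rdiv at 1. rewrite Rmult_assoc, Rinv_l, Rmult_1_r by lra. exact H. }
  split; apply is_lim_seq_eps; intros eps He; destruct (H eps He) as [N HN]; exists N; intros n Hn; specialize (HN n Hn).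
  - exact (Rle_lt_trans _ _ _ (fst_le_Cmod ((f (s + RtoC (x n)) - f s) / RtoC (x n) - l)%C) HN).
  - exact (Rle_lt_trans _ _ _ (snd_le_Cmod ((f (s + RtoC (x n)) - f s) / RtoC (x n) - l)%C) HN).
Qed.

Lemma cexp_RtoC (y : R) : cexp (RtoC y) = RtoC (exp y).
Proof. unfold cexp, Re, Im; simpl. rewrite cos_0, sin_0. apply injective_projections; simpl; ring. Qed.

Lemma ncpow_shift (n k : nat) (s : C) :
  (RtoC (INR (S n) ^ k) * ncpow (S n) (- s) = ncpow (S n) (- (s - RtoC (INR k))))%C.
Proof.
  unfold ncpow. assert (Pn : 0 < INR (S n)) by (apply lt_0_INR; lia).
  replace (- (s - RtoC (INR k)) * RtoC (ln (INR (S n))))%C with (RtoC (INR k * ln (INR (S n))) + - s * RtoC (ln (INR (S n))))%C by (rewrite RtoC_mult; ring).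
  rewrite cexp_add, cexp_RtoC, exp_INR_mul, exp_ln by trivial. reflexivity.
Qed.

Section LValues.
Variables (chi : Z -> C) (k : nat) (F0 : C) (L dL : C -> C).
Hypothesis Hc : forall n, Cmod (chi n) <= 1.
Hypothesis HL : is_Lfunction chi L dL.
Let Phi (v : R) : C := Fk chi k (exp v).
Let Psi (v : R) : C := (Phi v - F0 * gamf v)%C.
Hypothesis PhiD : decays 0 Phi.
Hypothesis PsiD : decays 1 Psi.

(** Term by term integration. The abscissa [k + 3] is one more than the loss [k + 2] from the
    coefficients near [t = 0], which leaves the domination rate 1. *)
Lemma mellin_Phi (s : C) : INR k + 3 <= Re s -> mellin Phi s = (mellin gamf s * L (s - RtoC (INR k)))%C.
Proof.
  intros Hs. set (sg := Re s) in *. pose proof (pos_INR k) as Pk.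
  destruct (INR_unbounded (sg + 1)) as [j Hj]. assert (J0 : (0 < j)%nat) by (apply INR_lt; simpl; lra).
  set (A := (2 * INR (k + 2)) ^ (k + 2)). set (B := (2 * INR j) ^ j).
  assert (Pk2 : 0 <= INR (k + 2)) by apply pos_INR.
  assert (A0 : 0 <= A) by (apply pow_le; lra). assert (B0 : 0 <= B) by (apply pow_le; pose proof (pos_INR j); lra).
  assert (A1 : INR (k + 2) ^ (k + 2) <= A) by (apply pow_incr; lra).
  set (f := fun n v => (cexp (s * RtoC v) * (RtoC (INR (S n) ^ k) * chi (Z.of_nat (S n)) * RtoC (exp (- (INR (S n) * exp v)))))%C).
  assert (D : forall n, cdom 1 (A * (1 + B) * / INR (S n) ^ 2) (f n)).
  { intros n. set (x := INR (S n)). assert (P1 : 1 <= x) by (unfold x; rewrite S_INR; pose proof (pos_INR n); lra).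
    assert (Ix : 0 < / x ^ 2) by (apply Rinv_0_lt_compat; nra).
    split.
    - intros v. apply ccont_mult; [apply ccont_cexp|]. apply ccont_mult; [apply ccont_const|]. apply ccont_RtoC.
      apply (ex_derive_continuous (fun v => exp (- (INR (S n) * exp v)))). auto_derive. trivial.
    - intros v. unfold f. rewrite !Cmod_mult, Cmod_cexp, Re_mul_R, !Cmod_R. fold sg x.
      rewrite (Rabs_pos_eq (x ^ k)), (Rabs_pos_eq (exp _)) by (try (left; apply exp_pos); apply pow_le; lra).
      assert (Px : 0 <= x ^ k) by (apply pow_le; lra). pose proof (exp_pos (- (x * exp v))) as Pe. pose proof (exp_pos (sg * v)) as Ps.
      pose proof (exp_pos v) as Pv.
      apply Rle_trans with (exp (sg * v) * (x ^ k * exp (- (x * exp v)))).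
      { apply Rmult_le_compat_l; [lra|]. apply Rmult_le_compat_r; [lra|]. specialize (Hc (Z.of_nat (S n))). pose proof (Cmod_ge_0 (chi (Z.of_nat (S n)))). nra. }
      (* For [v <= 0] the whole exponential serves to sum over [n]. For [v > 0] half of it does, and
         the other half beats [exp (sg v)] through [double_exp_bound]. *)
      destruct (Rle_dec v 0) as [Lv|Lv].
      + pose proof (exp_term_bound k n (exp v) Pv) as Bd. fold x in Bd.
        pose proof (expC_exp k 1 v ltac:(lra)) as E. rewrite Rmult_1_l, Rdiv_1_r in E. rewrite E in Bd.
        apply Rle_trans with (exp (sg * v) * ((A * exp (- (INR (k + 2) * v))) * / x ^ 2)).
        { apply Rmult_le_compat_l; [lra|]. eapply Rle_trans. exact Bd. apply Rmult_le_compat_r; [lra|]. apply Rmult_le_compat_r; [left; apply exp_pos|exact A1]. }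
        replace (exp (sg * v) * (A * exp (- (INR (k + 2) * v)) * / x ^ 2)) with (A * / x ^ 2 * (exp (sg * v) * exp (- (INR (k + 2) * v)))) by ring.
        rewrite <- exp_plus.
        replace (A * (1 + B) * / x ^ 2 * exp (- (1 * Rabs v))) with (A * / x ^ 2 * ((1 + B) * exp (- (1 * Rabs v)))) by ring.
        apply Rmult_le_compat_l; [apply Rmult_le_pos; lra|].
        rewrite <- (Rmult_1_l (exp (sg * v + _))). apply Rmult_le_compat; [lra|left; apply exp_pos|lra|].
        apply exp_mono. rewrite Rabs_left1 by lra. rewrite plus_INR. simpl (INR 2). nra.
      + pose proof (exp_term_bound k n (/ 2 * exp v) ltac:(lra)) as Bd. fold x in Bd.
        pose proof (expC_exp k (/ 2) v ltac:(lra)) as E. replace (INR (k + 2) / / 2) with (2 * INR (k + 2)) in E by field. fold A in E. rewrite E in Bd.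
        assert (X1 : exp (- (x * exp v)) <= exp (- (x * (/ 2 * exp v))) * (B * exp (- (INR j * v)))).
        { eapply Rle_trans with (exp (- (x * (/ 2 * exp v))) * exp (- (exp v / 2))).
          - rewrite <- exp_plus. apply exp_mono. nra.
          - apply Rmult_le_compat_l; [left; apply exp_pos|]. now apply double_exp_bound. }
        assert (X2 : exp (- (INR (k + 2) * v)) <= 1) by (rewrite <- exp_0; apply exp_mono; rewrite plus_INR; simpl (INR 2); nra).
        apply Rle_trans with (exp (sg * v) * ((A * / x ^ 2) * (B * exp (- (INR j * v))))).
        { apply Rmult_le_compat_l; [lra|]. apply Rle_trans with (x ^ k * (exp (- (x * (/ 2 * exp v))) * (B * exp (- (INR j * v))))).
          - now apply Rmult_le_compat_l.
          - rewrite <- Rmult_assoc. apply Rmult_le_compat_r. { apply Rmult_le_pos; [lra|left; apply exp_pos]. }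
            eapply Rle_trans. exact Bd. apply Rmult_le_compat_r; [lra|]. rewrite <- (Rmult_1_r A) at 2. now apply Rmult_le_compat_l. }
        replace (exp (sg * v) * (A * / x ^ 2 * (B * exp (- (INR j * v))))) with (A * / x ^ 2 * B * (exp (sg * v) * exp (- (INR j * v)))) by ring.
        rewrite <- exp_plus. replace (A * (1 + B) * / x ^ 2) with (A * / x ^ 2 * (1 + B)) by ring.
        assert (Q0 : 0 <= A * / x ^ 2) by (apply Rmult_le_pos; lra).
        apply Rmult_le_compat; [now apply Rmult_le_pos|left; apply exp_pos|apply Rmult_le_compat_l; lra|].
        apply exp_mono. rewrite Rabs_pos_eq by lra. nra. }
  assert (SM : ex_series (fun n => A * (1 + B) * / INR (S n) ^ 2)) by apply (ex_series_scal_l (A * (1 + B)) _ ex_series_inv_sqr).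
  assert (E1 : mellin Phi s = CI (fun v => CSeries (fun n => f n v))).
  { unfold mellin. f_equal. extensionality v. unfold Phi, Fk, f. symmetry. apply (CSeries_scal _ _ _ (Fk_csum chi k (exp v) Hc (exp_pos v))). }
  rewrite E1, (CI_CSeries 1 _ f ltac:(lra) D SM).
  set (w := fun n => (chi (Z.of_nat (S n)) * ncpow (S n) (- (s - RtoC (INR k))))%C).
  assert (Sw : csum w (fun n => / INR (S n) ^ 2)).
  { split; [|exact ex_series_inv_sqr]. intros n. unfold w. rewrite Cmod_mult.
    assert (P1 : 1 <= INR (S n)) by (rewrite S_INR; pose proof (pos_INR n); lra).
    assert (Q : Cmod (ncpow (S n) (- (s - RtoC (INR k)))) <= / INR (S n) ^ 2).
    { unfold ncpow. rewrite Cmod_cexp, Re_mul_R. replace (/ INR (S n) ^ 2) with (exp (- (2 * ln (INR (S n))))).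
      2:{ rewrite exp_Ropp. f_equal. replace 2 with (INR 2) by (simpl; ring). rewrite exp_INR_mul, exp_ln by lra. reflexivity. }
      apply exp_mono. assert (0 <= ln (INR (S n))) by (rewrite <- ln_1; apply ln_le; lra).
      replace (Re (- (s - RtoC (INR k)))) with (- (sg - INR k)) by (unfold sg, Re; simpl; ring). nra. }
    specialize (Hc (Z.of_nat (S n))). pose proof (Cmod_ge_0 (chi (Z.of_nat (S n)))). pose proof (Cmod_ge_0 (ncpow (S n) (- (s - RtoC (INR k))))). nra. }
  assert (EL : CSeries w = L (s - RtoC (INR k))%C).
  { apply CSeries_unique. apply (proj2 HL). replace (Re (s - RtoC (INR k))) with (sg - INR k) by (unfold sg, Re; simpl; ring). lra. }
  rewrite <- EL, <- (CSeries_scal _ _ _ Sw). apply CSeries_ext. intros n. unfold f, w.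
  destruct (decays_cdom 0 gamf s gamf_decays ltac:(fold sg; lra)) as [d [M [Hd HD]]].
  assert (Dn : exists d M, 0 < d /\ cdom d M (fun v => cexp (s * RtoC v) * RtoC (exp (- (INR (S n) * exp v))))%C).
  { destruct (decays_cdom 0 (fun v => RtoC (exp (- (INR (S n) * exp v)))) s) as [d' [M' H']]; [|fold sg; lra|now exists d', M'].
    destruct gamf_decays as [_ [K [K0 [G1 G2]]]]. assert (P1 : 1 <= INR (S n)) by (rewrite S_INR; pose proof (pos_INR n); lra).
    assert (Cmp : forall v, Cmod (RtoC (exp (- (INR (S n) * exp v)))) <= Cmod (gamf v)).
    { intros v. unfold gamf. rewrite !Cmod_R, !Rabs_pos_eq by (left; apply exp_pos). apply exp_mono. pose proof (exp_pos v). nra. }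
    split. { intros v. apply ccont_RtoC. apply (ex_derive_continuous (fun v => exp (- (INR (S n) * exp v)))). auto_derive. trivial. }
    exists K. split; trivial. split; intros v Hv; (eapply Rle_trans; [apply Cmp|auto]). }
  destruct Dn as [d' [M' [Hd' HD']]].
  replace (fun v => cexp (s * RtoC v) * (RtoC (INR (S n) ^ k) * chi (Z.of_nat (S n)) * RtoC (exp (- (INR (S n) * exp v)))))%C
    with (fun v => (RtoC (INR (S n) ^ k) * chi (Z.of_nat (S n))) * (cexp (s * RtoC v) * RtoC (exp (- (INR (S n) * exp v)))))%C by (extensionality v; ring).
  rewrite (CI_scal d' M' _ _ Hd' HD'), mellin_exp_n by (fold sg; lra). rewrite <- ncpow_shift. ring.
Qed.

(* [mellin Phi s = Gamma s * L (s - k)] extends to [0 < Re s]; since [mellin Psi = mellin Phi - F0 * Gamma] is regular at [s = 0],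
   where [Gamma s ~ 1 / s], the first two Taylor coefficients of [L] at [- k] can be read off. *)
Lemma L_values : L (RtoC (- INR k)) = F0 /\ dL (RtoC (- INR k)) = CI Psi.
Proof.
  destruct HL as [HLd HLs].
  assert (Ld : forall s, Cdiff L s (dL s)). { intros s. apply Cdiff_intro. apply is_derive_C_eps. apply HLd. }
  set (kk := RtoC (INR k)).
  assert (Sh : forall s, exists l, Cdiff (fun z => L (z - kk)%C) s l).
  { intros s. eexists. apply (Cdiff_comp L (fun z => z - kk)%C s (dL (s - kk)%C)); [apply Ld|].
    exact (Cdiff_minus (fun z => z) (fun _ => kk) s _ _ (Cdiff_id s) (Cdiff_const kk s)). }
  set (W := fun s => (mellin Psi s - mellin gamf s * (L (s - kk) - F0))%C).
  assert (HW : holo W).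
  { intros s Hs. destruct (mellin_diff 1 Psi s PsiD ltac:(lra)) as [l1 H1]. destruct (mellin_diff 0 gamf s gamf_decays ltac:(lra)) as [l2 H2].
    destruct (Sh s) as [l3 H3].
    pose proof (Cdiff_minus (fun z => L (z - kk)%C) (fun _ => F0) s _ _ H3 (Cdiff_const F0 s)) as H4.
    eexists. exact (Cdiff_minus (mellin Psi) _ s _ _ H1 (Cdiff_mult (mellin gamf) _ s _ _ H2 H4)). }
  assert (HZ : forall s, INR k + 3 < Re s -> W s = RtoC 0).
  { intros s Hs. pose proof (pos_INR k). unfold W.
    destruct (decays_cdom 0 Phi s PhiD ltac:(lra)) as [d1 [M1 [Hd1 D1]]]. destruct (decays_cdom 0 gamf s gamf_decays ltac:(lra)) as [d2 [M2 [Hd2 D2]]].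
    set (d := Rmin d1 d2). assert (Hd : 0 < d) by now apply Rmin_pos.
    apply (cdom_weaken d1 M1 d M1 _ (Rmin_l _ _) (Rle_refl _)) in D1. apply (cdom_weaken d2 M2 d M2 _ (Rmin_r _ _) (Rle_refl _)) in D2.
    assert (E : mellin Psi s = (mellin Phi s - F0 * mellin gamf s)%C).
    { unfold mellin at 2 3. rewrite <- (CI_scal d _ _ _ Hd D2), <- (CI_minus d _ _ _ _ Hd D1 (cdom_scal _ _ _ _ D2)).
      unfold mellin. f_equal. extensionality v. unfold Psi. ring. }
    rewrite E, mellin_Phi by lra. fold kk. ring. }
  assert (Eq : forall x, 0 < x -> mellin Psi (RtoC x) = (mellin gamf (RtoC x) * (L (RtoC x - kk) - F0))%C).
  { intros x Hx. pose proof (zero_of_half_plane_zero W (INR k + 3) x HW HZ Hx) as E. unfold W in E.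
    replace (mellin Psi (RtoC x)) with (mellin Psi (RtoC x) - mellin gamf (RtoC x) * (L (RtoC x - kk) - F0) + mellin gamf (RtoC x) * (L (RtoC x - kk) - F0))%C by ring.
    rewrite E. ring. }
  (* Everything is read off along the real points [1 / (n + 1)], where [gam_rec] controls the Gamma
     function. *)
  set (xs := fun n => / (1 * INR (S n))).
  assert (Xl : is_lim_seq xs 0) by (apply inv_lin_lim; lra).
  assert (Xp : forall n, 0 < xs n). { intros n. unfold xs. apply Rinv_0_lt_compat. rewrite Rmult_1_l. apply lt_0_INR. lia. }
  assert (Gl : clim (fun n => RtoC (xs n) * mellin gamf (RtoC (xs n)))%C (RtoC 1)).
  { destruct (mellin_diff 0 gamf (RtoC 1) gamf_decays) as [l Hl]. { simpl. lra. }
    pose proof (Cdiff_seq _ _ _ xs Hl Xl) as Q. rewrite mellin_gamf_real, gam_1 in Q. eapply clim_ext; [|exact Q].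
    intros n. cbv beta. rewrite <- RtoC_plus, !mellin_gamf_real, <- RtoC_mult. f_equal. rewrite gam_rec by apply Xp. f_equal. ring. }
  assert (Pl : clim (fun n => mellin Psi (RtoC (xs n))) (mellin Psi (RtoC 0))).
  { destruct (mellin_diff 1 Psi (RtoC 0) PsiD) as [l Hl]. { simpl. lra. }
    eapply clim_ext; [|exact (Cdiff_seq _ _ _ xs Hl Xl)]. intros n. simpl. f_equal. ring. }
  set (s0 := RtoC (- INR k)).
  assert (Es0 : forall x, (RtoC x - kk = s0 + RtoC x)%C) by (intros x; unfold s0, kk; rewrite RtoC_opp; ring).
  assert (Ll : clim (fun n => L (RtoC (xs n) - kk)%C) (L s0)).
  { eapply clim_ext; [|exact (Cdiff_seq _ _ _ xs (Ld s0) Xl)]. intros n. simpl. now rewrite Es0. }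
  (* Multiply the identity by [x]: the left side tends to 0 since [mellin Psi] is continuous at 0,
     while [x * gam x] tends to 1. *)
  assert (V1 : L s0 = F0).
  { assert (A : clim (fun n => RtoC (xs n) * mellin Psi (RtoC (xs n)))%C (RtoC 0 * mellin Psi (RtoC 0))%C) by (apply clim_mult; trivial; now apply clim_RtoC).
    assert (B : clim (fun n => RtoC (xs n) * mellin Psi (RtoC (xs n)))%C (RtoC 1 * (L s0 + - F0))%C).
    { eapply clim_ext; [|apply (clim_mult _ _ _ _ Gl (clim_plus _ _ _ _ Ll (clim_const (- F0)%C)))].
      intros n. simpl. rewrite (Eq (xs n) (Xp n)). ring. }
    pose proof (clim_unique _ _ _ A B) as E. replace (L s0) with (RtoC 1 * (L s0 + - F0) + F0)%C by ring. rewrite <- E. ring. }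
  split; trivial.
  (* Now that [F0 = L s0], the identity equates [mellin Psi x] with [x * gam x] times the difference
     quotient of [L] at [s0]. *)
  assert (Ql : clim (fun n => (L (s0 + RtoC (xs n)) - L s0) / RtoC (xs n))%C (dL s0)).
  { apply Cdiff_quot; trivial. intros n. pose proof (Xp n). lra. }
  assert (B : clim (fun n => mellin Psi (RtoC (xs n))) (RtoC 1 * dL s0)%C).
  { eapply clim_ext; [|apply (clim_mult _ _ _ _ Gl Ql)]. intros n. simpl. rewrite (Eq (xs n) (Xp n)), Es0, V1.
    field. apply RtoC_neq. pose proof (Xp n). lra. }
  pose proof (clim_unique _ _ _ Pl B) as E. rewrite Cmult_1_l in E. rewrite <- E. unfold mellin. f_equal. extensionality v.
  rewrite Cmult_0_l, cexp_0. ring.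
Qed.

End LValues.

(** * Behaviour of the Lambert series at zero and at infinity *)

Lemma Fk_ccont (chi : Z -> C) (k : nat) (v : R) : (forall n, Cmod (chi n) <= 1) ->
  ccont (fun v => Fk chi k (exp v)) v.
Proof.
  intros Hc. unfold Fk.
  apply (ccont_CSeries (fun n v => RtoC (INR (S n) ^ k) * chi (Z.of_nat (S n)) * RtoC (exp (- (INR (S n) * exp v))))%C
    (fun n => expC k (exp (v - 1)) * / INR (S n) ^ 2)).
  - intros n. apply ccont_mult; [apply ccont_const|]. apply ccont_RtoC.
    apply (ex_derive_continuous (fun v => exp (- (INR (S n) * exp v)))). auto_derive. trivial.
  - apply (ex_series_scal_l _ _ ex_series_inv_sqr).
  - exists (mkposreal 1 Rlt_0_1). intros y Hy n.
    unfold ball in Hy; simpl in Hy. unfold AbsRing_ball, abs, minus, plus, opp in Hy; simpl in Hy. apply Rabs_def2 in Hy.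
    assert (Pn : 0 < INR (S n)) by (apply lt_0_INR; lia).
    eapply Rle_trans; [|apply (exp_term_bound k n (exp (v - 1)) (exp_pos _))].
    rewrite !Cmod_mult, !Cmod_R, (Rabs_pos_eq (INR (S n) ^ k)), (Rabs_pos_eq (exp _)) by (try (left; apply exp_pos); apply pow_le; lra).
    assert (0 <= INR (S n) ^ k) by (apply pow_le; lra). specialize (Hc (Z.of_nat (S n))). pose proof (Cmod_ge_0 (chi (Z.of_nat (S n)))).
    apply Rmult_le_compat; [nra|left; apply exp_pos|nra|]. apply exp_mono.
    assert (exp (v - 1) <= exp y) by (apply exp_mono; lra). nra.
Qed.

(** For [n, t >= 1] one has [n t >= t / 2 + n / 2]: the first half is the decay, the second sums the
    series. *)
Lemma Fk_decay (chi : Z -> C) (k : nat) : (forall n, Cmod (chi n) <= 1) ->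
  exists K, 0 <= K /\ forall t, 1 <= t -> Cmod (Fk chi k t) <= K * exp (- (t / 2)).
Proof.
  intros Hc. set (K0 := expC k (/ 2)). assert (K00 : 0 <= K0) by (apply expC_pos; lra).
  set (Sm := Series (fun n => / INR (S n) ^ 2)).
  assert (Sp : 0 <= Sm). { rewrite <- (Series_zero (fun _ => 0)) by trivial. apply Series_le; [|exact ex_series_inv_sqr]. intros n. split; [lra|].
    left. apply Rinv_0_lt_compat, pow_lt, lt_0_INR. lia. }
  exists (2 * (K0 * Sm)). split; [nra|]. intros t Ht.
  assert (B : csum (fun n => RtoC (INR (S n) ^ k) * chi (Z.of_nat (S n)) * RtoC (exp (- (INR (S n) * t))))%C (fun n => exp (- (t / 2)) * K0 * / INR (S n) ^ 2)).
  { split; [|apply (ex_series_scal_l (exp (- (t / 2)) * K0) _ ex_series_inv_sqr)].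
    intros n. assert (P1 : 1 <= INR (S n)) by (rewrite S_INR; pose proof (pos_INR n); lra).
    rewrite !Cmod_mult, !Cmod_R, (Rabs_pos_eq (INR (S n) ^ k)), (Rabs_pos_eq (exp _)) by (try (left; apply exp_pos); apply pow_le; lra).
    assert (0 <= INR (S n) ^ k) by (apply pow_le; lra). specialize (Hc (Z.of_nat (S n))). pose proof (Cmod_ge_0 (chi (Z.of_nat (S n)))).
    pose proof (exp_term_bound k n (/ 2) ltac:(lra)) as T. fold K0 in T.
    apply Rle_trans with (INR (S n) ^ k * (exp (- (t / 2)) * exp (- (INR (S n) * / 2)))).
    - apply Rmult_le_compat; [nra|left; apply exp_pos|nra|]. rewrite <- exp_plus. apply exp_mono. nra.
    - replace (INR (S n) ^ k * (exp (- (t / 2)) * exp (- (INR (S n) * / 2)))) with (exp (- (t / 2)) * (INR (S n) ^ k * exp (- (INR (S n) * / 2)))) by ring.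
      rewrite Rmult_assoc. apply Rmult_le_compat_l; [left; apply exp_pos|exact T]. }
  eapply Rle_trans. apply (CSeries_bound _ _ B). rewrite Series_scal_l. fold Sm. apply Req_le. ring.
Qed.

(** The exponent [k + 1] is even, so the sign of the base does not matter. *)
Lemma inv_cpt_opp (t b : R) (k : nat) : b <> 0 -> Nat.Odd k -> ((/ cpt t b) ^ S k = (/ cpt (- t) (- b)) ^ S k)%C.
Proof.
  intros Hb [m ->]. replace (S (2 * m + 1)) with (2 * S m)%nat by lia. rewrite !Cpow_mult_r. f_equal.
  assert (E : cpt (- t) (- b) = (- cpt t b)%C) by (apply injective_projections; simpl; ring). rewrite E. simpl.
  field. now apply cpt_nz.
Qed.

Section Growth.
Variables (q : nat) (chi : Z -> C) (eps : R).
Hypothesis Hq : (2 <= q)%nat.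
Hypothesis Hp : primitive_char (Z.of_nat q) chi.
Hypothesis He : chi (-1)%Z = RtoC eps.

Let Hd : dchar (Z.of_nat q) chi := proj1 Hp.

(* The limit of [Fk chi k t] as [t -> 0+]. *)
Definition F0 (k : nat) : C :=
  match k with
  | O => g0 q chi eps
  | S _ => (kap q chi eps k * CSeries (fun j => cchi chi j * ek eps k (freq q j) 0))%C
  end.

(** Pole terms normalised to vanish at [t = 0], so that the constant of the expansion is the limit
    at 0 for every [k]. *)
Definition edelta (k : nat) (b t : R) : C :=
  match k with O => e0 eps b t | S _ => (ek eps k b t - ek eps k b 0)%C end.

Lemma edelta_bound (k : nat) (b t : R) : 0 < b -> Cmod (edelta k b t) <= (1 + Rabs eps) * INR (S k) * Rabs t * (/ b) ^ S (S k).
Proof.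
  intros Hb. destruct k as [|k].
  - simpl edelta. eapply Rle_trans. now apply e0_bound. simpl INR. lra.
  - simpl edelta. pose proof (ek_lip eps (S k) b t 0 Hb) as E. now rewrite Rminus_0_r in E.
Qed.

Lemma edelta_csum (k : nat) (t : R) : csum (fun j => cchi chi j * edelta k (freq q j) t)%C
   (fun j => (1 + Rabs eps) * INR (S k) * Rabs t * INR q ^ S (S k) * / INR (S j) ^ 2).
Proof.
  apply (csum_cchi q chi Hq Hp); [lia| |].
  - pose proof (Rabs_pos eps). pose proof (Rabs_pos t). pose proof (pos_INR (S k)). repeat apply Rmult_le_pos; lra.
  - intros j. apply edelta_bound. now apply freq_pos.
Qed.

Lemma Fk_partial_fractions (k : nat) (t : R) : 0 < t ->
  (Fk chi k t = F0 k + kap q chi eps k * CSeries (fun j => cchi chi j * edelta k (freq q j) t))%C.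
Proof.
  intros Ht. destruct k as [|k].
  - now apply Fk_partial_fractions_0.
  - rewrite (Fk_partial_fractions_S q chi eps Hq Hp He k t Ht). unfold F0, edelta.
    destruct (ek_csum q chi eps Hq Hp (S k) t ltac:(lia)) as [A SA]. destruct (ek_csum q chi eps Hq Hp (S k) 0 ltac:(lia)) as [B SB].
    rewrite (CSeries_ext (fun j => cchi chi j * (ek eps (S k) (freq q j) t - ek eps (S k) (freq q j) 0))%C
       (fun j => cchi chi j * ek eps (S k) (freq q j) t - cchi chi j * ek eps (S k) (freq q j) 0)%C) by (intros; ring).
    rewrite (CSeries_minus _ _ _ _ SA SB). ring.
Qed.

Lemma Fk_near0 (k : nat) : exists K, 0 <= K /\ forall t, 0 < t -> Cmod (Fk chi k t - F0 k) <= K * t.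
Proof.
  set (K0 := (1 + Rabs eps) * INR (S k) * INR q ^ S (S k)). set (Sm := Series (fun n => / INR (S n) ^ 2)).
  assert (Sp : 0 <= Sm). { rewrite <- (Series_zero (fun _ => 0)) by trivial. apply Series_le; [|exact ex_series_inv_sqr]. intros n. split; [lra|].
    left. apply Rinv_0_lt_compat, pow_lt, lt_0_INR. lia. }
  assert (K00 : 0 <= K0). { unfold K0. pose proof (Rabs_pos eps). apply Rmult_le_pos; [apply Rmult_le_pos; [lra|apply pos_INR]|apply pow_le, pos_INR]. }
  exists (Cmod (kap q chi eps k) * (2 * (K0 * Sm))). split. { apply Rmult_le_pos; [apply Cmod_ge_0|nra]. }
  intros t Ht. rewrite Fk_partial_fractions by trivial.
  replace (F0 k + kap q chi eps k * CSeries (fun j => cchi chi j * edelta k (freq q j) t) - F0 k)%C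
    with (kap q chi eps k * CSeries (fun j => cchi chi j * edelta k (freq q j) t))%C by ring.
  rewrite Cmod_mult, !Rmult_assoc. apply Rmult_le_compat_l; [apply Cmod_ge_0|].
  eapply Rle_trans. apply (CSeries_bound _ _ (edelta_csum k t)).
  rewrite (Rabs_pos_eq t) by lra.
  rewrite (Series_ext _ (fun j => (K0 * t) * / INR (S j) ^ 2)) by (intros; unfold K0; ring). rewrite Series_scal_l. fold Sm. apply Req_le. ring.
Qed.

Lemma Phi_decays (k : nat) : decays 0 (fun v => Fk chi k (exp v)).
Proof.
  pose proof (chi_le_1 _ _ Hd) as Hc. split. { intros v. now apply Fk_ccont. }
  destruct (Fk_near0 k) as [K1 [P1 H1]]. destruct (Fk_decay chi k Hc) as [K2 [P2 H2]].
  pose proof (Cmod_ge_0 (F0 k)) as P0.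
  exists (Cmod (F0 k) + K1 + K2). split; [lra|]. split.
  - intros v Hv. rewrite Rmult_0_l, exp_0, Rmult_1_r. specialize (H1 (exp v) (exp_pos v)).
    assert (exp v <= 1) by (rewrite <- exp_0; now apply exp_mono).
    replace (Fk chi k (exp v)) with (F0 k + (Fk chi k (exp v) - F0 k))%C by ring. eapply Rle_trans. apply Cmod_triangle.
    pose proof (exp_pos v). nra.
  - intros v Hv. eapply Rle_trans. apply H2. { rewrite <- exp_0. now apply exp_mono. }
    apply Rmult_le_compat_r; [left; apply exp_pos|lra].
Qed.

(** Subtracting [F0 * e^(-t)] removes the limit at [t = 0] and keeps the decay at infinity, so the
    Mellin transform becomes regular for [Re s > - 1], in particular at 0. *)
Lemma Psi_decays (k : nat) : decays 1 (fun v => Fk chi k (exp v) - F0 k * gamf v)%C.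
Proof.
  pose proof (chi_le_1 _ _ Hd) as Hc. destruct gamf_decays as [Gc _]. split.
  { intros v. apply ccont_minus; [now apply Fk_ccont|]. apply ccont_mult; [apply ccont_const|apply Gc]. }
  destruct (Fk_near0 k) as [K1 [P1 H1]]. destruct (Fk_decay chi k Hc) as [K2 [P2 H2]].
  pose proof (Cmod_ge_0 (F0 k)) as P0.
  exists (Cmod (F0 k) + K1 + K2). split; [lra|]. split.
  - intros v Hv. rewrite Rmult_1_l. specialize (H1 (exp v) (exp_pos v)). pose proof (exp_pos v) as Pv.
    replace (Fk chi k (exp v) - F0 k * gamf v)%C with ((Fk chi k (exp v) - F0 k) + F0 k * RtoC (1 - exp (- exp v)))%C by (unfold gamf; rewrite RtoC_minus; ring).
    eapply Rle_trans. apply Cmod_triangle. rewrite Cmod_mult, Cmod_R.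
    pose proof (exp_ineq1_le (- exp v)) as Q. assert (exp (- exp v) <= 1) by (rewrite <- exp_0; apply exp_mono; lra).
    rewrite Rabs_pos_eq by lra.
    assert (Cmod (F0 k) * (1 - exp (- exp v)) <= Cmod (F0 k) * exp v) by (apply Rmult_le_compat_l; lra). nra.
  - intros v Hv. eapply Rle_trans. apply Cmod_minus_le. rewrite Cmod_mult. unfold gamf. rewrite Cmod_R, Rabs_pos_eq by (left; apply exp_pos).
    assert (B : Cmod (Fk chi k (exp v)) <= K2 * exp (- (exp v / 2))). { apply H2. rewrite <- exp_0. now apply exp_mono. }
    pose proof (exp_pos v) as Pv. pose proof (exp_pos (- (exp v / 2))) as Pe.
    assert (exp (- exp v) <= exp (- (exp v / 2))) by (apply exp_mono; lra). nra.
Qed.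

(** At [t = 0] the poles [i b] and [- i b] have equal even powers, and [eps = - 1] makes them
    cancel. *)
Lemma F0_odd (k : nat) : eps = -1 -> Nat.Odd k -> F0 k = RtoC 0.
Proof.
  intros E Hk. destruct k as [|k]; [destruct Hk; lia|]. unfold F0.
  rewrite (CSeries_ext _ (fun j => RtoC 0 * RtoC 0)%C).
  - rewrite (CSeries_scal (RtoC 0) (fun _ => RtoC 0) (fun n => / INR (S n) ^ 2)); [ring|]. split; [|exact ex_series_inv_sqr].
    intros n. rewrite Cmod_0. left. apply Rinv_0_lt_compat, pow_lt, lt_0_INR. lia.
  - intros j. unfold ek. pose proof (freq_pos q j Hq). rewrite (inv_cpt_opp 0 (freq q j) (S k)) by (trivial; lra).
    rewrite Ropp_0, E. ring.
Qed.

End Growth.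

(** * The integral of a product of partial fractions *)

(* [PV f I]: [f] has a primitive on R and its principal value integral is [I]. *)
Definition PV (f : R -> C) (I : C) : Prop :=
  exists H : R -> C, (forall t, cderiv H t (f t)) /\
    forall eps, 0 < eps -> exists T0, forall T, T0 <= T -> Cmod (H T - H (Ropp T) - I) < eps.

Lemma cderiv_plus (H G : R -> C) (t : R) (a b : C) : cderiv H t a -> cderiv G t b -> cderiv (fun y => H y + G y)%C t (a + b)%C.
Proof. intros [A B] [A' B']. split; simpl; now apply (is_derive_plus (K := R_AbsRing) (V := R_NormedModule)). Qed.

Lemma cderiv_scal (c : C) (H : R -> C) (t : R) (a : C) : cderiv H t a -> cderiv (fun y => c * H y)%C t (c * a)%C.
Proof.
  intros [A B]. split; simpl.
  - apply (is_derive_minus (K := R_AbsRing) (V := R_NormedModule)); now apply (is_derive_scal (fun y => _)).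
  - apply (is_derive_plus (K := R_AbsRing) (V := R_NormedModule)); now apply (is_derive_scal (fun y => _)).
Qed.

Lemma cderiv_quad (H : R -> C) (t : R) (l : C) (K : R) :
  (forall h, Cmod (H (t + h)%R - H t - RtoC h * l) <= K * h ^ 2) -> cderiv H t l.
Proof.
  intros Q.
  assert (P : forall (f : R -> R) (l : R), (forall h, Rabs (f (t + h) - f t - h * l) <= K * h ^ 2) -> is_derive f t l).
  { intros f m B. apply is_derive_Reals. intros eps He. set (K' := Rabs K + 1).
    assert (HK : 0 < K') by (unfold K'; pose proof (Rabs_pos K); lra).
    assert (Hd : 0 < eps / K') by now apply Rdiv_lt_0_compat. exists (mkposreal _ Hd). simpl. intros h Hh0 Hh.
    specialize (B h). pose proof (Rabs_pos_lt h Hh0) as Ph.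
    replace ((f (t + h) - f t) / h - m) with ((f (t + h) - f t - h * m) / h) by (field; trivial).
    unfold Rdiv at 1. rewrite Rabs_mult, Rabs_inv. apply Rmult_lt_reg_r with (Rabs h); trivial.
    rewrite Rmult_assoc, Rinv_l, Rmult_1_r by lra. eapply Rle_lt_trans. exact B. rewrite <- (pow2_abs h).
    apply Rle_lt_trans with (K' * Rabs h * Rabs h). { pose proof (Rle_abs K). unfold K'. nra. }
    apply Rmult_lt_compat_r; trivial. apply Rmult_lt_compat_l with (r := K') in Hh; trivial.
    replace (K' * (eps / K')) with eps in Hh by (field; lra). exact Hh. }
  split; apply P; intros h; eapply Rle_trans; [|apply (Q h)| |apply (Q h)].
  - eapply Rle_trans; [|apply fst_le_Cmod]. apply Req_le. f_equal. simpl. ring.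
  - eapply Rle_trans; [|apply snd_le_Cmod]. apply Req_le. f_equal. simpl. ring.
Qed.

Lemma PV_ext (f g : R -> C) (I J : C) : (forall t, f t = g t) -> I = J -> PV f I -> PV g J.
Proof. intros E <- [H [A B]]. exists H. split; trivial. intros t. rewrite <- E. apply A. Qed.

Lemma PV_plus (f g : R -> C) (I J : C) : PV f I -> PV g J -> PV (fun t => f t + g t)%C (I + J)%C.
Proof.
  intros [H [A B]] [G [A' B']]. exists (fun t => H t + G t)%C. split. { intros t. now apply cderiv_plus. }
  intros eps He. destruct (B (eps / 2) ltac:(lra)) as [T1 H1]. destruct (B' (eps / 2) ltac:(lra)) as [T2 H2].
  exists (Rmax T1 T2). intros T HT. pose proof (Rmax_l T1 T2). pose proof (Rmax_r T1 T2).
  specialize (H1 T ltac:(lra)). specialize (H2 T ltac:(lra)).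
  replace (H T + G T - (H (Ropp T) + G (Ropp T)) - (I + J))%C with ((H T - H (Ropp T) - I) + (G T - G (Ropp T) - J))%C by ring.
  eapply Rle_lt_trans. apply Cmod_triangle. lra.
Qed.

Lemma PV_scal (c : C) (f : R -> C) (I : C) : PV f I -> PV (fun t => c * f t)%C (c * I)%C.
Proof.
  intros [H [A B]]. exists (fun t => c * H t)%C. split. { intros t. now apply cderiv_scal. }
  intros eps He. assert (P : 0 < Cmod c + 1) by (pose proof (Cmod_ge_0 c); lra).
  destruct (B (eps / (Cmod c + 1)) ltac:(now apply Rdiv_lt_0_compat)) as [T1 H1]. exists T1. intros T HT. specialize (H1 T HT).
  replace (c * H T - c * H (Ropp T) - c * I)%C with (c * (H T - H (Ropp T) - I))%C by ring. rewrite Cmod_mult.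
  apply Rle_lt_trans with ((Cmod c + 1) * Cmod (H T - H (Ropp T) - I)).
  - apply Rmult_le_compat_r; [apply Cmod_ge_0|lra].
  - apply Rmult_lt_compat_l with (r := Cmod c + 1) in H1; trivial. replace ((Cmod c + 1) * (eps / (Cmod c + 1))) with eps in H1 by (field; lra). exact H1.
Qed.

Lemma PV_squeeze (f H : R -> C) (I : C) (K : R) : (forall t, cderiv H t (f t)) ->
  (forall T, 1 <= T -> Cmod (H T - H (Ropp T) - I) <= K / T) -> PV f I.
Proof.
  intros A B. exists H. split; trivial. intros eps He. exists (Rmax 1 (Rabs K / eps + 1)). intros T HT.
  pose proof (Rmax_l 1 (Rabs K / eps + 1)). pose proof (Rmax_r 1 (Rabs K / eps + 1)).
  specialize (B T ltac:(lra)). eapply Rle_lt_trans. exact B. apply Rmult_lt_reg_r with T; [lra|].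
  unfold Rdiv. rewrite Rmult_assoc, Rinv_l, Rmult_1_r by lra. pose proof (Rle_abs K).
  assert (E : Rabs K = Rabs K / eps * eps) by (field; lra). assert (Rabs K / eps < T) by lra. nra.
Qed.

(** The order is at least 2, so the primitive is again a power of [1 / (t - i b)] and vanishes at
    both ends. *)
Lemma PV_inv_pow (b : R) (l : nat) : 0 < b -> PV (fun t => (/ cpt t (- b)) ^ S (S l))%C (RtoC 0).
Proof.
  intros Hb. set (c := RtoC (- / INR (S l))). assert (Pl : 0 < INR (S l)) by (apply lt_0_INR; lia).
  apply (PV_squeeze _ (fun t => c * (/ cpt t (- b)) ^ S l)%C _ (2 * Cmod c)).
  - intros t. replace ((/ cpt t (- b)) ^ S (S l))%C with (c * (RtoC (- INR (S l)) * (/ cpt t (- b)) ^ S (S l)))%C.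
    2:{ unfold c. rewrite Cmult_assoc, <- RtoC_mult. replace (- / INR (S l) * - INR (S l)) with 1 by (field; lra). ring. }
    apply cderiv_scal. apply (cderiv_quad _ _ _ (quadC (S l) * (/ Rabs (- b)) ^ S (S (S l)))). intros h.
    pose proof (inv_cpt_quad (S l) t h (- b) ltac:(lra)) as Q.
    replace ((/ cpt (t + h) (- b)) ^ S l - (/ cpt t (- b)) ^ S l - RtoC h * (RtoC (- INR (S l)) * (/ cpt t (- b)) ^ S (S l)))%C
      with ((/ cpt (t + h) (- b)) ^ S l - (/ cpt t (- b)) ^ S l + RtoC (INR (S l) * h) * (/ cpt t (- b)) ^ S (S l))%C by (rewrite RtoC_mult, RtoC_opp; ring).
    eapply Rle_trans. exact Q. apply Req_le. ring.
  - intros T HT.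
    assert (B : forall x, 1 <= Rabs x -> Cmod ((/ cpt x (- b)) ^ S l) <= / Rabs x).
    { intros x Hx. rewrite Cmod_pow. assert (D : Cmod (/ cpt x (- b)) <= / Rabs x).
      { rewrite Cmod_inv by (apply cpt_nz; lra). apply Rinv_le_contravar; [lra|]. apply (fst_le_Cmod (cpt x (- b))). }
      pose proof (Cmod_ge_0 (/ cpt x (- b))) as C0.
      assert (I1 : / Rabs x <= 1) by (rewrite <- Rinv_1; apply Rinv_le_contravar; lra).
      apply Rle_trans with (Cmod (/ cpt x (- b)) ^ 1); [|rewrite pow_1; exact D].
      simpl. assert (Cmod (/ cpt x (- b)) ^ l <= 1) by (rewrite <- (pow1 l); apply pow_incr; lra).
      assert (0 <= Cmod (/ cpt x (- b)) ^ l) by now apply pow_le. nra. }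
    pose proof (B T ltac:(rewrite Rabs_pos_eq; lra)) as B1. pose proof (B (- T) ltac:(rewrite Rabs_Ropp, Rabs_pos_eq; lra)) as B2.
    rewrite Rabs_Ropp in B2. rewrite (Rabs_pos_eq T) in B1, B2 by lra.
    replace (c * (/ cpt T (- b)) ^ S l - c * (/ cpt (- T) (- b)) ^ S l - RtoC 0)%C with (c * ((/ cpt T (- b)) ^ S l - (/ cpt (- T) (- b)) ^ S l))%C by ring.
    rewrite Cmod_mult. pose proof (Cmod_minus_le ((/ cpt T (- b)) ^ S l) ((/ cpt (- T) (- b)) ^ S l)) as M.
    pose proof (Cmod_ge_0 c). unfold Rdiv. replace (2 * Cmod c * / T) with (Cmod c * (2 * / T)) by ring. apply Rmult_le_compat_l; lra.
Qed.

(** The difference is [- atan (b / T)], and [atan] is 1-Lipschitz. *)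
Lemma atan_at_infinity (b T : R) : 0 < b -> 0 < T -> Rabs (atan (T / b) - PI / 2) <= b / T.
Proof.
  intros Hb HT. assert (P : 0 < T / b) by now apply Rdiv_lt_0_compat.
  assert (P' : 0 < b / T) by now apply Rdiv_lt_0_compat.
  assert (E : atan (b / T) = PI / 2 - atan (T / b)). { replace (b / T) with (/ (T / b)) by (field; lra). now apply atan_inv. }
  replace (atan (T / b) - PI / 2) with (- atan (b / T)) by lra. rewrite Rabs_Ropp.
  assert (H : forall y, Rabs (y - 0) <= Rabs (b / T - 0) -> is_derive atan y (/ (1 + y ^ 2)) /\ Rabs (/ (1 + y ^ 2)) <= 1).
  { intros y _. split. { apply is_derive_Reals. apply derivable_pt_lim_atan. }
    pose proof (pow2_ge_0 y). rewrite Rabs_pos_eq by (left; apply Rinv_0_lt_compat; lra). rewrite <- Rinv_1. apply Rinv_le_contravar; lra. }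
  pose proof (bounded_variation _ _ _ _ _ H) as B. rewrite atan_0, !Rminus_0_r, Rmult_1_l in B. now rewrite (Rabs_pos_eq (b / T)) in B by lra.
Qed.

Lemma is_derive_atan_div (b t : R) : 0 < b -> is_derive (fun y => atan (y / b)) t (b / (b ^ 2 + t ^ 2)).
Proof.
  intros Hb. replace (b / (b ^ 2 + t ^ 2)) with (scal (/ b) (/ (1 + (t / b) ^ 2))).
  2:{ unfold scal; simpl; unfold mult; simpl. field. split; nra. }
  apply (is_derive_comp atan (fun y => y / b)).
  - apply is_derive_Reals. apply derivable_pt_lim_atan.
  - auto_derive; trivial. field. lra.
Qed.

(** A primitive of [1 / (t - i b)] is [ln |t - i b| + i atan (t / b)]. The logarithm is even in [t],
    and the arctangent gains [pi] over the line for every [b > 0], so the difference contributes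
    nothing. *)
Lemma PV_log_diff (b w : R) : 0 < b -> 0 < w -> PV (fun t => / cpt t (- b) - / cpt t (- w))%C (RtoC 0).
Proof.
  intros Hb Hw.
  assert (D : forall b t, 0 < b -> cderiv (fun y => cpt (ln (y ^ 2 + b ^ 2) / 2) (atan (y / b))) t (/ cpt t (- b))%C).
  { clear. intros b t Hb. pose proof (pow2_ge_0 t). assert (0 < t ^ 2 + b ^ 2) by nra. split; unfold cpt, Cinv; cbn [fst snd].
    - auto_derive; [nra|]. field; repeat split; nra.
    - replace (- - b / (t ^ 2 + (- b) ^ 2)) with (b / (b ^ 2 + t ^ 2)) by (field; repeat split; nra). now apply is_derive_atan_div. }
  set (Hf := fun b y => cpt (ln (y ^ 2 + b ^ 2) / 2) (atan (y / b))).
  apply (PV_squeeze _ (fun y => Hf b y + RtoC (-1) * Hf w y)%C _ (2 * (b + w))).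
  - intros t. replace (/ cpt t (- b) - / cpt t (- w))%C with (/ cpt t (- b) + RtoC (-1) * / cpt t (- w))%C by ring.
    apply cderiv_plus; [now apply D|]. apply cderiv_scal. now apply D.
  - intros T HT.
    replace (Hf b T + RtoC (-1) * Hf w T - (Hf b (Ropp T) + RtoC (-1) * Hf w (Ropp T)) - RtoC 0)%C with (Ci * RtoC (2 * ((atan (T / b) - PI / 2) - (atan (T / w) - PI / 2))))%C.
    2:{ unfold Hf. apply injective_projections; simpl.
        - replace (- T * (- T * 1)) with (T * (T * 1)) by ring. ring.
        - replace (- T / b) with (- (T / b)) by (field; lra). replace (- T / w) with (- (T / w)) by (field; lra). rewrite !atan_opp. ring. }
    rewrite Cmod_mult, Cmod_Ci, Rmult_1_l, Cmod_R, Rabs_mult, (Rabs_pos_eq 2) by lra.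
    pose proof (atan_at_infinity b T Hb ltac:(lra)). pose proof (atan_at_infinity w T Hw ltac:(lra)).
    replace (2 * (b + w) / T) with (2 * (b / T + w / T)) by (field; lra). apply Rmult_le_compat_l; [lra|].
    unfold Rminus at 1. eapply Rle_trans. apply Rabs_triang. rewrite Rabs_Ropp. lra.
Qed.

Lemma PV_poisson (w : R) : 0 < w -> PV (fun t => RtoC (w / (w ^ 2 + t ^ 2))) (RtoC PI).
Proof.
  intros Hw. apply (PV_squeeze _ (fun y => RtoC (atan (y / w))) _ (2 * w)).
  - intros t. split; simpl.
    + now apply is_derive_atan_div.
    + apply (is_derive_const (K := R_AbsRing) (V := R_NormedModule) 0).
  - intros T HT. replace (RtoC (atan (T / w)) - RtoC (atan (- T / w)) - RtoC PI)%C with (RtoC (2 * (atan (T / w) - PI / 2))).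
    2:{ replace (- T / w) with (- (T / w)) by (field; lra). rewrite atan_opp, <- !RtoC_minus. f_equal. field. }
    rewrite Cmod_R, Rabs_mult, (Rabs_pos_eq 2) by lra. pose proof (atan_at_infinity w T Hw ltac:(lra)).
    replace (2 * w / T) with (2 * (w / T)) by (field; lra). lra.
Qed.

(** Closing the contour in the lower half-plane, which is free of poles, explains the value 0. The
    proof separates the poles by partial fractions, by induction on the order. *)
Lemma PV_two_poles (b w : R) (l : nat) : 0 < b -> 0 < w -> PV (fun t => (/ cpt t (- b)) ^ S l * / cpt t (- w))%C (RtoC 0).
Proof.
  intros Hb Hw. destruct (Req_dec b w) as [<-|Hne].
  - eapply PV_ext; [|reflexivity|apply (PV_inv_pow b l Hb)]. intros t. simpl. ring.
  - set (c := (/ cpt 0 (b - w))%C). assert (N0 : cpt 0 (b - w) <> RtoC 0) by (apply cpt_nz; lra).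
    assert (E : forall t, (/ cpt t (- b) * / cpt t (- w) = c * (/ cpt t (- b) - / cpt t (- w)))%C).
    { intros t. unfold c. assert (X : cpt 0 (b - w) = (cpt t (- w) - cpt t (- b))%C) by (apply injective_projections; simpl; ring).
      rewrite X in *. field. repeat split; trivial; apply cpt_nz; lra. }
    induction l as [|l IH].
    + eapply PV_ext; [| |apply (PV_scal c _ _ (PV_log_diff b w Hb Hw))]; [|ring]. intros t. simpl. rewrite Cmult_1_r. symmetry. apply E.
    + eapply PV_ext; [| |apply (PV_scal c _ _ (PV_plus _ _ _ _ (PV_inv_pow b l Hb) (PV_scal (RtoC (-1)) _ _ IH)))]; [|ring].
      intros t. cbv beta. specialize (E t). set (x := (/ cpt t (- b))%C) in *. set (z := (/ cpt t (- w))%C) in *.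
      change (x ^ S (S l))%C with (x * x ^ S l)%C. generalize (x ^ S l)%C. intros p.
      transitivity (p * (x * z))%C; [rewrite E; ring|ring].
Qed.

(** The Poisson integral of a function holomorphic in the lower half-plane is its value at [- i w],
    here [(/ (- i (b + w)))^l] times [pi]. The kernel is [w / ((t + i w) (t - i w))]: splitting
    [1 / ((t - i b) (t + i w))] lowers [l] by one and leaves an integral whose poles are both above
    the line, which vanishes by [PV_two_poles]. *)
Lemma PV_pow_poisson (b w : R) (l : nat) : 0 < b -> 0 < w ->
  PV (fun t => (/ cpt t (- b)) ^ l * RtoC (w / (w ^ 2 + t ^ 2)))%C (RtoC PI * (/ cpt 0 (- (b + w))) ^ l)%C.
Proof.
  intros Hb Hw. set (b0 := (/ cpt 0 (- (b + w)))%C). induction l as [|l IH].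
  - eapply PV_ext; [| |apply (PV_poisson w Hw)]; simpl; [intros t; ring|ring].
  - eapply PV_ext; [| |apply (PV_plus _ _ _ _ (PV_scal b0 _ _ IH) (PV_scal (- (b0 * RtoC w))%C _ _ (PV_two_poles b w l Hb Hw)))]; [|simpl; ring].
    intros t. cbv beta.
    assert (N1 : cpt t (- b) <> RtoC 0) by (apply cpt_nz; lra). assert (N2 : cpt t (- w) <> RtoC 0) by (apply cpt_nz; lra).
    assert (N3 : cpt t w <> RtoC 0) by (apply cpt_nz; lra). assert (N4 : cpt 0 (- (b + w)) <> RtoC 0) by (apply cpt_nz; lra).
    assert (W : RtoC (w / (w ^ 2 + t ^ 2)) = (RtoC w * (/ cpt t w * / cpt t (- w)))%C).
    { assert (X : (cpt t w * cpt t (- w))%C = RtoC (w ^ 2 + t ^ 2)) by (apply injective_projections; simpl; ring).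
      pose proof (pow2_ge_0 t). assert (Nzr : w ^ 2 + t ^ 2 <> 0) by nra.
      rewrite RtoC_div by exact Nzr. unfold Cdiv. f_equal. rewrite <- X. field. now split. }
    rewrite W. change ((/ cpt t (- b)) ^ S l)%C with (/ cpt t (- b) * (/ cpt t (- b)) ^ l)%C.
    assert (X : cpt 0 (- (b + w)) = (cpt t (- b) - cpt t w)%C) by (apply injective_projections; simpl; ring).
    unfold b0. rewrite X in *. field. repeat split; trivial.
Qed.

(** The substitution [t = e^v] folds the line at 0: [H (e^v) - H (- e^v)] is a primitive of the
    folded integrand, and it vanishes at minus infinity because [H] is continuous at 0. *)
Lemma PV_CI (f : R -> C) (I : C) : PV f I -> (forall t, ccont f t) ->
  CI (fun v => RtoC (exp v) * (f (exp v) + f (Ropp (exp v))))%C = I.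
Proof.
  intros [H [HD HL]] Hc.
  assert (HC : forall t, ccont H t).
  { intros t. destruct (HD t) as [A B]. split; apply (ex_derive_continuous (K := R_AbsRing) (V := R_NormedModule)); eexists; eassumption. }
  apply (CI_FTC _ (fun v => H (exp v) + RtoC (-1) * H (Ropp (exp v)))%C).
  - intros v. replace (RtoC (exp v) * (f (exp v) + f (Ropp (exp v))))%C
      with (RtoC (exp v) * f (exp v) + RtoC (-1) * (RtoC (- exp v) * f (Ropp (exp v))))%C by (rewrite RtoC_opp; ring).
    assert (Cmp : forall (g : R -> R) (g' : R), is_derive g v g' -> cderiv (fun y => H (g y)) v (RtoC g' * f (g v))%C).
    { intros g g' Hg. destruct (HD (g v)) as [A B]. split.
      - replace (fst (RtoC g' * f (g v))%C) with (scal g' (fst (f (g v)))) by (unfold scal; simpl; unfold mult; simpl; ring).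
        apply (is_derive_comp (fun y => fst (H y)) g v); trivial.
      - replace (snd (RtoC g' * f (g v))%C) with (scal g' (snd (f (g v)))) by (unfold scal; simpl; unfold mult; simpl; ring).
        apply (is_derive_comp (fun y => snd (H y)) g v); trivial. }
    apply cderiv_plus; [|apply cderiv_scal].
    + apply (Cmp exp). auto_derive; trivial. ring.
    + apply (Cmp (fun y => - exp y)). auto_derive; trivial. ring.
  - intros v. assert (E1 : continuous exp v) by (apply (ex_derive_continuous exp); auto_derive; trivial).
    assert (E2 : continuous (fun y => - exp y) v) by (apply (ex_derive_continuous (fun y => - exp y)); auto_derive; trivial).
    apply ccont_mult; [now apply ccont_RtoC|]. apply ccont_plus; apply ccont_comp; auto.
  - assert (Z : clim (fun n => H (exp (- INR n)) + RtoC (-1) * H (Ropp (exp (- INR n))))%C (H 0 + RtoC (-1) * H 0)%C).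
    { assert (E : is_lim_seq (fun n => exp (- INR n)) 0).
      { eapply is_lim_seq_ext; [|apply (exp_neg_lim 1 Rlt_0_1)]. intros n. simpl. now rewrite Rmult_1_l. }
      assert (Cl : forall x : nat -> R, is_lim_seq x 0 -> clim (fun n => H (x n)) (H 0)).
      { intros x Hx. destruct (HC 0) as [A B]. split.
        - apply (filterlim_comp _ _ _ x (fun y => fst (H y)) eventually (locally 0)); trivial.
        - apply (filterlim_comp _ _ _ x (fun y => snd (H y)) eventually (locally 0)); trivial. }
      apply clim_plus; [now apply Cl|]. apply clim_mult; [apply clim_const|]. apply (Cl (fun n => - exp (- INR n))).
      replace (Finite 0) with (Rbar_opp 0) by (simpl; f_equal; ring). exact (proj1 (is_lim_seq_opp _ (Finite 0)) E). }
    assert (U : clim (fun n => H (exp (INR n)) + RtoC (-1) * H (Ropp (exp (INR n))))%C I).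
    { assert (Q : forall eps, 0 < eps -> exists N, forall n, (N <= n)%nat -> Cmod (H (exp (INR n)) + RtoC (-1) * H (Ropp (exp (INR n))) - I)%C < eps).
      { intros eps He. destruct (HL eps He) as [T0 HT]. destruct (INR_unbounded T0) as [N HN]. exists N. intros n Hn.
        replace (H (exp (INR n)) + RtoC (-1) * H (Ropp (exp (INR n))) - I)%C with (H (exp (INR n)) - H (Ropp (exp (INR n))) - I)%C by ring.
        apply HT. apply le_INR in Hn. pose proof (exp_ineq1_le (INR n)). lra. }
      split; apply is_lim_seq_eps; intros eps He; destruct (Q eps He) as [N HN]; exists N; intros n Hn; specialize (HN n Hn).
      - exact (Rle_lt_trans _ _ _ (fst_le_Cmod (H (exp (INR n)) + RtoC (-1) * H (Ropp (exp (INR n))) - I)%C) HN).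
      - exact (Rle_lt_trans _ _ _ (snd_le_Cmod (H (exp (INR n)) + RtoC (-1) * H (Ropp (exp (INR n))) - I)%C) HN). }
    pose proof (clim_plus _ _ _ _ U (clim_mult _ _ _ _ (clim_const (RtoC (-1))) Z)) as Fin.
    replace (I + RtoC (-1) * (H 0 + RtoC (-1) * H 0))%C with I in Fin by ring.
    eapply clim_ext; [|exact Fin]. intros n. simpl. ring.
Qed.

Lemma geom_factor (x y : C) (n : nat) : (x ^ n - y ^ n = (x - y) * fsum (fun l => x ^ l * y ^ (n - S l)) n)%C.
Proof.
  induction n as [|n IH]; [simpl; ring|].
  change (fsum (fun l => x ^ l * y ^ (S n - S l)) (S n))%C with (fsum (fun l => x ^ l * y ^ (S n - S l)) n + x ^ n * y ^ (S n - S n))%C.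
  rewrite (fsum_ext _ (fun l => y * (x ^ l * y ^ (n - S l)))%C).
  2:{ intros l Hl. replace (S n - S l)%nat with (S (n - S l)) by lia. simpl. ring. }
  rewrite fsum_scal, Nat.sub_diag. transitivity (y * (x ^ n - y ^ n) + (x - y) * x ^ n)%C; [simpl; ring|]. rewrite IH. simpl. ring.
Qed.

Lemma PV_fsum (f : nat -> R -> C) (I : nat -> C) (n : nat) : (forall l, PV (f l) (I l)) -> PV (fun t => fsum (fun l => f l t) n) (fsum I n).
Proof.
  intros H. induction n as [|n IH]; simpl.
  - eapply PV_ext; [| |apply (PV_scal (RtoC 0) _ _ (H O))]; [intros; cbv beta; ring|ring].
  - now apply PV_plus.
Qed.

Lemma ccont_fsum (f : nat -> R -> C) (n : nat) (v : R) : (forall l, ccont (f l) v) -> ccont (fun t => fsum (fun l => f l t) n) v.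
Proof. intros H. induction n as [|n IH]; simpl; [apply ccont_const|now apply ccont_plus]. Qed.

Lemma ccont_inv_cpt (b t : R) : b <> 0 -> ccont (fun y => / cpt y b)%C t.
Proof.
  intros Hb. apply ccont_inv; [now apply cpt_nz|]. split; simpl; [apply continuous_id|apply continuous_const].
Qed.

(* With [t = e^v] the integral folds the principal value over the real line of [(/ (t - i b))^l] against a Poisson kernel,
   which evaluates the former at [- i w], [w = y / c]. *)
Lemma term_integral (eps : R) (k : nat) (b c y : R) : eps = 1 \/ eps = -1 -> Nat.Odd k -> 0 < b -> 0 < c -> 0 < y ->
  CI (fun v => e0 eps c (y * exp (- v)) * (ek eps k b (exp v) - ek eps k b 0))%C
  = (RtoC (2 * PI / c) * ((/ cpt 0 (- (b + y / c))) ^ S k - (/ cpt 0 (- b)) ^ S k))%C.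
Proof.
  intros He Hk Hb Hc Hy. set (w := y / c). assert (Hw : 0 < w) by now apply Rdiv_lt_0_compat.
  set (a := fun t => (/ cpt t (- b))%C). set (a0 := a 0). set (b0 := (/ cpt 0 (- (b + w)))%C).
  set (P := fun t => RtoC (w / (w ^ 2 + t ^ 2))).
  assert (Pe : forall t, P (- t) = P t) by (intros t; unfold P; f_equal; f_equal; ring).
  (* Since [k + 1] is even, the pole at [- i b] taken at [t] is the pole at [i b] taken at [- t]:
     the second half of the folded integrand. *)
  assert (EK : forall t, (ek eps k b t - ek eps k b 0 = (a t ^ S k - a0 ^ S k) + RtoC eps * (a (- t)%R ^ S k - a0 ^ S k))%C).
  { intros t. unfold ek. rewrite (inv_cpt_opp t b k), (inv_cpt_opp 0 b k) by (trivial; lra). rewrite Ropp_0. unfold a0, a. ring. }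
  assert (Pc : forall t, ccont P t).
  { intros t. apply ccont_RtoC. pose proof (pow2_ge_0 t). apply (ex_derive_continuous (fun t => w / (w ^ 2 + t ^ 2))). auto_derive. nra. }
  assert (Ac : forall t, ccont a t) by (intros t; apply ccont_inv_cpt; lra).
  assert (Na : forall t, cpt t (- b) <> RtoC 0) by (intros; apply cpt_nz; lra).
  assert (U : forall v, y * exp (- v) = c * w / exp v).
  { intros v. unfold w. rewrite exp_Ropp. field. pose proof (exp_pos v). lra. }
  destruct He as [-> | ->].
  (* Here [e0 1 c u = 2 u / (u^2 + c^2)], which for [u = c w / t] is [(2 / c) t] times the Poisson
     kernel; the factor [t] is the Jacobian of [t = e^v]. *)
  - set (f := fun t => (RtoC (2 / c) * ((a t ^ S k) * P t + (- a0 ^ S k) * P t))%C).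
    assert (Hf : PV f (RtoC (2 / c) * (RtoC PI * b0 ^ S k + (- a0 ^ S k) * RtoC PI))%C).
    { apply PV_scal, PV_plus; [apply (PV_pow_poisson b w (S k) Hb Hw)|]. apply PV_scal. apply (PV_poisson w Hw). }
    transitivity (RtoC (2 / c) * (RtoC PI * b0 ^ S k + (- a0 ^ S k) * RtoC PI))%C.
    2:{ replace (2 * PI / c) with (2 / c * PI) by (field; lra). rewrite RtoC_mult. unfold b0, a0, a. ring. }
    rewrite <- (PV_CI f _ Hf).
    2:{ intros t. apply ccont_mult; [apply ccont_const|]. apply ccont_plus; apply ccont_mult; trivial; [now apply ccont_pow|apply ccont_const]. }
    f_equal. extensionality v. rewrite EK, U. set (t := exp v). assert (Pt : 0 < t) by apply exp_pos.
    unfold f. rewrite Pe.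
    replace (e0 1 c (c * w / t)) with (RtoC t * (RtoC (2 / c) * P t))%C; [ring|].
    unfold e0, P. rewrite <- !RtoC_mult. assert (0 < c * w / t) by (apply Rdiv_lt_0_compat; nra). set (u := c * w / t) in *.
    replace (t * (2 / c * (w / (w ^ 2 + t ^ 2)))) with (2 * u / (u ^ 2 + c ^ 2)).
    2:{ assert (0 < c * w) by (now apply Rmult_lt_0_compat). assert (0 < c * t) by (now apply Rmult_lt_0_compat). unfold u. field. repeat split; try lra; nra. }
    apply injective_projections; simpl; field; repeat split; nra.
  (* Here [e0 (-1) c u] is a constant times the Poisson kernel, without the Jacobian factor [t].
     That factor is taken from [a t ^ S k - a0 ^ S k], which vanishes at 0; [Q] is the quotient by
     [t], times the kernel, written out by [geom_factor]. *)
  - set (Q := fun t => fsum (fun l => (- a0 ^ (S k - l)) * (a t ^ S l * P t))%C (S k)).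
    set (f := fun t => (cpt 0 (- (2 / c * w)) * Q t)%C).
    assert (HQ : PV Q (fsum (fun l => (- a0 ^ (S k - l)) * (RtoC PI * b0 ^ S l))%C (S k))).
    { apply (PV_fsum (fun l t => (- a0 ^ (S k - l)) * (a t ^ S l * P t))%C). intros l. apply PV_scal. apply (PV_pow_poisson b w (S l) Hb Hw). }
    pose proof (PV_scal (cpt 0 (- (2 / c * w))) _ _ HQ) as Hf.
    transitivity (cpt 0 (- (2 / c * w)) * fsum (fun l => (- a0 ^ (S k - l)) * (RtoC PI * b0 ^ S l)) (S k))%C.
    2:{ fold (a 0). fold a0. fold w. fold b0. rewrite (geom_factor b0 a0 (S k)).
        replace (b0 - a0)%C with (cpt 0 w * (b0 * a0))%C.
        2:{ unfold b0, a0, a. assert (X : cpt 0 w = (cpt 0 (- b) - cpt 0 (- (b + w)))%C) by (apply injective_projections; simpl; ring).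
            rewrite X. field. split; apply cpt_nz; lra. }
        transitivity (RtoC (2 * PI / c) * cpt 0 w * ((b0 * a0) * fsum (fun l => b0 ^ l * a0 ^ (S k - S l)) (S k)))%C; [|ring].
        rewrite <- !fsum_scal. apply fsum_ext. intros l Hl. replace (S k - l)%nat with (S (S k - S l)) by lia.
        replace (RtoC (2 * PI / c) * cpt 0 w)%C with (- (cpt 0 (- (2 / c * w)) * RtoC PI))%C.
        2:{ apply injective_projections; simpl; field; lra. }
        simpl. ring. }
    rewrite <- (PV_CI f _ Hf).
    2:{ intros t. apply ccont_mult; [apply ccont_const|]. apply (ccont_fsum (fun l t => (- a0 ^ (S k - l)) * (a t ^ S l * P t))%C). intros l.
        apply ccont_mult; [apply ccont_const|]. apply ccont_mult; trivial. now apply ccont_pow. }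
    f_equal. extensionality v. rewrite EK, U. set (t := exp v). assert (Pt : 0 < t) by apply exp_pos.
    assert (QE : forall x, (RtoC x * Q x = (a x ^ S k - a0 ^ S k) * P x)%C).
    { intros x. rewrite (geom_factor (a x) a0 (S k)).
      replace (a x - a0)%C with (- (RtoC x * (a x * a0)))%C.
      2:{ unfold a0, a. pose proof (inv_cpt_diff x 0 (- b) ltac:(lra)) as E. rewrite E. replace (0 - x) with (- x) by ring. rewrite RtoC_opp. ring. }
      unfold Q. rewrite <- fsum_scal.
      transitivity ((- (RtoC x * (a x * a0)) * P x) * fsum (fun l => a x ^ l * a0 ^ (S k - S l)) (S k))%C; [|ring].
      rewrite <- fsum_scal. apply fsum_ext. intros l Hl. replace (S k - l)%nat with (S (S k - S l)) by lia. simpl. ring. }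
    unfold f. transitivity (cpt 0 (- (2 / c * w)) * (RtoC t * Q t - RtoC (- t) * Q (Ropp t)))%C.
    2:{ rewrite RtoC_opp. ring. }
    rewrite !QE, Pe.
    replace (e0 (-1) c (c * w / t)) with (cpt 0 (- (2 / c * w)) * P t)%C; [ring|].
    unfold e0, P. assert (0 < c * w / t) by (apply Rdiv_lt_0_compat; nra). set (u := c * w / t) in *.
    replace (w / (w ^ 2 + t ^ 2)) with (/ w * (u ^ 2 / (u ^ 2 + c ^ 2))).
    2:{ assert (0 < c * w) by (now apply Rmult_lt_0_compat). assert (0 < c * t) by (now apply Rmult_lt_0_compat). unfold u. field. repeat split; try lra; nra. }
    apply injective_projections; simpl; field; repeat split; nra.
Qed.

(** * The Bessel series *)

Ltac toC := match goal with |- @eq _ ?a ?b => change (@eq C a b) end.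

(** At each end one of the two exponentials alone suffices, by [exp (- z / 2) <= 2 / z]. *)
Lemma exp_two_sided (y v : R) : 0 < y -> exp (- ((exp v + y * exp (- v)) / 2)) <= (2 + 2 / y) * exp (- (1 * Rabs v)).
Proof.
  intros Hy. pose proof (exp_pos v) as P1. pose proof (exp_pos (- v)) as P2. assert (Iy : 0 < / y) by now apply Rinv_0_lt_compat.
  assert (Q : forall z, 0 < z -> exp (- (z / 2)) <= 2 / z).
  { intros z Hz. pose proof (exp_pow_bound 1 (z / 2) ltac:(lia) ltac:(lra)) as B. simpl in B. eapply Rle_trans. exact B. apply Req_le. field. lra. }
  destruct (Rle_dec 0 v) as [L|L].
  - apply Rle_trans with (exp (- (exp v / 2))). { apply exp_mono. nra. }
    eapply Rle_trans. now apply Q. rewrite (Rabs_pos_eq v) by lra. rewrite Rmult_1_l, exp_Ropp. unfold Rdiv at 1.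
    apply Rmult_le_compat_r; [left; now apply Rinv_0_lt_compat|]. assert (0 < 2 / y) by (apply Rdiv_lt_0_compat; lra). lra.
  - apply Rle_trans with (exp (- (y * exp (- v) / 2))). { apply exp_mono. lra. }
    eapply Rle_trans. { apply Q. nra. } rewrite (Rabs_left v) by lra.
    replace (2 / (y * exp (- v))) with (2 / y * exp (- (1 * - v))).
    2:{ replace (- (1 * - v)) with (- - v) by ring. rewrite (exp_Ropp (- v)). field. lra. }
    apply Rmult_le_compat_r; [left; apply exp_pos|]. lra.
Qed.

Lemma two_sided_dom (d m y : R) : 1 <= d -> 1 <= m -> 0 < y ->
  dominated 1 (2 + 2 / y) (fun v => exp (- (d * exp v + m * (y * exp (- v))))).
Proof.
  intros Hd Hm Hy. split.
  - intros v. apply (ex_derive_continuous (fun v => exp (- (d * exp v + m * (y * exp (- v)))))). auto_derive. trivial.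
  - intros v. rewrite Rabs_pos_eq by (left; apply exp_pos). eapply Rle_trans; [|now apply exp_two_sided].
    apply exp_mono. pose proof (exp_pos v). pose proof (exp_pos (- v)). assert (0 < y * exp (- v)) by nra. nra.
Qed.

(** Shifting [v] by [ln (s / d)] balances the two exponentials into [2 s cosh v]. *)
Lemma K0_IntR (d m y : R) : 1 <= d -> 1 <= m -> 0 < y ->
  IntR (fun v => exp (- (d * exp v + m * (y * exp (- v))))) = 2 * K0 (2 * sqrt (y * (d * m))).
Proof.
  intros Hd Hm Hy. set (s := sqrt (y * (d * m))).
  assert (Pm : 0 < y * (d * m)) by (apply Rmult_lt_0_compat; nra).
  assert (Ps : 0 < s) by now apply sqrt_lt_R0. assert (Es : s * s = y * (d * m)) by (apply sqrt_sqrt; lra).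
  pose proof (two_sided_dom d m y Hd Hm Hy) as D.
  rewrite <- (IntR_shift 1 _ (ln (s / d)) _ Rlt_0_1 D).
  pose proof (dominated_shift 1 _ (ln (s / d)) _ Rlt_0_1 D) as D'.
  assert (E : (fun v => exp (- (d * exp (v + ln (s / d)) + m * (y * exp (- (v + ln (s / d))))))) = (fun v => exp (- (2 * s * cosh v)))).
  { extensionality v. f_equal. f_equal. rewrite exp_Ropp, !exp_plus, exp_ln by (apply Rdiv_lt_0_compat; lra).
    unfold cosh. rewrite exp_Ropp. pose proof (exp_pos v).
    replace (m * (y * / (exp v * (s / d)))) with (s * s / s * / exp v) by (rewrite Es; field; lra). field. lra. }
  cbv beta in D'. rewrite E in D'. rewrite E. unfold K0. rewrite (even_RInt_gen 1 _ _ Rlt_0_1 D').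
  - field.
  - intros v. unfold cosh. rewrite Ropp_involutive. f_equal. f_equal. f_equal. f_equal. ring.
Qed.

(** The exponent [2 (k + 2)] turns the square root into [(y d m)^(k + 2)], which absorbs [d^k] and
    leaves [1 / (d m)^2]. *)
Lemma double_sum_bound (k : nat) (d m y : R) : 1 <= d -> 1 <= m -> 0 < y ->
  d ^ k * exp (- sqrt (y * (d * m))) <= (INR (2 * (k + 2))) ^ (2 * (k + 2)) / y ^ (k + 2) * / d ^ 2 * / m ^ 2.
Proof.
  intros Hd Hm Hy. assert (Pdm : 1 <= d * m) by nra. assert (Pm : 0 < y * (d * m)) by nra.
  pose proof (exp_pow_bound (2 * (k + 2)) (sqrt (y * (d * m))) ltac:(lia) ltac:(now apply sqrt_lt_R0)) as B.
  unfold Rdiv in B. rewrite Rpow_mult_distr, pow_inv in B.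
  rewrite (pow_mult (sqrt _)) in B. replace (sqrt (y * (d * m)) ^ 2) with (y * (d * m)) in B by (simpl; rewrite Rmult_1_r, sqrt_sqrt; lra).
  set (X := INR (2 * (k + 2)) ^ (2 * (k + 2))) in *. assert (X0 : 0 <= X) by (apply pow_le, pos_INR).
  rewrite !Rpow_mult_distr in B.
  assert (Pd : 0 < d ^ k) by (apply pow_lt; lra). assert (Py : 0 < y ^ (k + 2)) by now apply pow_lt.
  assert (Pd2 : 0 < d ^ 2) by (apply pow_lt; lra). assert (Pm2 : 0 < m ^ 2) by (apply pow_lt; lra).
  assert (Pmk : m ^ 2 <= m ^ (k + 2)) by (apply Rle_pow; [lra|lia]).
  apply Rmult_le_compat_l with (r := d ^ k) in B; [|lra]. eapply Rle_trans. exact B.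
  rewrite (pow_add d k 2).
  replace (d ^ k * (X * / (y ^ (k + 2) * (d ^ k * d ^ 2 * m ^ (k + 2))))) with (X / y ^ (k + 2) * / d ^ 2 * / m ^ (k + 2)) by (field; lra).
  apply Rmult_le_compat_l.
  - apply Rmult_le_pos; [|left; now apply Rinv_0_lt_compat]. apply Rmult_le_pos; trivial. left; now apply Rinv_0_lt_compat.
  - apply Rinv_le_contravar; lra.
Qed.

Lemma Fk_bounded (q : nat) (chi : Z -> C) (eps : R) (k : nat) : (2 <= q)%nat -> primitive_char (Z.of_nat q) chi -> chi (-1)%Z = RtoC eps ->
  exists K, 0 <= K /\ forall t, 0 < t -> Cmod (Fk chi k t - F0 q chi eps k) <= K.
Proof.
  intros Hq Hp He. destruct (Fk_near0 q chi eps Hq Hp He k) as [K1 [P1 H1]].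
  destruct (Fk_decay chi k (chi_le_1 _ _ (proj1 Hp))) as [K2 [P2 H2]]. pose proof (Cmod_ge_0 (F0 q chi eps k)).
  exists (K1 + (K2 + Cmod (F0 q chi eps k))). split; [lra|]. intros t Ht. destruct (Rle_dec t 1) as [L|L].
  - specialize (H1 t Ht). nra.
  - eapply Rle_trans. apply Cmod_minus_le. specialize (H2 t ltac:(lra)).
    assert (exp (- (t / 2)) <= 1) by (rewrite <- exp_0; apply exp_mono; lra). pose proof (exp_pos (- (t / 2))). nra.
Qed.

Lemma cdivisor_sum_ext (f g : nat -> nat -> C) (n : nat) :
  (forall i j, (S i * S j = S n)%nat -> f i j = g i j) -> cdivisor_sum f n = cdivisor_sum g n.
Proof.
  intros H. unfold cdivisor_sum. rewrite !sum_n_fsum. apply fsum_ext. intros i Hi.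
  destruct (Nat.eqb_spec (S n mod S i) 0) as [E|E]; trivial. apply H.
  pose proof (Nat.div_mod_eq (S n) (S i)) as D. rewrite E in D. destruct (S n / S i)%nat as [|n0]; [lia|]. change (Nat.pred (S n0)) with n0. lia.
Qed.

Lemma cdivisor_sum_sigma (k : nat) (chi1 chi2 : Z -> C) (c : C) (n : nat) :
  cdivisor_sum (fun i j => RtoC (INR (S i) ^ k) * (chi1 (Z.of_nat (S i)) * chi2 (Z.of_nat (S j))) * c)%C n = (sigma k chi1 chi2 (S n) * c)%C.
Proof.
  unfold cdivisor_sum, sigma. change (Nat.pred (S n)) with n. rewrite !sum_n_fsum. rewrite Cmult_comm, <- fsum_scal. apply fsum_ext. intros i Hi.
  destruct (Nat.eqb_spec (S n mod S i) 0) as [E|E]; [|ring].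
  pose proof (Nat.div_mod_eq (S n) (S i)) as D. rewrite E in D. destruct (S n / S i)%nat as [|n0]; [lia|]. change (Nat.pred (S n0)) with n0. ring.
Qed.

Lemma bessel_series (k : nat) (chi1 chi2 : Z -> C) (y : R) : (forall n, Cmod (chi1 n) <= 1) -> (forall n, Cmod (chi2 n) <= 1) -> 0 < y ->
  is_series (K := C_AbsRing) (V := C_NormedModule)
    (fun n => sigma k chi1 chi2 (S n) * RtoC (2 * K0 (2 * sqrt (y * INR (S n)))))%C
    (CI (fun v => Fk chi1 k (exp v) * Fk chi2 0 (y * exp (- v)))%C).
Proof.
  intros H1 H2 Hy.
  set (f := fun i v => (RtoC (INR (S i) ^ k) * chi1 (Z.of_nat (S i)) * RtoC (exp (- (INR (S i) * exp v))))%C).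
  set (g := fun j v => (RtoC (INR (S j) ^ 0) * chi2 (Z.of_nat (S j)) * RtoC (exp (- (INR (S j) * (y * exp (- v))))))%C).
  set (X := (INR (2 * (k + 2))) ^ (2 * (k + 2)) / y ^ (k + 2)).
  assert (N1 : forall i, 1 <= INR (S i)) by (intros i; rewrite S_INR; pose proof (pos_INR i); lra).
  assert (Fg : forall i j, (fun v => f i v * g j v)%C = (fun v => (RtoC (INR (S i) ^ k) * (chi1 (Z.of_nat (S i)) * chi2 (Z.of_nat (S j)))) * RtoC (exp (- (INR (S i) * exp v + INR (S j) * (y * exp (- v))))))%C).
  { intros i j. extensionality v. unfold f, g. rewrite Ropp_plus_distr, exp_plus, RtoC_mult. simpl (INR (S j) ^ 0). ring. }
  assert (Cf : forall i v, ccont (f i) v).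
  { intros i v. apply ccont_mult; [apply ccont_const|]. apply ccont_RtoC. apply (ex_derive_continuous (fun v => exp (- (INR (S i) * exp v)))). auto_derive. trivial. }
  assert (Cg : forall j v, ccont (g j) v).
  { intros j v. apply ccont_mult; [apply ccont_const|]. apply ccont_RtoC. apply (ex_derive_continuous (fun v => exp (- (INR (S j) * (y * exp (- v)))))). auto_derive. trivial. }
  destruct (CI_product_series 1 f g (fun i => (2 + 2 / y) * X * / INR (S i) ^ 2) (fun j => / INR (S j) ^ 2) Rlt_0_1 Cf Cg) as [_ HS].
  - intros i j v.
    replace (Cmod (f i v * g j v)) with (Cmod (RtoC (INR (S i) ^ k) * (chi1 (Z.of_nat (S i)) * chi2 (Z.of_nat (S j))) * RtoC (exp (- (INR (S i) * exp v + INR (S j) * (y * exp (- v)))))))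
      by (symmetry; exact (f_equal (fun h => Cmod (h v)) (Fg i j))).
    specialize (N1 i) as Di. specialize (N1 j) as Dj. set (d := INR (S i)) in *. set (m := INR (S j)) in *.
    rewrite !Cmod_mult, !Cmod_R, (Rabs_pos_eq (d ^ k)), (Rabs_pos_eq (exp _)) by (try (left; apply exp_pos); apply pow_le; lra).
    set (c1 := Cmod (chi1 (Z.of_nat (S i)))). set (c2 := Cmod (chi2 (Z.of_nat (S j)))).
    assert (C1 : 0 <= c1 <= 1) by (split; [apply Cmod_ge_0|apply H1]). assert (C2 : 0 <= c2 <= 1) by (split; [apply Cmod_ge_0|apply H2]).
    assert (Pk : 0 < d ^ k) by (apply pow_lt; lra).
    pose proof (exp_pos v) as Pv. pose proof (exp_pos (- v)) as Pv'.
    (* Half of the exponent, by the arithmetic-geometric mean, becomes [sqrt (y d m)] and sums over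
       [d] and [m]; the other half, as [d, m >= 1], is integrable in [v]. *)
    assert (Sq : exp (- (d * exp v + m * (y * exp (- v)))) <= exp (- sqrt (y * (d * m))) * exp (- ((exp v + y * exp (- v)) / 2))).
    { rewrite <- exp_plus. apply exp_mono.
      assert (AG : sqrt (y * (d * m)) <= (d * exp v + m * (y * exp (- v))) / 2).
      { apply Rsqr_incr_0_var.
        - unfold Rsqr. rewrite sqrt_sqrt by (repeat apply Rmult_le_pos; lra).
          assert (Z : exp v * exp (- v) = 1) by (rewrite <- exp_plus, Rplus_opp_r; apply exp_0).
          pose proof (pow2_ge_0 (d * exp v - m * (y * exp (- v)))) as SS.
          assert (d * exp v * (m * (y * exp (- v))) = y * (d * m)) by (transitivity (y * (d * m) * (exp v * exp (- v))); [ring|rewrite Z; ring]).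
          nra.
        - apply Rmult_le_pos; [|lra]. assert (0 < y * exp (- v)) by nra. nra. }
      assert (0 < y * exp (- v)) by nra. nra. }
    pose proof (double_sum_bound k d m y Di Dj Hy) as B1. fold X in B1.
    pose proof (exp_two_sided y v Hy) as B2.
    apply Rle_trans with (d ^ k * (exp (- sqrt (y * (d * m))) * exp (- ((exp v + y * exp (- v)) / 2)))).
    { apply Rmult_le_compat; [|left; apply exp_pos| |exact Sq].
      - apply Rmult_le_pos; [lra|]. apply Rmult_le_pos; lra.
      - assert (c1 * c2 <= 1) by nra. assert (0 <= c1 * c2) by nra. nra. }
    rewrite <- Rmult_assoc.
    replace ((2 + 2 / y) * X * / d ^ 2 * / m ^ 2 * exp (- (1 * Rabs v))) with ((X * / d ^ 2 * / m ^ 2) * ((2 + 2 / y) * exp (- (1 * Rabs v)))) by ring.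
    apply Rmult_le_compat; [|left; apply exp_pos|exact B1|exact B2]. apply Rmult_le_pos; [lra|left; apply exp_pos].
  - apply (ex_series_scal_l ((2 + 2 / y) * X) _ ex_series_inv_sqr).
  - exact ex_series_inv_sqr.
  - intros v. eexists. apply (Fk_csum chi1 k (exp v) H1 (exp_pos v)).
  - intros v. eexists. apply (Fk_csum chi2 0 (y * exp (- v)) H2). pose proof (exp_pos (- v)). nra.
  - eapply is_series_ext; [|exact HS]. intros n. rewrite <- cdivisor_sum_sigma. apply cdivisor_sum_ext. intros i j E.
    rewrite Fg. specialize (N1 i) as Di. specialize (N1 j) as Dj.
    pose proof (two_sided_dom (INR (S i)) (INR (S j)) y Di Dj Hy) as D.
    assert (D' : cdom 1 (2 + 2 / y) (fun v => RtoC (exp (- (INR (S i) * exp v + INR (S j) * (y * exp (- v))))))).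
    { destruct D as [A B]. split; intros v; [now apply ccont_RtoC|]. rewrite Cmod_R. apply B. }
    rewrite (CI_scal 1 _ _ _ Rlt_0_1 D'), CI_RtoC, (K0_IntR _ _ _ Di Dj Hy), <- mult_INR, E. reflexivity.
Qed.

(** [1 / (- i be) = i / be], and [i^(k+1) = - (-1)^((k-1)/2)] for odd [k]. *)
Lemma ipow_value (be : R) (k : nat) : 0 < be -> Nat.Odd k ->
  ((/ cpt 0 (- be)) ^ S k = RtoC (- (-1) ^ ((k - 1) / 2) / be ^ (k + 1)))%C.
Proof.
  intros Hb [r ->]. replace ((2 * r + 1 - 1) / 2)%nat with r by (rewrite Nat.add_sub, Nat.mul_comm, Nat.div_mul; lia).
  replace (S (2 * r + 1)) with (2 * S r)%nat by lia. replace (2 * r + 1 + 1)%nat with (2 * S r)%nat by lia.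
  rewrite Cpow_mult_r, pow_mult.
  assert (E : ((/ cpt 0 (- be)) ^ 2 = RtoC (-1 * / be ^ 2))%C).
  { apply injective_projections; simpl; field; nra. }
  rewrite E, <- RtoC_pow. f_equal. rewrite Rpow_mult_distr, pow_inv.
  assert (0 < (be ^ 2) ^ S r) by (apply pow_lt; nra). replace ((-1) ^ S r) with (- (-1) ^ r) by (simpl; ring). field. lra.
Qed.

(** * The identity up to the constant [c], for both parities at once *)

Section Core.
Variables (k p q : nat) (chi1 chi2 : Z -> C) (eps y : R).
Hypothesis Hk : Nat.Odd k.
Hypothesis Hp : (2 <= p)%nat.
Hypothesis Hq : (2 <= q)%nat.
Hypothesis P1 : primitive_char (Z.of_nat p) chi1.
Hypothesis P2 : primitive_char (Z.of_nat q) chi2.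
Hypothesis Heps : eps = 1 \/ eps = -1.
Hypothesis E1 : chi1 (-1)%Z = RtoC eps.
Hypothesis E2 : chi2 (-1)%Z = RtoC eps.
Hypothesis Hy : 0 < y.

Let Rabs_eps : Rabs eps = 1.
Proof. destruct Heps as [-> | ->]; [apply Rabs_pos_eq; lra|rewrite Rabs_left; lra]. Qed.

Let phi (m : nat) (v : R) : C := (ek eps k (freq p m) (exp v) - ek eps k (freq p m) 0)%C.
Let ej (j : nat) (v : R) : C := e0 eps (freq q j) (y * exp (- v)).

(** [|u + i c| >= sqrt (u c)] interpolates between the bounds [u / c^2] and [1 / c]. The first would
    cancel all decay of [phi] at minus infinity, the second is not summable over [c]; the geometric
    mean avoids both defects. *)
Lemma e0_sqrt_bound (c u : R) : 0 < c -> 0 < u -> Cmod (e0 eps c u) <= 2 * (sqrt u / (c * sqrt c)).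
Proof.
  intros Hc Hu.
  assert (A : forall b, Rabs b = c -> Cmod (/ cpt u b - / cpt 0 b) <= sqrt u / (c * sqrt c)).
  { intros b Hb. assert (b <> 0) by (intros ->; rewrite Rabs_R0 in Hb; lra).
    rewrite inv_cpt_diff by trivial. rewrite !Cmod_mult, Cmod_R. replace (0 - u) with (- u) by ring. rewrite Rabs_Ropp, (Rabs_pos_eq u) by lra.
    pose proof (sqrt_lt_R0 c Hc) as Sc. pose proof (sqrt_lt_R0 u Hu) as Su.
    assert (B2 : Cmod (/ cpt 0 b) <= / c) by (rewrite <- Hb; now apply Cmod_inv_cpt_le).
    assert (B1 : Cmod (/ cpt u b) <= / (sqrt u * sqrt c)).
    { rewrite Cmod_inv by now apply cpt_nz. apply Rinv_le_contravar; [nra|].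
      pose proof (fst_le_Cmod (cpt u b)) as X1. pose proof (snd_le_Cmod (cpt u b)) as X2. simpl in X1, X2. rewrite Hb in X2. rewrite Rabs_pos_eq in X1 by lra.
      pose proof (sqrt_sqrt u ltac:(lra)). pose proof (sqrt_sqrt c ltac:(lra)). pose proof (pow2_ge_0 (sqrt u - sqrt c)). nra. }
    apply Rle_trans with (u * (/ (sqrt u * sqrt c) * / c)).
    - apply Rmult_le_compat_l; [lra|]. apply Rmult_le_compat; try apply Cmod_ge_0; trivial.
    - rewrite <- (sqrt_sqrt u) at 1 by lra. apply Req_le. field. lra. }
  unfold e0. eapply Rle_trans. apply Cmod_triangle. rewrite Cmod_mult, Cmod_R, Rabs_eps.
  pose proof (A (- c) ltac:(rewrite Rabs_Ropp, Rabs_pos_eq; lra)). pose proof (A c ltac:(rewrite Rabs_pos_eq; lra)). lra.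
Qed.

Let KA : R := 2 * sqrt y * (INR q * sqrt (INR q)).
Let KB : R := 2 * INR (S k) * INR p ^ S (S k) + 4 * INR p ^ S k.

Lemma ej_bound (j : nat) (v : R) : Cmod (ej j v) <= KA * / (INR (S j) * sqrt (INR (S j))) * exp (- v / 2).
Proof.
  pose proof (freq_pos q j Hq) as Fp. pose proof (exp_pos (- v)) as Pv. assert (Pq : 0 < INR q) by (apply lt_0_INR; lia).
  assert (Pj : 0 < INR (S j)) by (apply lt_0_INR; lia).
  eapply Rle_trans. { apply e0_sqrt_bound; [exact Fp|nra]. }
  rewrite sqrt_mult by lra. replace (sqrt (exp (- v))) with (exp (- v / 2)).
  2:{ symmetry. apply sqrt_lem_1; [lra|left; apply exp_pos|]. rewrite <- exp_plus. f_equal. field. }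
  assert (Fr : INR (S j) / INR q <= freq q j).
  { unfold freq. pose proof PI2_3_2 as P3. unfold PI2 in P3. unfold Rdiv. apply Rmult_le_compat_r; [left; now apply Rinv_0_lt_compat|]. nra. }
  assert (P0 : 0 < INR (S j) / INR q) by now apply Rdiv_lt_0_compat.
  assert (Sq : sqrt (INR (S j)) / sqrt (INR q) <= sqrt (freq q j)).
  { rewrite <- sqrt_div by lra. apply sqrt_le_1; lra. }
  pose proof (sqrt_lt_R0 _ Pj) as S1. pose proof (sqrt_lt_R0 _ Pq) as S2. pose proof (sqrt_lt_R0 _ Fp) as S3.
  assert (P0' : 0 < sqrt (INR (S j)) / sqrt (INR q)) by now apply Rdiv_lt_0_compat.
  assert (I : / (freq q j * sqrt (freq q j)) <= INR q * sqrt (INR q) * / (INR (S j) * sqrt (INR (S j)))).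
  { replace (INR q * sqrt (INR q) * / (INR (S j) * sqrt (INR (S j)))) with (/ (INR (S j) / INR q * (sqrt (INR (S j)) / sqrt (INR q)))) by (field; lra).
    apply Rinv_le_contravar; [now apply Rmult_lt_0_compat|]. apply Rmult_le_compat; lra. }
  assert (E0 : 0 < sqrt y * exp (- v / 2)) by (apply Rmult_lt_0_compat; [now apply sqrt_lt_R0|apply exp_pos]).
  unfold KA. replace (2 * sqrt y * (INR q * sqrt (INR q)) * / (INR (S j) * sqrt (INR (S j))) * exp (- v / 2))
    with (2 * (sqrt y * exp (- v / 2) * (INR q * sqrt (INR q) * / (INR (S j) * sqrt (INR (S j)))))) by ring.
  apply Rmult_le_compat_l; [lra|]. unfold Rdiv at 1. apply Rmult_le_compat_l; lra.
Qed.

(** First-order vanishing at [t = 0] and boundedness at infinity; both bounds are summable over [m]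
    because [k >= 1]. *)
Lemma phi_bound (m : nat) (v : R) : Cmod (phi m v) <= KB * / INR (S m) ^ 2 * Rmin 1 (exp v).
Proof.
  pose proof (freq_pos p m Hp) as Fp. pose proof (exp_pos v) as Pv. set (b := freq p m) in *.
  assert (Pp : 0 <= INR p) by apply pos_INR.
  assert (Q0 : 0 < / INR (S m) ^ 2) by (apply Rinv_0_lt_compat, pow_lt, lt_0_INR; lia).
  pose proof (pow_le (INR p) (S (S k)) Pp) as Q1. pose proof (pow_le (INR p) (S k) Pp) as Q2. pose proof (pos_INR (S k)) as Q3.
  assert (k1 : (1 <= k)%nat) by (destruct Hk; lia).
  assert (B1 : Cmod (phi m v) <= 2 * INR (S k) * INR p ^ S (S k) * / INR (S m) ^ 2 * exp v).
  { pose proof (ek_lip eps k b (exp v) 0 Fp) as L. fold (phi m v) in L. rewrite Rabs_eps, Rminus_0_r, (Rabs_pos_eq (exp v)) in L by lra.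
    pose proof (inv_freq p Hp (S (S k)) m ltac:(lia)) as I. fold b in I.
    eapply Rle_trans. exact L. replace (2 * INR (S k) * INR p ^ S (S k) * / INR (S m) ^ 2 * exp v) with ((1 + 1) * INR (S k) * exp v * (INR p ^ S (S k) * / INR (S m) ^ 2)) by ring.
    apply Rmult_le_compat_l; trivial. repeat apply Rmult_le_pos; lra. }
  assert (B2 : Cmod (phi m v) <= 4 * INR p ^ S k * / INR (S m) ^ 2).
  { unfold phi. eapply Rle_trans. apply Cmod_minus_le. fold b. pose proof (ek_bound eps k b (exp v) Fp) as X1. pose proof (ek_bound eps k b 0 Fp) as X2.
    rewrite Rabs_eps in X1, X2. pose proof (inv_freq p Hp (S k) m ltac:(lia)) as I. fold b in I. lra. }
  unfold KB. unfold Rmin. destruct (Rle_dec 1 (exp v)) as [L|L].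
  - rewrite Rmult_1_r. eapply Rle_trans. exact B2. apply Rmult_le_compat_r; [lra|]. assert (0 <= 2 * INR (S k) * INR p ^ S (S k)) by (apply Rmult_le_pos; lra). lra.
  - eapply Rle_trans. exact B1. apply Rmult_le_compat_r; [lra|]. apply Rmult_le_compat_r; [lra|]. lra.
Qed.

Lemma min_exp (v : R) : exp (- v / 2) * Rmin 1 (exp v) <= exp (- (/ 2 * Rabs v)).
Proof.
  destruct (Rle_dec 0 v) as [L|L].
  - rewrite (Rabs_pos_eq v) by lra. rewrite <- (Rmult_1_r (exp (- (/ 2 * v)))). apply Rmult_le_compat; [left; apply exp_pos| |apply exp_mono; lra|apply Rmin_l].
    apply Rmin_glb; [lra|left; apply exp_pos].
  - rewrite (Rabs_left v) by lra. apply Rle_trans with (exp (- v / 2) * exp v).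
    + apply Rmult_le_compat_l; [left; apply exp_pos|apply Rmin_r].
    + rewrite <- exp_plus. apply exp_mono. lra.
Qed.

Lemma KA_pos : 0 <= KA.
Proof. unfold KA. repeat apply Rmult_le_pos; try lra; try apply sqrt_pos; apply pos_INR. Qed.

Lemma KB_pos : 0 <= KB.
Proof.
  unfold KB. pose proof (pow_le (INR p) (S (S k)) (pos_INR p)). pose proof (pow_le (INR p) (S k) (pos_INR p)). pose proof (pos_INR (S k)).
  assert (0 <= 2 * INR (S k) * INR p ^ S (S k)) by (apply Rmult_le_pos; lra). lra.
Qed.

Lemma ej_phi_bound (j m : nat) (v : R) :
  Cmod (ej j v * phi m v) <= (KA * / (INR (S j) * sqrt (INR (S j)))) * (KB * / INR (S m) ^ 2) * exp (- (/ 2 * Rabs v)).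
Proof.
  rewrite Cmod_mult.
  eapply Rle_trans. { apply Rmult_le_compat; [apply Cmod_ge_0|apply Cmod_ge_0|apply ej_bound|apply phi_bound]. }
  replace (KA * / (INR (S j) * sqrt (INR (S j))) * exp (- v / 2) * (KB * / INR (S m) ^ 2 * Rmin 1 (exp v)))
    with (KA * / (INR (S j) * sqrt (INR (S j))) * (KB * / INR (S m) ^ 2) * (exp (- v / 2) * Rmin 1 (exp v))) by ring.
  apply Rmult_le_compat_l; [|apply min_exp].
  assert (0 < INR (S j)) by (apply lt_0_INR; lia). assert (0 < INR (S m)) by (apply lt_0_INR; lia).
  pose proof (sqrt_lt_R0 (INR (S j)) H).
  apply Rmult_le_pos; apply Rmult_le_pos; try apply KA_pos; try apply KB_pos; left; apply Rinv_0_lt_compat; nra.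
Qed.

Lemma ccont_ek (b v : R) : b <> 0 -> ccont (fun v => ek eps k b (exp v)) v.
Proof.
  intros Hb. apply (ccont_comp (fun t => ek eps k b t) exp); [apply (ex_derive_continuous exp); auto_derive; trivial|].
  unfold ek. apply ccont_plus; [apply ccont_pow, ccont_inv_cpt; lra|]. apply ccont_mult; [apply ccont_const|]. now apply ccont_pow, ccont_inv_cpt.
Qed.

Lemma ccont_phi (m : nat) (v : R) : ccont (phi m) v.
Proof. pose proof (freq_pos p m Hp). apply ccont_minus; [apply ccont_ek; lra|apply ccont_const]. Qed.

Lemma ccont_ej (j : nat) (v : R) : ccont (ej j) v.
Proof.
  pose proof (freq_pos q j Hq).
  apply (ccont_comp (fun t => e0 eps (freq q j) t) (fun v => y * exp (- v))).
  - apply (ex_derive_continuous (fun v => y * exp (- v))). auto_derive. trivial.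
  - unfold e0. apply ccont_plus; [apply ccont_minus; [apply ccont_inv_cpt; lra|apply ccont_const]|].
    apply ccont_mult; [apply ccont_const|]. apply ccont_minus; [apply ccont_inv_cpt; lra|apply ccont_const].
Qed.

(** With [y = a^2 x / 4] this is the shift [a^2 p q x / (16 pi^2)] of the theorem. *)
Let A0 : R := y * (INR p * INR q) / (4 * PI ^ 2).
(** The part of [term_integral] that depends on neither pole; see [term_value]. *)
Let D0 : R := (-1) ^ ((k - 1) / 2) * (2 * PI) * (2 * PI / INR q) ^ k * (INR p * INR q / (4 * PI ^ 2)) ^ (k + 1).

(** With [n = (j+1) (m+1)] the frequencies satisfy [b c = 4 pi^2 n / (p q)], so [b] and [b + y / c]
    are [1 / c] times multiples of [n] and [n + A0]. The remaining [c^(k+1) / c] is the source of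
    the weight [(j+1)^k]. Since [j] belongs to [chi2], the divisor sum has the characters
    exchanged. *)
Lemma term_value (j m : nat) :
  CI (fun v => ej j v * phi m v)%C =
  RtoC (D0 * INR (S j) ^ k * (1 / (INR (S j) * INR (S m)) ^ (k + 1) - 1 / (INR (S j) * INR (S m) + A0) ^ (k + 1))).
Proof.
  pose proof (freq_pos p m Hp) as Fb. pose proof (freq_pos q j Hq) as Fc. unfold ej, phi.
  rewrite (term_integral eps k (freq p m) (freq q j) y Heps Hk Fb Fc Hy).
  assert (Pyc : 0 < y / freq q j) by now apply Rdiv_lt_0_compat.
  rewrite !ipow_value by (trivial; lra). rewrite <- RtoC_minus, <- RtoC_mult. f_equal.
  set (sg := (-1) ^ ((k - 1) / 2)).
  assert (Pp : 0 < INR p) by (apply lt_0_INR; lia). assert (Pq : 0 < INR q) by (apply lt_0_INR; lia).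
  assert (Pj : 0 < INR (S j)) by (apply lt_0_INR; lia). assert (Pm : 0 < INR (S m)) by (apply lt_0_INR; lia). pose proof PI_RGT_0 as Ppi.
  set (b := freq p m) in *. set (c := freq q j) in *. set (n := INR (S j) * INR (S m)). assert (Pn : 0 < n) by (unfold n; nra).
  set (R := INR p * INR q / (4 * PI ^ 2)). assert (PR : 0 < R) by (unfold R; apply Rdiv_lt_0_compat; nra).
  assert (PA : 0 < A0) by (unfold A0; apply Rdiv_lt_0_compat; [apply Rmult_lt_0_compat; nra|nra]).
  assert (Eb : b = n / R / c) by (unfold b, c, n, R, freq; field; repeat split; nra).
  assert (Ebw : b + y / c = (n + A0) / R / c) by (rewrite Eb; unfold A0, R; field; repeat split; nra).
  assert (Ec : c = 2 * PI / INR q * INR (S j)) by (unfold c, freq; field; lra).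
  rewrite Eb, Ebw in *. unfold D0. fold sg R.
  unfold Rdiv. rewrite !Rpow_mult_distr, !pow_inv.
  assert (Pk1 : 0 < n ^ (k + 1)) by now apply pow_lt. assert (Pk2 : 0 < (n + A0) ^ (k + 1)) by (apply pow_lt; lra).
  assert (PR1 : 0 < R ^ (k + 1)) by now apply pow_lt. assert (Pc1 : 0 < c ^ (k + 1)) by now apply pow_lt.
  assert (Ecc : c ^ (k + 1) = (2 * PI) ^ k * / INR q ^ k * INR (S j) ^ k * c).
  { rewrite pow_add, pow_1. rewrite Ec at 1. unfold Rdiv. now rewrite !Rpow_mult_distr, pow_inv. }
  rewrite Rpow_mult_distr in Ecc.
  transitivity (2 * PI * / c * sg * R ^ (k + 1) * c ^ (k + 1) * (/ n ^ (k + 1) - / (n + A0) ^ (k + 1))); [field; lra|].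
  rewrite Ecc. field. repeat split; try lra. apply Rgt_not_eq, pow_lt; trivial.
Qed.

Lemma D0_nz : D0 <> 0.
Proof.
  unfold D0. assert (Pp : 0 < INR p) by (apply lt_0_INR; lia). assert (Pq : 0 < INR q) by (apply lt_0_INR; lia). pose proof PI_RGT_0.
  assert (X1 : (-1) ^ ((k - 1) / 2) <> 0) by (apply pow_nonzero; lra).
  assert (X2 : (2 * PI / INR q) ^ k <> 0) by (apply pow_nonzero, Rgt_not_eq, Rdiv_lt_0_compat; lra).
  assert (X3 : (INR p * INR q / (4 * PI ^ 2)) ^ (k + 1) <> 0) by (apply pow_nonzero, Rgt_not_eq, Rdiv_lt_0_compat; nra).
  apply Rmult_integral_contrapositive_currified; trivial.
  apply Rmult_integral_contrapositive_currified; trivial.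
  apply Rmult_integral_contrapositive_currified; trivial. lra.
Qed.

Let Sf (v : R) : C := CSeries (fun j => cchi chi2 j * e0 eps (freq q j) (y * exp (- v)))%C.
Let Sg (v : R) : C := CSeries (fun m => cchi chi1 m * (ek eps k (freq p m) (exp v) - ek eps k (freq p m) 0))%C.

Lemma T_series : is_series (K := C_AbsRing) (V := C_NormedModule)
   (fun n => RtoC D0 * (sigma k (conj_char chi2) (conj_char chi1) (S n) *
      RtoC (1 / INR (S n) ^ (k + 1) - 1 / (INR (S n) + A0) ^ (k + 1))))%C (CI (fun v => Sf v * Sg v)%C).
Proof.
  destruct (CI_product_series (/ 2) (fun j v => cchi chi2 j * ej j v)%C (fun m v => cchi chi1 m * phi m v)%C
    (fun j => KA * / (INR (S j) * sqrt (INR (S j)))) (fun m => KB * / INR (S m) ^ 2) ltac:(lra)) as [_ HS].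
  - intros j v. apply ccont_mult; [apply ccont_const|apply ccont_ej].
  - intros m v. apply ccont_mult; [apply ccont_const|apply ccont_phi].
  - intros j m v. eapply Rle_trans; [|apply ej_phi_bound].
    replace (cchi chi2 j * ej j v * (cchi chi1 m * phi m v))%C with ((cchi chi2 j * cchi chi1 m) * (ej j v * phi m v))%C by ring.
    rewrite Cmod_mult, (Cmod_mult (cchi chi2 j)). pose proof (cchi_le_1 q chi2 P2 j) as X1. pose proof (cchi_le_1 p chi1 P1 m) as X2.
    pose proof (Cmod_ge_0 (cchi chi2 j)). pose proof (Cmod_ge_0 (cchi chi1 m)). pose proof (Cmod_ge_0 (ej j v * phi m v)).
    rewrite <- (Rmult_1_l (Cmod (ej j v * phi m v))) at 2. apply Rmult_le_compat_r; trivial. nra.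
  - apply (ex_series_scal_l KA _ ex_series_inv_32).
  - apply (ex_series_scal_l KB _ ex_series_inv_sqr).
  - intros v. destruct (e0_csum q chi2 eps Hq P2 (y * exp (- v))) as [B HB]. now exists B.
  - intros v. assert (k1 : exists k', k = S k') by (destruct Hk as [r ->]; exists (2 * r)%nat; lia). destruct k1 as [k' Ek].
    exists (fun j => (1 + Rabs eps) * INR (S k) * Rabs (exp v) * INR p ^ S (S k) * / INR (S j) ^ 2).
    pose proof (edelta_csum p chi1 eps Hp P1 k (exp v)) as X. unfold phi. rewrite Ek in *. exact X.
  - eapply is_series_ext; [|exact HS]. intros n. toC.
    transitivity (sigma k (conj_char chi2) (conj_char chi1) (S n) * (RtoC D0 * RtoC (1 / INR (S n) ^ (k + 1) - 1 / (INR (S n) + A0) ^ (k + 1))))%C; [|ring].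
    rewrite <- cdivisor_sum_sigma. apply cdivisor_sum_ext. intros j m E.
    replace (fun v => cchi chi2 j * ej j v * (cchi chi1 m * phi m v))%C with (fun v => (cchi chi2 j * cchi chi1 m) * (ej j v * phi m v))%C by (extensionality v; ring).
    assert (Dm : cdom (/ 2) ((KA * / (INR (S j) * sqrt (INR (S j)))) * (KB * / INR (S m) ^ 2)) (fun v => ej j v * phi m v)%C).
    { split; intros v; [apply ccont_mult; [apply ccont_ej|apply ccont_phi]|apply ej_phi_bound]. }
    rewrite (CI_scal (/ 2) _ _ _ ltac:(lra) Dm), term_value, <- mult_INR, E, !RtoC_mult. unfold conj_char, cchi. ring.
Qed.

Definition Ff (v : R) : C := Fk chi1 k (exp v).
Definition Gf (v : R) : C := Fk chi2 0 (y * exp (- v)).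
Definition a1 : C := F0 p chi1 eps k.
Definition a2 : C := F0 q chi2 eps 0.

Lemma Ff_Sg (v : R) : (Ff v - a1 = kap p chi1 eps k * Sg v)%C.
Proof.
  unfold Ff, a1. rewrite (Fk_partial_fractions p chi1 eps Hp P1 E1 k (exp v) (exp_pos v)).
  assert (k1 : exists k', k = S k') by (destruct Hk as [r ->]; exists (2 * r)%nat; lia). destruct k1 as [k' Ek].
  unfold Sg. rewrite Ek. unfold edelta. ring.
Qed.

Lemma Gf_Sf (v : R) : (Gf v - a2 = kap q chi2 eps 0 * Sf v)%C.
Proof.
  unfold Gf, a2. rewrite (Fk_partial_fractions q chi2 eps Hq P2 E2 0 (y * exp (- v))) by (pose proof (exp_pos (- v)); nra).
  unfold Sf, edelta. ring.
Qed.

Lemma ccont_Ff (v : R) : ccont Ff v.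
Proof. exact (Fk_ccont chi1 k v (chi_le_1 _ _ (proj1 P1))). Qed.

Lemma Gf_exp (v : R) : Gf v = Fk chi2 0 (exp (- v + ln y)).
Proof. unfold Gf. f_equal. rewrite exp_plus, exp_ln by trivial. ring. Qed.

Lemma ccont_Gf (v : R) : ccont Gf v.
Proof.
  replace Gf with (fun v => Fk chi2 0 (exp (- v + ln y))) by (extensionality u; now rewrite Gf_exp).
  apply (ccont_comp (fun u => Fk chi2 0 (exp u)) (fun v => - v + ln y)).
  - apply (ex_derive_continuous (fun v => - v + ln y)). auto_derive. trivial.
  - exact (Fk_ccont chi2 0 (- v + ln y) (chi_le_1 _ _ (proj1 P2))).
Qed.

(** At each end one factor vanishes to first order while the other stays bounded. *)
Lemma product_cdom : exists M, cdom 1 M (fun v => (Gf v - a2) * (Ff v - a1))%C.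
Proof.
  destruct (Fk_near0 p chi1 eps Hp P1 E1 k) as [K1 [Q1 H1]]. destruct (Fk_near0 q chi2 eps Hq P2 E2 0) as [K2 [Q2 H2]].
  destruct (Fk_bounded p chi1 eps k Hp P1 E1) as [K3 [Q3 H3]]. destruct (Fk_bounded q chi2 eps 0 Hq P2 E2) as [K4 [Q4 H4]].
  exists (K2 * y * K3 + K4 * K1). split.
  - intros v. apply ccont_mult; apply ccont_minus; try apply ccont_const; [apply ccont_Gf|apply ccont_Ff].
  - intros v. rewrite Cmod_mult. pose proof (exp_pos v) as Pv. pose proof (exp_pos (- v)) as Pv'. assert (Py : 0 < y * exp (- v)) by nra.
    specialize (H1 (exp v) Pv). specialize (H3 (exp v) Pv). specialize (H2 _ Py). specialize (H4 _ Py).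
    fold (Ff v) in H1, H3. fold (Gf v) in H2, H4. fold a1 in H1, H3. fold a2 in H2, H4.
    pose proof (Cmod_ge_0 (Gf v - a2)). pose proof (Cmod_ge_0 (Ff v - a1)).
    assert (Z1 : 0 <= K2 * y * K3) by (repeat apply Rmult_le_pos; lra). assert (Z2 : 0 <= K4 * K1) by (apply Rmult_le_pos; lra).
    destruct (Rle_dec 0 v) as [L|L].
    + rewrite (Rabs_pos_eq v), Rmult_1_l by lra. apply Rle_trans with (K2 * (y * exp (- v)) * K3); [apply Rmult_le_compat; trivial|]. nra.
    + rewrite (Rabs_left v) by lra. replace (- (1 * - v)) with v by ring. apply Rle_trans with (K4 * (K1 * exp v)); [apply Rmult_le_compat; trivial|]. nra.
Qed.

Lemma product_integral : CI (fun v => (Gf v - a2) * (Ff v - a1))%C = (kap q chi2 eps 0 * kap p chi1 eps k * CI (fun v => Sf v * Sg v))%C.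
Proof.
  destruct product_cdom as [M HM].
  (* Dividing by the constant transfers domination from the left-hand product to [Sf * Sg]; if the
     constant is 0, both sides are 0. *)
  destruct (classic (kap q chi2 eps 0 * kap p chi1 eps k = RtoC 0)%C) as [Z|NZ].
  - rewrite Z, Cmult_0_l. replace (fun v => (Gf v - a2) * (Ff v - a1))%C with (fun v : R => RtoC 0).
    + rewrite CI_RtoC. f_equal. apply IntR_unique. apply is_lim_seq_ext with (fun _ => 0); [|apply is_lim_seq_const].
      intros n. rewrite RInt_const. unfold scal; simpl; unfold mult; simpl. ring.
    + extensionality v. rewrite Gf_Sf, Ff_Sg. transitivity (kap q chi2 eps 0 * kap p chi1 eps k * (Sf v * Sg v))%C; [rewrite Z; ring|ring].
  - set (K := (kap q chi2 eps 0 * kap p chi1 eps k)%C) in *.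
    replace (fun v => Sf v * Sg v)%C with (fun v => / K * ((Gf v - a2) * (Ff v - a1)))%C.
    + rewrite (CI_scal 1 _ _ _ Rlt_0_1 HM). field. exact NZ.
    + extensionality v. rewrite Gf_Sf, Ff_Sg. unfold K. field.
      split; intros X; apply NZ; unfold K; rewrite X; ring.
Qed.

(** Reduces the theorem to the integral of the terms that contain [F 0] or [G 0], the only place
    where the parities differ. *)
Lemma core_identity (a x : R) (c : C) : a ^ 2 * x / 4 = y -> 0 < a -> 0 < x ->
  CI (fun v => Ff v * Gf v)%C = (c + CI (fun v => (Gf v - a2) * (Ff v - a1)))%C ->
  bessel_identity k (Z.of_nat p) (Z.of_nat q) chi1 chi2 a x c.
Proof.
  intros Ey Ha Hx Hcc. unfold bessel_identity. rewrite <- !INR_IZR_INZ.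
  assert (Pp : 0 < INR p) by (apply lt_0_INR; lia). assert (Pq : 0 < INR q) by (apply lt_0_INR; lia). pose proof PI_RGT_0 as Ppi.
  assert (EA : a ^ 2 * INR p * INR q * x / (16 * PI ^ 2) = A0) by (unfold A0; rewrite <- Ey; field; lra).
  rewrite EA. exists (/ RtoC D0 * CI (fun v => Sf v * Sg v))%C.
  assert (ND : RtoC D0 <> RtoC 0) by (apply RtoC_neq, D0_nz).
  split.
  - pose proof (is_series_scal (K := C_AbsRing) (V := C_NormedModule) (/ RtoC D0)%C _ _ T_series) as HS.
    eapply is_series_ext; [|exact HS]. intros n. toC.
    set (z := (sigma k (conj_char chi2) (conj_char chi1) (S n) * RtoC (1 / INR (S n) ^ (k + 1) - 1 / (INR (S n) + A0) ^ (k + 1)))%C).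
    transitivity (/ RtoC D0 * (RtoC D0 * z))%C; [reflexivity|]. clearbody z. field. exact ND.
  - pose proof (bessel_series k chi1 chi2 y (chi_le_1 _ _ (proj1 P1)) (chi_le_1 _ _ (proj1 P2)) Hy) as HS.
    pose proof (is_series_scal (K := C_AbsRing) (V := C_NormedModule) (RtoC (1 / 2)) _ _ HS) as S2. clear HS.
    fold Ff in S2. change (fun v => (Fk chi1 k (exp v) * Fk chi2 0 (y * exp (- v)))%C) with (fun v => (Ff v * Gf v)%C) in S2.
    rewrite Hcc, product_integral in S2.
    match goal with |- is_series _ ?l => replace l with (scal (RtoC (1 / 2)) (c + kap q chi2 eps 0 * kap p chi1 eps k * CI (fun v => Sf v * Sg v))%C : C) end.
    + eapply is_series_ext; [|exact S2]. intros n. toC.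
      assert (Es : 2 * sqrt (y * INR (S n)) = a * sqrt (INR (S n) * x)).
      { assert (Pn : 0 < INR (S n)) by (apply lt_0_INR; lia). rewrite <- Ey.
        replace (a ^ 2 * x / 4 * INR (S n)) with ((a / 2) * (a / 2) * (INR (S n) * x)) by field.
        rewrite sqrt_mult, sqrt_square by (try lra; nra). field. }
      transitivity (RtoC (1 / 2) * (sigma k chi1 chi2 (S n) * RtoC (2 * K0 (2 * sqrt (y * INR (S n))))))%C; [reflexivity|].
      rewrite Es, RtoC_mult. replace (RtoC (1 / 2)) with (/ RtoC 2)%C by (rewrite <- RtoC_inv by lra; f_equal; lra).
      field.
    + change (RtoC (1 / 2) * (c + kap q chi2 eps 0 * kap p chi1 eps k * CI (fun v => Sf v * Sg v)) =
        RtoC (1 / 2) * c + RtoC ((-1) ^ ((k - 1) / 2) * INR (fact k) * INR p ^ k / (2 * (2 * PI) ^ (k + 1))) *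
          (gauss_sum (Z.of_nat p) chi1 * gauss_sum (Z.of_nat q) chi2 * (/ RtoC D0 * CI (fun v => Sf v * Sg v))))%C.
      (* The comparison of all constants; [eps^2 = 1] makes it independent of the parity. *)
      assert (Eco : (RtoC (1 / 2) * (kap q chi2 eps 0 * kap p chi1 eps k) =
         RtoC ((-1) ^ ((k - 1) / 2) * INR (fact k) * INR p ^ k / (2 * (2 * PI) ^ (k + 1))) * (gauss_sum (Z.of_nat p) chi1 * gauss_sum (Z.of_nat q) chi2) * / RtoC D0)%C).
      { assert (Er : 1 / 2 * (INR (fact k) * (eps * eps) / (INR p * INR q)) * D0 = (-1) ^ ((k - 1) / 2) * INR (fact k) * INR p ^ k / (2 * (2 * PI) ^ (k + 1))).
        { assert (Ee : eps * eps = 1) by (destruct Heps as [-> | ->]; ring). rewrite Ee. unfold D0.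
          assert (PQ : 0 < INR q ^ k) by now apply pow_lt. assert (PP : 0 < (2 * PI) ^ k) by (apply pow_lt; lra).
          replace (4 * PI ^ 2) with ((2 * PI) * (2 * PI)) by ring.
          unfold Rdiv. rewrite !(pow_add _ k 1), !pow_1, !Rpow_mult_distr, !pow_inv, !Rpow_mult_distr.
          rewrite Rpow_mult_distr in PP. assert (P2k : 0 < 2 ^ k) by (apply pow_lt; lra). assert (Pik : 0 < PI ^ k) by now apply pow_lt.
          field. repeat split; lra. }
        rewrite <- Er. unfold kap. simpl (fact 0). simpl (INR 1).
        unfold Rdiv. rewrite !RtoC_mult. rewrite (RtoC_inv (INR p * INR q)) by nra. rewrite (RtoC_mult (INR p)).
        field. repeat split; trivial; apply RtoC_neq; lra. }
      transitivity (RtoC (1 / 2) * c + (RtoC (1 / 2) * (kap q chi2 eps 0 * kap p chi1 eps k)) * CI (fun v => Sf v * Sg v))%C; [ring|].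
      rewrite Eco. ring.
Qed.

End Core.

(** * The constant [c] in the two parities *)

Lemma cdom_of_decays (f : R -> C) : decays 1 f -> exists d M, 0 < d /\ cdom d M f.
Proof.
  intros H. destruct (decays_cdom 1 f (RtoC 0) H) as [d [M [Hd HD]]]. { simpl. lra. }
  exists d, M. split; trivial. replace f with (fun v => cexp (RtoC 0 * RtoC v) * f v)%C; trivial.
  extensionality v. rewrite Cmult_0_l, cexp_0. ring.
Qed.

(** Modulus 1 would force the constant character 1, which is neither non-principal nor odd. Modulus
    at least 2 secures [chi 0 = 0]. *)
Lemma modulus_nat (q : Z) (chi : Z -> C) : primitive_char q chi -> ~ (forall n, chi n = RtoC 1) ->
  exists q', q = Z.of_nat q' /\ (2 <= q')%nat.
Proof.
  intros [Hd _] Hn. assert (H1 : (1 <= q)%Z) by apply Hd. exists (Z.to_nat q). split; [lia|].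
  destruct (Z.eq_dec q 1) as [E|E]; [|lia]. exfalso. apply Hn. intros n.
  rewrite <- (periodic_Z chi q (chi_periodic _ _ Hd) n (1 - n)), E. replace (n + (1 - n) * 1)%Z with 1%Z by lia. apply Hd.
Qed.

(** Here [G 0 = 0], so the remaining term is [F 0 * G (y e^(-v))]. A reflection and a shift by
    [ln y] remove [y] from its integral, and with [G 0 = 0] nothing is subtracted in the integral
    that [L_values] identifies as the derivative of [L2] at 0. *)
Lemma even_case (k : nat) (p q : nat) (chi1 chi2 : Z -> C) (L1 dL1 L2 dL2 : C -> C) (a x : R) :
  Nat.Odd k -> (2 <= p)%nat -> (2 <= q)%nat -> primitive_char (Z.of_nat p) chi1 -> primitive_char (Z.of_nat q) chi2 ->
  is_Lfunction chi1 L1 dL1 -> is_Lfunction chi2 L2 dL2 -> 0 < a -> 0 < x ->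
  chi1 (-1)%Z = RtoC 1 -> chi2 (-1)%Z = RtoC 1 ->
  bessel_identity k (Z.of_nat p) (Z.of_nat q) chi1 chi2 a x (L1 (RtoC (- INR k)) * dL2 (RtoC 0))%C.
Proof.
  intros Hk Hp Hq P1 P2 HL1 HL2 Ha Hx E1 E2. set (y := a ^ 2 * x / 4). assert (Hy : 0 < y) by (apply Rdiv_lt_0_compat; [apply Rmult_lt_0_compat; [apply pow_lt|]|]; lra).
  destruct (L_values chi1 k (F0 p chi1 1 k) L1 dL1 (chi_le_1 _ _ (proj1 P1)) HL1 (Phi_decays p chi1 1 Hp P1 E1 k) (Psi_decays p chi1 1 Hp P1 E1 k)) as [V1 _].
  destruct (L_values chi2 0 (F0 q chi2 1 0) L2 dL2 (chi_le_1 _ _ (proj1 P2)) HL2 (Phi_decays q chi2 1 Hq P2 E2 0) (Psi_decays q chi2 1 Hq P2 E2 0)) as [_ V2].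
  simpl INR in V2. rewrite Ropp_0 in V2.
  assert (G0 : F0 q chi2 1 0 = RtoC 0) by (apply (g0_even q chi2 1); trivial).
  apply (core_identity k p q chi1 chi2 1 y Hk Hp Hq P1 P2 (or_introl eq_refl) E1 E2 Hy); trivial.
  destruct (product_cdom k p q chi1 chi2 1 y Hp Hq P1 P2 E1 E2 Hy) as [M HM].
  pose proof (Psi_decays q chi2 1 Hq P2 E2 0) as PD. rewrite G0 in PD, V2.
  replace (fun v => Fk chi2 0 (exp v) - RtoC 0 * gamf v)%C with (fun v => Fk chi2 0 (exp v)) in PD, V2 by (extensionality v; ring).
  destruct (cdom_of_decays _ PD) as [d [M' [Hd HD]]].
  destruct (cdom_shift_ex d M' (ln y) _ Hd HD) as [M'' HD''].
  assert (EG : CI (Gf chi2 y) = dL2 (RtoC 0)).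
  { rewrite V2, <- (CI_shift d M' (ln y) _ Hd HD), <- (CI_reflect d M'' _ Hd HD''). f_equal. extensionality v. now apply Gf_exp. }
  assert (HG : exists M, cdom d M (Gf chi2 y)).
  { exists M''. replace (Gf chi2 y) with (fun v => (fun v => Fk chi2 0 (exp (v + ln y))) (- v)).
    - destruct HD'' as [A B]. split; intros v.
      + apply (ccont_comp (fun v => Fk chi2 0 (exp (v + ln y))) Ropp); [apply (ex_derive_continuous Ropp); auto_derive; trivial|apply A].
      + rewrite <- (Rabs_Ropp v). apply B.
    - extensionality v. symmetry. now apply Gf_exp. }
  destruct HG as [M3 HG]. set (d' := Rmin d 1). assert (Hd' : 0 < d') by (apply Rmin_pos; lra).
  apply (cdom_weaken d M3 d' M3 _ (Rmin_l _ _) (Rle_refl _)) in HG. apply (cdom_weaken 1 M d' M _ (Rmin_r _ _) (Rle_refl _)) in HM.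
  rewrite V1, <- EG. fold (a1 k p chi1 1). rewrite <- (CI_scal d' _ _ _ Hd' HG), <- (CI_plus d' _ _ _ _ Hd' (cdom_scal _ _ _ _ HG) HM).
  f_equal. extensionality v. unfold a2. rewrite G0. ring.
Qed.

(** Here [F 0 = 0] and the remaining term is [G 0 * F (e^v)], so [L_values] applies directly: the
    derivative now falls on [L1], at [- k]. *)
Lemma odd_case (k : nat) (p q : nat) (chi1 chi2 : Z -> C) (L1 dL1 L2 dL2 : C -> C) (a x : R) :
  Nat.Odd k -> (2 <= p)%nat -> (2 <= q)%nat -> primitive_char (Z.of_nat p) chi1 -> primitive_char (Z.of_nat q) chi2 ->
  is_Lfunction chi1 L1 dL1 -> is_Lfunction chi2 L2 dL2 -> 0 < a -> 0 < x ->
  chi1 (-1)%Z = RtoC (-1) -> chi2 (-1)%Z = RtoC (-1) ->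
  bessel_identity k (Z.of_nat p) (Z.of_nat q) chi1 chi2 a x (dL1 (RtoC (- INR k)) * L2 (RtoC 0))%C.
Proof.
  intros Hk Hp Hq P1 P2 HL1 HL2 Ha Hx E1 E2. set (y := a ^ 2 * x / 4). assert (Hy : 0 < y) by (apply Rdiv_lt_0_compat; [apply Rmult_lt_0_compat; [apply pow_lt|]|]; lra).
  destruct (L_values chi1 k (F0 p chi1 (-1) k) L1 dL1 (chi_le_1 _ _ (proj1 P1)) HL1 (Phi_decays p chi1 (-1) Hp P1 E1 k) (Psi_decays p chi1 (-1) Hp P1 E1 k)) as [_ V1].
  destruct (L_values chi2 0 (F0 q chi2 (-1) 0) L2 dL2 (chi_le_1 _ _ (proj1 P2)) HL2 (Phi_decays q chi2 (-1) Hq P2 E2 0) (Psi_decays q chi2 (-1) Hq P2 E2 0)) as [V2 _].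
  simpl INR in V2. rewrite Ropp_0 in V2.
  assert (G0 : F0 p chi1 (-1) k = RtoC 0) by (apply (F0_odd p chi1 (-1)); trivial).
  apply (core_identity k p q chi1 chi2 (-1) y Hk Hp Hq P1 P2 (or_intror eq_refl) E1 E2 Hy); trivial.
  destruct (product_cdom k p q chi1 chi2 (-1) y Hp Hq P1 P2 E1 E2 Hy) as [M HM].
  pose proof (Psi_decays p chi1 (-1) Hp P1 E1 k) as PD. rewrite G0 in PD, V1.
  replace (fun v => Fk chi1 k (exp v) - RtoC 0 * gamf v)%C with (Ff k chi1) in PD, V1 by (extensionality v; unfold Ff; ring).
  destruct (cdom_of_decays _ PD) as [d [M' [Hd HD]]].
  set (d' := Rmin d 1). assert (Hd' : 0 < d') by (apply Rmin_pos; lra).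
  apply (cdom_weaken d M' d' M' _ (Rmin_l _ _) (Rle_refl _)) in HD. apply (cdom_weaken 1 M d' M _ (Rmin_r _ _) (Rle_refl _)) in HM.
  rewrite V1, V2, Cmult_comm. fold (a2 q chi2 (-1)). rewrite <- (CI_scal d' _ _ _ Hd' HD), <- (CI_plus d' _ _ _ _ Hd' (cdom_scal _ _ _ _ HD) HM).
  f_equal. extensionality v. unfold a1. rewrite G0. ring.
Qed.

Theorem theorem2p11 (k : nat) (p q : Z) (chi1 chi2 : Z -> C)
  (L1 dL1 L2 dL2 : C -> C) (a x : R) :
  Nat.Odd k ->
  primitive_char p chi1 -> primitive_char q chi2 ->
  is_Lfunction chi1 L1 dL1 -> is_Lfunction chi2 L2 dL2 ->
  (0 < a)%R -> (0 < x)%R ->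
  (even_char chi1 -> even_char chi2 -> ~ principal p chi1 -> ~ principal q chi2 ->
     bessel_identity k p q chi1 chi2 a x
       (Cmult (L1 (RtoC (- INR k))) (dL2 (RtoC 0)))) /\
  (odd_char chi1 -> odd_char chi2 ->
     bessel_identity k p q chi1 chi2 a x
       (Cmult (dL1 (RtoC (- INR k))) (L2 (RtoC 0)))).
Proof.
  intros Hk P1 P2 HL1 HL2 Ha Hx. split.
  - intros E1 E2 N1 N2.
    destruct (modulus_nat p chi1 P1) as [p' [-> Hp]]. { intros H. apply N1. intros n _. apply H. }
    destruct (modulus_nat q chi2 P2) as [q' [-> Hq]]. { intros H. apply N2. intros n _. apply H. }
    now apply (even_case k p' q' chi1 chi2 L1 dL1 L2 dL2).
  - intros E1 E2.
    assert (N : forall chi, odd_char chi -> ~ (forall n, chi n = RtoC 1)).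
    { intros chi O H. unfold odd_char in O. rewrite H in O. apply RtoC_inj in O. lra. }
    destruct (modulus_nat p chi1 P1 (N _ E1)) as [p' [-> Hp]]. destruct (modulus_nat q chi2 P2 (N _ E2)) as [q' [-> Hq]].
    now apply (odd_case k p' q' chi1 chi2 L1 dL1 L2 dL2).
Qed.
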